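(* Let $\mathbb{K}=\mathbb{R}$ or $\mathbb{K}=\mathbb{C}$. Let $F:(\mathbb{K}^N,0)\to(\mathbb{K}^m,0)$, $m\ge N$, be a polynomial mapping (so $F(0)=0$), let $X\subset\mathbb{K}^N$ be the algebraic set defined by a system of equations $g_1(x)=\dots=g_r(x)=0$, where $g_1,\dots,g_r\in\mathbb{K}[x_1,\dots,x_N]$, and let $d=\max\{\deg F,\deg g_1,\dots,\deg g_r\}$. Assume that $d>0$ and $0\in X$. (a) If $\mathbb{K}=\mathbb{R}$, then $\mathcal{L}^{\mathbb{R}}_0(F|X)\le d(6d-3)^{N-1}$. (b) If $\mathbb{K}=\mathbb{C}$, then $\mathcal{L}^{\mathbb{C}}_0(F|X)\le d^N$.
   Context: $|\cdot|$ is the Euclidean norm, $\operatorname{dist}$ the Euclidean distance to a set; $\deg F$ is the maximum of the degrees of the components of $F$. It is assumed that $0$ is an accumulation point of $X$. Łojasiewicz exponent at $0$. $\mathcal{L}^{\mathbb{K}}_0(F|X)$ is the smallest exponent $\eta$ for which there exist $C,\varepsilon>0$ such that $$|F(x)|\ge C\operatorname{dist}(x,F^{-1}(0)\cap X)^{\eta}\quad\text{for } x\in X,\ |x|<\varepsilon.$$ If $0$ is not an accumulation point of $X\setminus F^{-1}(0)$, one puts $\mathcal{L}^{\mathbb{K}}_0(F|X)=0$. *)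

(* Defs.v *)
From HB Require Import structures.
From mathcomp Require Import all_boot all_order all_algebra.
From mathcomp Require Import boolp classical_sets reals exp.
From mathcomp Require Import complex.
From mathcomp Require mpoly.

Set Implicit Arguments.
Unset Strict Implicit.
Unset Printing Implicit Defensive.

Import Order.TTheory GRing.Theory Num.Theory.
Local Open Scope classical_set_scope.
Local Open Scope ring_scope.

(* The Euclidean notions take the absolute value [abs : K -> R] as a
   parameter, so that they serve both K = R (with [absR]) and K = R[i]
   (with [absC], the real-valued modulus). *)
Definition absR (R : realType) (x : R) : R := `|x|.
Definition absC (R : realType) (z : R[i]) : R := ComplexField.Normc.normc z.

Section Euclidean.
Variables (R : realType) (K : fieldType) (abs : K -> R).

Definition enorm n (x : 'rV[K]_n) : R :=
  Num.sqrt (\sum_(i < n) abs (x ord0 i) ^+ 2).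

Definition edist n (x : 'rV[K]_n) (A : set 'rV[K]_n) : R :=
  inf [set enorm (x - a) | a in A].

Definition clusters_at0 n (A : set 'rV[K]_n) : Prop :=
  forall e : R, 0 < e -> exists x, [/\ A x, x != 0 & enorm x < e].

End Euclidean.

Section Polynomials.
Variable K : fieldType.

(* Total degree; the zero polynomial has degree 0 here. *)
Definition mdegree n (p : mpoly.mpoly n K) : nat :=
  \max_(m <- mpoly.msupp p) mpoly.mdeg m.

Definition max_degree n k (p : 'I_k -> mpoly.mpoly n K) : nat :=
  \max_(i < k) mdegree (p i).

Definition polymap n k (p : 'I_k -> mpoly.mpoly n K) (x : 'rV[K]_n) :
    'rV[K]_k :=
  \row_(i < k) mpoly.meval (fun j => x ord0 j) (p i).

Definition zero_set n k (p : 'I_k -> mpoly.mpoly n K) : set 'rV[K]_n :=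
  [set x | polymap p x = 0].

End Polynomials.

Section LojasiewiczExponent.
Variables (R : realType) (K : fieldType) (abs : K -> R).
Variables (n k : nat) (F : 'rV[K]_n -> 'rV[K]_k) (X : set 'rV[K]_n).

Definition lojasiewicz_inequality (eta : R) : Prop :=
  exists C e : R, [/\ 0 < C, 0 < e &
    forall x, X x -> enorm abs x < e ->
      C * powR (edist abs x (F @^-1` [set 0] `&` X)) eta <= enorm abs (F x)].

(* "L is the Lojasiewicz exponent at 0 of F restricted to X": the smallest
   admissible exponent (a minimum, not merely an infimum), or 0 in the
   degenerate case. *)
Definition is_lojasiewicz_exponent (L : R) : Prop :=
  (clusters_at0 abs (X `\` F @^-1` [set 0]) ->
     lojasiewicz_inequality L /\
     forall eta, lojasiewicz_inequality eta -> L <= eta) /\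
  (~ clusters_at0 abs (X `\` F @^-1` [set 0]) -> L = 0).

End LojasiewiczExponent.

(* Main.v *)
Require Import Defs.
From HB Require Import structures.
From mathcomp Require Import all_boot all_order all_algebra.
From mathcomp Require Import boolp classical_sets reals exp.
From mathcomp Require Import complex.
From mathcomp Require mpoly.
From mathcomp Require Import ring lra zify perm.
From mathcomp Require Import topology normedtype derive.
From mathcomp Require ordered_qelim qe_rcf spectral.

Set Implicit Arguments.
Unset Strict Implicit.
Unset Printing Implicit Defensive.

Import Order.TTheory GRing.Theory Num.Theory.
Import -(notations) mpoly.
Import numFieldNormedType.Exports.
Local Open Scope classical_set_scope.
Local Open Scope ring_scope.

(** Let V be the zero set of F in X. Both bounds come from an inequality |F(x)| >= C dist(x,
    V)^theta on X near 0. That a smallest exponent exists is a separate matter, common to both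
    fields.

    Elimination. Let Psi_1, ..., Psi_N have degree at most d and be non-degenerate at infinity.
    Polynomials then form a free module over K[Psi], with basis the d^N monomials whose exponents
    are all below d. Multiplication by a further Psi_0 has a characteristic determinant that
    vanishes at the values of (Psi_0, Psi) ([det_elim_mx]), has degree at most d^N on lines in the
    space of these values ([size_det_elim_line]), and over an algebraically closed field has only
    such values as zeros ([elim_root]). Adding rho x_i^d to any system of degree at most d makes it
    non-degenerate for all but finitely many rho ([qr_det_generic]).

    Complex case. Let f list the components of F and the g_i. Eliminate with generic linear forms in
    the x_k and the s f_j, perturbed by rho x_i^d. Normalised, the determinant tends to a nonzero
    polynomial b when rho tends to 0 and then s to infinity; at the linear data of a point x, b is
    O(|f(x)|) ([pencil_limit]). On a suitable line the determinant is a polynomial of degree at most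
    d^N. Its roots come from points y with y - x or s f(y) large, so they keep a distance of order
    dist(x, V) from the parameter of x ([pencil_ratio]). As b is bounded below at a fixed parameter
    of that line, comparing the two values gives C dist(x, V)^(d^N) <= |f(x)| ([complex_bound]).

    Real case. The polynomial f = |F|^2 + |g|^2 is nonnegative of degree at most 2d, has zero set V
    and equals |F|^2 on X. It suffices that f >= C dist^(2d (6d-3)^(N-1)) near 0
    ([zero_bound_main]). For N = 1 this is an order of vanishing. For N = 2 one descends along a
    line to a polar curve, on which f and each coordinate satisfy a relation found by counting
    dimensions ([plane_relation], [curve_bound]). For N >= 3 put G = |grad f|^2 and follow
    minimisers x(s) of G - s f in a small box. Elimination shows that they stay within O(s^(1/B)) of
    their limit, B = (4d-3)^N, and |grad f|^2 <= s f along them, so f(x(s)) = O(s^(1 + 2/B)).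
    Optimising G >= s (f - f(x(s))) over s gives a gradient inequality ([gradient_power]), and an
    Ekeland argument turns it into f >= C dist^(B+2) ([gradient_descent]); B + 2 is small enough
    from three variables on.

    Smallest exponent. By quantifier elimination, the least value of |F|^2 on X at distance t from
    V, in a ball of radius e, is semialgebraic in (e, t). Its orders in t lie in a finite list
    independent of e ([graph_exponents]), and this makes the infimum of the admissible exponents a
    minimum ([min_exponent]). The same tools provide the continuous monotone paths of the real case
    ([tame_selection]). *)

(** * Degree bounds for multivariate polynomials *)

Section DegreeBound.
Variables (A : comNzRingType) (n : nat).
Implicit Types (p q : mpoly n A) (m : multinom n).

(** Phrased through nonzero coefficients, so that the zero polynomial satisfies every bound and the
    bound passes through any ring morphism. *)
Definition deg_le p T := forall m, mcoeff m p != 0 -> (mdeg m <= T)%N.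

Lemma deg_leW p S T : (S <= T)%N -> deg_le p S -> deg_le p T.
Proof. by move=> ST pS m /pS /leq_trans; apply. Qed.

Lemma deg_leC c T : deg_le (mpolyC n c) T.
Proof.
move=> m; rewrite mcoeffC; have [-> _|_] := eqVneq m (@mnm0 n); last by rewrite mulr0 eqxx.
by rewrite mdeg0.
Qed.

Lemma deg_le0 T : deg_le 0 T.
Proof. by move=> m; rewrite mcoeff0 eqxx. Qed.

Lemma deg_leX m T : (mdeg m <= T)%N -> deg_le (mpolyX A m) T.
Proof.
move=> mT m'; rewrite mcoeffX; have [<-//|_] := eqVneq m m'.
by rewrite eqxx.
Qed.

Lemma deg_leD p q T : deg_le p T -> deg_le q T -> deg_le (p + q) T.
Proof.
move=> pT qT m; rewrite mcoeffD; have [p0|/pT//] := eqVneq (mcoeff m p) 0.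
by rewrite p0 add0r; apply: qT.
Qed.

Lemma deg_leZ c p T : deg_le p T -> deg_le (c *: p) T.
Proof.
move=> pT m; rewrite mcoeffZ; have [->|/pT//] := eqVneq (mcoeff m p) 0.
by rewrite mulr0 eqxx.
Qed.

Lemma deg_leN p T : deg_le p T -> deg_le (- p) T.
Proof. by move=> pT m; rewrite mcoeffN oppr_eq0; apply: pT. Qed.

Lemma deg_leB p q T : deg_le p T -> deg_le q T -> deg_le (p - q) T.
Proof. by move=> pT qT; apply: deg_leD => //; apply: deg_leN. Qed.

Lemma deg_leM p q S T : deg_le p S -> deg_le q T -> deg_le (p * q) (S + T).
Proof.
move=> pS qT m; rewrite -mcoeff_msupp => /msuppM_le.
case/allpairsP => [[m1 m2]] /= [h1 h2 ->].
rewrite mdegD leq_add //; [apply: pS | apply: qT];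
  by rewrite -mcoeff_msupp.
Qed.

Lemma deg_le_exp p S k : deg_le p S -> deg_le (p ^+ k) (S * k).
Proof.
move=> pS; elim: k => [|k IH]; first by rewrite expr0 muln0; apply: deg_leC.
by rewrite exprS mulnS; apply: deg_leM.
Qed.

Lemma deg_le_sum (I : Type) (r : seq I) (P : pred I) (F : I -> mpoly n A) T :
  (forall i, P i -> deg_le (F i) T) -> deg_le (\sum_(i <- r | P i) F i) T.
Proof.
move=> FT; apply: (big_ind (fun p => deg_le p T)) => //; first exact: deg_le0.
by move=> p q; apply: deg_leD.
Qed.

Lemma deg_le_prod (I : Type) (r : seq I) (F : I -> mpoly n A) (S : I -> nat) :
  (forall i, deg_le (F i) (S i)) ->
  deg_le (\prod_(i <- r) F i) (\sum_(i <- r) S i).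
Proof.
move=> FS; apply: (big_ind2 (fun p T => deg_le p T)) => //.
  exact: deg_leC.
by move=> p S1 q S2; apply: deg_leM.
Qed.

Lemma deg_le_sumE p T : deg_le p T ->
  p = \sum_(m : bmultinom n T.+1) mcoeff (bmnm m) p *: mpolyX A (bmnm m).
Proof.
move=> pT; apply/mpolyP => m; rewrite raddf_sum /=.
have [mT|mT] := leqP (mdeg m) T; last first.
  rewrite big1 => [|m' _].
    by apply/eqP; apply: contraTT mT => /pT; rewrite -leqNgt.
  rewrite mcoeffZ mcoeffX; have [E|_] := eqVneq (bmnm m') m; last by rewrite mulr0.
  by have := bmdeg m'; rewrite E ltnS leqNgt mT.
have mT' : (mdeg m < T.+1)%N by [].
rewrite (bigD1 (BMultinom mT')) //= mcoeffZ mcoeffX eqxx mulr1 big1 ?addr0 //.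
move=> m' /eqP m'N; rewrite mcoeffZ mcoeffX.
have [E|_] := eqVneq (bmnm m') m; last by rewrite mulr0.
by case: m'N; apply: val_inj.
Qed.

Lemma deg_le_ind T (P : mpoly n A -> Prop) :
  (forall m, (mdeg m <= T)%N -> P (mpolyX A m)) -> P 0 ->
  (forall c p, P p -> P (c *: p)) -> (forall p q, P p -> P q -> P (p + q)) ->
  forall p, deg_le p T -> P p.
Proof.
move=> PX P0 PZ PD p /deg_le_sumE ->; apply: (big_ind P) => // m _.
by apply/PZ/PX; have := bmdeg m; rewrite ltnS.
Qed.

End DegreeBound.

Lemma deg_le_map (A B : comNzRingType) (f : {rmorphism A -> B}) n
    (p : mpoly n A) T : deg_le p T -> deg_le (map_mpoly f p) T.
Proof.
move=> pT m; rewrite mcoeff_map_mpoly; have [->|/pT//] := eqVneq (mcoeff m p) 0.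
by rewrite raddf0 eqxx.
Qed.

Lemma deg_le_mdegree (K : fieldType) n (p : mpoly n K) T :
  (mdegree p <= T)%N -> deg_le p T.
Proof.
move=> pT m m0; apply: leq_trans pT; rewrite /mdegree.
by rewrite (big_rem m) /= ?leq_maxl // mcoeff_msupp.
Qed.

(** * Division by a system Psi and fraction-free elimination *)

Section FreeModule.
Variables (A : comNzRingType) (N e : nat).
Local Notation d := e.+1.
Local Notation box := {ffun 'I_N -> 'I_d}.
Variable Psi : 'I_N -> mpoly N A.

Definition mnm_quo (m : multinom N) : multinom N := Multinom [tuple (m i %/ d)%N | i < N].
Definition mnm_rem (m : multinom N) : box := [ffun i => inord (m i %% d)].
Definition box_mnm (a : box) : multinom N := Multinom [tuple (a i : nat) | i < N].

Lemma box_mnmE a i : box_mnm a i = a i :> nat.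
Proof. by rewrite /box_mnm mnmE. Qed.

Lemma mnm_quoE m i : mnm_quo m i = (m i %/ d)%N.
Proof. by rewrite /mnm_quo mnmE. Qed.

Lemma box_mnm_remE m i : box_mnm (mnm_rem m) i = (m i %% d)%N.
Proof. by rewrite box_mnmE ffunE inordK // ltn_pmod. Qed.

Lemma box_mnm_inj : injective box_mnm.
Proof.
move=> a b E; apply/ffunP => i; apply: val_inj => /=.
by rewrite -!box_mnmE E.
Qed.

Lemma mdeg_quo_rem m :
  (mdeg m = d * mdeg (mnm_quo m) + mdeg (box_mnm (mnm_rem m)))%N.
Proof.
rewrite !mdegE big_distrr -big_split /=; apply: eq_bigr => i _.
by rewrite box_mnm_remE mnm_quoE mulnC -divn_eq.
Qed.

Lemma mnm_rem_box a : mnm_rem (box_mnm a) = a.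
Proof.
apply: box_mnm_inj; apply/mnmP => i; rewrite box_mnm_remE box_mnmE.
by rewrite modn_small.
Qed.

Lemma mnm_quo_box a : mnm_quo (box_mnm a) = @mnm0 N.
Proof.
apply/mnmP => i; rewrite mnm_quoE box_mnmE divn_small // ?mnm0E //.
Qed.

(** Each factor x_l^d of x^m is traded for Psi_l. When these products form a basis, the polynomial
    ring is free over the subring generated by Psi, with the box monomials as basis. *)
Definition qr_poly (m : multinom N) : mpoly N A :=
  (\prod_i Psi i ^+ (m i %/ d)) * mpolyX A (box_mnm (mnm_rem m)).

Hypothesis Psi_deg : forall i, deg_le (Psi i) d.

Lemma qr_poly_deg m : deg_le (qr_poly m) (mdeg m).
Proof.
rewrite mdeg_quo_rem /qr_poly; apply: deg_leM; last exact: deg_leX.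
rewrite mdegE big_distrr /=; apply: deg_le_prod => i.
by rewrite mnm_quoE; apply: deg_le_exp.
Qed.

Section Level.
Variable T : nat.
Local Notation I := 'I_#|{: bmultinom N T.+1}|.

Definition level_mnm (i : I) : multinom N := bmnm (enum_val i).

Lemma level_mnm_deg i : (mdeg (level_mnm i) <= T)%N.
Proof. by have := bmdeg (enum_val i); rewrite ltnS. Qed.

Definition qr_mx : 'M[A]_(#|{: bmultinom N T.+1}|) :=
  \matrix_(i, j) mcoeff (level_mnm j) (qr_poly (level_mnm i)).
Definition qr_det := \det qr_mx.
Definition coef_row (p : mpoly N A) : 'rV[A]_(#|{: bmultinom N T.+1}|) :=
  \row_j mcoeff (level_mnm j) p.
(** Coordinates in the family [qr_poly], scaled by [qr_det]: the adjugate replaces the inverse, so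
    no division occurs and everything commutes with ring morphisms. *)
Definition qr_coord p := coef_row p *m \adj qr_mx.

Lemma deg_le_levelE p : deg_le p T ->
  p = \sum_(i : I) mcoeff (level_mnm i) p *: mpolyX A (level_mnm i).
Proof.
move=> pT; rewrite [LHS](deg_le_sumE pT).
exact: (big_enum_val (fun m : bmultinom N T.+1 => mcoeff (bmnm m) p *: mpolyX A (bmnm m))).
Qed.

Lemma level_mnm_inj : injective level_mnm.
Proof. by move=> i j /val_inj /enum_val_inj. Qed.

Lemma level_mnmP m : (mdeg m <= T)%N -> exists i, level_mnm i = m.
Proof.
rewrite -ltnS => mT; exists (enum_rank (BMultinom mT)).
by rewrite /level_mnm enum_rankK.
Qed.

Lemma coef_rowK p q : deg_le p T -> deg_le q T -> coef_row p = coef_row q -> p = q.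
Proof.
move=> pT qT E; rewrite (deg_le_levelE pT) (deg_le_levelE qT).
by apply: eq_bigr => i _; have /rowP/(_ i) := E; rewrite !mxE => ->.
Qed.

Lemma coef_row_sum (J : finType) (c : J -> A) (F : J -> mpoly N A) :
  coef_row (\sum_j c j *: F j) = \sum_j c j *: coef_row (F j).
Proof.
apply/rowP => j; rewrite mxE raddf_sum summxE.
by apply: eq_bigr => i _; rewrite !mxE /= mcoeffZ.
Qed.

Lemma qr_coordE p : deg_le p T ->
  qr_det *: p = \sum_i qr_coord p 0 i *: qr_poly (level_mnm i).
Proof.
move=> pT; apply: coef_rowK.
- exact: deg_leZ.
- apply: deg_le_sum => i _; apply: deg_leZ.
  exact: deg_leW (level_mnm_deg i) (@qr_poly_deg _).
rewrite coef_row_sum.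
have -> : \sum_j qr_coord p 0 j *: coef_row (qr_poly (level_mnm j))
        = qr_coord p *m qr_mx.
  apply/rowP => j; rewrite summxE mxE; apply: eq_bigr => i _.
  by rewrite !mxE.
rewrite /qr_coord -mulmxA mul_adj_mx mul_mx_scalar.
by apply/rowP => j; rewrite !mxE mcoeffZ.
Qed.

End Level.

Definition top_level (a : box) := (d + mdeg (box_mnm a))%N.

Section Elimination.
Variables (B : comNzRingType) (f : {rmorphism A -> B}).
Variable Psi0 : mpoly N A.
Hypothesis Psi0_deg : deg_le Psi0 d.

(** Up to the factors [qr_det], this is tau minus multiplication by Psi0 on the box monomials,
    modulo Psi_l = c_l. Each row is computed at its own level, the degree of Psi0 times its
    monomial, which keeps the weighted degrees of the entries sharp. *)
Definition elim_mx (tau : B) (c : 'I_N -> B) : 'M[B]_(#|{: box}|) :=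
  \matrix_(i, j)
    (f (qr_det (top_level (enum_val i))) * tau *+ (i == j)
     - \sum_(k | mnm_rem (level_mnm k) == enum_val j)
         f (qr_coord (top_level (enum_val i))
              (Psi0 * mpolyX A (box_mnm (enum_val i))) 0 k)
         * \prod_l c l ^+ (level_mnm k l %/ d)).

Lemma mmap_qr_poly y m : mmap f y (qr_poly m)
  = (\prod_l mmap f y (Psi l) ^+ (m l %/ d)) * mmap1 y (box_mnm (mnm_rem m)).
Proof.
rewrite /qr_poly rmorphM rmorph_prod /= mmapX; congr (_ * _).
by apply: eq_bigr => l _; rewrite rmorphXn.
Qed.

(** Expand Psi0 times a box monomial in the family [qr_poly] and evaluate at y: the vector of box
    monomials at y is in the kernel. *)
Lemma elim_mx_mul_box y (tau := mmap f y Psi0) (c := fun l => mmap f y (Psi l)) :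
  elim_mx tau c *m (\col_j mmap1 y (box_mnm (enum_val j))) = 0.
Proof.
apply/colP => i; rewrite !mxE.
under eq_bigr => j _ do rewrite !mxE mulrBl.
rewrite sumrB (bigD1 i) //= eqxx mulr1n big1 ?addr0 => [|j /negPf ji]; last first.
  by rewrite eq_sym ji mulr0n mul0r.
apply/eqP; rewrite subr_eq0; apply/eqP.
set T := top_level _; set p := Psi0 * _.
have pT : deg_le p T by apply: deg_leM => //; apply: deg_leX.
have := congr1 (mmap f y) (qr_coordE pT).
rewrite -mul_mpolyC rmorphM /= mmapC /p rmorphM /= mmapX mulrA => ->.
rewrite raddf_sum /=.
under [RHS]eq_bigr => j _ do rewrite mulr_suml.
rewrite (exchange_big_dep xpredT) //=; apply: eq_bigr => k _.
rewrite -mul_mpolyC rmorphM /= mmapC mmap_qr_poly mulrA.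
rewrite (big_pred1 (enum_rank (mnm_rem (level_mnm k)))) ?enum_rankK //.
move=> j /=; apply/eqP/eqP => [->|->]; first by rewrite enum_valK.
by rewrite enum_rankK.
Qed.

(** The kernel vector has the entry 1 at exponent zero; multiplying by the adjugate therefore kills
    the determinant over any commutative ring. *)
Lemma det_elim_mx y :
  \det (elim_mx (mmap f y Psi0) (fun l => mmap f y (Psi l))) = 0.
Proof.
set X := elim_mx _ _; pose w := \col_j mmap1 y (box_mnm (enum_val j)) : 'cV[B]_#|{:box}|.
have Xw : X *m w = 0 by exact: elim_mx_mul_box.
have := congr1 (mulmx (\adj X)) Xw; rewrite mulmxA mul_adj_mx mulmx0 mul_scalar_mx.
move/colP => /(_ (enum_rank [ffun=> ord0])); rewrite !mxE enum_rankK.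
rewrite /mmap1 big1 ?mulr1 // => l _.
by rewrite box_mnmE ffunE expr0.
Qed.

End Elimination.
End FreeModule.

(** * Compatibility of elimination with ring morphisms *)

Section Naturality.
Variables (A A' : comNzRingType) (g : {rmorphism A -> A'}) (N e : nat).
Variable Psi : 'I_N -> mpoly N A.
Let Psi' l := map_mpoly g (Psi l).

Lemma map_qr_poly m : qr_poly e Psi' m = map_mpoly g (qr_poly e Psi m).
Proof.
rewrite /qr_poly rmorphM rmorph_prod /= map_mpolyX; congr (_ * _).
by apply: eq_bigr => l _; rewrite rmorphXn.
Qed.

Lemma map_qr_mx T : qr_mx e Psi' T = map_mx g (qr_mx e Psi T).
Proof. by apply/matrixP => i j; rewrite !mxE map_qr_poly mcoeff_map_mpoly. Qed.

Lemma map_qr_det T : qr_det e Psi' T = g (qr_det e Psi T).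
Proof. by rewrite /qr_det map_qr_mx det_map_mx. Qed.

Lemma map_qr_coord T p :
  qr_coord e Psi' T (map_mpoly g p) = map_mx g (qr_coord e Psi T p).
Proof.
rewrite /qr_coord map_qr_mx map_mxM /= map_mx_adj; congr (_ *m _).
by apply/rowP => j; rewrite !mxE mcoeff_map_mpoly.
Qed.

(** Here the coefficients of Psi and Psi0 are pushed forward and the values tau, c stay put;
    [elim_mx_rmorph] moves the values instead. *)
Lemma map_elim_mx (B : comNzRingType) (f : {rmorphism A' -> B})
   (h : {rmorphism A -> B}) Psi0 tau c : (forall x, f (g x) = h x) ->
  elim_mx e Psi' f (map_mpoly g Psi0) tau c = elim_mx e Psi h Psi0 tau c.
Proof.
move=> fgh; apply/matrixP => i j; rewrite !mxE map_qr_det fgh; congr (_ - _).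
apply: eq_bigr => k _; rewrite -(map_mpolyX g) -rmorphM map_qr_coord.
by rewrite !mxE fgh.
Qed.

End Naturality.

Lemma elim_mx_rmorph (A B B' : comNzRingType) N e (Psi : 'I_N -> mpoly N A)
   (f : {rmorphism A -> B}) (g : {rmorphism B -> B'}) (h : {rmorphism A -> B'}) Psi0 tau c :
   (forall x, g (f x) = h x) ->
  map_mx g (elim_mx e Psi f Psi0 tau c) = elim_mx e Psi h Psi0 (g tau) (fun l => g (c l)).
Proof.
move=> gfh; apply/matrixP => i j; rewrite !mxE rmorphB rmorphMn rmorphM /= gfh.
congr (_ - _); rewrite rmorph_sum; apply: eq_bigr => k _.
rewrite rmorphM /= gfh rmorph_prod; congr (_ * _).
by apply: eq_bigr => l _; rewrite rmorphXn.
Qed.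

(** * Generic non-degeneracy of the division *)

Section QrDet.
Variables (N e : nat).
Local Notation d := e.+1.

Lemma qr_det_Xn (A : comNzRingType) T :
  qr_det e (fun l : 'I_N => mpolyX A (mnm_muln (mnm1 l) d) : mpoly N A) T = 1.
Proof.
rewrite /qr_det.
suff -> : qr_mx e (fun l : 'I_N => mpolyX A (mnm_muln (mnm1 l) d)) T = 1%:M by rewrite det1.
apply/matrixP => i j; rewrite !mxE.
have -> : qr_poly e (fun l : 'I_N => mpolyX A (mnm_muln (mnm1 l) d)) (level_mnm i)
        = mpolyX A (level_mnm i).
  rewrite /qr_poly; under eq_bigr => l _ do rewrite mpolyXn.
  rewrite mprodXE -mpolyXD; congr mpolyX; apply/mnmP => l.
  rewrite mnmDE box_mnm_remE mnm_sumE [RHS](divn_eq _ d); congr addn.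
  rewrite (bigD1 l) //= !mulmnE mnm1E eqxx mul1n mulnC big1 ?addn0 // => l' ne.
  by rewrite !mulmnE mnm1E (negPf ne).
by rewrite mcoeffX (inj_eq (@level_mnm_inj _ _)).
Qed.

Lemma qr_poly_scale (A : comNzRingType) (Psi : 'I_N -> mpoly N A) rho m :
  qr_poly e (fun l : 'I_N => rho *: Psi l) m = rho ^+ mdeg (mnm_quo e m) *: qr_poly e Psi m.
Proof.
rewrite /qr_poly scalerAl; congr (_ * _).
under eq_bigr => l _ do rewrite exprZn.
rewrite scaler_prod mdegE -(big_morph _ (exprD rho) (expr0 rho)); congr (_ ^+ _ *: _).
by apply: eq_bigr => l _; rewrite mnm_quoE.
Qed.

Lemma qr_det_scale (A : comNzRingType) (Psi : 'I_N -> mpoly N A) rho T :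
  exists E, qr_det e (fun l : 'I_N => rho *: Psi l) T = rho ^+ E * qr_det e Psi T.
Proof.
exists (\sum_i mdeg (mnm_quo e (@level_mnm N T i)))%N; rewrite /qr_det.
have -> : qr_mx e (fun l : 'I_N => rho *: Psi l) T
  = diag_mx (\row_i rho ^+ mdeg (mnm_quo e (level_mnm i))) *m qr_mx e Psi T.
  apply/matrixP => i j; rewrite mul_diag_mx !mxE qr_poly_scale mcoeffZ //.
rewrite det_mulmx det_diag; congr (_ * _).
rewrite (big_morph _ (exprD rho) (expr0 rho)).
by apply: eq_bigr => i _; rewrite !mxE.
Qed.

(* At infinite [rho] the polynomials degenerate to pure powers, for which the
   determinant is 1; so it vanishes for finitely many [rho] only. *)
Lemma qr_det_generic (K : fieldType) (psi : 'I_N -> mpoly N K) T1 :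
  exists2 q : {poly K}, q != 0 & forall rho, rho != 0 -> ~~ root q rho^-1 ->
  forall T, (T <= T1)%N ->
    qr_det e (fun l : 'I_N => rho *: mpolyX K (mnm_muln (mnm1 l) d) + psi l) T != 0.
Proof.
(* The indeterminate stands for 1/rho: after scaling by rho, the system x_l^d + psi_l / rho is the
   one of the statement. *)
pose Psi l : mpoly N {poly K} :=
  mpolyX _ (mnm_muln (mnm1 l) d) + 'X *: map_mpoly polyC (psi l).
have evP (x : K) T : (qr_det e Psi T).[x]
    = qr_det e (fun l : 'I_N => mpolyX K (mnm_muln (mnm1 l) d) + x *: psi l) T.
  rewrite -[LHS]/(horner_eval x _) -map_qr_det; congr (qr_det _ _ _).
  apply/funext => l; rewrite /Psi rmorphD /= map_mpolyX map_mpolyZ /=.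
  congr (_ + _ *: _); first by rewrite /horner_eval hornerX.
  by apply/mpolyP => m; rewrite !mcoeff_map_mpoly /= /horner_eval hornerC.
exists (\prod_(T < T1.+1) qr_det e Psi T).
  apply/prodf_neq0 => T _; apply/eqP => /(congr1 (fun q => q.[0])).
  rewrite evP horner0; under eq_fun do rewrite scale0r addr0.
  by rewrite qr_det_Xn; apply/eqP/oner_neq0.
move=> rho rho0; rewrite /root horner_prod => /prodf_neq0 H T TT1.
have := H (inord T) isT; rewrite evP inordK // => HT.
have [E] := qr_det_scale (fun l : 'I_N => mpolyX K (mnm_muln (mnm1 l) d) + rho^-1 *: psi l) rho T.
under eq_fun do rewrite scalerDr scalerA divff // scale1r.
by move=> ->; rewrite mulf_neq0 // expf_neq0.
Qed.

End QrDet.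

(** * Degree of the elimination determinant along a line *)

(** In each term of the Leibniz expansion the weights u_i and u_(s i) cancel over the permutation,
    leaving d times the degree below d n. *)
Lemma size_det_weighted (F : idomainType) n (M : 'M[{poly F}]_n) (d : nat)
    (u : 'I_n -> nat) : (0 < d)%N ->
  (forall i j, M i j != 0 -> (d * (size (M i j)).-1 + u j <= d + u i)%N) ->
  (size (\det M) <= n.+1)%N.
Proof.
move=> d0 HM; rewrite /determinant; apply: (leq_trans (size_sum _ _ _)).
apply/bigmax_leqP => s _; rewrite -signr_odd size_Msign.
have [i /eqP Mi|nz] := pickP (fun i => M i (s i) == 0).
  by rewrite (bigD1 i) //= Mi mul0r size_poly0.
apply: (leq_trans (size_poly_prod_leq _ _)) => /=.
have E i : size (M i (s i)) = (size (M i (s i))).-1.+1 by rewrite prednK // size_poly_gt0 nz.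
under eq_bigr => i _ do rewrite E -addn1.
rewrite big_split /= sum1_card card_ord -addSn addnK ltnS.
rewrite -(leq_pmul2l d0) big_distrr /=.
rewrite -(leq_add2r (\sum_i u i)) [X in (_ + X <= _)%N](reindex_inj (@perm_inj _ s)) /=.
rewrite -big_split /=; apply: (@leq_trans (\sum_i (d + u i))).
  by apply: leq_sum => i _; apply: HM; rewrite nz.
by rewrite big_split /= sum_nat_const card_ord mulnC.
Qed.

Section LineDegree.
Variables (K : fieldType) (N e : nat) (Psi : 'I_N -> mpoly N K) (Psi0 : mpoly N K).
Local Notation d := e.+1.
Local Notation box := {ffun 'I_N -> 'I_d}.

(** Weight the rows by the degrees of the box monomials. A quotient exponent of total degree k costs
    d k of the level, so the entry (i, j) has degree at most (d + |a_i| - |a_j|) / d, and there are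
    d^N box monomials. *)
Lemma size_det_elim_line (c v : 'I_N -> K) :
  (size (\det (elim_mx e Psi polyC Psi0 'X (fun l => (c l)%:P + v l *: 'X)%R))
    <= (d ^ N).+1)%N.
Proof.
have <- : #|{: box}| = (d ^ N)%N by rewrite card_ffun !card_ord.
apply: (@size_det_weighted _ _ _ d (fun i => mdeg (box_mnm (enum_val i)))) => // i j.
rewrite mxE => nz.
set p := (_ - _) in nz *.
have u_le : (mdeg (box_mnm (enum_val j)) <= d + mdeg (box_mnm (enum_val i)))%N.
  have [//|lt] := leqP (mdeg (box_mnm (enum_val j))) (d + mdeg (box_mnm (enum_val i))).
  case/eqP: nz; rewrite /p; have -> : (i == j) = false.
    by apply: contraTF lt => /eqP ->; rewrite -leqNgt leq_addl.
  rewrite mulr0n big1 ?subrr // => k /eqP E.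
  have := level_mnm_deg k; rewrite (mdeg_quo_rem e) E /top_level => h.
  by move: (leq_trans (leq_addl _ _) h); rewrite leqNgt lt.
suff H : (size p <= ((d + mdeg (box_mnm (enum_val i)) - mdeg (box_mnm (enum_val j))) %/ d).+1)%N.
  rewrite addnC -leq_subRL // mulnC -leq_divRL //.
  by move: H; case: (size p).
apply: (leq_trans (size_polyD _ _)); rewrite geq_max size_polyN; apply/andP; split.
  have [->|_] := eqVneq i j; last by rewrite mulr0n size_poly0.
  rewrite mulr1n addnK divnn /=; apply: (leq_trans (size_polyMleq _ _)).
  by rewrite size_polyX addn2 /= ltnS size_polyC; case: (_ != 0).
apply: (leq_trans (size_sum _ _ _)); apply/bigmax_leqP => k /eqP E.
rewrite mul_polyC; apply: (leq_trans (size_scale_leq _ _)).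
apply: (leq_trans (size_poly_prod_leq _ _)) => /=.
have dk : (mdeg (mnm_quo e (level_mnm k)) <=
   (d + mdeg (box_mnm (enum_val i)) - mdeg (box_mnm (enum_val j))) %/ d)%N.
  rewrite leq_divRL // mulnC.
  have := level_mnm_deg k; rewrite (mdeg_quo_rem e) E /top_level => h.
  by rewrite -(leq_add2r (mdeg (box_mnm (enum_val j)))) subnK // (leq_trans _ h) // leq_addl.
rewrite [X in (_ - X)%N](_ : _ = N); last by rewrite -[RHS]card_ord; apply: eq_card.
rewrite leq_subLR addnS ltnS; apply: leq_trans (leq_add (leqnn N) dk).
rewrite mdegE -[X in (X + _)%N]card_ord -sum1_card -big_split /=.
apply: leq_sum => l _; rewrite mnm_quoE.
apply: (leq_trans (size_poly_exp_leq _ _)); rewrite -add1n leq_add2l.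
have : (size ((c l)%:P + v l *: 'X)%R <= 2)%N.
  apply: (leq_trans (size_polyD _ _)); rewrite geq_max.
  rewrite (leq_trans (size_polyC_leq1 _)) //=.
  by rewrite (leq_trans (size_scale_leq _ _)) ?size_polyX.
case: size => [|[|[|//]]] _; rewrite /= ?mul0n // mul1n //.
Qed.
End LineDegree.

(** * Fibres of Psi and functionals on the quotient by Psi - c *)

Section Roots.
Variables (K : fieldType) (N e : nat) (Psi : 'I_N -> mpoly N K) (Psi0 : mpoly N K).
Local Notation d := e.+1.
Local Notation box := {ffun 'I_N -> 'I_d}.
Hypothesis Psi_deg : forall i, deg_le (Psi i) d.

Lemma qr_coord_qr_poly T (i : 'I_#|{: bmultinom N T.+1}|) j :
  qr_coord e Psi T (qr_poly e Psi (level_mnm i)) 0 j = qr_det e Psi T *+ (i == j).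
Proof.
rewrite /qr_coord.
have -> : coef_row T (qr_poly e Psi (level_mnm i)) = row i (qr_mx e Psi T).
  by apply/rowP => k; rewrite !mxE.
by rewrite -row_mul mul_mx_adj !mxE.
Qed.

Lemma qr_ind T (P : mpoly N K -> Prop) : qr_det e Psi T != 0 ->
  (forall m, (mdeg m <= T)%N -> P (qr_poly e Psi m)) -> P 0 ->
  (forall c p, P p -> P (c *: p)) -> (forall p q, P p -> P q -> P (p + q)) ->
  forall p, deg_le p T -> P p.
Proof.
move=> det0 PX P0 PZ PD p /(qr_coordE Psi_deg) E.
rewrite -[p]scale1r -(mulVf det0) -scalerA E; apply: (PZ).
apply: (big_ind P) => // i _; apply/PZ/PX; exact: level_mnm_deg.
Qed.

Lemma qr_poly_shift m q : qr_poly e Psi (mnm_add m (mnm_muln q d)) =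
  (\prod_l Psi l ^+ q l) * qr_poly e Psi m.
Proof.
rewrite /qr_poly mulrA -big_split /=; congr (_ * mpolyX _ _).
  apply: eq_bigr => l _; rewrite mnmDE mulmnE divnDMl //.
  by rewrite -exprD addnC.
by apply/mnmP => l; rewrite !box_mnm_remE mnmDE mulmnE addnC modnMDl.
Qed.

Section Functional.
Variables (T : nat) (c : 'I_N -> K).
Hypothesis det0 : qr_det e Psi T != 0.

(* The functional on polynomials of degree at most [T] that is [lam] on box
   monomials and factors through the quotient by the [Psi l - c l]. *)
Definition ext_fun (lam : box -> K) (p : mpoly N K) : K :=
  (qr_det e Psi T)^-1 * \sum_k qr_coord e Psi T p 0 k *
    ((\prod_l c l ^+ (level_mnm k l %/ d)) * lam (mnm_rem e (level_mnm k))).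

Lemma ext_funD lam p q : ext_fun lam (p + q) = ext_fun lam p + ext_fun lam q.
Proof.
rewrite /ext_fun -mulrDr -big_split /=; congr (_ * _).
apply: eq_bigr => k _; rewrite -mulrDl; congr (_ * _).
rewrite /qr_coord; have -> : coef_row T (p + q) = coef_row T p + coef_row T q.
  by apply/rowP => j; rewrite !mxE mcoeffD.
by rewrite mulmxDl mxE.
Qed.

Lemma ext_funZ lam a p : ext_fun lam (a *: p) = a * ext_fun lam p.
Proof.
rewrite /ext_fun [RHS]mulrCA; congr (_ * _); rewrite big_distrr /=.
apply: eq_bigr => k _; rewrite [RHS]mulrA; congr (_ * _).
rewrite /qr_coord; have -> : coef_row T (a *: p) = a *: coef_row T p.
  by apply/rowP => j; rewrite !mxE mcoeffZ.
by rewrite -scalemxAl mxE.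
Qed.

Lemma ext_fun0 lam : ext_fun lam 0 = 0.
Proof. by rewrite -(scale0r 0) ext_funZ mul0r. Qed.

Lemma ext_fun_qr lam m : (mdeg m <= T)%N ->
  ext_fun lam (qr_poly e Psi m) = (\prod_l c l ^+ (m l %/ d)) * lam (mnm_rem e m).
Proof.
move=> mT; have [i <-] := level_mnmP mT; rewrite /ext_fun.
rewrite (bigD1 i) //= [X in _ + X]big1 => [|j /negPf ji]; last first.
  by rewrite qr_coord_qr_poly eq_sym ji mulr0n mul0r.
by rewrite addr0 qr_coord_qr_poly eqxx mulr1n mulKf.
Qed.

Lemma qr_poly_box (a : box) : qr_poly e Psi (box_mnm a) = mpolyX K (box_mnm a).
Proof.
rewrite /qr_poly mnm_rem_box big1 ?mul1r // => l _.
by rewrite box_mnmE divn_small // expr0.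
Qed.

Lemma ext_fun_box lam (a : box) : (mdeg (box_mnm a) <= T)%N ->
  ext_fun lam (mpolyX K (box_mnm a)) = lam a.
Proof.
move=> aT; rewrite -qr_poly_box ext_fun_qr // mnm_rem_box big1 ?mul1r // => l _.
by rewrite box_mnmE divn_small.
Qed.

Hypothesis det0' : forall S, (S <= T)%N -> qr_det e Psi S != 0.

(** On the basis [qr_poly], multiplying by Psi^q only shifts the quotient exponents, which the
    functional turns into the factor c^q. Non-degeneracy at level S lets p itself be expanded in
    that basis. *)
Lemma ext_fun_prod lam q p S : (S + d * mdeg q <= T)%N -> deg_le p S ->
  ext_fun lam ((\prod_l Psi l ^+ q l) * p) = (\prod_l c l ^+ q l) * ext_fun lam p.
Proof.
move=> ST; have dS : qr_det e Psi S != 0.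
  by apply/det0'/(leq_trans _ ST)/leq_addr.
move: p; apply: (@qr_ind S _ dS).
- move=> m mS; rewrite -qr_poly_shift ext_fun_qr; last first.
    by rewrite mdegD mdegMn mulnC (leq_trans _ ST) // leq_add2r.
  rewrite ext_fun_qr; last by rewrite (leq_trans mS) // (leq_trans _ ST) // leq_addr.
  rewrite mulrA -big_split /=; congr (_ * lam _).
    by apply: eq_bigr => l _; rewrite mnmDE mulmnE divnDMl // -exprD addnC.
  apply: (@box_mnm_inj N e); apply/mnmP => l.
  by rewrite !box_mnm_remE mnmDE mulmnE addnC modnMDl.
- by rewrite mulr0 ext_fun0 mulr0.
- by move=> a p IH; rewrite -scalerAr !ext_funZ IH mulrCA.
- by move=> p q' IHp IHq; rewrite mulrDr !ext_funD IHp IHq mulrDr.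
Qed.

(** The transpose of multiplication by g on the quotient by Psi - c, in box coordinates. *)
Definition mul_fun (lam : box -> K) (g : mpoly N K) (a : box) : K :=
  ext_fun lam (g * mpolyX K (box_mnm a)).

Lemma mdeg_box (a : box) : (mdeg (box_mnm a) <= N * e)%N.
Proof.
rewrite mdegE -[X in (X * _)%N]card_ord -sum_nat_const; apply: leq_sum => i _.
by rewrite box_mnmE -ltnS.
Qed.

(** By [ext_fun_prod] both sides reduce to products of g with box monomials. The level conditions
    leave room for the factor g of degree d. *)
Lemma ext_mul_fun lam g p S : (S + d <= T)%N -> (d + N * e <= T)%N -> deg_le g d -> deg_le p S ->
  ext_fun (mul_fun lam g) p = ext_fun lam (g * p).
Proof.
move=> ST TN gd; have dS : qr_det e Psi S != 0.
  by apply/det0'/(leq_trans _ ST)/leq_addr.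
move: p; apply: (@qr_ind S _ dS).
- move=> m mS; rewrite ext_fun_qr; last by rewrite (leq_trans mS) // (leq_trans _ ST) // leq_addr.
  have -> : g * qr_poly e Psi m = (\prod_l Psi l ^+ mnm_quo e m l) *
      (g * mpolyX K (box_mnm (mnm_rem e m))).
    rewrite /qr_poly mulrCA; congr (_ * _); apply: eq_bigr => l _.
    by rewrite mnm_quoE.
  rewrite (@ext_fun_prod _ _ _ (d + mdeg (box_mnm (mnm_rem e m)))); last first.
  + by apply: deg_leM => //; apply: deg_leX.
  + rewrite -addnA [X in (_ + X)%N]addnC -mdeg_quo_rem addnC (leq_trans _ ST) //.
    by rewrite leq_add2r.
  by congr (_ * _); apply: eq_bigr => l _; rewrite mnm_quoE.
- by rewrite mulr0 !ext_fun0.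
- by move=> a p IH; rewrite -scalerAr !ext_funZ IH.
- by move=> p q' IHp IHq; rewrite mulrDr !ext_funD IHp IHq.
Qed.

End Functional.

Lemma ext_fun_level S T c lam p : (S <= T)%N -> qr_det e Psi S != 0 -> qr_det e Psi T != 0 ->
  deg_le p S -> ext_fun S c lam p = ext_fun T c lam p.
Proof.
move=> ST dS dT; move: p; apply: (@qr_ind S _ dS).
- by move=> m mS; rewrite !ext_fun_qr // (leq_trans mS).
- by rewrite !ext_fun0.
- by move=> a p IH; rewrite !ext_funZ IH.
- by move=> p q' IHp IHq; rewrite !ext_funD IHp IHq.
Qed.

(** More than d^N points would make the evaluations on box monomials linearly dependent. The
    dependency spreads to all polynomials of degree at most T, yet a product of d^N affine forms
    isolates one point. *)
Lemma leq_size_fiber T (c : 'I_N -> K) (s : seq 'rV[K]_N) :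
  (d ^ N <= T)%N -> qr_det e Psi T != 0 -> uniq s ->
  (forall y, y \in s -> forall l, meval (fun j => y 0 j) (Psi l) = c l) ->
  (size s <= d ^ N)%N.
Proof.
move=> DT dT us sP; rewrite leqNgt; apply/negP => lt.
pose y (k : 'I_(d ^ N).+1) := nth 0 s k.
have ys k : y k \in s by apply: mem_nth; apply: leq_trans (ltn_ord k) lt.
have y_inj k l : y k = y l -> k = l.
  move=> /eqP; rewrite nth_uniq //; try exact: leq_trans (ltn_ord _) lt.
  by move=> /eqP; apply: val_inj.
pose ev k (p : mpoly N K) := meval (fun j => y k 0 j) p.
pose V : 'M[K]_((d ^ N).+1, #|{: box}|) :=
  \matrix_(k, b) ev k (mpolyX K (box_mnm (enum_val b))).
have rV : (\rank V <= d ^ N)%N.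
  by apply: (leq_trans (rank_leq_col _)); rewrite card_ffun !card_ord.
have : kermx V != 0.
  by rewrite -mxrank_eq0 mxrank_ker -lt0n subn_gt0.
move=> /rowV0Pn [w /sub_kermxP wV w0].
(* All the points have the same values c of Psi, so a dependency on box monomials survives
   multiplication by powers of Psi. *)
have wE p : deg_le p T -> \sum_k w 0 k * ev k p = 0.
  move: p; apply: (@qr_ind T _ dT).
  - move=> m mT; have /rowP/(_ (enum_rank (mnm_rem e m))) := wV.
    rewrite mxE [RHS]mxE => E; transitivity ((\prod_l c l ^+ (m l %/ d)) *
      \sum_j w 0 j * V j (enum_rank (mnm_rem e m))); last by rewrite E mulr0.
    rewrite big_distrr /=; apply: eq_bigr => k _.
    rewrite /ev /meval mmap_qr_poly mulrCA mxE enum_rankK.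
    rewrite [ev _ _]mevalX; congr (_ * (_ * _)).
    by apply: eq_bigr => l _; congr (_ ^+ _); apply: sP.
  - by rewrite big1 // => k _; rewrite /ev meval0 mulr0.
  - move=> a p IH; transitivity (a * \sum_k w 0 k * ev k p); last by rewrite IH mulr0.
    by rewrite big_distrr; apply: eq_bigr => k _ /=; rewrite /ev mevalZ mulrCA.
  - move=> p q IHp IHq.
    transitivity (\sum_k w 0 k * ev k p + \sum_k w 0 k * ev k q).
      by rewrite -big_split /=; apply: eq_bigr => k _; rewrite /ev mevalD mulrDr.
    by rewrite IHp IHq addr0.
have [k0 wk0] : exists k0, w 0 k0 != 0.
  apply/existsP; rewrite -negb_forall; apply: contra w0 => /forallP w0.
  by apply/eqP/rowP => k; rewrite mxE; apply/eqP.
have sep k : exists q : mpoly N K,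
    [/\ deg_le q 1, k != k0 -> ev k q = 0 & ev k0 q != 0].
  have [->|kk0] := eqVneq k k0.
    by exists (mpolyC N 1); split => //; rewrite ?eqxx // /ev ?mevalC ?oner_eq0 //; apply: deg_leC.
  have [i yi] : exists i, y k0 0 i != y k 0 i.
    apply/existsP; rewrite -negb_forall; apply: contra kk0 => /forallP yE.
    by apply/eqP/esym/y_inj/rowP => i; apply/eqP.
  exists (mpolyX K (mnm1 i) - mpolyC N (y k 0 i)); split.
  - by apply: deg_leB; [apply: deg_leX; rewrite mdeg1|apply: deg_leC].
  - by move=> _; rewrite /ev mevalB mevalXU mevalC subrr.
  - by rewrite /ev mevalB mevalXU mevalC subr_eq0.
have [q qP] := choice sep.
(* There are d^N factors of degree at most 1, within the level T; the product vanishes at every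
   point but the one of index k0. *)
pose p := \prod_(k | k != k0) q k.
have pT : deg_le p T.
  rewrite /p -big_filter.
  apply: (@deg_leW _ _ _ (\sum_(k <- [seq k <- index_enum _ | k != k0]) 1)%N).
    by rewrite big_filter sum1_card cardC1 card_ord.
  by apply: deg_le_prod => k; case: (qP k).
have := wE p pT; rewrite (bigD1 k0) //= big1 ?addr0 => [|k kk0]; last first.
  rewrite /ev /p rmorph_prod (bigD1 k) //=; case: (qP k) => _ /(_ kk0).
  by rewrite /ev => -> _; rewrite mul0r mulr0.
move/eqP; rewrite mulf_eq0 (negPf wk0) /= /ev /p rmorph_prod /=.
by apply/negP/prodf_neq0 => k _; case: (qP k).
Qed.
End Roots.

(** * Over a closed field, roots of the determinant are values *)

Section ClosedRoots.
Variables (K : numClosedFieldType) (N e : nat).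
Variables (Psi : 'I_N -> mpoly N K) (Psi0 : mpoly N K).
Local Notation d := e.+1.
Local Notation box := {ffun 'I_N -> 'I_d}.
Hypothesis Psi_deg : forall i, deg_le (Psi i) d.
Hypothesis Psi0_deg : deg_le Psi0 d.
(** Box monomials have degree at most N e; this level leaves room for two successive multiplications
    by polynomials of degree d. *)
Let T := (d + (d + N * e))%N.
Hypothesis det_neq0 : forall S, (S <= T)%N -> qr_det e Psi S != 0.

Variable c : 'I_N -> K.
Let E : (box -> K) -> mpoly N K -> K := ext_fun Psi T c.

Let lam_of (v : 'rV[K]_#|{: box}|) : box -> K := fun a => v 0 (enum_rank a).

Let mul_mx (g : mpoly N K) : 'M[K]_#|{: box}| :=
  \matrix_(i, j) E (fun a => (a == enum_val i)%:R) (g * mpolyX K (box_mnm (enum_val j))).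

Let ET lam g : E lam g = \sum_(i < #|{: box}|) lam (enum_val i) * E (fun a => (a == enum_val i)%:R) g.
Proof.
rewrite /E /ext_fun; under [RHS]eq_bigr => i _ do rewrite mulrCA.
rewrite -mulr_sumr; congr (_ * _); under [RHS]eq_bigr => i _ do rewrite mulr_sumr.
rewrite exchange_big; apply: eq_bigr => k _ /=.
rewrite (bigD1 (enum_rank (mnm_rem e (level_mnm k)))) //= enum_rankK eqxx mulr1.
rewrite [X in _ = _ + X]big1 ?addr0 => [|i /negPf ik]; last first.
  case: (mnm_rem e (level_mnm k) =P enum_val i) => [Ei|_]; last by rewrite !mulr0.
  by move: ik; rewrite Ei enum_valK eqxx.
by rewrite mulrA mulrC.
Qed.

Let mul_mxE v g a : (v *m mul_mx g) 0 (enum_rank a) = mul_fun Psi T c (lam_of v) g a.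
Proof.
rewrite mxE /mul_fun [RHS]ET; apply: eq_bigr => i _.
by rewrite mxE enum_rankK /lam_of enum_valK.
Qed.

Let dT : qr_det e Psi T != 0. Proof. exact: det_neq0. Qed.

Let lam_of_mul v g : lam_of (v *m mul_mx g) = mul_fun Psi T c (lam_of v) g.
Proof. by apply/funext => a; rewrite /lam_of mul_mxE. Qed.

Let mul_mx2E v g h a : deg_le g d -> deg_le h d ->
  (v *m mul_mx g *m mul_mx h) 0 (enum_rank a) = E (lam_of v) (g * (h * mpolyX K (box_mnm a))).
Proof.
move=> gd hd; rewrite mul_mxE lam_of_mul /mul_fun -/(mul_fun Psi T c (lam_of v) g).
apply: (@ext_mul_fun _ _ _ _ Psi_deg _ _ dT det_neq0 _ _ _ (d + N * e)) => //.
- by rewrite addnC.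
- by rewrite /T leq_addl.
- apply: deg_leM => //; apply: deg_leX; exact: mdeg_box.
Qed.

Let mul_mx_comm g h : deg_le g d -> deg_le h d -> comm_mx (mul_mx g) (mul_mx h).
Proof.
move=> gd hd; apply/row_matrixP => i; rewrite !row_mul !rowE -[X in X = _]mulmxA.
apply/rowP => j; rewrite -[j]enum_valK !mulmxA !mul_mx2E //.
by rewrite mulrCA.
Qed.

Let deg1 i : deg_le (mpolyX K (mnm1 i) : mpoly N K) d.
Proof. by apply: deg_leX; rewrite mdeg1. Qed.

(** A root yields a functional on the quotient that is an eigenvector for Psi0 with eigenvalue tau.
    The multiplications by the coordinates commute and preserve that eigenspace, so they have a
    common eigenvector in it; their eigenvalues are the coordinates of the point sought, and the
    functional is a multiple of evaluation there. *)
Lemma elim_root (tau : K) : \det (elim_mx e Psi idfun Psi0 tau c) = 0 ->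
  exists y : 'I_N -> K, meval y Psi0 = tau /\ forall l, meval y (Psi l) = c l.
Proof.
(* A kernel vector indexed by the columns is wanted: its entries are the values of a functional on
   the box monomials. *)
rewrite -det_tr => /eqP /det0P [u u0 uX].
have uP : u *m mul_mx Psi0 = tau *: u.
  apply/rowP => j; rewrite -[j]enum_valK mul_mxE /mul_fun mxE.
  set a := enum_val j; pose S := top_level a.
  have ST : (S <= T)%N.
    by rewrite /S /top_level /T leq_add2l (leq_trans (mdeg_box a)) // leq_addl.
  have pS : deg_le (Psi0 * mpolyX K (box_mnm a)) S.
    by apply: deg_leM => //; apply: deg_leX.
  rewrite -(ext_fun_level Psi_deg c (lam_of u) ST (det_neq0 ST) dT pS) /ext_fun.
  have /rowP/(_ j) := uX; rewrite !mxE.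
  under eq_bigr => k _ do rewrite !mxE mulrBr.
  rewrite sumrB (bigD1 j) //= eqxx mulr1n [X in _ + X - _]big1 => [|k /negPf kj]; last first.
    by rewrite eq_sym kj mulr0n mulr0.
  rewrite addr0 => /eqP; rewrite subr_eq0 => /eqP Eu.
  apply: (mulfI (det_neq0 ST)); rewrite mulrA divff ?det_neq0 // mul1r.
  rewrite [RHS]mulrCA [RHS]mulrA enum_valK [RHS]mulrC [tau * _]mulrC -/S -/a.
  rewrite mulrA in Eu; rewrite mulrA Eu.
  under [RHS]eq_bigr => k _ do rewrite mulr_sumr.
  rewrite (exchange_big_dep xpredT) //=; apply: eq_bigr => k _.
  rewrite (big_pred1 (enum_rank (mnm_rem e (level_mnm k)))); last first.
    by move=> i /=; apply/eqP/eqP => [->|->]; rewrite ?enum_valK ?enum_rankK.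
  by rewrite /lam_of [RHS]mulrC -mulrA.
have eig : u *m (mul_mx Psi0 - tau%:M) = 0.
  by rewrite mulmxBr uP mul_mx_scalar subrr.
have r0 : (0 < \rank (eigenspace (mul_mx Psi0) tau))%N.
  rewrite lt0n mxrank_eq0; apply/rowV0Pn; exists u => //.
  by apply/eigenspaceP.
pose V := eigenspace (mul_mx Psi0) tau.
pose As := [seq mul_mx (mpolyX K (mnm1 i)) | i <- enum 'I_N].
have stab B : B \in As -> stablemx V B.
  move=> /mapP [i _ ->]; apply: comm_mx_stable_eigenspace.
  exact: mul_mx_comm.
have AsC : {in As &, forall A B, comm_mx A B}.
  by move=> _ _ /mapP [i _ ->] /mapP [j _ ->]; apply: mul_mx_comm.
have [] := @spectral.common_eigenvector K _ [seq restrictmx V B | B <- As] r0.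
  move=> _ _ /mapP [B BA ->] /mapP [B' BA' ->].
  rewrite /comm_mx -!conjmxM ?inE ?stablemx_row_base ?stab //.
  by rewrite AsC.
move=> v v0 /allP vP; pose w := v *m row_base V.
have w0 : w != 0 by rewrite mulmx_free_eq0 // row_base_free.
have wV : (w <= V)%MS by rewrite mulmx_sub // eq_row_base.
have wP i : exists y, w *m mul_mx (mpolyX K (mnm1 i)) = y *: w.
  apply/sub_rVP; rewrite -/(stablemx _ _) /w -stablemx_restrict; last first.
    by apply: stab; apply: map_f; rewrite mem_enum.
  by apply: vP; apply: map_f; apply: map_f; rewrite mem_enum.
have [y yP] := choice wP.
have wX i p : deg_le p (d + N * e) -> E (lam_of w) (mpolyX K (mnm1 i) * p) = y i * E (lam_of w) p.
  move=> pd; rewrite /E -(@ext_mul_fun _ _ _ _ Psi_deg _ _ dT det_neq0 _ _ _ (d + N * e)) //.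
  - rewrite -lam_of_mul yP.
    have -> : lam_of (y i *: w) = fun a => y i * lam_of w a.
      by apply/funext => a; rewrite /lam_of mxE.
    rewrite -/E [LHS]ET [in RHS]ET mulr_sumr; apply: eq_bigr => k _.
    by rewrite -mulrA.
  - by rewrite /T addnC.
  - by rewrite /T leq_addl.
(* Induction on the degree: stripping one variable costs its eigenvalue. *)
have E1 m : (mdeg m <= d)%N \/ (mdeg m <= N * e)%N ->
   E (lam_of w) (mpolyX K m) = (\prod_i y i ^+ m i) * E (lam_of w) 1.
  move=> mT; have {mT} : (mdeg m <= d + N * e)%N.
    by case: mT => /leq_trans; apply; rewrite ?leq_addr ?leq_addl.
  have [k] := ubnP (mdeg m); elim: k m => // k IH m mk mT.
  have [m0|] := eqVneq m (@mnm0 N).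
    by rewrite m0 mpolyX0 big1 ?mul1r // => i _; rewrite mnm0E.
  rewrite -mdeg_eq0 mdegE sum_nat_eq0 negb_forall => /existsP [i mi].
  have mE : m = mnm_add (mnm1 i) (mnm_sub m (mnm1 i)).
    by rewrite addmC submK // lep1mP.
  have dm : mdeg m = (mdeg (mnm_sub m (mnm1 i))).+1 by rewrite {1}mE mdegD mdeg1.
  rewrite {1}mE mpolyXD wX; last first.
    by apply: deg_leX; rewrite (leq_trans _ mT) // dm.
  have h1 : (mdeg (mnm_sub m (mnm1 i)) < k)%N by move: mk; rewrite dm ltnS.
  have h2 : (mdeg (mnm_sub m (mnm1 i)) <= d + N * e)%N.
    by apply: leq_trans mT; rewrite dm.
  rewrite (IH _ h1 h2).
  rewrite mulrA; congr (_ * _); rewrite [RHS](bigD1 i) //= (bigD1 i) //= mulrA; congr (_ * _).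
    by rewrite -exprS mnmBE mnm1E eqxx subn1 prednK // lt0n.
  apply: eq_bigr => l /negPf li; rewrite mnmBE mnm1E eq_sym li subn0 //.
have E2 p : deg_le p d -> E (lam_of w) p = meval y p * E (lam_of w) 1.
  move: p; apply: deg_le_ind.
  - by move=> m md; rewrite E1; [rewrite mevalX|left].
  - by rewrite /E ext_fun0 meval0 mul0r.
  - by move=> a p IH; rewrite /E ext_funZ -/E IH mevalZ mulrA.
  - by move=> p q IHp IHq; rewrite /E ext_funD -/E IHp IHq mevalD mulrDl.
have boxT (a : box) : (mdeg (box_mnm a) <= T)%N.
  by rewrite (leq_trans (mdeg_box a)) // /T addnA leq_addl.
have EX a : E (lam_of w) (mpolyX K (box_mnm a)) = lam_of w a.
  exact: ext_fun_box.
(* If the value at 1 vanished, so would the values at all box monomials, that is, the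
   eigenvector. *)
have Ew0 : E (lam_of w) 1 != 0.
  apply: contra w0 => /eqP E0; apply/eqP/rowP => j; rewrite -[j]enum_valK [RHS]mxE.
  rewrite -/(lam_of w _) -EX E1; last by right; exact: mdeg_box.
  by rewrite E0 mulr0.
exists y; split.
  apply: (mulIf Ew0); rewrite -E2 //.
  pose a0 : box := [ffun=> ord0].
  have X0 : mpolyX K (box_mnm a0) = 1.
    rewrite -mpolyX0; congr mpolyX; apply/mnmP => i.
    by rewrite box_mnmE ffunE mnm0E.
  have /eigenspaceP wT := wV.
  have /rowP/(_ (enum_rank a0)) := wT; rewrite mul_mxE /mul_fun [RHS]mxE X0 mulr1.
  by move=> E0; rewrite -X0 EX; exact: E0.
move=> l; apply: (mulIf Ew0); rewrite -E2 //.
have := @ext_fun_prod _ _ _ _ Psi_deg T c dT det_neq0 (lam_of w) (mnm1 l) 1 0.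
have d1 : deg_le (1 : mpoly N K) 0 by rewrite -(mpolyC1 N K); apply: deg_leC.
rewrite mdeg1 muln1 add0n leq_addr => /(_ isT d1).
rewrite !mulr1 -/E (bigD1 l) //= mnm1E eqxx expr1 big1 ?mulr1 => [|i /negPf il]; last first.
  by rewrite mnm1E eq_sym il expr0.
move=> ->; congr (_ * _); rewrite (bigD1 l) //= mnm1E eqxx expr1 big1 ?mulr1 // => i /negPf il.
by rewrite mnm1E eq_sym il expr0.
Qed.

End ClosedRoots.

(** * Induction on polynomials, absolute values and elementary estimates *)

Section MpolyInd.
Variables (A : comNzRingType) (n : nat) (P : mpoly n A -> Prop).
Hypotheses (PC : forall c, P (mpolyC n c)) (PX : forall i, P (mpolyX A (mnm1 i))).
Hypotheses (PD : forall p q, P p -> P q -> P (p + q)) (PM : forall p q, P p -> P q -> P (p * q)).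

Lemma mpoly_ring_ind p : P p.
Proof.
rewrite [p]mpolyE; apply: (big_ind P) => //; first by rewrite -(mpolyC0 n A).
move=> m _; rewrite -mul_mpolyC; apply: PM => //.
rewrite mpolyXE_id; apply: (big_ind P) => //; first by rewrite -(mpolyC1 n A).
move=> i _; elim: (m i) => [|k IH]; first by rewrite expr0 -(mpolyC1 n A).
by rewrite exprS; apply: PM.
Qed.
End MpolyInd.

(** What [absR] and [absC] have in common; all estimates needed for both fields rest on these
    properties only. *)
Record absolute_value (R : realType) (K : fieldType) (abs : K -> R) : Prop := {
  av_ge0 : forall x, 0 <= abs x;
  av0 : abs 0 = 0;
  av0_eq0 : forall x, abs x = 0 -> x = 0;
  avM : forall x y, abs (x * y) = abs x * abs y;
  avD : forall x y, abs (x + y) <= abs x + abs y }.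

Lemma absR_absolute_value (R : realType) : absolute_value (@absR R).
Proof.
split=> [x||x|x y|x y]; rewrite /absR ?normr0 //; first exact: normr0_eq0.
  exact: normrM.
exact: ler_normD.
Qed.

Lemma absC_absolute_value (R : realType) : absolute_value (@absC R).
Proof.
split=> [x||x|x y|x y]; rewrite /absC.
- by case: x => a b /=; apply: sqrtr_ge0.
- exact: ComplexField.Normc.normc0.
- exact: ComplexField.Normc.eq0_normc.
- exact: ComplexField.Normc.normcM.
- exact: le_normcD.
Qed.

Section AbsoluteValue.
Variables (R : realType) (K : fieldType) (abs : K -> R).
Hypothesis av : absolute_value abs.

Lemma av1 : abs 1 = 1.
Proof.
have a1 : abs 1 != 0 by apply/eqP => /(av0_eq0 av)/eqP; rewrite oner_eq0.
by apply: (mulfI a1); rewrite -(avM av) !mulr1.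
Qed.

Lemma av_gt0 x : (0 < abs x) = (x != 0).
Proof.
rewrite lt_def (av_ge0 av) andbT; congr (~~ _).
by apply/eqP/eqP => [/(av0_eq0 av)|->]; rewrite ?(av0 av).
Qed.

Lemma avN x : abs (- x) = abs x.
Proof.
suff aN1 : abs (-1) = 1 by rewrite -mulN1r (avM av) aN1 mul1r.
have : abs (-1) ^+ 2 = 1 by rewrite expr2 -(avM av) mulrNN mulr1 av1.
by move/eqP; rewrite sqrp_eq1 ?(av_ge0 av) // => /eqP.
Qed.

Lemma avB x y : abs (x - y) = abs (y - x).
Proof. by rewrite -avN opprB. Qed.

Lemma av_leB x y : abs (x - y) <= abs x + abs y.
Proof. by rewrite -[abs y]avN; apply: avD. Qed.

Lemma av_lerB x y : abs x - abs y <= abs (x - y).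
Proof. by rewrite lerBlDr; apply: le_trans (avD av _ _); rewrite subrK. Qed.

Lemma avX x k : abs (x ^+ k) = abs x ^+ k.
Proof. by elim: k => [|k IH]; rewrite ?expr0 ?av1 // !exprS (avM av) IH. Qed.

Lemma avV x : abs x^-1 = (abs x)^-1.
Proof.
have [->|x0] := eqVneq x 0; first by rewrite invr0 (av0 av) invr0.
have ax0 : abs x != 0 by rewrite gt_eqF // av_gt0.
by apply: (mulfI ax0); rewrite -(avM av) !divff // av1.
Qed.

Lemma av_sum (I : Type) (r : seq I) (P : pred I) (F : I -> K) :
  abs (\sum_(i <- r | P i) F i) <= \sum_(i <- r | P i) abs (F i).
Proof.
apply: (big_ind2 (fun x y => abs x <= y)) => //; first by rewrite (av0 av).
by move=> x1 y1 x2 y2 h1 h2; apply: le_trans (avD av _ _) _; apply: lerD.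
Qed.

Lemma av_prod (I : Type) (r : seq I) (P : pred I) (F : I -> K) :
  abs (\prod_(i <- r | P i) F i) = \prod_(i <- r | P i) abs (F i).
Proof. exact: (big_morph abs (avM av) av1). Qed.

Lemma av_natr k : abs k%:R <= k%:R.
Proof.
elim: k => [|k IH]; first by rewrite (av0 av).
by rewrite -!natr1; apply: le_trans (avD av _ _) _; rewrite lerD // av1.
Qed.

Lemma mpoly_bounded n (p : mpoly n K) (r : R) : exists2 C, 0 < C &
  forall v, (forall i, abs (v i) <= r) -> abs (meval v p) <= C.
Proof.
move: p; apply: mpoly_ring_ind.
- move=> c; exists (abs c + 1); first by rewrite ltr_wpDl // (av_ge0 av).
  by move=> v _; rewrite mevalC lerDl.
- move=> i; exists (`|r| + 1); first by rewrite ltr_wpDl.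
  move=> v vr; rewrite mevalXU; apply: le_trans (vr i) _.
  by apply: le_trans (ler_norm r) _; rewrite lerDl.
- move=> p q [C C0 HC] [D D0 HD]; exists (C + D); first exact: addr_gt0.
  move=> v vr; rewrite mevalD; apply: le_trans (avD av _ _) _.
  by apply: lerD; [apply: HC|apply: HD].
- move=> p q [C C0 HC] [D D0 HD]; exists (C * D); first exact: mulr_gt0.
  move=> v vr; rewrite mevalM (avM av).
  by apply: ler_pM; rewrite ?(av_ge0 av) //; [apply: HC|apply: HD].
Qed.

Lemma mpoly_lipschitz n (p : mpoly n K) (r : R) : exists2 C, 0 < C &
  forall v w delta, (forall i, abs (v i) <= r) -> (forall i, abs (w i) <= r) ->
   (forall i, abs (v i - w i) <= delta) -> 0 <= delta ->
   abs (meval v p - meval w p) <= C * delta.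
Proof.
move: p; apply: mpoly_ring_ind.
- move=> c; exists 1 => // v w t _ _ _ t0; rewrite !mevalC subrr (av0 av).
  by rewrite mul1r.
- by move=> i; exists 1 => // v w t _ _ vw _; rewrite !mevalXU mul1r.
- move=> p q [C C0 HC] [D D0 HD]; exists (C + D); first exact: addr_gt0.
  move=> v w t vr wr vw t0; rewrite !mevalD opprD addrACA.
  apply: le_trans (avD av _ _) _; rewrite mulrDl.
  by apply: lerD; [apply: HC|apply: HD].
- move=> p q [C C0 HC] [D D0 HD].
  have [P P0 HP] := mpoly_bounded p r; have [Q Q0 HQ] := mpoly_bounded q r.
  exists (C * Q + P * D); first by rewrite addr_gt0 // mulr_gt0.
  move=> v w t vr wr vw t0; rewrite !mevalM.
  have -> : meval v p * meval v q - meval w p * meval w q =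
    (meval v p - meval w p) * meval v q + meval w p * (meval v q - meval w q) by ring.
  apply: le_trans (avD av _ _) _; rewrite !(avM av) mulrDl; apply: lerD.
    rewrite mulrAC; apply: ler_pM; rewrite ?(av_ge0 av) //; [exact: HC|exact: HQ].
  rewrite -mulrA; apply: ler_pM; rewrite ?(av_ge0 av) //; [exact: HP|exact: HD].
Qed.

(* The coefficients of [p] along the line [w + s u]. *)
Lemma mpoly_line_coef n (p : mpoly n K) (r : R) : exists2 C, 0 < C &
  forall (w u : 'I_n -> K) nu, (forall i, abs (w i) <= r) -> (forall i, abs (u i) <= nu) ->
    0 <= nu -> nu <= 1 ->
    let P := mmap polyC (fun i => (w i)%:P + u i *: 'X) p in
    forall l, abs P`_l <= C * (if l == 0%N then 1 else nu).
Proof.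
(* For products one must bound the number of convolution terms; hence the size bound S, uniform in w
   and u, in the induction. *)
suff [S [C C0 H]] : exists S : nat, exists2 C, 0 < C &
  forall (w u : 'I_n -> K) nu, (forall i, abs (w i) <= r) -> (forall i, abs (u i) <= nu) ->
    0 <= nu -> nu <= 1 ->
    let P := mmap polyC (fun i => (w i)%:P + u i *: 'X) p in
    (size P <= S)%N /\ forall l, abs P`_l <= C * (if l == 0%N then 1 else nu).
  by exists C => // w u nu h1 h2 h3 h4 /=; have [] := H w u nu h1 h2 h3 h4.
move: p; apply: mpoly_ring_ind.
- move=> c; exists 1%N, (abs c + 1); first by rewrite ltr_wpDl // (av_ge0 av).
  move=> w u nu _ _ nu0 _ /=; rewrite mmapC size_polyC_leq1; split=> // l.
  rewrite coefC; case: eqP => _; first by rewrite mulr1 lerDl.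
  by rewrite (av0 av) mulr_ge0 // addr_ge0 // (av_ge0 av).
- move=> i; exists 2%N, (`|r| + 1); first by rewrite ltr_wpDl.
  move=> w u nu wr unu nu0 nu1 /=; rewrite mmapX mmap1U; split.
    apply: (leq_trans (size_polyD _ _)); rewrite geq_max.
    rewrite (leq_trans (size_polyC_leq1 _)) //=.
    by rewrite (leq_trans (size_scale_leq _ _)) ?size_polyX.
  move=> l; rewrite coefD coefC coefZ coefX; case: eqP => [->|l0].
    rewrite mulr0 addr0 mulr1; apply: le_trans (wr i) _.
    by apply: le_trans (ler_norm r) _; rewrite lerDl.
  rewrite add0r.
  have r1 : nu <= (`|r| + 1) * nu by rewrite ler_peMl // lerDr.
  case: (l == 1)%N; rewrite ?mulr1 ?mulr0 ?(av0 av).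
    exact: le_trans (unu i) r1.
  exact: le_trans nu0 r1.
- move=> p q [S [C C0 HC]] [T [D D0 HD]]; exists (S + T)%N, (C + D); first exact: addr_gt0.
  move=> w u nu wr unu nu0 nu1 /=; rewrite raddfD /=.
  have /= [sP Pl] := HC w u nu wr unu nu0 nu1; have /= [sQ Ql] := HD w u nu wr unu nu0 nu1.
  split=> [|l].
    apply: (leq_trans (size_polyD _ _)); rewrite geq_max.
    by rewrite (leq_trans sP) ?leq_addr // (leq_trans sQ) ?leq_addl.
  by rewrite coefD; apply: le_trans (avD av _ _) _; rewrite mulrDl; apply: lerD.
- move=> p q [S [C C0 HC]] [T [D D0 HD]].
  exists (S + T)%N, ((S + T).+1%:R * (C * D)); first by rewrite mulr_gt0 ?mulr_gt0 ?ltr0n.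
  move=> w u nu wr unu nu0 nu1 /=; rewrite rmorphM /=.
  have /= [sP Pl] := HC w u nu wr unu nu0 nu1; have /= [sQ Ql] := HD w u nu wr unu nu0 nu1.
  set P := mmap _ _ p in sP Pl *; set Q := mmap _ _ q in sQ Ql *.
  have sPQ : (size (P * Q)%R <= S + T)%N.
    apply: (leq_trans (size_polyMleq _ _)); apply: (leq_trans (leq_pred _)).
    exact: leq_add.
  split=> // l; set th := (if _ then _ else _).
  have th0 : 0 <= th by rewrite /th; case: ifP.
  have th1 : th <= 1 by rewrite /th; case: ifP.
  have [lS|Sl] := ltnP l (S + T); last first.
    rewrite nth_default ?(leq_trans sPQ) // (av0 av) !mulr_ge0 //; exact: ltW.
  rewrite coefM; apply: le_trans (av_sum _ _ _) _.
  apply: (@le_trans _ _ (\sum_(j < l.+1) (C * D * th))).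
    apply: ler_sum => j _; rewrite (avM av).
    have a0 : 0 <= abs P`_j by rewrite (av_ge0 av).
    have b0 : 0 <= abs Q`_(l - j) by rewrite (av_ge0 av).
    apply: le_trans (ler_pM a0 b0 (Pl j) (Ql (l - j)%N)) _.
    rewrite mulrACA; apply: ler_wpM2l; first by rewrite mulr_ge0 // ltW.
    rewrite /th; have [j0|j0] := eqVneq (nat_of_ord j) 0%N.
      by rewrite j0 subn0 mul1r.
    have -> : (l == 0)%N = false.
      apply/negP => /eqP l0; move: j0; rewrite -leqn0.
      by rewrite -{1}l0 -ltnS ltn_ord.
    by rewrite ler_piMr //; case: ifP.
  rewrite big_const_ord iter_addr_0 -[leLHS]mulr_natl -[leRHS]mulrA.
  have CD : 0 <= C * D by rewrite mulr_ge0 // ltW.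
  apply: ler_pM; [exact: ler0n|exact: mulr_ge0| |by []].
  by rewrite ler_nat; apply: (leq_trans lS).
Qed.
End AbsoluteValue.

(** * The generic pencil and its elimination form *)

Section IteratedEval.
Variables (K : fieldType) (n : nat).
Section Eval.
Variables (S : comNzRingType) (kap : {rmorphism K -> S}) (val : 'I_n -> S) (s rho : S).
(** [eval1], [eval2] and [eval3] specialise successively the generic coefficients, the parameter s
    and the parameter rho. *)
Definition eval1 : {rmorphism mpoly n K -> S} := mmap kap val.
Definition eval2 : {rmorphism {poly mpoly n K} -> S} :=
  horner_morph (fun x => mulrC s (eval1 x)).
Definition eval3 : {rmorphism {poly {poly mpoly n K}} -> S} :=
  horner_morph (fun x => mulrC rho (eval2 x)).

Lemma eval2E p : eval2 p = (map_poly eval1 p).[s]. Proof. by []. Qed.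
Lemma eval3E p : eval3 p = (map_poly eval2 p).[rho]. Proof. by []. Qed.
Lemma eval2C x : eval2 x%:P = eval1 x. Proof. exact: horner_morphC. Qed.
Lemma eval2X : eval2 'X = s. Proof. exact: horner_morphX. Qed.
Lemma eval3C x : eval3 x%:P = eval2 x. Proof. exact: horner_morphC. Qed.
Lemma eval3X : eval3 'X = rho. Proof. exact: horner_morphX. Qed.
End Eval.

Variables (S S' : comNzRingType) (kap : {rmorphism K -> S}) (kap' : {rmorphism K -> S'}).
Variables (g : {rmorphism S -> S'}) (val : 'I_n -> S) (s rho : S).
Hypothesis gkap : forall x, g (kap x) = kap' x.

Lemma rmorph_eval1 p : g (eval1 kap val p) = eval1 kap' (fun i => g (val i)) p.
Proof.
rewrite /eval1 /= /mmap rmorph_sum; apply: eq_bigr => m _.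
rewrite rmorphM gkap /mmap1 rmorph_prod; congr (_ * _).
by apply: eq_bigr => i _; rewrite rmorphXn.
Qed.

Lemma rmorph_eval2 p :
  g (eval2 kap val s p) = eval2 kap' (fun i => g (val i)) (g s) p.
Proof.
rewrite !eval2E -horner_map -map_poly_comp; congr horner.
by apply: eq_map_poly => x /=; rewrite -rmorph_eval1.
Qed.

Lemma rmorph_eval3 p :
  g (eval3 kap val s rho p) = eval3 kap' (fun i => g (val i)) (g s) (g rho) p.
Proof.
rewrite !eval3E -horner_map -map_poly_comp; congr horner.
by apply: eq_map_poly => x /=; rewrite -rmorph_eval2.
Qed.

End IteratedEval.

Lemma mmap_map_mpoly (K S : comNzRingType) (kap : {rmorphism K -> S}) n x (p : mpoly n K) :
  mmap idfun (fun i => kap (x i)) (map_mpoly kap p) = kap (meval x p).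
Proof.
move: p; apply: mpoly_ring_ind.
- by move=> c; rewrite map_mpolyC mmapC mevalC.
- by move=> i; rewrite map_mpolyX mmapX mmap1U mevalXU.
- by move=> p q IHp IHq; rewrite mevalD !raddfD /= IHp IHq.
- by move=> p q IHp IHq; rewrite mevalM !rmorphM /= IHp IHq.
Qed.

Section Pencil.
Variables (K : fieldType) (N M e : nat) (f : 'I_M -> mpoly N K).
Local Notation d := e.+1.
Local Notation gen := ('I_N + 'I_M)%type.
Hypothesis f_deg : forall j, deg_le (f j) d.

Section Ring.
Variables (S : comNzRingType) (kap : {rmorphism K -> S}).

(** A linear form, with coefficients u, in the generators x_k and s f_j. *)
Definition pencil0 (s : S) (u : gen -> S) : mpoly N S :=
  \sum_k u (inl k) *: mpolyX S (mnm1 k)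
  + s *: \sum_j u (inr j) *: map_mpoly kap (f j).

(** The term rho x_i^d makes the system eliminable for generic rho; later rho tends to 0 and s to
    infinity, so that s f_j forces roots towards the zeros of f. *)
Definition pencil (rho s : S) (L : 'I_N -> gen -> S) (i : 'I_N) : mpoly N S :=
  rho *: mpolyX S (mnm_muln (mnm1 i) d) + pencil0 s (L i).

Definition pencil_det rho s U L tau c :=
  \det (elim_mx e (pencil rho s L) idfun (pencil0 s U) tau c).

Lemma pencil0_deg s u : deg_le (pencil0 s u) d.
Proof.
apply: deg_leD; first by apply: deg_le_sum => k _; apply/deg_leZ/deg_leX; rewrite mdeg1.
by apply/deg_leZ/deg_le_sum => j _; apply/deg_leZ/deg_le_map.
Qed.

Lemma pencil_deg rho s L i : deg_le (pencil rho s L i) d.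
Proof.
apply: deg_leD; last exact: pencil0_deg.
by apply/deg_leZ/deg_leX; rewrite mdegMn mdeg1 mul1n.
Qed.

Definition gens (s : S) (x : 'I_N -> K) (w : gen) : S :=
  match w with inl k => kap (x k) | inr j => s * kap (meval x (f j)) end.

Lemma meval_pencil0 s u x :
  mmap idfun (fun i => kap (x i)) (pencil0 s u) = \sum_w u w * gens s x w.
Proof.
rewrite big_sumType /= /pencil0 raddfD /= raddf_sum /= -mul_mpolyC rmorphM /= mmapC.
congr (_ + _).
  apply: eq_bigr => k _; rewrite -mul_mpolyC rmorphM /= mmapC mmapX mmap1U //.
rewrite raddf_sum /= big_distrr; apply: eq_bigr => j _ /=.
rewrite -mul_mpolyC rmorphM /= mmapC mulrCA; congr (_ * (_ * _)).
by rewrite mmap_map_mpoly.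
Qed.

Lemma pencil_det_relation rho s U L x :
  pencil_det rho s U L (\sum_w U w * gens s x w)
    (fun i => rho * kap (x i) ^+ d + \sum_w L i w * gens s x w) = 0.
Proof.
rewrite -[RHS](@det_elim_mx S N e (pencil rho s L) (@pencil_deg rho s L) S idfun
  (pencil0 s U) (@pencil0_deg s U) (fun i => kap (x i))).
rewrite meval_pencil0; congr (\det (elim_mx _ _ _ _ _ _)); apply/funext => i.
rewrite /pencil raddfD /= meval_pencil0 -mul_mpolyC rmorphM /= mmapC mmapX.
congr (_ * _ + _); rewrite /mmap1 (bigD1 i) //= mulmnE mnm1E eqxx mul1n big1 ?mulr1 //.
by move=> l /negPf li; rewrite mulmnE mnm1E eq_sym li expr0.
Qed.

End Ring.

Section Naturality.
Variables (S S' : comNzRingType) (kap : {rmorphism K -> S}) (kap' : {rmorphism K -> S'}).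
Variable g : {rmorphism S -> S'}.
Hypothesis gkap : forall x, g (kap x) = kap' x.

Lemma map_pencil0 s u : map_mpoly g (pencil0 kap s u) = pencil0 kap' (g s) (fun w => g (u w)).
Proof.
rewrite /pencil0 rmorphD /= map_mpolyZ !rmorph_sum /=; congr (_ + _ *: _).
  by apply: eq_bigr => k _; rewrite map_mpolyZ map_mpolyX.
apply: eq_bigr => j _; rewrite map_mpolyZ; congr (_ *: _).
by apply/mpolyP => m; rewrite !mcoeff_map_mpoly /= gkap.
Qed.

Lemma map_pencil rho s L i :
  map_mpoly g (pencil kap rho s L i) = pencil kap' (g rho) (g s) (fun i w => g (L i w)) i.
Proof. by rewrite /pencil rmorphD /= map_mpolyZ map_mpolyX map_pencil0. Qed.

Lemma rmorph_pencil_det rho s U L tau c :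
  g (pencil_det kap rho s U L tau c) =
  pencil_det kap' (g rho) (g s) (fun w => g (U w)) (fun i w => g (L i w)) (g tau) (fun i => g (c i)).
Proof.
rewrite /pencil_det -det_map_mx.
rewrite (@elim_mx_rmorph S S S' N e _ idfun g g) //; congr (\det _).
transitivity (elim_mx e (fun l => map_mpoly g (pencil kap rho s L l)) idfun
  (map_mpoly g (pencil0 kap s U)) (g tau) (fun i => g (c i))).
  by apply/esym; apply: map_elim_mx.
rewrite map_pencil0.
have -> // : (fun l => map_mpoly g (pencil kap rho s L l)) =
  pencil kap' (g rho) (g s) (fun i w => g (L i w)).
by apply/funext => i; rewrite map_pencil.
Qed.

Lemma rmorph_pencil_det_eq r0 s0 U0 L0 t0 c0 rho s U L tau c :
  g r0 = rho -> g s0 = s -> (forall w, g (U0 w) = U w) -> (forall i w, g (L0 i w) = L i w) ->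
  g t0 = tau -> (forall i, g (c0 i) = c i) ->
  g (pencil_det kap r0 s0 U0 L0 t0 c0) = pencil_det kap' rho s U L tau c.
Proof.
move=> <- <- EU EL <- Ec; rewrite rmorph_pencil_det.
have -> : (fun w => g (U0 w)) = U by apply/funext.
have -> : (fun i w => g (L0 i w)) = L by apply/funext => i; apply/funext.
by have -> : (fun i => g (c0 i)) = c by apply/funext.
Qed.
End Naturality.

Definition pencil_var := (option 'I_N * gen + option 'I_N)%type.
Local Notation n0 := #|{: pencil_var}|.

(* Rows of coefficients and target coordinates are indexed by [option 'I_N]:
   [None] stands for the distinguished form, [Some i] for the [i]-th one. *)
Definition pencil_val (S : Type) (U : gen -> S) (L : 'I_N -> gen -> S) (tau : S) (c : 'I_N -> S)
    (k : 'I_n0) : S :=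
  match enum_val k with
  | inl (None, w) => U w
  | inl (Some i, w) => L i w
  | inr None => tau
  | inr (Some i) => c i
  end.

Definition const3 : {rmorphism K -> {poly {poly mpoly n0 K}}} :=
  (polyC \o (polyC \o @mpolyC n0 K)).
Definition var3 (w : pencil_var) : {poly {poly mpoly n0 K}} :=
  (mpolyX K (mnm1 (enum_rank w)))%:P%:P.

Definition var_U w := var3 (inl (None, w)).
Definition var_L i w := var3 (inl (Some i, w)).
Definition var_tau := var3 (inr None).
Definition var_c i := var3 (inr (Some i)).

(** The determinant with all data generic: the outer variable is rho, the inner one s, and the
    coefficients are polynomials in the forms and the target values. *)
Definition pencil_form : {poly {poly mpoly n0 K}} :=
  pencil_det const3 'X 'X%:P var_U var_L var_tau var_c.

Lemma eval_pencil_form (S : comNzRingType) (kap : {rmorphism K -> S}) rho s U L tau c :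
  eval3 kap (pencil_val U L tau c) s rho pencil_form = pencil_det kap rho s U L tau c.
Proof.
set ev := eval3 _ _ _ _.
have E w : ev (var3 w) = pencil_val U L tau c (enum_rank w).
  by rewrite /ev /var3 eval3C eval2C /eval1 /= mmapX mmap1U.
have evc x : ev (const3 x) = kap x.
  by rewrite /ev /const3 /= eval3C eval2C /eval1 /= mmapC.
have evr : ev 'X = rho by rewrite /ev eval3X.
have evs : ev 'X%:P = s by rewrite /ev eval3C eval2X.
apply: (rmorph_pencil_det_eq evc evr evs).
- by move=> w; rewrite E /pencil_val enum_rankK.
- by move=> i w; rewrite E /pencil_val enum_rankK.
- by rewrite E /pencil_val enum_rankK.
- by move=> i; rewrite E /pencil_val enum_rankK.
Qed.

(** At rho = 1, s = 0, tau = 1 with all forms zero, the elimination matrix is the identity. *)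
Lemma pencil_form_neq0 : pencil_form != 0.
Proof.
apply/eqP => /(congr1 (eval3 (idfun : {rmorphism K -> K})
   (pencil_val (fun=> 0) (fun _ _ => 0) 1 (fun=> 0)) 0 1)).
rewrite eval_pencil_form rmorph0 => /eqP; apply/negP.
have P0 : pencil0 (idfun : {rmorphism K -> K}) 0 (fun=> 0) = 0.
  by rewrite /pencil0 scale0r addr0 big1 // => k _; rewrite scale0r.
have PE : pencil (idfun : {rmorphism K -> K}) 1 0 (fun _ _ => 0)
        = fun l : 'I_N => mpolyX K (mnm_muln (mnm1 l) d).
  by apply/funext => l; rewrite /pencil P0 addr0 scale1r.
rewrite /pencil_det P0 PE.
suff -> : elim_mx e (fun l : 'I_N => mpolyX K (mnm_muln (mnm1 l) d)) idfun 0 1 (fun=> 0) = 1%:M.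
  by rewrite det1 oner_eq0.
apply/matrixP => i j; rewrite !mxE qr_det_Xn /= mulr1 big1 ?subr0 // => k _.
rewrite mul0r /qr_coord; have -> : coef_row (top_level (enum_val i)) (0 : mpoly N K) = 0.
  by apply/rowP => l; rewrite !mxE mcoeff0.
by rewrite mul0mx mxE mul0r.
Qed.

End Pencil.

(** * Limits of one-variable polynomials *)

Section PolyLimits.
Variables (R : realType) (K : fieldType) (abs : K -> R).
Hypothesis av : absolute_value abs.

Lemma poly_bounded (p : {poly K}) (r : R) : exists2 C, 0 < C &
  forall x, abs x <= r -> abs p.[x] <= C.
Proof.
elim/poly_ind: p => [|p c [C C0 HC]].
  by exists 1 => // x _; rewrite horner0 (av0 av) ler01.
exists (C * `|r| + abs c + 1).
  by rewrite ltr_wpDl // addr_ge0 ?(av_ge0 av) // mulr_ge0 // ltW.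
move=> x xr; rewrite hornerMXaddC; apply: le_trans (avD av _ _) _.
rewrite (avM av) -addrA; apply: lerD; last by rewrite lerDl.
apply: ler_pM; rewrite ?(av_ge0 av) //; first exact: HC.
exact: le_trans xr (ler_norm r).
Qed.

Lemma poly_cvg0 (p : {poly K}) (eta : R) : 0 < eta -> exists2 r, 0 < r &
  forall x, abs x <= r -> abs (p.[x] - p.[0]) <= eta.
Proof.
move=> eta0; have [q ->] : exists q, p = q * 'X + (p.[0])%:P.
  elim/poly_ind: p => [|p c _]; first by exists 0; rewrite horner0 mul0r addr0.
  by exists p; rewrite hornerMXaddC mulr0 add0r.
have [C C0 HC] := poly_bounded q 1; exists (Num.min 1 (eta / C)).
  by rewrite lt_min ltr01 divr_gt0.
move=> x; rewrite le_min => /andP [x1 xe].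
rewrite !hornerMXaddC mulr0 add0r addrK (avM av).
have -> : eta = C * (eta / C) by rewrite mulrC divfK // gt_eqF.
by apply: ler_pM; rewrite ?(av_ge0 av) //; apply: HC.
Qed.

Lemma poly_cvg_lead (p : {poly K}) n (eta : R) : (size p <= n.+1)%N -> 0 < eta ->
  exists2 S1, 1 <= S1 & forall x, S1 <= abs x -> abs (p.[x] / x ^+ n - p`_n) <= eta.
Proof.
move=> sp eta0; pose C := \sum_(i < n) abs p`_i + 1.
have C0 : 0 < C by rewrite ltr_wpDl // sumr_ge0 // => i _; apply: (av_ge0 av).
exists (Num.max 1 (C / eta)); first by rewrite le_max lexx.
move=> x; rewrite ge_max => /andP [x1 xC].
have ax0 : 0 < abs x by apply: lt_le_trans x1.
have x0 : x != 0 by rewrite -(av_gt0 av).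
rewrite (horner_coef_wide _ sp) big_ord_recr /= mulrDl mulfK ?expf_neq0 // addrK.
rewrite mulr_suml; apply: le_trans (av_sum av _ _ _) _.
apply: (@le_trans _ _ (C / abs x)); last first.
  by rewrite ler_pdivrMr // mulrC -ler_pdivrMr.
apply: (@le_trans _ _ (\sum_(i < n) abs p`_i / abs x)); last first.
  by rewrite -mulr_suml ler_pM2r ?invr_gt0 // lerDl.
apply: ler_sum => i _; rewrite !(avM av) (avV av) !(avX av) -mulrA.
apply: ler_wpM2l; first exact: av_ge0.
rewrite ler_pdivrMr ?exprn_gt0 // mulrC -[X in _ / X]expr1 -expfB_cond //.
  by rewrite subn1; apply: ler_weXn2l => //; rewrite -ltnS prednK // (leq_trans _ (ltn_ord i)).
by rewrite (negPf (lt0r_neq0 ax0)) /= (leq_trans _ (ltn_ord i)).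
Qed.

Lemma poly_split_X (A : idomainType) (p : {poly A}) : p != 0 ->
  exists k q, p = 'X^k * q /\ q`_0 != 0.
Proof.
move=> p0; have [k [q /implyP/(_ p0) q0 pE]] := multiplicity_XsubC p 0.
exists k, q; split; first by rewrite mulrC pE subr0.
by move: q0; rewrite /root horner_coef0.
Qed.

End PolyLimits.

(** * The limit form b of the pencil *)

Section PencilLimit.
Variables (R : realType) (K : fieldType) (abs : K -> R).
Hypothesis av : absolute_value abs.
Variables (N M e : nat) (f : 'I_M -> mpoly N K).
Local Notation d := e.+1.
Local Notation gen := ('I_N + 'I_M)%type.
Local Notation n0 := #|{: pencil_var N M}|.
Hypothesis f_deg : forall j, deg_le (f j) d.
Let idK : {rmorphism K -> K} := idfun.

(** b is the leading coefficient in s of the lowest coefficient in rho of [pencil_form], which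
    yields the limit clause. For the upper bound, set rho = 0 in the relation satisfied at the
    generators of x and compare coefficients of s^k: b at the linear data is minus a sum of terms,
    each containing a slope in s, and these slopes are combinations of the f_j(x). *)
Lemma pencil_limit : exists (b : mpoly n0 K) (kap k : nat), [/\ b != 0,
  forall val eta, 0 < eta -> exists2 S1, 1 <= S1 & forall s, S1 <= abs s ->
    exists2 r1, 0 < r1 & forall rho, rho != 0 -> abs rho <= r1 ->
    abs (eval3 idK val s rho (pencil_form e f) / (rho ^+ kap * s ^+ k) - meval val b) <= eta &
  forall r, 0 <= r -> exists2 C, 0 < C & forall (U : gen -> K) (L : 'I_N -> gen -> K) (x : 'I_N -> K) nu,
    (forall w, abs (U w) <= r) -> (forall i w, abs (L i w) <= r) -> (forall i, abs (x i) <= r) ->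
    (forall j, abs (meval x (f j)) <= nu) -> 0 <= nu -> r * M%:R * nu <= 1 ->
    abs (meval (pencil_val U L (\sum_i U (inl i) * x i) (fun l => \sum_i L l (inl i) * x i)) b)
      <= C * nu].
Proof.
have [kap [B' [BE B'0]]] := poly_split_X (pencil_form_neq0 e f).
set q := B'`_0 in B'0; pose k := (size q).-1.
have sq : size q = k.+1 by rewrite prednK // size_poly_gt0.
exists (lead_coef q), kap, k; split; first by rewrite lead_coef_eq0.
- move=> val eta eta0; have eta2 : 0 < eta / 2 by rewrite divr_gt0.
  pose p := map_poly (eval1 idK val) q.
  have sp : (size p <= k.+1)%N by rewrite (leq_trans (size_poly _ _)) // sq.
  have [S1 S11 HS] := poly_cvg_lead av sp eta2; exists S1 => // s sS.
  have s1 : 1 <= abs s by apply: le_trans sS.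
  have as0 : 0 < abs s by apply: lt_le_trans s1.
  have s0 : s != 0 by rewrite -(av_gt0 av).
  have [r1 r10 Hr] := poly_cvg0 av (map_poly (eval2 idK val s) B') eta2.
  exists r1 => // rho rho0 /Hr hr; have {HS} hs := HS s sS.
  rewrite BE rmorphM rmorphXn eval3X invfM mulrACA divff ?expf_neq0 // mul1r.
  rewrite eval3E; set E := _.[rho] in hr *.
  have E0 : (map_poly (eval2 idK val s) B').[0] = p.[s].
    by rewrite horner_coef0 coef_map /= -/q -eval2E.
  rewrite E0 in hr; have pk : p`_k = meval val (lead_coef q).
    by rewrite /p coef_map lead_coefE.
  rewrite -pk in hr hs *.
  have -> : E / s ^+ k - p`_k = (E - p.[s]) / s ^+ k + (p.[s] / s ^+ k - p`_k).
    by rewrite mulrBl addrA subrK.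
  apply: le_trans (avD av _ _) _; rewrite [eta]splitr; apply: lerD => //.
  rewrite (avM av) (avV av) (avX av) ler_pdivrMr ?exprn_gt0 //.
  apply: (le_trans hr); rewrite ler_peMr ?(ltW eta2) //; exact: exprn_ege1.
move=> r r0; pose r2 := r + N%:R * (r * r).
have /choice [Cj HCj] j : exists c, 0 < c /\
    forall (w u : 'I_n0 -> K) nu, (forall i, abs (w i) <= r2) -> (forall i, abs (u i) <= nu) ->
    0 <= nu -> nu <= 1 ->
    forall l, abs (mmap polyC (fun i => (w i)%:P + u i *: 'X) q`_j)`_l
      <= c * (if l == 0%N then 1 else nu).
  have [C C0 HC] := mpoly_line_coef av q`_j r2.
  by exists C; split=> // w u nu h1 h2 h3 h4; apply: HC.
pose C := \sum_(j < k) Cj j; have C0 : 0 <= C.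
  by rewrite sumr_ge0 // => j _; apply/ltW; case: (HCj j).
exists (C * (r * M%:R) + 1); first by rewrite ltr_wpDl // mulr_ge0 // mulr_ge0.
move=> U L x nu HU HL Hx Hf nu0 nu1.
(* A form takes the value [lin + s slo] at x. Correspondingly the generic variables are specialised
   to w + s u, where only the target values have a slope. *)
pose lin (u : gen -> K) := \sum_i u (inl i) * x i.
pose slo (u : gen -> K) := \sum_j u (inr j) * meval x (f j).
pose w := pencil_val U L (lin U) (fun l => lin (L l)).
pose u := pencil_val (fun _ : gen => 0) (fun _ _ => 0) (slo U) (fun l => slo (L l)).
have Hlin v : (forall a, abs (v a) <= r) -> abs (lin v) <= r2.
  move=> Hv; apply: le_trans (av_sum av _ _ _) _.
  apply: (@le_trans _ _ (\sum_(i < N) r * r)); last first.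
    by rewrite sumr_const card_ord /r2 mulr_natl lerDr.
  by apply: ler_sum => i _; rewrite (avM av); apply: ler_pM; rewrite ?(av_ge0 av).
have Hslo v : (forall a, abs (v a) <= r) -> abs (slo v) <= r * M%:R * nu.
  move=> Hv; apply: le_trans (av_sum av _ _ _) _.
  apply: (@le_trans _ _ (\sum_(i < M) r * nu)); last first.
    by rewrite sumr_const card_ord -[r * nu *+ M]mulr_natl mulrCA mulrA.
  by apply: ler_sum => i _; rewrite (avM av); apply: ler_pM; rewrite ?(av_ge0 av).
have nu'0 : 0 <= r * M%:R * nu by rewrite !mulr_ge0.
have r2r : r <= r2 by rewrite /r2 lerDl mulr_ge0 // mulr_ge0.
have Hw i : abs (w i) <= r2.
  rewrite /w /pencil_val; case: (enum_val i) => [[[l|] a]|[l|]].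
  - exact: le_trans (HL _ _) r2r.
  - exact: le_trans (HU _) r2r.
  - exact: Hlin.
  - exact: Hlin.
have Hu i : abs (u i) <= r * M%:R * nu.
  rewrite /u /pencil_val; case: (enum_val i) => [[[l|] a]|[l|]]; rewrite ?(av0 av) //; exact: Hslo.
pose val' i : {poly K} := (w i)%:P + u i *: 'X.
pose P j := eval1 polyC val' q`_j.
have HP j l : abs (P j)`_l <= Cj j * (if l == 0%N then 1 else r * M%:R * nu).
  by have [_] := HCj j; apply.
have P0 : (P k)`_0 = meval w (lead_coef q).
  rewrite -horner_coef0 -/(horner_eval 0 (P k)) /P.
  rewrite (@rmorph_eval1 K n0 _ _ polyC idK (horner_eval 0)) ?lead_coefE //.
    congr (eval1 _ _ _); apply/funext => i.
    transitivity ((w i)%:P + u i *: 'X).[0] => [//|]; by rewrite hornerD hornerC hornerZ hornerX mulr0 addr0.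
  by move=> z; exact: hornerC.
(* The relation holds with rho and s as indeterminates; cancel the power of rho, then put rho =
   0. *)
have rel : eval2 polyC val' 'X q = 0.
  pose kap3 : {rmorphism K -> {poly {poly K}}} := (polyC \o polyC).
  pose U3 a : {poly {poly K}} := kap3 (U a); pose L3 i a : {poly {poly K}} := kap3 (L i a).
  pose s3 : {poly {poly K}} := 'X%:P.
  have := eval_pencil_form e f kap3 'X s3 U3 L3 (\sum_a U3 a * gens f kap3 s3 x a)
    (fun i => 'X * kap3 (x i) ^+ d + \sum_a L3 i a * gens f kap3 s3 x a).
  rewrite pencil_det_relation // BE rmorphM rmorphXn eval3X => /eqP.
  rewrite mulf_eq0 expf_eq0 polyX_eq0 andbF /= => /eqP.
  move=> /(congr1 (horner_eval 0)); rewrite (rmorph_eval3 (kap' := polyC)); last first.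
    by move=> z; exact: hornerC.
  have G (z : {poly {poly K}}) : (horner_eval (0 : {poly K}) : {rmorphism _ -> _}) z = z.[0].
    by [].
  rewrite rmorph0 eval3E !G hornerX [s3.[0]]hornerC horner_coef0 coef_map -/q.
  move=> <-; congr (eval2 _ _ _ _); apply/funext => i.
  have Hs v : (\sum_a kap3 (v a) * gens f kap3 s3 x a).[0] = (lin v)%:P + slo v *: 'X.
    rewrite horner_sum big_sumType /=; congr (_ + _).
      rewrite /lin raddf_sum; apply: eq_bigr => a _.
      by rewrite hornerM !hornerC -polyCM.
    rewrite /slo scaler_suml; apply: eq_bigr => a _.
    by rewrite !hornerM !hornerC mulrCA -polyCM mulrC mul_polyC.
  rewrite /val' /w /u /pencil_val; case: (enum_val i) => [[[l|] a]|[l|]].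
  - by rewrite scale0r addr0; apply/esym; exact: hornerC.
  - by rewrite scale0r addr0; apply/esym; exact: hornerC.
  - apply/esym; transitivity ('X * kap3 (x l) ^+ d + \sum_a L3 l a * gens f kap3 s3 x a).[0] => //.
    by rewrite hornerD hornerM hornerX mul0r add0r; exact: Hs.
  - by apply/esym; exact: Hs.
(* The coefficient of s^k: for j < k the term s^j contributes a coefficient of positive degree k - j
   in s, hence of size O(nu). *)
have {}rel : \sum_(j < k.+1) (P j)`_(k - j) = 0.
  move: rel; rewrite eval2E => /(congr1 (fun p : {poly K} => p`_k)).
  have sP : (size (map_poly (eval1 polyC val') q) <= k.+1)%N.
    by rewrite (leq_trans (size_poly _ _)) // sq.
  rewrite (horner_coef_wide _ sP) coef_sum coef0 => rel.
  rewrite -[RHS]rel; apply: eq_bigr => j _.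
  by rewrite coefMXn ltnNge -ltnS ltn_ord /= coef_map.
move: rel; rewrite big_ord_recr /= subnn P0 => /eqP; rewrite addrC addr_eq0 => /eqP ->.
rewrite (avN av); apply: le_trans (av_sum av _ _ _) _.
apply: (@le_trans _ _ (\sum_(j < k) Cj j * (r * M%:R * nu))); last first.
  by rewrite -mulr_suml -/C mulrA mulrDl mul1r lerDl.
apply: ler_sum => j _; have := HP j (k - j)%N.
by rewrite subn_eq0 leqNgt ltn_ord.
Qed.
End PencilLimit.

(** * Restriction to lines, interpolation and root estimates *)

Section LineExpansion.
Variables (K : fieldType) (n : nat).

Definition line_poly (w u : 'I_n -> K) (p : mpoly n K) : {poly K} :=
  mmap polyC (fun i => (w i)%:P + u i *: 'X) p.

Lemma horner_line w u p t : (line_poly w u p).[t] = meval (fun i => w i + u i * t) p.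
Proof.
move: p; apply: mpoly_ring_ind => [c|i|p q IHp IHq|p q IHp IHq]; rewrite /line_poly.
- by rewrite mmapC hornerC mevalC.
- by rewrite mmapX mmap1U mevalXU hornerD hornerC hornerZ hornerX.
- by rewrite raddfD /= hornerD -!/(line_poly _ _ _) IHp IHq mevalD.
- by rewrite rmorphM /= hornerM -!/(line_poly _ _ _) IHp IHq mevalM.
Qed.

Lemma line_coef0 w u p : (line_poly w u p)`_0 = meval w p.
Proof.
rewrite -horner_coef0 horner_line; congr (meval _ _).
by apply/funext => i; rewrite mulr0 addr0.
Qed.

Lemma line_coef1 w u p : (line_poly w u p)`_1 = \sum_i u i * meval w (mderiv i p).
Proof.
move: p; apply: mpoly_ring_ind => [c|i|p q IHp IHq|p q IHp IHq].
- rewrite /line_poly mmapC coefC big1 // => i _.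
  by rewrite mderivC meval0 mulr0.
- rewrite /line_poly mmapX mmap1U coefD coefC coefZ coefX mulr1 add0r.
  rewrite (bigD1 i) //= big1 ?addr0 => [|j ji]; rewrite mderivX mnm1E.
    rewrite eqxx scale1r (_ : mnm_sub _ _ = mnm0) ?mpolyX0 ?meval1 ?mulr1 //.
    by apply/mnmP => j; rewrite mnmBE subnn mnm0E.
  by rewrite eq_sym (negPf ji) scale0r meval0 mulr0.
- rewrite /line_poly raddfD /= coefD -!/(line_poly _ _ _) IHp IHq -big_split.
  by apply: eq_bigr => i _; rewrite mderivD mevalD mulrDr.
- rewrite /line_poly rmorphM /= coefM -!/(line_poly _ _ _) big_ord_recl big_ord1 /=.
  rewrite !line_coef0 IHp IHq mulr_sumr mulr_suml -big_split.
  by apply: eq_bigr => i _; rewrite mderivM mevalD !mevalM /=; ring.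
Qed.

End LineExpansion.

Lemma numField_poly_eq0 (K : numFieldType) (p : {poly K}) :
  (forall k : nat, p.[k%:R] = 0) -> p = 0.
Proof.
move=> H; apply/eqP; apply/negPn/negP => p0.
have := @max_poly_roots _ p [seq k%:R | k <- iota 0 (size p)] p0.
rewrite size_map size_iota ltnn => F; suff: false by []. apply: F.
  by apply/allP => x /mapP [k _ ->]; rewrite /root H eqxx.
by rewrite map_inj_uniq ?iota_uniq // => a b /eqP; rewrite eqr_nat => /eqP.
Qed.

Lemma mpoly_eq0P (K : numFieldType) n (p : mpoly n K) : (forall v, meval v p = 0) -> p = 0.
Proof.
have [T] : exists T, deg_le p T by exists (mdegree p); exact: deg_le_mdegree.
elim: T p => [|T IH] p dp H.
  all: suff Hm m : m != mnm0 -> mcoeff m p = 0.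
  1,3: have pE : p = mpolyC n (mcoeff mnm0 p).
  1,3: apply/mpolyP => m; rewrite mcoeffC; have [->|/Hm ->] := eqVneq m mnm0; rewrite ?mulr1 ?mulr0 //.
  1,2: by rewrite pE; have := H (fun=> 0); rewrite {1}pE mevalC => ->; rewrite mpolyC0.
- move=> m0; apply/eqP/negPn/negP => /dp; rewrite leqn0 mdeg_eq0; exact/negP.
- have D0 i : mderiv i p = 0.
    apply: IH => [m'|v].
      rewrite mcoeff_deriv mulrn_eq0 /= => /dp.
      by rewrite mdegD mdeg1 addn1 ltnS.
    have L0 : line_poly v (fun j => (j == i)%:R) p = 0.
      by apply: numField_poly_eq0 => k; rewrite horner_line H.
    have := line_coef1 v (fun j => (j == i)%:R) p; rewrite L0 coef0 (bigD1 i) //= eqxx mul1r.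
    by rewrite big1 ?addr0 // => j /negPf ->; rewrite mul0r.
  move=> m0; have [i mi] : exists i, m i != 0%N.
    apply/existsP; rewrite -negb_forall; apply: contra m0 => /forallP h.
    by apply/eqP/mnmP => i; rewrite mnm0E; apply/eqP.
  have mE : m = mnm_add (mnm_sub m (mnm1 i)) (mnm1 i).
    by rewrite submK //; apply/mnm_lepP => j; rewrite mnm1E; case: eqP => [<-|]//; rewrite lt0n.
  have := mcoeff_deriv i (mnm_sub m (mnm1 i)) p.
  rewrite D0 mcoeff0 -mE => /esym/eqP; rewrite mulrn_eq0 /= => /eqP //.
Qed.

Section AbsBounds.
Variables (R : realType) (K : numFieldType) (abs : K -> R).
Hypothesis av : absolute_value abs.

(** Divided differences: passing from g to (g - g(x0)) / (X - x0) loses one sample point and one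
    degree, with constants depending on the sample only. *)
Lemma interp_bound q (l : seq K) : uniq l -> size l = q -> exists2 C, 0 < C &
  forall (g : {poly K}) nu, (size g <= q)%N -> (forall x, x \in l -> abs g.[x] <= nu) ->
    0 <= nu -> forall i, abs g`_i <= C * nu.
Proof.
elim: q l => [|q IH] [|x0 l] //=.
  by move=> _ _; exists 1 => // g nu; rewrite leqn0 size_poly_eq0 => /eqP -> _ nu0 i; rewrite coef0 (av0 av) mul1r.
move=> /andP [x0l ul] [sl]; have [C C0 HC] := IH l ul sl.
have [m m0 Hm] : exists2 m, 0 < m & forall x, x \in l -> m * abs (x - x0) >= 1.
  elim: l x0l {ul sl IH HC} => [|y l IHl]; first by exists 1.
  rewrite inE negb_or => /andP [x0y /IHl [m m0 Hm]].
  have yx : 0 < abs (y - x0) by rewrite (av_gt0 av) subr_eq0 eq_sym.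
  exists (m + (abs (y - x0))^-1); first by rewrite addr_gt0 ?invr_gt0.
  move=> x; rewrite inE => /orP [/eqP ->|/Hm h].
    by rewrite mulrDl mulVf ?gt_eqF // lerDr mulr_ge0 // ltW.
  by rewrite mulrDl (le_trans h) // lerDl mulr_ge0 ?(av_ge0 av) // invr_ge0 ltW.
pose C1 := C * (2 * m); have C10 : 0 < C1 by rewrite !mulr_gt0.
exists (C1 * (1 + abs x0) + 1).
  by rewrite ltr_wpDl // mulr_ge0 ?(ltW C10) // addr_ge0 ?(av_ge0 av).
move=> g nu sg Hg nu0; pose h := (g - g.[x0]%:P) %/ ('X - x0%:P).
have gE : g = g.[x0]%:P + h * ('X - x0%:P).
  have dv : 'X - x0%:P %| g - g.[x0]%:P.
    by rewrite dvdp_XsubCl rootE hornerD hornerN hornerC subrr.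
  by rewrite /h divpK // addrC subrK.
have sh : (size h <= q)%N.
  rewrite size_divp ?polyXsubC_eq0 // size_XsubC leq_subLR add1n.
  apply: leq_trans (size_polyD _ _) _; rewrite geq_max sg size_polyN.
  exact: leq_trans (size_polyC_leq1 _) _.
have Hh x : x \in l -> abs h.[x] <= 2 * m * nu.
  move=> xl; have gx : g.[x] = g.[x0] + h.[x] * (x - x0).
    by rewrite {1}gE hornerD hornerM hornerC hornerXsubC.
  have a : abs (h.[x]) * abs (x - x0) <= 2 * nu.
    rewrite -(avM av) (_ : _ * _ = g.[x] - g.[x0]); last by rewrite gx [RHS]addrC addKr.
    apply: le_trans (av_leB av _ _) _; rewrite mulr_natl mulr2n.
    by apply: lerD; apply: Hg; rewrite inE ?eqxx ?xl ?orbT.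
  apply: (@le_trans _ _ (abs h.[x] * (m * abs (x - x0)))).
    by rewrite ler_peMr ?(av_ge0 av) //; apply: Hm.
  by rewrite mulrCA [2 * m]mulrC -mulrA; apply: ler_wpM2l => //; apply: ltW.
have Hc i : abs h`_i <= C1 * nu.
  by rewrite /C1 -mulrA; apply: HC => //; rewrite !mulr_ge0 // ltW.
have C1n : 0 <= C1 * nu by rewrite mulr_ge0 // ltW.
move=> i; rewrite gE coefD mulrBr coefB coefMX coefMC coefC.
rewrite mulrDl mul1r mulrDr mulr1 mulrDl [leRHS]addrC.
apply: le_trans (avD av _ _) _; apply: lerD.
  by case: (i == _); rewrite ?(av0 av) //; apply: Hg; rewrite inE eqxx.
apply: le_trans (av_leB av _ _) _; apply: lerD.
  by case: (i == _); rewrite ?(av0 av).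
by rewrite (avM av) mulrAC; apply: ler_wpM2r; rewrite ?(av_ge0 av).
Qed.
End AbsBounds.

Section RootRatio.
Variables (R : realType) (K : numClosedFieldType) (abs : K -> R).
Hypothesis av : absolute_value abs.

(** Factor p over the closed field: each factor x - z grows at most by 1 + |c0 - t0| / r from t0 to
    c0. *)
Lemma root_ratio (p : {poly K}) D t0 c0 r : (size p <= D.+1)%N -> 0 < r ->
  (forall z, root p z -> r <= abs (z - t0)) ->
  abs p.[c0] <= abs p.[t0] * (1 + abs (c0 - t0) / r) ^+ D.
Proof.
move=> sp r0 Hr; have [->|p0] := eqVneq p 0; first by rewrite !horner0 (av0 av) mul0r.
have [s pE] := closed_field_poly_normal p.
have lc0 : lead_coef p != 0 by rewrite lead_coef_eq0.
have sD : (size s <= D)%N.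
  by move: sp; rewrite pE size_scale // size_prod_XsubC.
have rs z : z \in s -> root p z by rewrite pE rootZ // root_prod_XsubC.
set B := 1 + _; have B1 : 1 <= B by rewrite lerDl divr_ge0 ?(av_ge0 av) // ltW.
have E x : p.[x] = lead_coef p * \prod_(z <- s) (x - z).
  rewrite {1}pE hornerZ horner_prod; congr (_ * _); apply: eq_bigr => z _.
  by rewrite hornerXsubC.
apply: (@le_trans _ _ (abs p.[t0] * B ^+ size s)); last first.
  by apply: ler_wpM2l; rewrite ?(av_ge0 av) //; apply: ler_weXn2l.
rewrite !E !(avM av) -mulrA; apply: ler_wpM2l; first exact: (av_ge0 av).
rewrite !(av_prod av); elim: s rs {pE sD E} => [|z s IH] rs.
  by rewrite !big_nil expr0 mulr1.
rewrite !big_cons /= exprS mulrACA; apply: ler_pM; rewrite ?(av_ge0 av) //.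
- by rewrite -(av_prod av) (av_ge0 av).
- have h : r <= abs (t0 - z) by rewrite (avB av); apply/Hr/rs; rewrite inE eqxx.
  have -> : c0 - z = (t0 - z) + (c0 - t0) by ring.
  apply: le_trans (avD av _ _) _; rewrite /B mulrDr mulr1 lerD2l.
  by rewrite mulrCA ler_peMr ?(av_ge0 av) // ler_pdivlMr // mul1r.
- by apply: IH => y ys; apply: rs; rewrite inE ys orbT.
Qed.
End RootRatio.

Lemma box_min (R : realType) n (a : 'I_n -> R) (r L : R) (h : ('I_n -> R) -> R) : 0 <= r ->
  let box x := forall i, `|x i - a i| <= r in
  (forall x y t, box x -> box y -> (forall i, `|x i - y i| <= t) -> 0 <= t ->
     `|h x - h y| <= L * t) ->
  exists2 x, box x & forall y, box y -> h x <= h y.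
Proof.
move=> r0 box Hh.
pose A : set 'rV[R]_n := [set v | forall i, v ord0 i \in `[a i - r, a i + r]].
have boxA v : A v <-> box (fun i => v ord0 i).
  split=> H i; have := H i.
    by rewrite in_itv /= -ler_distlC distrC.
  by rewrite in_itv /= -ler_distlC distrC.
have cA : compact A.
  have -> : A = [set v : 'rV[R]_n | forall i, `[a i - r, a i + r]%classic (v ord0 i)].
    by [].
  by apply: (@rV_compact _ _ (fun i => `[a i - r, a i + r]%classic)) => i; apply: segment_compact.
have A0 : A !=set0.
  by exists (\row_i a i); apply/boxA => i; rewrite mxE subrr normr0.
pose g (v : 'rV[R]_n) := h (fun i => v ord0 i).
have cg : {within A, continuous g}.
  apply/subspace_continuousP => x xA; apply/cvgrPdist_lt => eta eta0.
  pose L1 := `|L| + 1; have L10 : 0 < L1 by rewrite ltr_wpDl.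
  have dl0 : 0 < eta / L1 by rewrite divr_gt0.
  rewrite near_withinE; apply/nbhs_ballP; exists (eta / L1) => //= y xy yA.
  have bx : box (fun i => x ord0 i) by apply/boxA.
  have by' : box (fun i => y ord0 i) by apply/boxA.
  apply: le_lt_trans (Hh _ _ (eta / L1) bx by' _ (ltW dl0)) _.
    by move=> i; apply/ltW; have [_ /(_ ord0 i)] := xy.
  rewrite mulrA ltr_pdivrMr // mulrC ltr_pM2l // (le_lt_trans (ler_norm L)) //.
  by rewrite /L1 ltrDl.
have [v vA Hv] := compact_EVT_min A0 cA cg.
exists (fun i => v ord0 i); first by apply/boxA; rewrite inE in vA.
move=> y By; have := Hv (\row_i y i); rewrite /g.
have -> : (fun i => (\row_i0 y i0) ord0 i) = y by apply/funext => i; rewrite mxE.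
apply; rewrite inE; apply/boxA => i; rewrite mxE; exact: By.
Qed.

Lemma fin_min (R : realType) (I : finType) (F : I -> R) : (forall i, 0 < F i) ->
  exists2 m, 0 < m & forall i, m <= F i.
Proof.
move=> F0; pose S := \sum_i (F i)^-1 + 1.
have S0 : 0 < S by rewrite ltr_wpDl // sumr_ge0 // => i _; rewrite invr_ge0 ltW.
exists S^-1; first by rewrite invr_gt0.
move=> i; rewrite -[F i]invrK lef_pV2 ?posrE ?invr_gt0 //.
rewrite /S (bigD1 i) //= -addrA lerDl addr_ge0 // sumr_ge0 // => j _.
by rewrite invr_ge0 ltW.
Qed.

Lemma fin_max (R : realType) (I : finType) (F : I -> R) :
  exists2 B, 1 <= B & forall i, F i <= B.
Proof.
exists (\sum_i `|F i| + 1); first by rewrite lerDr sumr_ge0.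
move=> i; apply: le_trans (ler_norm _) _.
by rewrite (bigD1 i) //= -addrA lerDl addr_ge0 // sumr_ge0.
Qed.

Lemma finite_list (T : eqType) (P : T -> Prop) D :
  (forall s : seq T, uniq s -> (forall y, y \in s -> P y) -> (size s <= D)%N) ->
  exists s : seq T, [/\ uniq s, (size s <= D)%N & forall y, y \in s <-> P y].
Proof.
move=> H; apply: contrapT => Hn.
suff /(_ D.+1) [s [us sP ss]] : forall k, exists s : seq T,
    [/\ uniq s, forall y, y \in s -> P y & size s = k].
  by have := H s us sP; rewrite ss ltnn.
elim=> [|k [s [us sP ss]]]; first by exists [::].
have [y [Py ys]] : exists y, P y /\ y \notin s.
  apply: contrapT => Hy; apply: Hn; exists s; split=> //; first exact: H.
  move=> y; split=> [/sP //|Py]; apply/negPn/negP => ys; apply: Hy; by exists y.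
exists (y :: s); split=> /=; rewrite ?ys ?ss // => z.
by rewrite inE => /orP [/eqP -> //|/sP].
Qed.

Lemma poly_nonroot_natr (K : numFieldType) (p : {poly K}) k0 : p != 0 ->
  exists2 k, (k0 <= k)%N & ~~ root p k%:R.
Proof.
move=> p0; apply: contrapT => H.
have : p \Po ('X + k0%:R%:P) = 0.
  apply: numField_poly_eq0 => k; rewrite horner_comp hornerD hornerX hornerC -natrD.
  apply/eqP/negPn/negP => h; apply: H; exists (k + k0)%N => //; exact: leq_addl.
move/(congr1 (fun q => q \Po ('X - k0%:R%:P))); rewrite comp_poly0 -comp_polyA.
by rewrite comp_polyD comp_polyX comp_polyC subrK comp_polyXr => /eqP; exact/negP.
Qed.

Lemma poly_nonroots (K : numFieldType) (p : {poly K}) J : p != 0 ->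
  exists l : 'I_J -> K, injective l /\ forall j, ~~ root p (l j).
Proof.
move=> p0; suff [s [us ss sP]] : exists s : seq K,
    [/\ uniq s, size s = J & forall z, z \in s -> ~~ root p z].
  exists (fun j => nth 0 s j); split=> [i j /eqP|j].
    by rewrite nth_uniq ?ss ?ltn_ord // => /eqP /val_inj.
  by apply: sP; apply: mem_nth; rewrite ss.
elim: J => [|J [s [us ss sP]]]; first by exists [::].
have [|k _] := @poly_nonroot_natr _ (p * \prod_(z <- s) ('X - z%:P)) 0.
  by rewrite mulf_neq0 // monic_neq0 // monic_prod_XsubC.
rewrite rootM root_prod_XsubC negb_or => /andP [pk ks].
exists (k%:R :: s); split=> /=; rewrite ?ks ?ss // => z.
by rewrite inE => /orP [/eqP -> //|/sP].
Qed.

Section AbsSeparation.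
Variables (R : realType) (K : numFieldType) (abs : K -> R).
Hypothesis av : absolute_value abs.

(* A polynomial of size at most [q.+1] with a coefficient of size [r] can be small at no more
   than [q] of the sample points. *)
Lemma interp_pigeonhole (q J : nat) (l : 'I_J -> K) : injective l ->
  exists2 c, 0 < c & forall (g : {poly K}) r i, (size g <= q.+1)%N -> 0 < r -> r <= abs g`_i ->
    (#|[set j | (abs g.[l j] < c * r)%R]%SET| <= q)%N.
Proof.
move=> linj.
have /choice [C HC] (A : {set 'I_J}) : exists C, 0 < C /\ ((q < #|A|)%N ->
  forall (g : {poly K}) nu, (size g <= q.+1)%N -> (forall j, j \in A -> abs g.[l j] <= nu) ->
    0 <= nu -> forall i, abs g`_i <= C * nu).
  have [qA|Aq] := ltnP q #|A|; last by exists 1; split.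
  have us : uniq (take q.+1 [seq l j | j <- enum A]).
    by rewrite take_uniq // map_inj_uniq // enum_uniq.
  have ss : size (take q.+1 [seq l j | j <- enum A]) = q.+1.
    by rewrite size_takel // size_map -cardE.
  have [C C0 HC] := interp_bound av us ss; exists C; split=> // _ g nu sg Hg nu0 i.
  apply: HC => // x /mem_take /mapP [j jA ->]; apply: Hg.
  by rewrite -(mem_enum A).
pose S := \sum_A C A + 1.
have S0 : 0 < S.
  by rewrite ltr_wpDl // sumr_ge0 // => A _; apply/ltW; case: (HC A).
exists S^-1; first by rewrite invr_gt0.
move=> g r i sg r0 ri; rewrite leqNgt; apply/negP => lt.
have [C0 /(_ lt g (S^-1 * r) sg)] := HC [set j | abs g.[l j] < S^-1 * r]%SET.
set A := [set j | _]%SET in C0 *; have nu0 : 0 <= S^-1 * r.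
  by rewrite mulr_ge0 ?invr_ge0 // ltW.
move=> /(_ _ nu0 i) h; have {}h : abs g`_i <= C A * (S^-1 * r).
  by apply: h => j; rewrite inE => /ltW.
have := le_trans ri h; rewrite mulrA leNgt => /negP; apply.
rewrite gtr_pMl // ltr_pdivrMr // mul1r /S (bigD1 A) //= -addrA ltrDl.
by rewrite ltr_wpDl // sumr_ge0 // => B _; apply/ltW; case: (HC B).
Qed.

End AbsSeparation.

(** * Compactness in complex coordinates *)

Section ComplexCompactness.
Variable R : realType.
Local Notation K := (complex R).
Let av := absC_absolute_value R.

Lemma absC_real (x : R) : absC (x%:C)%C = `|x|.
Proof. by rewrite /absC /= expr0n addr0 sqrtr_sqr. Qed.

Lemma absC_natr (k : nat) : absC (k%:R : K) = k%:R.
Proof. by rewrite -[X in absC X](rmorph_nat (real_complex R)) absC_real normr_nat. Qed.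

Lemma absC_Re (z : K) : `|complex.Re z| <= absC z.
Proof.
case: z => a b /=; rewrite /absC /= -sqrtr_sqr ler_wsqrtr // lerDl; exact: sqr_ge0.
Qed.

Lemma absC_Im (z : K) : `|complex.Im z| <= absC z.
Proof.
case: z => a b /=; by rewrite /absC /= -sqrtr_sqr ler_wsqrtr // lerDr sqr_ge0.
Qed.

Lemma absC_le (z : K) : absC z <= `|complex.Re z| + `|complex.Im z|.
Proof.
case: z => a b; have {1}-> : (a +i* b)%C = (a%:C + 'i * b%:C)%C.
  by apply/eqP; rewrite eq_complex /=; apply/andP; split; apply/eqP; ring.
apply: le_trans (avD av _ _) _; rewrite (avM av) !absC_real; apply: lerD => //.
by rewrite /absC /= expr0n add0r expr1n sqrtr1 mul1r.
Qed.

(** The continuous sum is minimised on a compact box in real and imaginary parts. Coordinates in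
    that box may be up to 2 r away from x in modulus, whence the radius of the hypothesis. *)
Lemma complex_sum_lower N M (f : 'I_M -> mpoly N K) (x : 'I_N -> K) (r : R) : 0 <= r ->
  (forall y, (forall i, absC (y i - x i) <= 2 * r) -> exists j, meval y (f j) != 0) ->
  exists2 mu, 0 < mu & forall y, (forall i, absC (y i - x i) <= r) ->
    mu <= \sum_j absC (meval y (f j)).
Proof.
move=> r0 Hf.
pose cx (z : 'I_(N + N) -> R) (i : 'I_N) : K := (z (lshift N i) +i* z (rshift N i))%C.
pose rl (y : 'I_N -> K) (k : 'I_(N + N)) : R :=
  match split k with inl i => complex.Re (y i) | inr i => complex.Im (y i) end.
have rlK y : cx (rl y) = y.
  apply/funext => i; rewrite /cx /rl.
  have -> : split (lshift N i) = inl i by apply: (can_inj (@unsplitK N N)); rewrite splitK.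
  have -> : split (rshift N i) = inr i by apply: (can_inj (@unsplitK N N)); rewrite splitK.
  by case: (y i).
have cxB z z' t : (forall k, `|z k - z' k| <= t) -> forall i, absC (cx z i - cx z' i) <= 2 * t.
  move=> H i; apply: le_trans (absC_le _) _.
  by rewrite mulr_natl mulr2n; apply: lerD; apply: H.
have [B B1 HB] := fin_max (fun i => absC (x i)).
have bnd z : (forall k, `|z k - rl x k| <= r) -> forall i, absC (cx z i) <= 2 * r + B.
  move=> H i; rewrite -[cx z i](subrK (x i)); apply: le_trans (avD av _ _) _.
  by apply: lerD => //; have := cxB _ _ _ H i; rewrite rlK.
have /choice [L HL] j : exists C, 0 < C /\ forall v w delta,
   (forall i, absC (v i) <= 2 * r + B) -> (forall i, absC (w i) <= 2 * r + B) ->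
   (forall i, absC (v i - w i) <= delta) -> 0 <= delta ->
   absC (meval v (f j) - meval w (f j)) <= C * delta.
  by have [C C0 HC] := mpoly_lipschitz av (f j) (2 * r + B); exists C.
pose h z := \sum_j absC (meval (cx z) (f j)).
have [|z Bz Hz] := @box_min R _ (rl x) r (\sum_j L j * 2) h r0.
  move=> z z' t Bz Bz' zz' t0; rewrite /h -sumrB.
  apply: le_trans (ler_norm_sum _ _ _) _; rewrite mulr_suml; apply: ler_sum => j _.
  have [_ HLj] := HL j; rewrite -mulrA.
  have t2 : 0 <= 2 * t by rewrite mulr_ge0.
  have h1 := HLj _ _ _ (bnd _ Bz) (bnd _ Bz') (cxB _ _ _ zz') t2.
  rewrite ler_norml; apply/andP; split.
    rewrite lerNl opprB; apply: le_trans (av_lerB av _ _) _.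
    by rewrite (avB av).
  exact: le_trans (av_lerB av _ _) _.
have cz i : absC (cx z i - x i) <= 2 * r by have := cxB _ _ _ Bz i; rewrite rlK.
have [j0 fj0] := Hf _ cz.
exists (h z).
  rewrite /h (bigD1 j0) //= ltr_pwDl ?(av_gt0 av) // sumr_ge0 // => j _.
  exact: (av_ge0 av).
move=> y Hy; have := Hz (rl y); rewrite /h rlK; apply=> k.
rewrite /rl; case: (split k) => i; apply: le_trans (Hy i).
  by rewrite -raddfB; apply: absC_Re.
by rewrite -raddfB; apply: absC_Im.
Qed.
End ComplexCompactness.

(** * Comparing two values of the determinant on a line *)

Section PencilLine.
Variables (K : fieldType) (N M e : nat) (f : 'I_M -> mpoly N K).
Local Notation gen := ('I_N + 'I_M)%type.
Let idK : {rmorphism K -> K} := idfun.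

Lemma pencil_det_line rho s (U : gen -> K) L (c v : 'I_N -> K) :
  exists2 p : {poly K}, (size p <= (e.+1 ^ N).+1)%N &
  forall t, p.[t] = pencil_det e f idK rho s U L t (fun i => c i + v i * t).
Proof.
exists (\det (elim_mx e (pencil e f idK rho s L) polyC (pencil0 f idK s U) 'X
          (fun l => (c l)%:P + v l *: 'X)%R)); first exact: size_det_elim_line.
move=> t; rewrite -/(horner_eval t _) -det_map_mx /pencil_det.
rewrite (@elim_mx_rmorph K {poly K} K N e _ polyC (horner_eval t) idK); last first.
  by move=> z; rewrite /= /horner_eval hornerC.
have E1 : horner_eval t ('X : {poly K}) = t by exact: hornerX.
have E2 : (fun l => horner_eval t ((c l)%:P + v l *: 'X)) = (fun l => c l + v l * t).
  by apply/funext => l; rewrite /horner_eval hornerD hornerC hornerZ hornerX.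
by congr (\det (elim_mx _ _ _ _ _ _)).
Qed.

Lemma meval_pencil rho s L i (y : 'I_N -> K) :
  meval y (pencil e f idK rho s L i)
  = rho * y i ^+ e.+1 + \sum_w L i w * gens f idK s y w.
Proof.
rewrite /pencil mevalD mevalZ -(meval_pencil0 f idK s (L i) y); congr (_ * _ + _).
rewrite mevalXn_id || rewrite /meval mmapX.
rewrite /mmap1 (bigD1 i) //= mulmnE mnm1E eqxx mul1n big1 ?mulr1 //.
by move=> l /negPf li; rewrite mulmnE mnm1E eq_sym li expr0.
Qed.

End PencilLine.

Section PencilRatio.
Variable R : realType.
Local Notation K := (complex R).
Let av := absC_absolute_value R.
Let idK : {rmorphism K -> K} := idfun.
Variables (N M e : nat) (f : 'I_M -> mpoly N K).
Hypothesis f_deg : forall j, deg_le (f j) e.+1.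
Local Notation D := (e.+1 ^ N)%N.
Local Notation gen := ('I_N + 'I_M)%type.
Local Notation q := #|{: gen}|.
Let T1 := (D + (e.+1 + (e.+1 + N * e)))%N.
Variables (U0 : gen -> K) (Lt : 'I_N -> gen -> K) (v : 'I_N -> K).
Variable lam : 'I_(q * D).+1 -> K.

(** Translates of points of a moment curve: pairing a probe with a vector P is a polynomial in the
    parameter with the P w as higher coefficients, so few parameters make it small. *)
Definition probe j (w : gen) : K := U0 w + lam j ^+ (enum_rank w).+1.
(** Subtracting v_i times the probe from the i-th tilted form leaves Lt_i, independent of j: for
    every probe, the points behind the roots on the line lie in one and the same fibre. *)
Definition tilt j (i : 'I_N) (w : gen) : K := Lt i w + v i * probe j w.

Variable c : R.
Hypothesis c_gt0 : 0 < c.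
Hypothesis lam_sep : forall (g : {poly K}) r i, (size g <= q.+1)%N -> 0 < r -> r <= absC g`_i ->
  (#|[set j | (absC g.[lam j] < c * r)%R]%SET| <= q)%N.

Lemma probe_separated (P : gen -> K) delta : 0 < delta -> (exists w, delta <= absC (P w)) ->
  (#|[set j | (absC (\sum_w probe j w * P w) < c * delta)%R]%SET| <= q)%N.
Proof.
move=> dl0 [w Pw].
pose g : {poly K} := (\sum_w U0 w * P w)%:P + \sum_w P w *: 'X ^+ (enum_rank w).+1.
have gE j : g.[lam j] = \sum_w probe j w * P w.
  rewrite /g hornerD hornerC horner_sum -big_split; apply: eq_bigr => a _ /=.
  by rewrite hornerZ hornerXn mulrDl [P a * _]mulrC.
have sg : (size g <= q.+1)%N.
  apply: leq_trans (size_polyD _ _) _; rewrite geq_max; apply/andP; split.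
    by rewrite (leq_trans (size_polyC_leq1 _)).
  apply: leq_trans (size_sum _ _ _) _; apply/bigmax_leqP => a _.
  apply: leq_trans (size_scale_leq _ _) _; rewrite size_polyXn ltnS; exact: ltn_ord.
have gw : g`_(enum_rank w).+1 = P w.
  rewrite /g coefD coefC /= add0r coef_sum (bigD1 w) //= coefZ coefXn eqxx mulr1.
  rewrite big1 ?addr0 // => a aw; rewrite coefZ coefXn eqSS.
  have /negPf -> : (enum_rank w != enum_rank a :> nat).
    by apply: contra aw => /eqP /val_inj /enum_rank_inj ->.
  by rewrite mulr0.
have := @lam_sep g delta (enum_rank w).+1 sg dl0; rewrite gw => /(_ Pw).
by under eq_finset do rewrite gE.
Qed.

Variables (rho s : K) (x : 'I_N -> K) (delta : R).
Hypothesis delta_gt0 : 0 < delta.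
Hypothesis det_Lt : forall T, (T <= T1)%N -> qr_det e (pencil e f idK rho s Lt) T != 0.
Hypothesis det_tilt : forall j T, (T <= T1)%N -> qr_det e (pencil e f idK rho s (tilt j)) T != 0.

Let P (y : 'I_N -> K) (w : gen) : K :=
  match w with inl i => y i - x i | inr j => s * meval y (f j) end.
Hypothesis P_large : forall y, exists w, delta <= absC (P y w).

Let cc i : K := \sum_k Lt i (inl k) * x k.
Let tau0 j : K := \sum_k probe j (inl k) * x k.

(** By [elim_root] a root on the line comes from a point y of the fibre of the Lt-system, which has
    at most D points. A probe separating all of these from x keeps the roots at distance c delta
    from tau0, and [root_ratio] concludes. *)
Lemma pencil_ratio (c0 : K) : exists j,
  let pd t := pencil_det e f idK rho s (probe j) (tilt j) t (fun i => cc i + v i * t) in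
  absC (pd c0) <= absC (pd (tau0 j)) * (1 + absC (c0 - tau0 j) / (c * delta)) ^+ D.
Proof.
have pdeg L i : deg_le (pencil e f idK rho s L i) e.+1 by exact: pencil_deg.
have pdeg0 U : deg_le (pencil0 f idK s U) e.+1 by exact: pencil0_deg.
have [Y [uY sY YP]] : exists Y : seq 'rV[K]_N, [/\ uniq Y, (size Y <= D)%N &
    forall y : 'rV[K]_N, y \in Y <->
      (forall l, meval (fun j => y 0 j) (pencil e f idK rho s Lt l) = cc l)].
  apply: finite_list => Y uY HY.
  apply: (@leq_size_fiber _ _ _ _ (pdeg Lt) D cc Y) => //.
  by apply: det_Lt; rewrite leq_addr.
pose bad (y : 'rV[K]_N) :=
  [set j | (absC (\sum_w probe j w * P (fun i => y 0 i) w) < c * delta)%R]%SET.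
have [j Hj] : exists j, forall y, y \in Y -> j \notin bad y.
  apply: contrapT => H.
  (* Pigeonhole: each of the at most D points excludes at most q of the q D + 1 probes. *)
  have : (\sum_(j : 'I_(q * D).+1) 1 <= \sum_(y <- Y) #|bad y|)%N.
    under [X in (_ <= X)%N]eq_bigr => y _ do rewrite -sum1_card big_mkcond.
    rewrite exchange_big; apply: leq_sum => j _.
    have [y [yY jy]] : exists y, y \in Y /\ j \in bad y.
      apply: contrapT => H'; apply: H; exists j => y yY; apply/negP => jy.
      by apply: H'; exists y.
    by rewrite (big_rem y) //= jy.
  rewrite sum1_card card_ord => le.
  have : (\sum_(y <- Y) #|bad y| <= \sum_(y <- Y) q)%N.
    by apply: leq_sum => y _; apply: probe_separated.
  rewrite big_const_seq count_predT iter_addn_0 => le2.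
  have := leq_trans le (leq_trans le2 _); move/(_ (q * D)%N).
  by rewrite leq_mul2l sY orbT ltnn => /(_ isT).
exists j => pd.
have [p sp pE] := pencil_det_line e f rho s (probe j) (tilt j) cc v.
rewrite /pd -!pE.
have RR := @root_ratio R K (@absC R) av p D (tau0 j) c0 (c * delta) sp.
apply: RR; first by rewrite mulr_gt0.
move=> z /rootP; rewrite pE /pencil_det => z0.
(* The root z is the value of the probe form at y; eliminating it from the tilted equations puts y
   in the fibre. *)
have [|y [yz yc]] := elim_root (pdeg (tilt j)) (pdeg0 (probe j)) _ z0.
  by move=> S ST; apply: det_tilt; rewrite (leq_trans ST) // leq_addl.
have zE : z = \sum_w probe j w * gens f idK s y w by rewrite -yz -meval_pencil0.
have yY : (\row_i y i) \in Y.
  apply/YP => l; have -> : (fun i => (\row_i0 y i0) 0 i) = y.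
    by apply/funext => i; rewrite mxE.
  have := yc l; rewrite !meval_pencil /tilt.
  under eq_bigr => w _ do rewrite mulrDl -mulrA.
  by rewrite big_split /= -mulr_sumr -zE addrA => /addIr.
have := Hj _ yY; rewrite inE -leNgt.
have -> : (fun i => (\row_i0 y i0) 0 i) = y by apply/funext => i; rewrite mxE.
suff -> : \sum_w probe j w * P y w = z - tau0 j by [].
rewrite zE /tau0 !big_sumType /= addrAC -sumrB; congr (_ + _).
by apply: eq_bigr => k _; rewrite mulrBr.
Qed.

End PencilRatio.

(** * The complex inequality *)

Section ComplexBound.
Variable R : realType.
Local Notation K := (complex R).
Let av := absC_absolute_value R.
Let idK : {rmorphism K -> K} := idfun.
Variables (N M e : nat) (f : 'I_M -> mpoly N K).
Hypothesis f_deg : forall j, deg_le (f j) e.+1.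
Local Notation D := (e.+1 ^ N)%N.
Local Notation gen := ('I_N + 'I_M)%type.
Local Notation q := #|{: gen}|.

(** Points within r of x stay away from the common zeros, so compactness bounds the sum of the |f_j|
    below there; a large s then makes some s f_j(y) exceed r. *)
Lemma gens_separated (x : 'I_N -> K) (r : R) : 0 < r ->
  (forall y, (forall j, meval y (f j) = 0) -> exists i, 5 * r <= absC (y i - x i)) ->
  exists S : R, forall s, S <= absC s -> forall y, exists w : gen,
    r <= absC (match w with inl i => y i - x i | inr j => s * meval y (f j) end).
Proof.
move=> r0 Hz; have [|mu mu0 Hmu] := @complex_sum_lower R N M f x r (ltW r0).
  move=> y Hy; apply: contrapT => H; have [|i] := Hz y.
    by move=> j; apply/eqP/negPn/negP => h; apply: H; exists j.
  by have := Hy i; have := r0; lra.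
exists (M%:R * r / mu + 1) => s Hs y; apply: contrapT => H.
have {}H w : absC (match w with inl i => y i - x i | inr j => s * meval y (f j) end) < r.
  by rewrite ltNge; apply/negP => h; apply: H; exists w.
have s0 : 0 < absC s.
  by apply: lt_le_trans Hs; rewrite ltr_wpDl // divr_ge0 ?(ltW mu0) // mulr_ge0 // ltW.
have h1 : mu <= \sum_j absC (meval y (f j)) by apply: Hmu => i; apply/ltW/(H (inl i)).
have h2 : \sum_j absC (meval y (f j)) <= M%:R * (r / absC s).
  apply: (@le_trans _ _ (\sum_(j < M) r / absC s)).
    apply: ler_sum => j _; rewrite ler_pdivlMr // mulrC -(avM av); exact/ltW/(H (inr j)).
  by rewrite sumr_const card_ord mulr_natl.
have := le_trans h1 h2; rewrite mulrA ler_pdivlMr // mulrC -ler_pdivlMr // leNgt => /negP; apply.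
by apply: lt_le_trans Hs; rewrite ltrDl.
Qed.

(** rho is taken as 1/k with k a large natural number avoiding the roots of the n polynomials given
    by [qr_det_generic]. *)
Lemma generic_param (n : nat) (s : K) (L : 'I_n -> 'I_N -> gen -> K) T1 (r : R) : 0 < r ->
  exists rho : K, [/\ rho != 0, absC rho <= r &
    forall j T, (T <= T1)%N -> qr_det e (pencil e f idK rho s (L j)) T != 0].
Proof.
move=> r0; have /choice [Q HQ] (j : 'I_n) : exists Q : {poly K}, Q != 0 /\
    forall rho, rho != 0 -> ~~ root Q rho^-1 -> forall T, (T <= T1)%N ->
      qr_det e (pencil e f idK rho s (L j)) T != 0.
  have [Q Q0 HQ] := qr_det_generic e (fun i => pencil0 f idK s (L j i)) T1.
  by exists Q.
have [|k kr kQ] := @poly_nonroot_natr K (\prod_j Q j) (Num.bound r^-1).+1.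
  by apply/prodf_neq0 => j _; have [] := HQ j.
have k0 : (0 < k)%N by apply: leq_ltn_trans kr.
have kn : k%:R != 0 :> K by rewrite pnatr_eq0 -lt0n.
exists k%:R^-1; split; first by rewrite invr_eq0.
  rewrite (avV av) absC_natr invf_ple ?posrE ?ltr0n //.
  apply: le_trans (_ : (Num.bound r^-1)%:R <= _); last by rewrite ler_nat ltnW.
  by apply/ltW/archi_boundP; rewrite invr_ge0 ltW.
move=> j; apply: (HQ j).2; first by rewrite invr_eq0.
rewrite invrK; apply: contra kQ => /rootP h; apply/rootP.
by rewrite horner_prod (bigD1 j) //= h mul0r.
Qed.

(** On the line through the data of x, the value of b at a fixed parameter c0 is at least beta/2,
    the one at the parameter of x is O(nu), and [pencil_ratio] bounds their quotient by a constant
    times rho0^(-D), up to errors that vanish in the limit. *)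
Lemma complex_bound : exists C eps : R, [/\ 0 < C, 0 < eps & forall x : 'I_N -> K,
  (forall i, absC (x i) <= eps) -> forall rho0, 0 < rho0 -> rho0 <= 1 ->
  (forall y, (forall j, meval y (f j) = 0) -> exists i, rho0 <= absC (y i - x i)) ->
  forall nu, (forall j, absC (meval x (f j)) <= nu) -> C * rho0 ^+ D <= nu].
Proof.
have [b [kap [k [b0 Hlim Hup]]]] := pencil_limit av f_deg.
(* The product of b with the variable tau is a nonzero polynomial. The coordinate c0 must be nonzero
   for the direction v below. *)
have [val0 [bv0 cv0]] : exists val0, meval val0 b != 0 /\
    val0 (enum_rank (inr None : pencil_var N M)) != 0.
  have W0 : b * mpolyX K (mnm1 (enum_rank (inr None : pencil_var N M))) != 0.
    rewrite mulf_neq0 //; apply/eqP => /(congr1 (mcoeff (mnm1 (enum_rank (inr None : pencil_var N M))))).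
    by rewrite mcoeffX eqxx mcoeff0 => /eqP; rewrite oner_eq0.
  apply: contrapT => H; case/negP: W0; apply/eqP/mpoly_eq0P => val.
  rewrite mevalM mevalXU; apply/eqP/negPn/negP; rewrite mulf_eq0 negb_or => /andP [h1 h2].
  by apply: H; exists val.
pose U0 w := val0 (enum_rank (inl (None, w) : pencil_var N M)).
pose L0 i w := val0 (enum_rank (inl (Some i, w) : pencil_var N M)).
pose c0 := val0 (enum_rank (inr None : pencil_var N M)).
pose cc0 i := val0 (enum_rank (inr (Some i) : pencil_var N M)).
have val0E : val0 = pencil_val U0 L0 c0 cc0.
  apply/funext => a; rewrite /pencil_val /U0 /L0 /c0 /cc0.
  by case E: (enum_val a) => [[[i|] w]|[i|]]; rewrite -E enum_valK.
(* The line through 0 with direction (1, v) contains the target (c0, cc0), and tilting Lt by U0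
   gives back L0. *)
pose v i := cc0 i / c0; pose Lt i w := L0 i w - v i * U0 w.
pose UP (w : gen) : {poly K} := (U0 w)%:P + 'X ^+ (enum_rank w).+1.
(* b at the base target, as a polynomial in the probe parameter; it is nonzero because parameter 0
   gives the data of val0. *)
pose bp := eval1 polyC
  (pencil_val UP (fun i w => (Lt i w)%:P + (v i)%:P * UP w) c0%:P (fun i => (v i * c0)%:P)) b.
pose pr t (w : gen) : K := U0 w + t ^+ (enum_rank w).+1.
have UPt t w : (UP w).[t] = pr t w by rewrite hornerD hornerC hornerXn.
have bpE t : bp.[t] =
   meval (pencil_val (pr t) (fun i w => Lt i w + v i * pr t w) c0 (fun i => v i * c0)) b.
  transitivity (horner_eval t bp) => //; rewrite /bp.
  rewrite (@rmorph_eval1 K _ _ _ polyC idK (horner_eval t)) //; last by move=> z; exact: hornerC.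
  congr (eval1 _ _ _); apply/funext => a.
  transitivity (pencil_val UP (fun i w => (Lt i w)%:P + (v i)%:P * UP w) c0%:P
     (fun i => (v i * c0)%:P) a).[t] => //; rewrite /pencil_val.
  case: (enum_val a) => [[[i|] w]|[i|]]; rewrite ?UPt ?hornerC //.
  by rewrite hornerD hornerM !hornerC UPt.
have bp0 : bp != 0.
  suff : bp.[0] != 0 by apply: contra => /eqP ->; rewrite horner0.
  rewrite bpE; have -> : pr 0 = U0 by apply/funext => w; rewrite /pr expr0n /= addr0.
  have -> : (fun i w => Lt i w + v i * U0 w) = L0.
    by apply/funext => i; apply/funext => w; rewrite subrK.
  have -> : (fun i => v i * c0) = cc0 by apply/funext => i; rewrite divfK.
  by rewrite -val0E.
have [lam [linj lroot]] := poly_nonroots (q * D).+1 bp0.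
have [c cgt0 lam_sep] := interp_pigeonhole av q linj.
pose U j := probe U0 lam j; pose L j := tilt U0 Lt v lam j.
have [B1 B1_1 HB1] := fin_max (fun a : 'I_(q * D).+1 * gen => absC (U a.1 a.2)).
have [B2 B2_1 HB2] := fin_max (fun a : 'I_(q * D).+1 * 'I_N * gen => absC (L a.1.1 a.1.2 a.2)).
have [B3 B3_1 HB3] := fin_max (fun a : 'I_N * gen => absC (Lt a.1 a.2)).
have [B4 B4_1 HB4] := fin_max (fun i => absC (v i)).
pose r := B1 + B2 + B3 + B4 + absC c0.
have a0 := av_ge0 av c0.
have r1 : 1 <= r by rewrite /r; lra.
have r_ge0 : 0 <= r by lra.
have bU j w : absC (U j w) <= r by have := HB1 (j, w); rewrite /r /=; lra.
have bL j i w : absC (L j i w) <= r by have := HB2 (j, i, w); rewrite /r /=; lra.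
have bLt i w : absC (Lt i w) <= r by have := HB3 (i, w); rewrite /r /=; lra.
have bv i : absC (v i) <= r by have := HB4 i; rewrite /r /=; lra.
have bc : absC c0 <= r by rewrite /r; lra.
clearbody r.
have [beta bt0 Hbeta] : exists2 m, 0 < m & forall j, m <= absC bp.[lam j].
  by apply: fin_min => j; rewrite (av_gt0 av); apply: lroot.
pose lin (u : gen -> K) (x : 'I_N -> K) := \sum_i u (inl i) * x i.
pose bval j t x := meval (pencil_val (U j) (L j) t (fun i => lin (Lt i) x + v i * t)) b.
have linB u x t : (forall w, absC (u w) <= r) -> (forall i, absC (x i) <= t) -> 0 <= t ->
    absC (lin u x) <= N%:R * r * t.
  move=> Hu Hx t0; apply: le_trans (av_sum av _ _ _) _.
  apply: (@le_trans _ _ (\sum_(i < N) r * t)).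
    by apply: ler_sum => i _; rewrite (avM av); apply: ler_pM; rewrite ?(av_ge0 av).
  by rewrite sumr_const card_ord -[r * t *+ N]mulr_natl mulrA.
have Nr0 : 0 <= N%:R * r by rewrite mulr_ge0.
pose r2 := r + N%:R * r + r * r.
have rr0 : 0 <= r * r by rewrite mulr_ge0.
have [CL CL0 HCL] := mpoly_lipschitz av b r2.
have [Cu Cu0 HCu] := Hup r r_ge0.
pose eps := Num.min 1 (beta / 2 / (CL * (N%:R * r + 1))).
have eps0 : 0 < eps by rewrite lt_min ltr01 /= !divr_gt0 // mulr_gt0 // ltr_wpDl.
have eps1 : eps <= 1 by rewrite ge_min lexx.
(* At t = c0 the data of x differ by O(eps) from those of the origin, where |b| is at least beta. *)
have lower j x : (forall i, absC (x i) <= eps) -> beta / 2 <= absC (bval j c0 x).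
  move=> Hx; have bpj := Hbeta j; rewrite bpE in bpj.
  have h3 i : absC (v i * c0) <= r * r.
    by rewrite (avM av); apply: ler_pM; rewrite ?(av_ge0 av).
  have h4 i : absC (lin (Lt i) x) <= N%:R * r * eps by apply: linB => //; apply: ltW.
  have h5 : N%:R * r * eps <= N%:R * r by rewrite -[leRHS]mulr1; apply: ler_wpM2l.
  pose A1 := pencil_val (U j) (L j) c0 (fun i => v i * c0).
  pose A2 := pencil_val (U j) (L j) c0 (fun i => lin (Lt i) x + v i * c0).
  have hA1 a : absC (A1 a) <= r2.
    rewrite /A1 /pencil_val /r2; case: (enum_val a) => [[[i|] w]|[i|]].
    - by have := bL j i w; lra.
    - by have := bU j w; lra.
    - by have := h3 i; lra.
    - by lra.
  have hA2 a : absC (A2 a) <= r2.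
    rewrite /A2 /pencil_val /r2; case: (enum_val a) => [[[i|] w]|[i|]].
    - by have := bL j i w; lra.
    - by have := bU j w; lra.
    - by have := h3 i; have := h4 i; have := avD av (lin (Lt i) x) (v i * c0); lra.
    - by lra.
  have h0 : 0 <= N%:R * r * eps by rewrite mulr_ge0 // ltW.
  have hA a : absC (A1 a - A2 a) <= N%:R * r * eps.
    rewrite /A1 /A2 /pencil_val; case: (enum_val a) => [[[i|] w]|[i|]];
      rewrite ?subrr ?(av0 av) //.
    by rewrite opprD addrCA subrr addr0 (avN av).
  have h6 := HCL A1 A2 _ hA1 hA2 hA h0.
  have h7 : CL * (N%:R * r * eps) <= beta / 2.
    have he : eps <= beta / 2 / (CL * (N%:R * r + 1)) by rewrite ge_min lexx orbT.
    have X0 : 0 < CL * (N%:R * r + 1) by rewrite mulr_gt0 // ltr_wpDl.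
    move: he; rewrite ler_pdivlMr // => he; apply: le_trans he.
    rewrite [leRHS]mulrCA; apply: ler_wpM2l; first exact: ltW.
    by rewrite mulrDr mulr1 [eps * _]mulrC lerDl ltW.
  have h8 : absC (meval A1 b) <= absC (meval A2 b) + absC (meval A1 b - meval A2 b).
    by rewrite addrC; apply: le_trans (avD av _ _); rewrite subrK.
  have bpA : beta <= absC (meval A1 b) by [].
  by rewrite /bval -/A2; lra.
pose B := 1 + 5 * (r + N%:R * r * r) / c.
have B_gt0 : 0 < B by rewrite ltr_pwDl // divr_ge0 ?(ltW cgt0) // mulr_ge0 // addr_ge0 // mulr_ge0.
(* [pencil_ratio] for finite s and rho, divided by rho^kap s^k and compared with b up to eta; s is
   chosen first, rho afterwards. *)
have step x rho0 eta : (forall i, absC (x i) <= eps) -> 0 < rho0 -> rho0 <= 1 ->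
  (forall y, (forall j, meval y (f j) = 0) -> exists i, rho0 <= absC (y i - x i)) -> 0 < eta ->
  exists j, absC (bval j c0 x) <= (absC (bval j (lin (U j) x) x) + eta) * (B / rho0) ^+ D + eta.
  move=> Hx rho00 rho01 Hz eta0; have dl0 : 0 < rho0 / 5 by lra.
  have [|S0 HS0] := @gens_separated x (rho0 / 5) dl0.
    by move=> y /Hz [i Hi]; exists i; lra.
  pose tt (a : 'I_(q * D).+1 * bool) := if a.2 then c0 else lin (U a.1) x.
  pose vl a := pencil_val (U a.1) (L a.1) (tt a) (fun i => lin (Lt i) x + v i * tt a).
  have /choice [S HS] a : exists S1, 1 <= S1 /\ forall s, S1 <= absC s ->
    exists2 r1, 0 < r1 & forall rho, rho != 0 -> absC rho <= r1 ->
    absC (eval3 idK (vl a) s rho (pencil_form e f) / (rho ^+ kap * s ^+ k) - meval (vl a) b) <= eta.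
    by have [S1 h1 h2] := Hlim (vl a) eta eta0; exists S1.
  have [SM SM1 HSM] := fin_max S.
  pose s : K := (Num.bound (`|S0| + SM))%:R.
  have sM : `|S0| + SM <= absC s.
    rewrite absC_natr; apply/ltW/archi_boundP; apply: addr_ge0 => //.
    exact: le_trans ler01 SM1.
  have sS0 : S0 <= absC s by have := ler_norm S0; lra.
  have sS a : S a <= absC s by have := HSM a; have := normr_ge0 S0; lra.
  have s0 : s != 0 by rewrite -(av_gt0 av); have := normr_ge0 S0; lra.
  have /choice [ra Hra] a : exists r1, 0 < r1 /\ forall rho, rho != 0 -> absC rho <= r1 ->
    absC (eval3 idK (vl a) s rho (pencil_form e f) / (rho ^+ kap * s ^+ k) - meval (vl a) b) <= eta.
    by have [r1' h1 h2] := (HS a).2 s (sS a); exists r1'.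
  have [rm rm0 Hrm] := fin_min (fun a => (Hra a).1).
  pose LL (o : 'I_(q * D).+2) := if unlift ord0 o is Some j then L j else Lt.
  have [rho [rho_neq0 rho_le Hdet]] :=
    @generic_param (q * D).+2 s LL (D + (e.+1 + (e.+1 + N * e)))%N rm rm0.
  have det_Lt T : (T <= D + (e.+1 + (e.+1 + N * e)))%N ->
      qr_det e (pencil e f idK rho s Lt) T != 0.
    by move=> HT; have := Hdet ord0 T HT; rewrite /LL unlift_none.
  have det_L j T : (T <= D + (e.+1 + (e.+1 + N * e)))%N ->
      qr_det e (pencil e f idK rho s (tilt U0 Lt v lam j)) T != 0.
    by move=> HT; have := Hdet (lift ord0 j) T HT; rewrite /LL liftK.
  have [j Hj] := pencil_ratio f_deg cgt0 lam_sep dl0 det_Lt det_L (HS0 s sS0) c0.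
  exists j; cbv zeta beta in Hj; rewrite -/(U j) -/(L j) -!/(lin _ x) in Hj.
  set X := rho ^+ kap * s ^+ k in Hra *.
  have X0 : 0 < absC X by rewrite (av_gt0 av) mulf_neq0 // expf_neq0.
  set d1 := absC (pencil_det _ _ _ _ _ _ _ c0 _) in Hj.
  set d2 := absC (pencil_det _ _ _ _ _ _ _ (lin _ _) _) in Hj.
  have E1 : absC (bval j c0 x) <= d1 / absC X + eta.
    have [_ /(_ rho rho_neq0 (le_trans rho_le (Hrm (j, true))))] := Hra (j, true).
    rewrite eval_pencil_form /= => h; rewrite /bval.
    set m := meval _ b in h *; rewrite -[m](subKr (pencil_det e f idK rho s (U j) (L j) c0
      (fun i => lin (Lt i) x + v i * c0) / X)).
    by apply: le_trans (av_leB av _ _) _; rewrite (avM av) (avV av) lerD2l.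
  have E2 : d2 / absC X <= absC (bval j (lin (U j) x) x) + eta.
    have [_ /(_ rho rho_neq0 (le_trans rho_le (Hrm (j, false))))] := Hra (j, false).
    rewrite eval_pencil_form /= => h.
    rewrite /d2 -(avV av) -(avM av).
    set m := bval _ _ _; rewrite -[X in absC X <= _](subrK m) addrC.
    by apply: le_trans (avD av _ _) _; rewrite lerD2l.
  apply: le_trans E1 _; rewrite lerD2r.
  set Q' := (1 + _) ^+ D in Hj.
  have Q'B : Q' <= (B / rho0) ^+ D.
    have n1 : 0 <= absC (c0 - lin (U j) x) by apply: (av_ge0 av).
    have n2 : absC (c0 - lin (U j) x) <= r + N%:R * r * r.
      apply: le_trans (av_leB av _ _) _; apply: lerD => //; apply: linB => // i.
      by have := Hx i; lra.
    have cd : 0 < c * (rho0 / 5) by rewrite mulr_gt0.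
    rewrite /Q'; apply: lerXn2r.
    - by rewrite nnegrE addr_ge0 // divr_ge0 // ltW.
    - by rewrite nnegrE divr_ge0 // ltW.
    rewrite ler_pdivlMr // mulrDl mul1r /B; apply: lerD => //.
    rewrite mulrAC ler_pdivrMr //.
    rewrite [leRHS](_ : _ = (r + N%:R * r * r) * rho0); last first.
      by field; rewrite gt_eqF.
    by apply: ler_wpM2r => //; apply: ltW.
  have d20 : 0 <= d2 by apply: (av_ge0 av).
  have Q'0 : 0 <= Q'.
    by rewrite exprn_ge0 // addr_ge0 // divr_ge0 ?(av_ge0 av) // mulr_ge0 // ltW.
  apply: (@le_trans _ _ (d2 / absC X * Q')).
    by rewrite mulrAC; apply: ler_wpM2r => //; rewrite invr_ge0 ltW.
  by apply: ler_pM => //; rewrite divr_ge0 // ltW.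
exists (Num.min (beta / 2 / (Cu * B ^+ D)) (r * M%:R + 1)^-1), eps; split=> //.
  rewrite lt_min; apply/andP; split.
    by rewrite !divr_gt0 // mulr_gt0 // exprn_gt0.
  by rewrite invr_gt0 ltr_wpDl // mulr_ge0.
move=> x Hx rho0 rho00 rho01 Hz nu Hnu.
have nu0 : 0 <= nu.
  rewrite leNgt; apply/negP => h; have [j /=|i] := Hz x.
    by move: h; rewrite ltNge; case/negP; apply: le_trans (Hnu j); apply: (av_ge0 av).
  by rewrite subrr (av0 av) leNgt rho00.
have rD : 0 < rho0 ^+ D by rewrite exprn_gt0.
have rD1 : rho0 ^+ D <= 1 by apply: exprn_ile1 => //; apply: ltW.
have rM0 : 0 < r * M%:R + 1 by rewrite ltr_wpDl // mulr_ge0.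
(* Outside the range of the upper bound for b, nu itself is bounded below. *)
have [small|big] := lerP (r * M%:R * nu) 1; last first.
  apply: (@le_trans _ _ ((r * M%:R + 1)^-1 * 1)).
    apply: ler_pM => //; last by rewrite ge_min lexx orbT.
      by rewrite le_min !divr_ge0 ?invr_ge0 ?(ltW rM0) ?(ltW bt0) // mulr_ge0 ?exprn_ge0 ?ltW.
    exact: ltW.
  by rewrite mulr1 -[_^-1]mul1r ler_pdivrMr // mulrDr mulr1 mulrC; lra.
(* x and rho0 are fixed while the error eta tends to 0. *)
have key : beta / 2 <= Cu * nu * (B / rho0) ^+ D.
  apply/ler_addgt0Pr => ee ee0.
  set Q := (B / rho0) ^+ D; have Q0 : 0 < Q by rewrite exprn_gt0 // divr_gt0.
  have Q1 : 0 < Q + 1 by rewrite addr_gt0.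
  have eta0 : 0 < ee / (Q + 1) by rewrite divr_gt0.
  have [j Hj] := step x rho0 _ Hx rho00 rho01 Hz eta0.
  have h1 := lower j x Hx.
  have h2 : absC (bval j (lin (U j) x) x) <= Cu * nu.
    have xr i : absC (x i) <= r by have := Hx i; lra.
    have := HCu (U j) (L j) x nu (bU j) (bL j) xr Hnu nu0 small.
    rewrite /bval; have -> // : (fun l => \sum_i L j l (inl i) * x i)
       = (fun i => lin (Lt i) x + v i * lin (U j) x).
    apply/funext => l; rewrite /L /tilt /lin mulr_sumr -big_split.
    by apply: eq_bigr => i _; rewrite mulrDl mulrA.
  apply: (le_trans h1); apply: (le_trans Hj); rewrite -/Q.
  rewrite [leRHS](_ : _ = (Cu * nu + ee / (Q + 1)) * Q + ee / (Q + 1)).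
    by rewrite lerD2r; apply: ler_wpM2r; rewrite ?(ltW Q0) // lerD2r.
  by field; rewrite gt_eqF.
apply: (@le_trans _ _ (beta / 2 / (Cu * B ^+ D) * rho0 ^+ D)).
  by apply: ler_wpM2r; rewrite ?(ltW rD) // ge_min lexx.
have CB : 0 < Cu * B ^+ D by rewrite mulr_gt0 // exprn_gt0.
rewrite mulrAC ler_pdivrMr //; move: key.
rewrite expr_div_n mulrA ler_pdivlMr // => h; apply: le_trans h _.
by rewrite [leRHS]mulrCA mulrA.
Qed.
End ComplexBound.

(** * Semialgebraic predicates through quantifier elimination *)

Section Definable.
Variable R : realType.
Implicit Types (rho : nat -> R) (e : seq R) (P Q : (nat -> R) -> Prop) (g h : (nat -> R) -> R).
Import ordered_qelim.

Definition upd rho i x : nat -> R := fun j => if j == i then x else rho j.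

Lemma nth_upd e i x : nth 0 (set_nth 0 e i x) = upd (nth 0 e) i x.
Proof. by apply/funext => j; rewrite nth_set_nth. Qed.

(* Only the environments [nth 0 e], which are finitely supported, matter. *)
Definition term_fun g := exists2 t : GRing.term R,
  GRing.rterm t & forall e, GRing.eval e t = g (nth 0 e).

(** Only quantifier-free formulas are used as witnesses; [def_ex] restores closure under
    quantifiers. Predicates on environments let the formulas be built from ordinary propositions. *)
Definition definable P := exists phi : ord.formula R,
  [/\ ord.qf_form phi, ord.rformula phi & forall e, ord.qf_eval e phi <-> P (nth 0 e)].

Lemma tf_var i : term_fun (fun rho => rho i).
Proof. by exists (GRing.Var R i). Qed.
Lemma tf_const c : term_fun (fun=> c).
Proof. by exists (GRing.Const c). Qed.
Lemma tf_add g h : term_fun g -> term_fun h -> term_fun (fun rho => g rho + h rho).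
Proof.
by move=> [t t1 t2] [s s1 s2]; exists (GRing.Add t s) => [|e] /=; rewrite ?t1 // t2 s2.
Qed.
Lemma tf_mul g h : term_fun g -> term_fun h -> term_fun (fun rho => g rho * h rho).
Proof.
by move=> [t t1 t2] [s s1 s2]; exists (GRing.Mul t s) => [|e] /=; rewrite ?t1 // t2 s2.
Qed.
Lemma tf_opp g : term_fun g -> term_fun (fun rho => - g rho).
Proof. by move=> [t t1 t2]; exists (GRing.Opp t) => [|e] //=; rewrite t2. Qed.
Lemma tf_sub g h : term_fun g -> term_fun h -> term_fun (fun rho => g rho - h rho).
Proof. by move=> hg hh; apply: tf_add hg (tf_opp hh). Qed.
Lemma tf_exp g k : term_fun g -> term_fun (fun rho => g rho ^+ k).
Proof. by move=> [t t1 t2]; exists (GRing.Exp t k) => [|e] //=; rewrite t2. Qed.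
Lemma tf_ext g h : g =1 h -> term_fun g -> term_fun h.
Proof. by move=> gh [t t1 t2]; exists t => // e; rewrite t2 gh. Qed.
Lemma tf_sum (I : Type) (r : seq I) (G : I -> (nat -> R) -> R) :
  (forall i, term_fun (G i)) -> term_fun (fun rho => \sum_(i <- r) G i rho).
Proof.
move=> HG; elim: r => [|i r IH].
  by apply: (tf_ext _ (tf_const 0)) => rho; rewrite big_nil.
by apply: (tf_ext _ (tf_add (HG i) IH)) => rho; rewrite big_cons.
Qed.

Definition block n rho k : 'I_n -> R := fun i => rho (k + i)%N.
Arguments block : clear implicits.

Lemma tf_meval n k (p : mpoly n R) : term_fun (fun rho => meval (block n rho k) p).
Proof.
move: p; apply: mpoly_ring_ind => [c|i|p q IHp IHq|p q IHp IHq].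
- by apply: (tf_ext _ (tf_const c)) => rho; rewrite mevalC.
- by apply: (tf_ext _ (tf_var (k + i))) => rho; rewrite mevalXU.
- by apply: (tf_ext _ (tf_add IHp IHq)) => rho; rewrite mevalD.
- by apply: (tf_ext _ (tf_mul IHp IHq)) => rho; rewrite mevalM.
Qed.

Lemma def_ext P Q : (forall rho, P rho <-> Q rho) -> definable P -> definable Q.
Proof. by move=> PQ [f [f1 f2 f3]]; exists f; split=> // e; rewrite f3 PQ. Qed.

Lemma def_lt g h : term_fun g -> term_fun h -> definable (fun rho => g rho < h rho).
Proof.
move=> [t t1 t2] [s s1 s2]; exists (ord.Lt t s); split=> //=; first by rewrite t1.
by move=> e; rewrite t2 s2.
Qed.
Lemma def_le g h : term_fun g -> term_fun h -> definable (fun rho => g rho <= h rho).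
Proof.
move=> [t t1 t2] [s s1 s2]; exists (ord.Le t s); split=> //=; first by rewrite t1.
by move=> e; rewrite t2 s2.
Qed.
Lemma def_eq g h : term_fun g -> term_fun h -> definable (fun rho => g rho = h rho).
Proof.
move=> [t t1 t2] [s s1 s2]; exists (ord.Equal t s); split=> //=; first by rewrite t1.
by move=> e; rewrite t2 s2; split=> /eqP.
Qed.
Lemma def_and P Q : definable P -> definable Q -> definable (fun rho => P rho /\ Q rho).
Proof.
move=> [f [f1 f2 f3]] [g [g1 g2 g3]]; exists (ord.And f g); split=> /=; rewrite ?f1 ?f2 //.
by move=> e; rewrite -f3 -g3; split=> /andP.
Qed.
Lemma def_not P : definable P -> definable (fun rho => ~ P rho).
Proof.
move=> [f [f1 f2 f3]]; exists (ord.Not f); split=> //= e.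
by rewrite -f3; split=> /negP.
Qed.
Lemma def_or P Q : definable P -> definable Q -> definable (fun rho => P rho \/ Q rho).
Proof.
move=> hP hQ; apply: (def_ext _ (def_not (def_and (def_not hP) (def_not hQ)))) => rho.
by split; [move=> /not_andP [/contrapT|/contrapT]; tauto|tauto].
Qed.
Lemma def_imp P Q : definable P -> definable Q -> definable (fun rho => P rho -> Q rho).
Proof.
move=> hP hQ; apply: (def_ext _ (def_or (def_not hP) hQ)) => rho.
by split=> [[]//|H]; have [p|p] := pselect (P rho); [right; apply: H|left].
Qed.
Lemma def_true : definable (fun=> True).
Proof. by exists (ord.Bool true); split. Qed.

(** Tarski-Seidenberg: the projection is eliminated by the verified procedure for real closed
    fields. *)
Lemma def_ex i P : definable P -> definable (fun rho => exists x, P (upd rho i x)).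
Proof.
move=> [f [f1 f2 f3]].
pose qe := ord.quantifier_elim (fun j bc => qe_rcf.qfr_to_formula (@qe_rcf.wproj R j bc)).
have rex : ord.rformula (ord.Exists i f) by [].
have wfw := fun i bc => @qe_rcf.wf_QE_wproj R i bc.
have /andP [q1 q2] := ord.quantifier_elim_wf wfw rex.
exists (qe (ord.Exists i f)); split=> // e.
have hP : ord.holds e (ord.Exists i f) <-> exists x, P (upd (nth 0 e) i x).
  split=> -[x Hx]; exists x.
    by rewrite -nth_upd; apply/f3/ord.qf_evalP.
  by apply/ord.qf_evalP/f3 => //; rewrite nth_upd.
rewrite -hP; have rP := ord.quantifier_elim_rformP wfw (@qe_rcf.valid_QE_wproj R) e rex.
by split=> /rP.
Qed.
Lemma def_all i P : definable P -> definable (fun rho => forall x, P (upd rho i x)).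
Proof.
move=> hP; apply: (def_ext _ (def_not (def_ex i (def_not hP)))) => rho; split.
  by move=> H x; apply: contrapT => h; apply: H; exists x.
by move=> H [x]; apply; apply: H.
Qed.

Definition updb n rho k (x : 'I_n -> R) : nat -> R :=
  fun j => if insub (j - k)%N is Some i then if (k <= j)%N then x i else rho j else rho j.
Arguments updb n : clear implicits.

Lemma block_updb n rho k x : block n (updb n rho k x) k = x.
Proof.
apply/funext => i; rewrite /block /updb addKn leq_addr insubT //= => lt.
by congr (x _); apply: val_inj.
Qed.

Lemma updb_lt n rho k x j : (j < k)%N -> updb n rho k x j = rho j.
Proof. by move=> jk; rewrite /updb leqNgt jk /=; case: insub. Qed.

Lemma block_updb_lt n m rho k l x : (l + m <= k)%N -> block m (updb n rho k x) l = block m rho l.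
Proof.
move=> lk; apply/funext => i; rewrite /block updb_lt //.
by apply: leq_trans lk; rewrite ltn_add2l.
Qed.

Lemma def_exb n k P : definable P ->
  definable (fun rho => exists x : 'I_n -> R, P (updb n rho k x)).
Proof.
elim: n P => [|n IH] P hP.
  apply: (def_ext _ hP) => rho; have E x : updb 0 rho k x = rho.
    by apply/funext => j; rewrite /updb; case: insubP => // -[].
  by split=> [h|[x]]; rewrite ?E //; exists (fun i => rho i); rewrite E.
apply: (def_ext _ (IH _ (def_ex (k + n) hP))) => rho.
have E (y : 'I_n -> R) z : upd (updb n rho k y) (k + n) z
  = updb n.+1 rho k (fun i => if unlift ord_max i is Some j then y j else z).
  apply/funext => j; rewrite /upd /updb; have [->|jn] := eqVneq j (k + n)%N.
    rewrite addKn leq_addr; case: insubP => [i _ ii|]; last by rewrite ltnSn.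
    have -> : i = ord_max by apply: val_inj.
    by rewrite unlift_none.
  case: insubP => [i li ii|ge].
    case: insubP => [i' _ ii'|]; last by rewrite ltnS (ltnW li).
    case: leqP => // kj; have -> : i' = lift ord_max i.
      by apply: ord_inj; rewrite lift_max; apply: etrans ii' (esym ii).
    by rewrite liftK.
  case: insubP => [i' li' ii'|//]; case: leqP => // kj; exfalso.
  by move: jn ge li'; move/eqP; lia.
split=> [[y [z h]]|[x h]].
  exists (fun i => if unlift ord_max i is Some j then y j else z).
  by rewrite -E.
exists (fun i => x (lift ord_max i)), (x ord_max); rewrite E.
suff <- : x = (fun i => if unlift ord_max i is Some j then x (lift ord_max j) else x ord_max) by [].
by apply/funext => i; case: unliftP => [j ->|->].
Qed.
Lemma def_allb n k P : definable P ->
  definable (fun rho => forall x : 'I_n -> R, P (updb n rho k x)).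
Proof.
move=> hP; apply: (def_ext _ (def_not (def_exb n k (def_not hP)))) => rho; split.
  by move=> H x; apply: contrapT => h; apply: H; exists x.
by move=> H [x]; apply; apply: H.
Qed.

Lemma term_line e i a s t : GRing.rterm t -> exists p : {poly R},
  forall x, GRing.eval (set_nth 0 e i (a + s * x)) t = p.[x].
Proof.
elim: t => //= [j|c|k|t IHt u IHu|t IHt|t IHt k|t IHt u IHu|t IHt k].
- case: (eqVneq j i) => [->|ji] _.
    by exists (a%:P + s *: 'X) => x; rewrite nth_set_nth /= eqxx hornerD hornerC hornerZ hornerX.
  by exists (e`_j)%:P => x; rewrite nth_set_nth /= (negPf ji) hornerC.
- by exists c%:P => x; rewrite hornerC.
- by exists k%:R%:P => x; rewrite hornerC.
- by move=> /andP [/IHt [p hp] /IHu [q hq]]; exists (p + q) => x; rewrite hornerD hp hq.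
- by move=> /IHt [p hp]; exists (- p) => x; rewrite hornerN hp.
- by move=> /IHt [p hp]; exists (p *+ k) => x; rewrite hornerMn hp.
- by move=> /andP [/IHt [p hp] /IHu [q hq]]; exists (p * q) => x; rewrite hornerM hp hq.
- by move=> /IHt [p hp]; exists (p ^+ k) => x; rewrite horner_exp hp.
Qed.

(** To the right of 0 the polynomial is x^k times a factor close to its nonzero value at 0. The test
    c stands for any sign condition, as one invariant under positive scaling. *)
Lemma poly_sign_near0 (p : {poly R}) : exists2 d, 0 < d & forall c : R -> bool,
  (forall x y, 0 < y -> c (y * x) = c x) ->
  exists b, forall x, 0 < x -> x < d -> c p.[x] = b.
Proof.
have [->|p0] := eqVneq p 0.
  by exists 1 => // c _; exists (c 0) => x _ _; rewrite horner0.
have [k [q [-> q0]]] := poly_split_X p0; rewrite -horner_coef0 in q0.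
have h2 : 0 < `|q.[0]| / 2 by rewrite divr_gt0 // normr_gt0.
have [d d0 Hd] := poly_cvg0 (absR_absolute_value R) q h2.
exists d => // c Hc; exists (c q.[0]) => x x0 xd.
rewrite hornerM hornerXn Hc ?exprn_gt0 //.
have -> : q.[x] = (q.[x] / q.[0]) * q.[0] by rewrite divfK.
apply: Hc; have := Hd x; rewrite /absR (ger0_norm (ltW x0)) => /(_ (ltW xd)).
have -> : q.[x] - q.[0] = (q.[x] / q.[0] - 1) * q.[0] by rewrite mulrBl divfK // mul1r.
rewrite normrM mulrC ler_pM2l ?normr_gt0 // ler_norml => /andP [h _].
by lra.
Qed.

(** On a ray each atom becomes a sign condition on a one-variable polynomial, constant just after
    the origin; connectives preserve this. *)
Lemma def_eventually P e i a s : definable P -> exists (b : bool) (d : R), 0 < d /\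
  forall x, 0 < x -> x < d -> (P (nth 0 (set_nth 0 e i (a + s * x))) <-> b).
Proof.
move=> [f [f1 f2 f3]]; suff [b [d [d0 H]]] : exists (b : bool) (d : R), 0 < d /\
  forall x, 0 < x -> x < d -> ord.qf_eval (set_nth 0 e i (a + s * x)) f = b.
  by exists b, d; split=> // x x0 xd; rewrite -f3 H.
elim: f f1 f2 {f3} => //= [b|t u|t u|t u|f IHf g IHg|f IHf g IHg|f IHf g IHg|f IHf].
- by exists b, 1.
- move=> _ /andP [/(term_line e i a s) [p hp] /(term_line e i a s) [q hq]].
  have [d d0 /(_ (fun x => x == 0)) [x y y0|b Hb]] := poly_sign_near0 (p - q).
    by rewrite mulf_eq0 gt_eqF.
  by exists b, d; split=> // x x0 xd; rewrite hp hq -(Hb x) // hornerD hornerN subr_eq0.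
- move=> _ /andP [/(term_line e i a s) [p hp] /(term_line e i a s) [q hq]].
  have [d d0 /(_ (fun x => x < 0)) [x y y0|b Hb]] := poly_sign_near0 (p - q).
    by rewrite pmulr_rlt0.
  by exists b, d; split=> // x x0 xd; rewrite hp hq -(Hb x) // hornerD hornerN subr_lt0.
- move=> _ /andP [/(term_line e i a s) [p hp] /(term_line e i a s) [q hq]].
  have [d d0 /(_ (fun x => x <= 0)) [x y y0|b Hb]] := poly_sign_near0 (p - q).
    by rewrite pmulr_rle0.
  by exists b, d; split=> // x x0 xd; rewrite hp hq -(Hb x) // hornerD hornerN subr_le0.
- move=> /andP [f1 g1] /andP [f2 g2]; have [b [d [d0 H]]] := IHf f1 f2.
  have [b' [d' [d'0 H']]] := IHg g1 g2; exists (b && b'), (Num.min d d').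
  by rewrite lt_min d0; split=> // x x0; rewrite lt_min => /andP [/(H x x0) -> /(H' x x0) ->].
- move=> /andP [f1 g1] /andP [f2 g2]; have [b [d [d0 H]]] := IHf f1 f2.
  have [b' [d' [d'0 H']]] := IHg g1 g2; exists (b || b'), (Num.min d d').
  by rewrite lt_min d0; split=> // x x0; rewrite lt_min => /andP [/(H x x0) -> /(H' x x0) ->].
- move=> /andP [f1 g1] /andP [f2 g2]; have [b [d [d0 H]]] := IHf f1 f2.
  have [b' [d' [d'0 H']]] := IHg g1 g2; exists (b ==> b'), (Num.min d d').
  by rewrite lt_min d0; split=> // x x0; rewrite lt_min => /andP [/(H x x0) -> /(H' x x0) ->].
- move=> f1 f2; have [b [d [d0 H]]] := IHf f1 f2; exists (~~ b), d; split=> // x x0 xd.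
  by rewrite H.
Qed.

Definition envn n (v : 'I_n -> R) : seq R := [seq v i | i <- enum 'I_n].

Lemma nth_envn n (v : 'I_n -> R) (i : 'I_n) : nth 0 (envn v) i = v i.
Proof. by rewrite (nth_map i) ?size_enum_ord // nth_ord_enum. Qed.

Lemma term_mpoly n t : GRing.rterm t -> exists p : mpoly n R,
  forall v, GRing.eval (envn v) t = meval v p.
Proof.
elim: t => //= [j|c|k|t IHt u IHu|t IHt|t IHt k|t IHt u IHu|t IHt k].
- have [jn|nj] := ltnP j n => _; last first.
    by exists 0 => v; rewrite meval0 nth_default // size_map size_enum_ord.
  exists (mpolyX R (mnm1 (Ordinal jn))) => v; rewrite mevalXU.
  exact: (nth_envn v (Ordinal jn)).
- by exists (mpolyC n c) => v; rewrite mevalC.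
- by exists (mpolyC n k%:R) => v; rewrite mevalC.
- by move=> /andP [/IHt [p hp] /IHu [q hq]]; exists (p + q) => x; rewrite mevalD hp hq.
- by move=> /IHt [p hp]; exists (- p) => x; rewrite mevalN hp.
- by move=> /IHt [p hp]; exists (p *+ k) => x; rewrite mevalMn hp.
- by move=> /andP [/IHt [p hp] /IHu [q hq]]; exists (p * q) => x; rewrite mevalM hp hq.
- by move=> /IHt [p hp]; exists (p ^+ k) => x; rewrite rmorphXn /= hp.
Qed.

Lemma mpoly_nbhs_neq0 n (p : mpoly n R) v : meval v p != 0 ->
  exists2 d, 0 < d & forall w, (forall i, `|w i - v i| < d) -> 0 < meval w p * meval v p.
Proof.
move=> p0; have [B B1 HB] := fin_max (fun i => `|v i|).
have [C C0 HC] := mpoly_lipschitz (absR_absolute_value R) p (B + 1).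
have P0 : 0 < `|meval v p| by rewrite normr_gt0.
exists (Num.min 1 (`|meval v p| / (2 * C))); first by rewrite lt_min ltr01 divr_gt0 // mulr_gt0.
set d := Num.min _ _ => w Hw.
have d1 : d <= 1 by rewrite ge_min lexx.
have d2 : C * d <= `|meval v p| / 2.
  have : d <= `|meval v p| / (2 * C) by rewrite ge_min lexx orbT.
  by rewrite !ler_pdivlMr ?mulr_gt0 // => h; rewrite -mulrA mulrC -mulrA.
have d0 : 0 <= d by rewrite le_min ler01 divr_ge0 // mulr_ge0 // ltW.
have := HC w v d; rewrite /absR => /(_ _ _ _ d0) H.
have {}H : `|meval w p - meval v p| <= C * d.
  apply: H => i; last exact/ltW/Hw.
    by have := HB i; have := Hw i; have := ler_distD (v i) (w i) 0; rewrite !subr0; lra.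
  by have := HB i; lra.
have := le_trans H d2; rewrite ler_norml; have [v0|v0|v0] := ltgtP (meval v p) 0.
- by rewrite ltr0_norm // nmulr_lgt0 // => /andP [_]; lra.
- by rewrite gtr0_norm // pmulr_lgt0 // => /andP [h _]; lra.
- by rewrite v0 eqxx in p0.
Qed.

(* The product of the non-zero polynomials occurring in a quantifier-free description. *)
Lemma def_locally_constant n P : definable P -> exists2 p : mpoly n R, p != 0 &
  forall v, meval v p != 0 -> exists2 d, 0 < d &
    forall w, (forall i, `|w i - v i| < d) -> (P (nth 0 (envn w)) <-> P (nth 0 (envn v))).
Proof.
move=> [f [f1 f2 f3]]; suff [p p0 H] : exists2 p : mpoly n R, p != 0 &
  forall v, meval v p != 0 -> exists2 d, 0 < d & forall w, (forall i, `|w i - v i| < d) ->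
    ord.qf_eval (envn w) f = ord.qf_eval (envn v) f.
  exists p => // v /H [d d0 Hd]; exists d => // w /Hd E.
  by rewrite -!f3 E.
have atom (t u : GRing.term R) (c : R -> bool) (cmp : R -> R -> bool) :
  (forall x y, 0 < x * y -> c x = c y) -> (forall x y, cmp x y = c (x - y)) ->
  GRing.rterm t && GRing.rterm u ->
  exists2 p : mpoly n R, p != 0 & forall v, meval v p != 0 -> exists2 d, 0 < d &
   forall w, (forall i, `|w i - v i| < d) ->
    cmp (GRing.eval (envn w) t) (GRing.eval (envn w) u) =
    cmp (GRing.eval (envn v) t) (GRing.eval (envn v) u).
  move=> Hc Hcmp /andP [/(term_mpoly n) [p hp] /(term_mpoly n) [q hq]].
  have [E|pq] := eqVneq (p - q) 0.
    exists 1; first exact: oner_neq0.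
    move=> v _; exists 1 => // w _.
    by rewrite !Hcmp !hp !hq -!mevalB E !meval0.
  exists (p - q) => // v /mpoly_nbhs_neq0 [d d0 Hd]; exists d => // w /Hd h.
  by rewrite !Hcmp !hp !hq -!mevalB; apply: Hc.
have conn (F G : seq R -> bool) (op : bool -> bool -> bool) :
  (exists2 p : mpoly n R, p != 0 & forall v, meval v p != 0 -> exists2 d, 0 < d &
     forall w, (forall i, `|w i - v i| < d) -> F (envn w) = F (envn v)) ->
  (exists2 p : mpoly n R, p != 0 & forall v, meval v p != 0 -> exists2 d, 0 < d &
     forall w, (forall i, `|w i - v i| < d) -> G (envn w) = G (envn v)) ->
  exists2 p : mpoly n R, p != 0 & forall v, meval v p != 0 -> exists2 d, 0 < d &
     forall w, (forall i, `|w i - v i| < d) ->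
       op (F (envn w)) (G (envn w)) = op (F (envn v)) (G (envn v)).
  move=> [p p0 Hp] [q q0 Hq]; exists (p * q); first by rewrite mulf_neq0.
  move=> v; rewrite mevalM mulf_eq0 negb_or => /andP [/Hp [d d0 Hd] /Hq [d' d'0 Hd']].
  exists (Num.min d d'); first by rewrite lt_min d0.
  by move=> w Hw; rewrite (Hd w) ?(Hd' w) // => i; have := Hw i; rewrite lt_min => /andP [].
elim: f f1 f2 {f3} => //= [b|t u|t u|t u|f IHf g IHg|f IHf g IHg|f IHf g IHg|f IHf].
- by move=> _ _; exists 1; [exact: oner_neq0|move=> v _; exists 1].
- move=> _; apply: (atom t u (fun x => x == 0) (fun x y => x == y)) => x y; last first.
    by rewrite subr_eq0.
  by have [->|x0] := eqVneq x 0; [rewrite mul0r ltxx|have [->|//] := eqVneq y 0; rewrite mulr0 ltxx].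
- move=> _; apply: (atom t u (fun x => x < 0) (fun x y => x < y)) => x y; last first.
    by rewrite subr_lt0.
  by rewrite pmulr_gt0_lt0 || (have [x0|x0] := ltP x 0; have [y0|y0] := ltP y 0 => //; nra).
- move=> _; apply: (atom t u (fun x => x <= 0) (fun x y => x <= y)) => x y; last first.
    by rewrite subr_le0.
  by have [x0|x0] := leP x 0; have [y0|y0] := leP y 0 => //; nra.
- by move=> /andP [f1 g1] /andP [f2 g2]; exact (conn (fun e => ord.qf_eval e f) (fun e => ord.qf_eval e g) andb (IHf f1 f2) (IHg g1 g2)).
- by move=> /andP [f1 g1] /andP [f2 g2]; exact (conn (fun e => ord.qf_eval e f) (fun e => ord.qf_eval e g) orb (IHf f1 f2) (IHg g1 g2)).
- by move=> /andP [f1 g1] /andP [f2 g2]; exact (conn (fun e => ord.qf_eval e f) (fun e => ord.qf_eval e g) implb (IHf f1 f2) (IHg g1 g2)).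
- move=> f1 f2; have [p p0 H] := IHf f1 f2; exists p => // v /H [d d0 Hd]; exists d => // w /Hd.
  by move=> ->.
Qed.

End Definable.
Arguments block {R} n rho k _.

(** * Orders of semialgebraic functions: a Newton polygon argument *)

Section Balance.
Variable R : realType.

(** Writing y = z t^q makes both monomials proportional, up to the factor z^(j'-j), which is thus
    pinched between constants. Taking extrema with 1 replaces the extraction of a root. *)
Lemma balance (A A' c t y : R) (i j i' j' : nat) : 0 < A -> 0 < A' -> 0 < c -> 0 < t -> 0 < y ->
  (j < j')%N -> A * (t ^+ i * y ^+ j) <= c * (A' * (t ^+ i' * y ^+ j')) ->
  A' * (t ^+ i' * y ^+ j') <= c * (A * (t ^+ i * y ^+ j)) ->
  let q := (i%:R - i'%:R) / (j'%:R - j%:R) in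
  Num.min 1 (A / (c * A')) * powR t q <= y /\ y <= Num.max 1 (c * A / A') * powR t q.
Proof.
move=> A0 A'0 c0 t0 y0 jj' h1 h2 q; set tq := powR t q.
have tq0 : 0 < tq by apply: powR_gt0.
pose dl := (j' - j)%N; have dl0 : (0 < dl)%N by rewrite subn_gt0.
have j'E : j' = (j + dl)%N by rewrite subnKC // ltnW.
have dR : j'%:R - j%:R = dl%:R :> R by rewrite j'E natrD addrAC subrr add0r.
have tqd : tq ^+ dl * t ^+ i' = t ^+ i.
  rewrite -powR_mulrn ?powR_ge0 // -powRrM /q dR divfK ?pnatr_eq0 -?lt0n //.
  have -> : t `^ (i%:R - i'%:R) = t ^+ i / t ^+ i'.
    by rewrite powRB ?(gt_eqF t0) ?implybT // (powR_mulrn i (ltW t0)) (powR_mulrn i' (ltW t0)).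
  by rewrite divfK // expf_neq0 // gt_eqF.
pose z := y / tq; have z0 : 0 < z by rewrite divr_gt0.
have yE : y = z * tq by rewrite divfK // gt_eqF.
have E : t ^+ i' * y ^+ j' = (t ^+ i * y ^+ j) * z ^+ dl.
  rewrite j'E exprD {2}yE exprMn -tqd; ring.
have W0 : 0 < t ^+ i * y ^+ j by rewrite mulr_gt0 // exprn_gt0.
have k1 : A <= c * A' * z ^+ dl.
  move: h1; rewrite E (_ : c * _ = (c * A' * z ^+ dl) * (t ^+ i * y ^+ j)); last by ring.
  by rewrite ler_pM2r.
have k2 : A' * z ^+ dl <= c * A.
  move: h2; rewrite E (_ : A' * _ = (A' * z ^+ dl) * (t ^+ i * y ^+ j)); last by ring.
  by rewrite [c * (A * _)]mulrA ler_pM2r.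
rewrite yE !ler_pM2r //; split.
  rewrite leNgt lt_min; apply/negP => /andP [z1 zA].
  have : z ^+ dl <= z by apply: ler_iXnr => //; apply: ltW.
  move=> h; move: zA; rewrite ltr_pdivlMr ?mulr_gt0 // ltNge => /negP; apply.
  apply: (le_trans k1); rewrite mulrC; apply: ler_wpM2r => //.
  by rewrite ltW // mulr_gt0.
rewrite leNgt gt_max; apply/negP => /andP [z1 zA].
have : z <= z ^+ dl by apply: ler_eXnr => //; apply: ltW.
move=> h; move: zA; rewrite ltr_pdivrMr // ltNge => /negP; apply.
by apply: le_trans k2; rewrite mulrC; apply: ler_wpM2l => //; apply: ltW.
Qed.

Lemma poly_eventually_neq0 (p : {poly R}) : p != 0 ->
  exists2 d, 0 < d & forall x, 0 < x -> x < d -> p.[x] != 0.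
Proof.
move=> p0; have [k [q [-> q0]]] := poly_split_X p0.
have q00 : 0 < `|q.[0]| / 2 by rewrite divr_gt0 // normr_gt0 horner_coef0.
have [r r0 Hr] := poly_cvg0 (absR_absolute_value R) q q00.
exists r => // x x0 xr; rewrite hornerM hornerXn mulf_neq0 ?expf_neq0 ?(gt_eqF x0) //.
apply/eqP => qx; have := Hr x; rewrite /absR ger0_norm ?(ltW x0) // => /(_ (ltW xr)).
by rewrite qx sub0r normrN; lra.
Qed.

Lemma envn3 (v : 'I_3 -> R) : envn v = [:: v ord0; v (lift ord0 ord0); v ord_max].
Proof.
apply: (@eq_from_nth _ 0); first by rewrite size_map size_enum_ord.
move=> i; rewrite size_map size_enum_ord => i3.
have -> := nth_envn v (Ordinal i3); case: i i3 => [|[|[|//]]] i3 /=; congr (v _); exact: val_inj.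
Qed.

(** Off the zeros of the polynomial of [def_locally_constant] a graph point would have a whole
    vertical segment in the graph. *)
Lemma graph_poly (P : (nat -> R) -> Prop) : definable P ->
  (forall a t y y', P (nth 0 [:: a; t; y]) -> P (nth 0 [:: a; t; y']) -> y = y') ->
  exists2 p : mpoly 3 R, p != 0 & forall v : 'I_3 -> R,
    P (nth 0 (envn v)) -> meval v p = 0.
Proof.
move=> /(@def_locally_constant R 3) [p p0 Hp] HP; exists p => // v Pv.
apply/eqP/negPn/negP => /Hp [d d0 Hd].
pose w (i : 'I_3) := if i == ord_max then v i + d / 2 else v i.
have /Hd/iffRL/(_ Pv) : forall i, `|w i - v i| < d.
  move=> i; rewrite /w; case: eqP => _; last by rewrite subrr normr0.
  by rewrite addrAC subrr add0r gtr0_norm; lra.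
move: Pv; rewrite !envn3 /w eqxx /= => h1 h2; have := HP _ _ _ _ h1 h2; lra.
Qed.

(** In a polynomial relation between a, t and y the terms add up to 0, so the largest one is matched
    by another up to the number of terms, and [balance] gives the order of y. The possible slopes
    depend on exponents only, hence not on a, once a lies below the positive zeros of the
    coefficients. *)
Lemma graph_exponents (P : (nat -> R) -> Prop) : definable P ->
  (forall a t y y', P (nth 0 [:: a; t; y]) -> P (nth 0 [:: a; t; y']) -> y = y') ->
  exists (Q : seq R) (a1 : R), 0 < a1 /\ forall a, 0 < a -> a < a1 ->
  exists t1 c C : R, [/\ 0 < t1, 0 < c, 0 < C & forall t y, 0 < t -> t < t1 -> 0 < y ->
     P (nth 0 [:: a; t; y]) -> exists2 q, q \in Q & c * powR t q <= y /\ y <= C * powR t q].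
Proof.
move=> defP uniqP; have [p p0 Hp] := graph_poly defP uniqP.
pose i0 : 'I_3 := ord0; pose i1 : 'I_3 := lift ord0 ord0; pose i2 : 'I_3 := ord_max.
pose B := (\max_(m <- msupp p) mdeg m)%N.
have mB m (i : 'I_3) : m \in msupp p -> (m i < B.+1)%N.
  move=> ms; rewrite ltnS; apply: leq_trans (leq_bigmax_seq _ ms isT).
  by rewrite mdegE (bigD1 i) //= leq_addr.
pose J := ('I_B.+1 * 'I_B.+1)%type.
pose hh (m : multinom 3) : J := (inord (m i1), inord (m i2)).
pose a_ (k : J) : {poly R} := \sum_(m <- msupp p | hh m == k) mcoeff m p *: 'X^(m i0).
have evp a t y : meval (fun i => nth 0 [:: a; t; y] i) p
  = \sum_k (a_ k).[a] * (t ^+ k.1 * y ^+ k.2).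
  rewrite mevalE (partition_big hh xpredT) //=; apply: eq_bigr => k _.
  rewrite /a_ horner_sum mulr_suml big_seq_cond [RHS]big_seq_cond.
  apply: eq_bigr => m /andP [ms /eqP <-]; rewrite hornerZ hornerXn -mulrA; congr (_ * _).
  rewrite !big_ord_recl big_ord0 mulr1 /= !inordK ?mB //.
  by congr (_ * (_ * _ ^+ m _)); apply: val_inj.
have [k0 ak0] : exists k, a_ k != 0.
  have : msupp p != [::] by rewrite msupp_eq0.
  case E: (msupp p) => [//|m s] _; have ms : m \in msupp p by rewrite E inE eqxx.
  exists (hh m); apply/eqP => /(congr1 (fun q : {poly R} => q`_(m i0))).
  rewrite coef0 /a_ big_mkcond coef_sum (bigD1_seq m) ?msupp_uniq //= eqxx coefZ coefXn eqxx mulr1.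
  rewrite big_seq_cond big1 ?addr0 => [h|m' /andP [m's mm']].
    by move: ms; rewrite mcoeff_msupp h eqxx.
  case: eqP => [[E1 E2]|_]; last by rewrite coef0.
  rewrite coefZ coefXn; case: eqP => [E0|]; last by rewrite mulr0.
  case/eqP: mm'; apply/mnmP => i.
  have F1 : m' i1 = m i1 by move/(congr1 val): E1; rewrite /= !inordK // mB.
  have F2 : m' i2 = m i2 by move/(congr1 val): E2; rewrite /= !inordK // mB.
  case: i => [[|[|[|//]]] ii].
  - by have -> : Ordinal ii = i0 by apply: val_inj.
  - by have -> : Ordinal ii = i1 by apply: val_inj.
  - by have -> : Ordinal ii = i2 by apply: val_inj.
pose n : R := #|{: J}|%:R.
have n0 : 0 < n by rewrite ltr0n; apply/card_gt0P; exists k0.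
have n1 : 1 <= n by rewrite ler1n; apply/card_gt0P; exists k0.
pose slope (kk : J * J) : R :=
  (kk.1.1%:R - kk.2.1%:R) / (kk.2.2%:R - kk.1.2%:R).
have /choice [da Hda] k : exists d, 0 < d /\ (a_ k != 0 -> forall x, 0 < x -> x < d -> (a_ k).[x] != 0).
  have [->|/poly_eventually_neq0 [d d0 Hd]] := eqVneq (a_ k) 0; last by exists d.
  by exists 1; split; rewrite ?eqxx.
have [a1 a10 Ha1] := fin_min (fun k => (Hda k).1).
exists [seq slope kk | kk <- enum {: J * J}], a1; split=> // a a0 aa1.
pose A k := `|(a_ k).[a]|.
have A0 k : a_ k != 0 -> 0 < A k.
  move=> ak; rewrite normr_gt0; apply: (Hda k).2 => //; exact: lt_le_trans (Ha1 k).
pose A' k := if a_ k == 0 then 1 else A k.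
have A'0 k : 0 < A' k by rewrite /A'; case: eqVneq => // /A0.
have [t1 t10 Ht1] := @fin_min R (J * J)%type (fun kk => Num.min 1 (A' kk.1 / (n * A' kk.2)))
  (fun kk => ltac:(by rewrite lt_min ltr01 divr_gt0 // mulr_gt0)).
have [C C1 HC] := @fin_max R (J * J)%type (fun kk => Num.max 1 (n * A' kk.1 / A' kk.2)).
exists t1, t1, C; split=> //; first by apply: lt_le_trans C1.
move=> t y t0 tt1 y0 Py.
have t1le kk : t1 <= 1 /\ t1 <= A' kk.1 / (n * A' kk.2).
  by have := Ht1 kk; rewrite le_min => /andP [].
have rel : \sum_k (a_ k).[a] * (t ^+ k.1 * y ^+ k.2) = 0.
  rewrite -evp; apply: Hp; rewrite envn3 /=; exact: Py.
pose T k := A' k * (t ^+ k.1 * y ^+ k.2).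
have T0 k : 0 < T k by rewrite /T !mulr_gt0 ?exprn_gt0.
have TE k : a_ k != 0 -> `|(a_ k).[a] * (t ^+ k.1 * y ^+ k.2)| = T k.
  move=> ak; rewrite normrM /T /A' (negPf ak); congr (_ * _).
  by rewrite ger0_norm // ltW // mulr_gt0 // exprn_gt0.
pose ks := [arg max_(k > k0 | a_ k != 0) T k]%O.
have [aks Hks] : a_ ks != 0 /\ forall k, a_ k != 0 -> T k <= T ks.
  by rewrite /ks; case: arg_maxP.
have [k' [ak' kks Tk']] : exists k', [/\ a_ k' != 0, k' != ks & T ks <= n * T k'].
  apply: contrapT => H.
  have lt k : a_ k != 0 -> k != ks -> n * T k < T ks.
    by move=> h1 h2; rewrite ltNge; apply/negP => h3; apply: H; exists k.
  move: rel; rewrite (bigD1 ks) //= => /eqP; rewrite addr_eq0 => /eqP E.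
  have := TE ks aks; rewrite E normrN => TE'.
  have : n * T ks <= \sum_(k | k != ks) T ks.
    apply: (@le_trans _ _ (n * \sum_(k | k != ks) `|(a_ k).[a] * (t ^+ k.1 * y ^+ k.2)|)).
      by rewrite -TE' ler_pM2l //; apply: ler_norm_sum.
    rewrite mulr_sumr; apply: ler_sum => k kk.
    have [ak|ak] := eqVneq (a_ k) 0; last by rewrite TE // ltW // lt.
    by rewrite ak horner0 mul0r normr0 mulr0 ltW.
  rewrite sumr_const -mulr_natl ler_pM2r // leNgt => /negP; apply.
  rewrite ltr_nat /J; have := cardC1 ks; rewrite -[RHS]subn1 => ->.
  by rewrite subn1 prednK //; apply/card_gt0P; exists ks.
have Tk's : T k' <= n * T ks.
  by apply: (le_trans (Hks k' ak')); rewrite ler_peMl // ltW.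
suff H : forall k l : J, k != l -> T k <= n * T l -> T l <= n * T k -> (k.2 <= l.2)%N ->
    exists2 q, q \in [seq slope kk | kk <- enum {: J * J}] &
    t1 * powR t q <= y /\ y <= C * powR t q.
  case: (leqP ks.2 k'.2) => [le|/ltnW le]; last by apply: (H k' ks).
  by apply: (H ks k') => //; rewrite eq_sym.
move=> k l kl Tkl Tlk; rewrite leq_eqVlt => /orP [/eqP E2|lt]; last first.
  exists (slope (k, l)); first by apply/map_f; rewrite mem_enum.
  have [h1 h2] := balance (A'0 k) (A'0 l) n0 t0 y0 lt Tkl Tlk.
  split.
    apply: le_trans h1; apply: ler_wpM2r; first exact: powR_ge0.
    exact: (Ht1 (k, l)).
  apply: (le_trans h2); apply: ler_wpM2r; first exact: powR_ge0.
  exact: (HC (k, l)).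
exfalso.
have key : forall u v : J, u.2 = v.2 :> nat -> (u.1 < v.1)%N -> T u <= n * T v -> False.
  move=> u v E lt; rewrite /T E !mulrA ler_pM2r ?exprn_gt0 //.
  rewrite -(subnKC (ltnW lt)) exprD !mulrA mulrAC ler_pM2r ?exprn_gt0 // => h.
  have h2 : t ^+ (v.1 - u.1) <= t.
    apply: ler_iXnr; rewrite ?subn_gt0 //; first exact: ltW.
    by have [h3 _] := t1le (u, v); apply: ltW; apply: lt_le_trans h3.
  have [_ /=] := t1le (u, v); rewrite leNgt => /negP; apply.
  apply: le_lt_trans tt1; rewrite ler_pdivrMr ?mulr_gt0 //.
  apply: (le_trans h); rewrite mulrC; apply: ler_wpM2r => //; apply: ltW; exact: mulr_gt0.
have [lt|lt|E1] := ltngtP k.1 l.1.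
- exact: (key k l).
- exact: (key l k).
- by case/eqP: kl; rewrite [k]surjective_pairing [l]surjective_pairing; congr (_, _); apply: val_inj.
Qed.

End Balance.

Section Quantify.
Variable R : realType.
Implicit Types (rho : nat -> R).

Lemma block_upd n rho i x k : (i < k)%N -> block n (upd rho i x) k = block n rho k.
Proof.
move=> ik; apply/funext => j; rewrite /block /upd.
by case: eqP => // E; move: ik; rewrite -E ltnNge leq_addr.
Qed.

(** The quantified variable is made an argument of Q; the second hypothesis says that i is fresh. *)
Lemma def_all' i (Q : (nat -> R) -> R -> Prop) : definable (fun rho => Q rho (rho i)) ->
  (forall rho x, Q (upd rho i x) x <-> Q rho x) -> definable (fun rho => forall x, Q rho x).
Proof.
move=> hQ HQ; apply: (def_ext _ (def_all i hQ)) => rho.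
have E x : upd rho i x i = x by rewrite /upd eqxx.
by split=> H x; have := H x; rewrite E HQ.
Qed.

Lemma def_ex' i (Q : (nat -> R) -> R -> Prop) : definable (fun rho => Q rho (rho i)) ->
  (forall rho x, Q (upd rho i x) x <-> Q rho x) -> definable (fun rho => exists x, Q rho x).
Proof.
move=> hQ HQ; apply: (def_ext _ (def_ex i hQ)) => rho.
have E x : upd rho i x i = x by rewrite /upd eqxx.
by split=> -[x H]; exists x; move: H; rewrite E HQ.
Qed.

Lemma def_allb' n k (Q : (nat -> R) -> ('I_n -> R) -> Prop) :
  definable (fun rho => Q rho (block n rho k)) ->
  (forall rho x, Q (updb rho k x) x <-> Q rho x) -> definable (fun rho => forall x, Q rho x).
Proof.
move=> hQ HQ; apply: (def_ext _ (def_allb n k hQ)) => rho.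
by split=> H x; have := H x; rewrite block_updb HQ.
Qed.

Lemma def_exb' n k (Q : (nat -> R) -> ('I_n -> R) -> Prop) :
  definable (fun rho => Q rho (block n rho k)) ->
  (forall rho x, Q (updb rho k x) x <-> Q rho x) -> definable (fun rho => exists x, Q rho x).
Proof.
move=> hQ HQ; apply: (def_ext _ (def_exb n k hQ)) => rho.
by split=> -[x H]; exists x; move: H; rewrite block_updb HQ.
Qed.
End Quantify.

(** * Existence of a smallest exponent *)

Section MinExponent.
Variables (R : realType) (n : nat) (G h : mpoly n R).
Implicit Types (x a : 'I_n -> R) (t u : R).
Hypothesis h_ge0 : forall x, 0 <= meval x h.
Hypothesis G0 : meval (fun=> 0) G = 0.
Hypothesis h0 : meval (fun=> 0) h = 0.

Definition nrm2 x : R := \sum_i x i ^+ 2.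
Definition inX x : Prop := meval x G = 0.
Definition inV x : Prop := inX x /\ meval x h = 0.
(** The distance from x to [inV], its infimum spelled out in first-order terms. *)
Definition isd x t : Prop := [/\ 0 <= t,
  forall a, inV a -> t ^+ 2 <= nrm2 (fun i => x i - a i) &
  forall u, t < u -> exists a, inV a /\ nrm2 (fun i => x i - a i) < u ^+ 2].
Definition exponent_ok eta : Prop := exists C eps : R, [/\ 0 < C, 0 < eps &
  forall x t, inX x -> nrm2 x < eps ^+ 2 -> isd x t -> C * powR t eta <= Num.sqrt (meval x h)].

Lemma nrm2_ge0 x : 0 <= nrm2 x.
Proof. by apply: sumr_ge0 => i _; apply: sqr_ge0. Qed.

Lemma nrm2_coord x u i : 0 < u -> nrm2 x < u ^+ 2 -> `|x i| < u.
Proof.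
move=> u0 xu; rewrite -(@ltr_pXn2r _ 2) ?nnegrE ?(ltW u0) // real_normK ?num_real //.
apply: le_lt_trans xu; rewrite /nrm2 (bigD1 i) //= lerDl.
by apply: sumr_ge0 => j _; apply: sqr_ge0.
Qed.

Lemma isd_le x t : isd x t -> t ^+ 2 <= nrm2 x.
Proof.
move=> [_ H _]; have := H (fun=> 0) (conj G0 h0).
by under eq_fun do rewrite subr0.
Qed.

Lemma isd_exists x : exists t, isd x t.
Proof.
pose S := [set Num.sqrt (nrm2 (fun i => x i - a i)) | a in [set a | inV a]].
have hS : has_inf S.
  split; first by exists (Num.sqrt (nrm2 (fun i => x i - 0))), (fun=> 0).
  by exists 0 => y [a _ <-]; apply: sqrtr_ge0.
exists (inf S); split.
- by apply: lb_le_inf; [exact: hS.1 | move=> y [a _ <-]; apply: sqrtr_ge0].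
- move=> a Va; have le : inf S <= Num.sqrt (nrm2 (fun i => x i - a i)).
    by apply: ge_inf; [exact: hS.2 | exists a].
  rewrite -[leRHS]sqr_sqrtr ?nrm2_ge0 //; apply: lerXn2r => //; rewrite nnegrE ?sqrtr_ge0 //.
  by apply: lb_le_inf; [exact: hS.1 | move=> y [b _ <-]; apply: sqrtr_ge0].
- move=> u /(inf_lt hS.1) [y [a Va <-] yu]; exists a; split => //.
  have u0 : 0 < u by apply: le_lt_trans yu; apply: sqrtr_ge0.
  rewrite -[ltLHS]sqr_sqrtr ?nrm2_ge0 //.
  by rewrite ltr_pXn2r // nnegrE ?sqrtr_ge0 // ltW.
Qed.

Lemma isd_gt0 x t : meval x h != 0 -> isd x t -> 0 < t.
Proof.
move=> hx [t0 _ H]; rewrite lt_neqAle t0 andbT; apply/eqP => t_0.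
have [d d0 Hd] := mpoly_nbhs_neq0 hx.
have [|a [[_ ha] xa]] := H d; first by rewrite -t_0.
have : 0 < meval a h * meval x h.
  by apply: Hd => i; rewrite distrC; apply: (nrm2_coord (x := fun i => x i - a i)).
by rewrite ha mul0r ltxx.
Qed.

Definition inK (e t : R) x : Prop := [/\ inX x, nrm2 x <= e ^+ 2 & isd x t].

(** Variables 0, 1, 2 are the radius e, the distance t and the infimum y of h on [inK e t];
    variables 3 and 4 and blocks from 5 on are left for quantifiers. *)
Definition value_graph (rho : nat -> R) : Prop :=
  (forall x, inK (rho 0%N) (rho 1%N) x -> rho 2%N <= meval x h) /\
  (forall u, rho 2%N < u -> exists x, inK (rho 0%N) (rho 1%N) x /\ meval x h < u).

Lemma def_inX k : definable (fun rho => inX (block n rho k)).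
Proof. exact: def_eq (tf_meval k G) (tf_const 0). Qed.

Lemma def_inV k : definable (fun rho => inV (block n rho k)).
Proof. apply: def_and (def_inX k) _; exact: def_eq (tf_meval k h) (tf_const 0). Qed.

Lemma tf_nrm2 k : term_fun (fun rho : nat -> R => nrm2 (block n rho k)).
Proof. by apply: tf_sum => i; apply: tf_exp; apply: tf_var. Qed.

Lemma tf_dist2 k l :
  term_fun (fun rho : nat -> R => nrm2 (fun i => block n rho k i - block n rho l i)).
Proof. by apply: tf_sum => i; apply: tf_exp; apply: tf_sub; apply: tf_var. Qed.

Lemma def_isd : definable (fun rho => isd (block n rho 5) (rho 1%N)).
Proof.
apply: (def_ext (P := fun rho => 0 <= rho 1%N /\
  ((forall a, inV a -> rho 1%N ^+ 2 <= nrm2 (fun i => block n rho 5 i - a i)) /\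
   (forall u, rho 1%N < u -> exists a, inV a /\ nrm2 (fun i => block n rho 5 i - a i) < u ^+ 2)))).
  by move=> rho; split=> [[h1 [h2 h3]]|[h1 h2 h3]]; split.
apply: def_and; first exact: def_le (tf_const 0) (tf_var R 1).
apply: def_and.
  apply: (def_allb' (k := (5 + n)%N)) => [|rho x]; last by rewrite block_updb_lt ?updb_lt.
  apply: def_imp (def_inV _) _; apply: def_le (tf_exp 2 (tf_var R 1)) (tf_dist2 _ _).
apply: (def_all' (i := 4)) => [|rho u]; last by rewrite block_upd.
apply: def_imp (def_lt (tf_var R 1) (tf_var R 4)) _.
apply: (def_exb' (k := (5 + n)%N)) => [|rho x]; last by rewrite block_updb_lt ?updb_lt.
apply: def_and (def_inV _) _; apply: def_lt (tf_dist2 _ _) (tf_exp 2 (tf_var R 4)).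
Qed.

Lemma def_inK : definable (fun rho => inK (rho 0%N) (rho 1%N) (block n rho 5)).
Proof.
apply: (def_ext (P := fun rho => inX (block n rho 5) /\
  (nrm2 (block n rho 5) <= rho 0%N ^+ 2 /\ isd (block n rho 5) (rho 1%N)))).
  by move=> rho; split=> [[h1 [h2 h3]]|[h1 h2 h3]]; split.
apply: def_and (def_inX _) (def_and _ def_isd).
exact: def_le (tf_nrm2 _) (tf_exp 2 (tf_var R 0)).
Qed.

Lemma def_value_graph : definable value_graph.
Proof.
apply: def_and.
  apply: (def_allb' (k := 5)) => [|rho x]; last by rewrite !updb_lt.
  exact: def_imp def_inK (def_le (tf_var R 2) (tf_meval _ _)).
apply: (def_all' (i := 3)) => [|rho u]; last by [].
apply: def_imp (def_lt (tf_var R 2) (tf_var R 3)) _.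
apply: (def_exb' (k := 5)) => [|rho x]; last by rewrite !updb_lt.
exact: def_and def_inK (def_lt (tf_meval _ _) (tf_var R 3)).
Qed.

Lemma value_graph_uniq e t y y' :
  value_graph (nth 0 [:: e; t; y]) -> value_graph (nth 0 [:: e; t; y']) -> y = y'.
Proof.
suff H z z' : value_graph (nth 0 [:: e; t; z]) -> value_graph (nth 0 [:: e; t; z']) -> z <= z'.
  by move=> h1 h2; apply/eqP; rewrite eq_le !H.
move=> [h1 _] [_ h2]; rewrite leNgt; apply/negP => /h2 [x [/= Kx]].
by rewrite ltNge => /negP; apply; apply: h1.
Qed.

Lemma value_graph_exists e t x : inK e t x -> exists y, value_graph (nth 0 [:: e; t; y]).
Proof.
move=> Kx; pose S := [set meval z h | z in [set z | inK e t z]].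
have hS : has_inf S.
  split; first by exists (meval x h), x.
  by exists 0 => y [a _ <-]; apply: h_ge0.
exists (inf S); split => /= [z Kz|u /(inf_lt hS.1) [y [z Kz <-] zu]]; last by exists z.
by apply: ge_inf; [exact: hS.2 | exists z].
Qed.

Hypothesis cluster : forall e, 0 < e -> exists x, [/\ inX x, meval x h != 0 & nrm2 x < e ^+ 2].

(** q is the order in t of the least value of h: a lower bound for all small t, attained up to a
    constant for arbitrarily small t. *)
Definition good e q : Prop := exists c C t1 : R, [/\ 0 < c, 0 < C, 0 < t1,
  forall t y, 0 < t -> t < t1 -> (exists x, inK e t x) -> value_graph (nth 0 [:: e; t; y]) ->
    c * powR t q <= y &
  forall t1', 0 < t1' -> exists t y, [/\ 0 < t, t < t1', 0 < y, value_graph (nth 0 [:: e; t; y]) &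
    (exists x, inK e t x) /\ y <= C * powR t q]].

Variable eta1 : R.
Hypothesis eta1_ok : exponent_ok eta1.

(** The admissible exponent [eta1] keeps the infimum positive, and [graph_exponents] speaks of
    positive values. *)
Lemma value_gt0 : exists2 e1, 0 < e1 & forall e t y, 0 < e -> e < e1 -> 0 < t ->
  (exists x, inK e t x) -> value_graph (nth 0 [:: e; t; y]) -> 0 < y.
Proof.
have [C [e1 [C0 e10 H]]] := eta1_ok; exists e1 => // e t y e0 ee1 t0 _ [_ Hy].
have p0 : 0 < C * powR t eta1 by rewrite mulr_gt0 // powR_gt0.
rewrite ltNge; apply/negP => y0.
have [|x [/= [Xx xe dx] hx]] := Hy ((C * powR t eta1) ^+ 2).
  by apply: le_lt_trans y0 _; rewrite exprn_gt0.
have xe1 : nrm2 x < e1 ^+ 2 by apply: le_lt_trans xe _; rewrite ltr_pXn2r // nnegrE ltW.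
have := H x t Xx xe1 dx; rewrite leNgt => /negP; apply.
by rewrite -[ltRHS](ger0_norm (ltW p0)) -sqrtr_sqr ltr_sqrt // exprn_gt0.
Qed.

(** Among the finitely many orders, keep those occurring for arbitrarily small t. The largest gives
    the smallest power of t < 1 and so bounds all values below. *)
Lemma good_exists : exists (Q : seq R) (e1 : R), 0 < e1 /\
  forall e, 0 < e -> e < e1 -> exists2 q, q \in Q & good e q.
Proof.
have [Q [a1 [a10 HQ]]] := graph_exponents def_value_graph value_graph_uniq.
have [e1 e10 Hpos] := value_gt0.
exists Q, (Num.min a1 e1); split; first by rewrite lt_min a10.
move=> e e0; rewrite lt_min => /andP [ea1 ee1].
have [t1 [c [C [t10 c0 C0 H]]]] := HQ e e0 ea1.
pose occ q t1' := exists t y, [/\ 0 < t, t < t1', 0 < y, value_graph (nth 0 [:: e; t; y]) &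
    (exists x, inK e t x) /\ (c * powR t q <= y /\ y <= C * powR t q)].
(* Below t2, an order of the list occurs only if it occurs arbitrarily close to 0. *)
have [t2 [t20 t21 Ht2]] : exists t2, [/\ 0 < t2, t2 <= Num.min 1 t1 & forall q, q \in Q -> occ q t2 ->
    forall t1', 0 < t1' -> occ q t1'].
  elim: Q {HQ H} => [|q Q [t2 [t20 t21 IH]]]; first by exists (Num.min 1 t1); rewrite lt_min ltr01.
  have [io|nio] := pselect (forall t1', 0 < t1' -> occ q t1').
    by exists t2; split=> // q'; rewrite inE => /orP [/eqP -> //|/IH].
  have [t3 t30 nt3] : exists2 t3, 0 < t3 & ~ occ q t3.
    apply: contrapT => hn; apply: nio => t1' t1'0; apply: contrapT => hn'; apply: hn; by exists t1'.
  exists (Num.min t2 t3); split; first by rewrite lt_min t20.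
    by rewrite ge_min t21.
  have mono q' u v : u <= v -> occ q' u -> occ q' v.
    by move=> uv [t [y [h1 h2 h3 h4 h5]]]; exists t, y; split=> //; apply: lt_le_trans uv.
  move=> q'; rewrite inE => /orP [/eqP ->|q'Q] oc.
    by case: nt3; apply: mono oc; rewrite ge_min lexx orbT.
  by apply: IH => //; apply: mono oc; rewrite ge_min lexx.
have t2m : t2 <= 1 /\ t2 <= t1 by move: t21; rewrite le_min => /andP.
have point t1' : 0 < t1' -> exists t y, [/\ 0 < t, t < t1', 0 < y,
    value_graph (nth 0 [:: e; t; y]) & exists x, inK e t x].
  move=> t1'0; have m0 : 0 < Num.min t1' e by rewrite lt_min t1'0.
  have [x [Xx hx xm]] := cluster m0; have [t dx] := isd_exists x.
  have t0 : 0 < t := isd_gt0 hx dx.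
  have tm : t < Num.min t1' e.
    rewrite -(@ltr_pXn2r _ 2) ?nnegrE ?(ltW t0) ?(ltW m0) //.
    exact: le_lt_trans (isd_le dx) xm.
  have Kx : inK e t x.
    split=> //; apply/ltW/(lt_le_trans xm); apply: lerXn2r; rewrite ?nnegrE ?(ltW m0) ?(ltW e0) //.
    by rewrite ge_min lexx orbT.
  have [y Hy] := value_graph_exists Kx; exists t, y; split=> //.
  - by move: tm; rewrite lt_min => /andP [].
  - by apply: (Hpos e t y) => //; exists x.
  - by exists x.
have pick t1' : 0 < t1' -> t1' <= t2 -> exists2 q, q \in Q & occ q t1'.
  move=> t1'0 le; have [t [y [t0 tt y0 vy Kx]]] := point t1' t1'0.
  have [|q qQ hq] := H t y t0 _ y0 vy; last by exists q => //; exists t, y.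
  by apply: (lt_le_trans tt); apply: (le_trans le); case: t2m.
pose Q' := [seq q <- Q | `[< occ q t2 >]].
have Q'P q : q \in Q' <-> q \in Q /\ occ q t2.
  by rewrite mem_filter; split=> [/andP [/asboolP]|[h1 h2]] //; apply/andP; split=> //; apply/asboolP.
have [qm qmQ' Hqm] : exists2 qm, qm \in Q' & forall q, q \in Q' -> q <= qm.
  have [q qQ oq] := pick t2 t20 (lexx _).
  have : q \in Q' by apply/Q'P.
  elim: Q' {Q'P} q {qQ oq} => // q0 [|q1 s] IH q _.
    by exists q0; rewrite ?mem_head // => q'; rewrite inE => /eqP ->.
  have [qm qms Hs] := IH q1 (mem_head _ _).
  exists (Num.max q0 qm); first by case: leP; rewrite inE ?eqxx ?qms ?orbT.
  by move=> q'; rewrite inE le_max => /orP [/eqP ->|/Hs ->]; rewrite ?lexx ?orbT.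
have [qmQ oqm] := (Q'P qm).1 qmQ'.
exists qm => //; exists c, C, t2; split=> //.
  move=> t y t0 tt2 Kx vy; have y0 : 0 < y by apply: (Hpos e t y).
  have [|q qQ [h1 h2]] := H t y t0 _ y0 vy.
    by apply: (lt_le_trans tt2); case: t2m.
  apply: le_trans (h1); apply: ler_wpM2l; first exact: ltW.
  apply: ger_powR; first by rewrite t0 /=; apply: le_trans (ltW tt2) _; case: t2m.
  by apply: Hqm; apply/Q'P; split=> //; exists t, y; split.
move=> t1' t1'0; have [t [y [a1' a2 a3 a4 [a5 [a6 a7]]]]] := Ht2 qm qmQ oqm t1' t1'0.
by exists t, y.
Qed.

Lemma good_pos_ineq e q : 0 < e -> good e q -> exists C eps : R, [/\ 0 < C, 0 < eps &
  forall x t, inX x -> nrm2 x < eps ^+ 2 -> isd x t -> 0 < t ->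
    C * powR t (q / 2) <= Num.sqrt (meval x h)].
Proof.
move=> e0 [c [C [t1 [c0 C0 t10 H _]]]].
exists (Num.sqrt c), (Num.min e t1); rewrite sqrtr_gt0 lt_min e0; split=> // x t Xx xm dx t0.
have m0 : 0 < Num.min e t1 by rewrite lt_min e0.
have tm : t < Num.min e t1.
  rewrite -(@ltr_pXn2r _ 2) ?nnegrE ?(ltW t0) ?(ltW m0) //.
  exact: le_lt_trans (isd_le dx) xm.
have Kx : inK e t x.
  split=> //; apply/ltW/(lt_le_trans xm); apply: lerXn2r; rewrite ?nnegrE ?(ltW m0) ?(ltW e0) //.
  by rewrite ge_min lexx.
have tq : 0 <= c * powR t q by rewrite mulr_ge0 ?powR_ge0 // ltW.
rewrite powRrM powR12_sqrt ?powR_ge0 // -sqrtrM ?(ltW c0) //; apply: ler_wsqrtr.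
have [y vy] := value_graph_exists Kx.
have hx := vy.1 x Kx; apply: le_trans hx => /=.
apply: (H t y) => //; last by exists x.
by move: tm; rewrite lt_min => /andP [].
Qed.

(** Otherwise h would stay away from 0 at points of X outside V tending to the origin. Positivity
    takes care of t = 0, where [powR 0 0] would be 1. *)
Lemma good_pos e q : 0 < e -> good e q -> 0 < q.
Proof.
move=> e0 gq; rewrite ltNge; apply/negP => q0.
have [C [eps [C0 eps0 H]]] := good_pos_ineq e0 gq.
have C20 : 0 < C ^+ 2 / 2 by rewrite divr_gt0 // exprn_gt0.
have [L L0 HL] := mpoly_lipschitz (absR_absolute_value R) h 1.
pose r := Num.min (Num.min 1 eps) (C ^+ 2 / 2 / L).
have r0 : 0 < r by rewrite !lt_min ltr01 eps0 divr_gt0.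
have [rle1 rle2] : r <= 1 /\ r <= eps.
  by split; rewrite /r !ge_min lexx ?orbT.
have rle3 : r <= C ^+ 2 / 2 / L by rewrite ge_min lexx orbT.
have [x [Xx hx xm]] := cluster r0; have [t dx] := isd_exists x.
have t0 : 0 < t := isd_gt0 hx dx.
have tr : t < r.
  rewrite -(@ltr_pXn2r _ 2) ?nnegrE ?(ltW t0) ?(ltW r0) //; exact: le_lt_trans (isd_le dx) xm.
have xe : nrm2 x < eps ^+ 2.
  by apply: (lt_le_trans xm); apply: lerXn2r; rewrite ?nnegrE ?(ltW r0) ?(ltW eps0).
have h1 := H x t Xx xe dx t0.
have h2 : 1 <= powR t (q / 2).
  rewrite -[leLHS](powRr0 t); apply: ger_powR; last by rewrite ler_pdivrMr // mul0r.
  by rewrite t0 (le_trans (ltW tr)).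
have h3 : C <= Num.sqrt (meval x h).
  by apply: le_trans h1; rewrite ler_peMr // ltW.
have h4 : C ^+ 2 <= meval x h.
  rewrite -[leRHS]sqr_sqrtr //; apply: lerXn2r => //; rewrite nnegrE ?sqrtr_ge0 //; exact: ltW.
have := HL x (fun=> 0) r; rewrite /absR h0 subr0 => /(_ _ _ _ (ltW r0)) h5.
have : `|meval x h| <= L * r.
  apply: h5 => i; rewrite ?subr0 ?normr0 //; last by apply/ltW; apply: nrm2_coord.
  by apply: le_trans rle1; apply/ltW; apply: nrm2_coord.
rewrite ger0_norm // => h6; move: rle3; rewrite ler_pdivlMr // mulrC => h7.
clear h5 HL; have : 0 < C ^+ 2 by rewrite exprn_gt0.
by lra.
Qed.

Lemma good_ok e q : 0 < e -> good e q -> exponent_ok (q / 2).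
Proof.
move=> e0 gq; have q0 := good_pos e0 gq.
have [C [eps [C0 eps0 H]]] := good_pos_ineq e0 gq.
exists C, eps; split=> // x t Xx xe dx; have [t0 _ _] := dx.
move: t0; rewrite le_eqVlt => /orP [/eqP <-|t0]; last exact: H.
by rewrite powR0 ?mulr0 ?sqrtr_ge0 // gt_eqF // divr_gt0.
Qed.

(** If q > 2 eta, the points with h at most of order t^q contradict h >= (C1 t^eta)^2, since t^(q -
    2 eta) tends to 0. *)
Lemma good_le eta : exponent_ok eta -> exists2 e1, 0 < e1 & forall e q, 0 < e -> e < e1 ->
  good e q -> q / 2 <= eta.
Proof.
move=> [C1 [e1 [C10 e10 H]]]; exists e1 => // e q e0 ee1 [c [C [t1 [c0 C0 t10 _ io]]]].
rewrite leNgt; apply/negP => lt; pose s := q - 2 * eta.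
have s0 : 0 < s by rewrite /s; lra.
pose t' := Num.min 1 (powR (C1 ^+ 2 / (2 * C)) (s^-1)).
have K0 : 0 < C1 ^+ 2 / (2 * C) by rewrite divr_gt0 ?exprn_gt0 // mulr_gt0.
have t'0 : 0 < t' by rewrite lt_min ltr01 powR_gt0.
have [t [y [t0 tt y0 vy [[x Kx] yC]]]] := io t' t'0.
have low : (C1 * powR t eta) ^+ 2 <= y.
  rewrite leNgt; apply/negP => /(vy.2 _) [z [/= [Xz ze dz]]].
  have zl : nrm2 z < e1 ^+ 2.
    by apply: (le_lt_trans ze); rewrite ltr_pXn2r // nnegrE ltW.
  have := H z t Xz zl dz => hz; rewrite ltNge => /negP; apply.
  rewrite -[leRHS]sqr_sqrtr //; apply: lerXn2r => //; rewrite nnegrE ?sqrtr_ge0 //.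
  by rewrite mulr_ge0 ?powR_ge0 // ltW.
have ts : powR t s <= C1 ^+ 2 / (2 * C).
  have -> : C1 ^+ 2 / (2 * C) = powR (powR (C1 ^+ 2 / (2 * C)) s^-1) s.
    by rewrite -powRrM mulVf ?gt_eqF // powRr1 // ltW.
  apply: ge0_ler_powR; rewrite ?nnegrE ?powR_ge0 ?(ltW s0) ?(ltW t0) //.
  by apply/ltW/(lt_le_trans tt); rewrite ge_min lexx orbT.
have E : powR t q = powR t s * (powR t eta) ^+ 2.
  rewrite -powR_mulrn ?powR_ge0 // -powRrM -powRD ?(gt_eqF t0) ?implybT //.
  by congr powR; rewrite /s; ring.
have W0 : 0 < (powR t eta) ^+ 2 by rewrite exprn_gt0 // powR_gt0.
have := le_trans low yC; rewrite E exprMn mulrA ler_pM2r // leNgt => /negP; apply.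
apply: (@le_lt_trans _ _ (C1 ^+ 2 / 2)); last first.
  by have : 0 < C1 ^+ 2 by [rewrite exprn_gt0]; lra.
rewrite (_ : C1 ^+ 2 / 2 = C * (C1 ^+ 2 / (2 * C))); last by field; rewrite gt_eqF.
by rewrite ler_pM2l.
Qed.

(** Good orders for all small radii come from one finite list; the least of them, halved because |F|
    is the square root of h, is admissible. Any admissible eta dominates q / 2 for a good q at a
    small enough radius, hence that minimum. *)
Theorem min_exponent : exists L, exponent_ok L /\ forall eta, exponent_ok eta -> L <= eta.
Proof.
have [Q [e1 [e10 HQ]]] := good_exists.
pose small q := exists e, [/\ 0 < e, e < e1 & good e q].
pose Q' := [seq q <- Q | `[< small q >]].
have Q'P q : q \in Q' <-> q \in Q /\ small q.
  by rewrite mem_filter; split=> [/andP [/asboolP]|[h1 h2]] //; apply/andP; split=> //; apply/asboolP.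
have [qm qmQ' Hqm] : exists2 qm, qm \in Q' & forall q, q \in Q' -> qm <= q.
  have e20 : 0 < e1 / 2 by rewrite divr_gt0.
  have [|q qQ gq] := HQ (e1 / 2) e20; first by lra.
  have : q \in Q' by apply/Q'P; split=> //; exists (e1 / 2); split=> //; lra.
  elim: Q' {Q'P} q {qQ gq} => // q0 [|q1 s] IH q _.
    by exists q0; rewrite ?mem_head // => q'; rewrite inE => /eqP ->.
  have [qm qms Hs] := IH q1 (mem_head _ _).
  exists (Num.min q0 qm); first by case: leP; rewrite inE ?eqxx ?qms ?orbT.
  by move=> q'; rewrite inE ge_min => /orP [/eqP ->|/Hs ->]; rewrite ?lexx ?orbT.
have [qmQ [e [e0 ee1 gq]]] := (Q'P qm).1 qmQ'.
exists (qm / 2); split; first exact: good_ok gq.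
move=> eta /good_le [e2 e20 He2]; pose e3 := Num.min e1 e2 / 2.
have m0 : 0 < Num.min e1 e2 by rewrite lt_min e10.
have e30 : 0 < e3 by rewrite divr_gt0.
have e31 : e3 < Num.min e1 e2 by rewrite /e3; lra.
move: e31; rewrite lt_min => /andP [e31 e32].
have [q qQ gq'] := HQ e3 e30 e31; apply: le_trans (He2 e3 q e30 e32 gq').
by rewrite ler_pM2r ?invr_gt0 //; apply: Hqm; apply/Q'P; split=> //; exists e3.
Qed.
End MinExponent.

(** * Renaming of variables *)

Section Rename.
Variable R : realType.
Import ordered_qelim.

Lemma term_rename (s : nat -> nat) (t : GRing.term R) : GRing.rterm t ->
  exists2 t', GRing.rterm t' &
    forall e e', (forall i, nth 0 e' i = nth 0 e (s i)) -> GRing.eval e' t = GRing.eval e t'.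
Proof.
elim: t => //= [i|c|k|t IHt u IHu|t IHt|t IHt k|t IHt u IHu|t IHt k].
- by move=> _; exists (GRing.Var R (s i)).
- by move=> _; exists (GRing.Const c).
- by move=> _; exists (GRing.NatConst R k).
- move=> /andP [/IHt [p p1 p2] /IHu [q q1 q2]].
  by exists (GRing.Add p q) => [|e e' H] /=; rewrite ?p1 // (p2 e) // (q2 e).
- by move=> /IHt [p p1 p2]; exists (GRing.Opp p) => // e e' H /=; rewrite (p2 e).
- by move=> /IHt [p p1 p2]; exists (GRing.NatMul p k) => // e e' H /=; rewrite (p2 e).
- move=> /andP [/IHt [p p1 p2] /IHu [q q1 q2]].
  by exists (GRing.Mul p q) => [|e e' H] /=; rewrite ?p1 // (p2 e) // (q2 e).
- by move=> /IHt [p p1 p2]; exists (GRing.Exp p k) => // e e' H /=; rewrite (p2 e).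
Qed.

Lemma formula_rename (s : nat -> nat) (f : ord.formula R) : ord.qf_form f -> ord.rformula f ->
  exists f', [/\ ord.qf_form f', ord.rformula f' &
    forall e e', (forall i, nth 0 e' i = nth 0 e (s i)) -> ord.qf_eval e' f = ord.qf_eval e f'].
Proof.
have bin (c : ord.formula R -> ord.formula R -> ord.formula R) (op : bool -> bool -> bool) g h :
  (forall g h, ord.qf_form (c g h) = ord.qf_form g && ord.qf_form h) ->
  (forall g h, ord.rformula (c g h) = ord.rformula g && ord.rformula h) ->
  (forall e g h, ord.qf_eval e (c g h) = op (ord.qf_eval e g) (ord.qf_eval e h)) ->
  (exists g', [/\ ord.qf_form g', ord.rformula g' &
    forall e e', (forall i, nth 0 e' i = nth 0 e (s i)) -> ord.qf_eval e' g = ord.qf_eval e g']) ->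
  (exists h', [/\ ord.qf_form h', ord.rformula h' &
    forall e e', (forall i, nth 0 e' i = nth 0 e (s i)) -> ord.qf_eval e' h = ord.qf_eval e h']) ->
  exists f', [/\ ord.qf_form f', ord.rformula f' &
    forall e e', (forall i, nth 0 e' i = nth 0 e (s i)) -> ord.qf_eval e' (c g h) = ord.qf_eval e f'].
  move=> H1 H2 H3 [g' [g1 g2 g3]] [h' [h1 h2 h3]]; exists (c g' h').
  by rewrite H1 H2 g1 g2; split=> // e e' He; rewrite !H3 (g3 e) // (h3 e).
elim: f => //= [b|t u|t u|t u|f IHf g IHg|f IHf g IHg|f IHf g IHg|f IHf].
- by exists (ord.Bool b).
- move=> _ /andP [/(term_rename s) [p p1 p2] /(term_rename s) [q q1 q2]].
  by exists (ord.Equal p q); split=> //= [|e e' H]; rewrite ?p1 // (p2 e) // (q2 e).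
- move=> _ /andP [/(term_rename s) [p p1 p2] /(term_rename s) [q q1 q2]].
  by exists (ord.Lt p q); split=> //= [|e e' H]; rewrite ?p1 // (p2 e) // (q2 e).
- move=> _ /andP [/(term_rename s) [p p1 p2] /(term_rename s) [q q1 q2]].
  by exists (ord.Le p q); split=> //= [|e e' H]; rewrite ?p1 // (p2 e) // (q2 e).
- move=> /andP [f1 g1] /andP [f2 g2].
  by have := bin (@ord.And R) andb f g; apply=> //; [exact: IHf|exact: IHg].
- move=> /andP [f1 g1] /andP [f2 g2].
  by have := bin (@ord.Or R) orb f g; apply=> //; [exact: IHf|exact: IHg].
- move=> /andP [f1 g1] /andP [f2 g2].
  by have := bin (@ord.Implies R) implb f g; apply=> //; [exact: IHf|exact: IHg].
- move=> f1 f2; have [g [g1 g2 g3]] := IHf f1 f2.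
  by exists (ord.Not g); split=> //= e e' H; rewrite (g3 e).
Qed.

(** Since s fixes almost all indices, renaming preserves finitely supported environments, the ones
    that [definable] constrains. *)
Lemma def_rename (P : (nat -> R) -> Prop) (s : nat -> nat) n : definable P ->
  (forall i, (n <= i)%N -> s i = i) -> definable (fun rho => P (fun i => rho (s i))).
Proof.
move=> [f [f1 f2 f3]] Hs; have [g [g1 g2 g3]] := formula_rename s f1 f2.
exists g; split=> // e.
pose e' := mkseq (fun i => nth 0 e (s i)) (maxn n (size e)).
have He' i : nth 0 e' i = nth 0 e (s i).
  have [lt|ge] := ltnP i (maxn n (size e)); first by rewrite nth_mkseq.
  move: (ge); rewrite geq_max => /andP [ni ei].
  by rewrite nth_default ?size_mkseq // Hs // nth_default.
rewrite -(g3 e e' He') f3; have -> // : nth 0 e' = fun i => nth 0 e (s i).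
exact/funext.
Qed.
End Rename.

(** * One-variable definable functions are eventually continuous and monotone *)

Section Tame.
Variables (R : realType) (e0 : R).
Implicit Types (h : R -> R) (rho : nat -> R).

Definition def_fun h := definable (fun rho : nat -> R =>
  (0 < rho 0%N /\ rho 0%N < e0) /\ h (rho 0%N) = rho 1%N).

Lemma def_fun_at h i j : def_fun h ->
  definable (fun rho => (0 < rho i /\ rho i < e0) /\ h (rho i) = rho j).
Proof.
move=> hh; pose s k := if k == 0%N then i else if k == 1%N then j else k.
by apply: (def_rename (s := s) (n := 2) hh) => -[|[|k]].
Qed.

Lemma def_fun_lt h i j : def_fun h ->
  definable (fun rho => (0 < rho i /\ rho i < e0) /\ h (rho i) < rho j).
Proof.
move=> hh; pose m := (i + j).+1.
have [mi mj] : (i == m) = false /\ (j == m) = false by rewrite /m; split; apply/eqP; lia.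
apply: (def_ext (P := fun rho => exists y, ((0 < rho i /\ rho i < e0) /\ h (rho i) = y) /\ y < rho j)).
  by move=> rho; split=> [[y [[h1 <-] h2]]|[h1 h2]] //; exists (h (rho i)).
apply: (def_ex' (i := m)) => [|rho y]; last by rewrite /upd mi mj.
exact: def_and (def_fun_at _ _ hh) (def_lt (tf_var R m) (tf_var R j)).
Qed.

Lemma def_fun_gt h i j : def_fun h ->
  definable (fun rho => (0 < rho i /\ rho i < e0) /\ rho j < h (rho i)).
Proof.
move=> hh; pose m := (i + j).+1.
have [mi mj] : (i == m) = false /\ (j == m) = false by rewrite /m; split; apply/eqP; lia.
apply: (def_ext (P := fun rho => exists y, ((0 < rho i /\ rho i < e0) /\ h (rho i) = y) /\ rho j < y)).
  by move=> rho; split=> [[y [[h1 <-] h2]]|[h1 h2]] //; exists (h (rho i)).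
apply: (def_ex' (i := m)) => [|rho y]; last by rewrite /upd mi mj.
exact: def_and (def_fun_at _ _ hh) (def_lt (tf_var R j) (tf_var R m)).
Qed.

Lemma def_fun_opp h : def_fun h -> def_fun (fun s => - h s).
Proof.
move=> hh; apply: (def_ext (P := fun rho => exists y,
   ((0 < rho 0%N /\ rho 0%N < e0) /\ h (rho 0%N) = y) /\ - y = rho 1%N)).
  by move=> rho; split=> [[y [[h1 <-] h2]]|[h1 h2]] //; exists (h (rho 0%N)).
apply: (def_ex' (i := 2)) => [|rho y]; last by [].
exact: def_and (def_fun_at _ _ hh) (def_eq (tf_opp (tf_var R 2)) (tf_var R 1)).
Qed.

(** Vanishing on the whole line of abscissa s is eventually true or eventually false as s decreases
    to 0. If true, every horizontal restriction of p has infinitely many zeros, so p = 0. *)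
Lemma mpoly2_fiber_neq0 (p : mpoly 2 R) : p != 0 -> exists2 e1, 0 < e1 &
  forall s, 0 < s -> s < e1 -> forall u v, u < v -> exists w, [/\ u < w, w < v &
    meval (fun i : 'I_2 => if i == ord0 then s else w) p != 0].
Proof.
move=> p0; pose P (rho : nat -> R) := forall y : R, meval (fun i : 'I_2 => if i == ord0 then rho 0%N else y) p = 0.
have defP : definable P.
  apply: (def_all' (i := 1)) => [|rho y]; last by [].
  apply: (def_ext _ (def_eq (tf_meval 0 p) (tf_const 0))) => rho.
  suff -> : block 2 rho 0 = (fun i : 'I_2 => if i == ord0 then rho 0%N else rho 1%N) by [].
  by apply/funext => -[[|[|//]] ii].
pose LP s := line_poly (fun i : 'I_2 => if i == ord0 then s else 0) (fun i => if i == ord0 then 0 else 1) p.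
have LPE s w : (LP s).[w] = meval (fun i : 'I_2 => if i == ord0 then s else w) p.
  rewrite horner_line; congr (meval _ p); apply/funext => i.
  by case: ifP => _; rewrite ?mul0r ?addr0 // mul1r add0r.
have [b [d [d0 Hd]]] := def_eventually [::] 0 0 1 defP.
have Pb s : 0 < s -> s < d -> P (nth 0 [:: s]) <-> b.
  by move=> s1 s2; have := Hd s s1 s2; rewrite /= add0r mul1r.
case: b {Hd} Pb => Pb; last first.
  exists d => // s s1 s2 u v uv.
  have LP0 : LP s != 0.
    apply/eqP => E; suff : false by []; apply: (Pb s s1 s2).1 => y /=.
    by have := LPE s y; rewrite E horner0.
  have c0 : LP s \Po ('X + u%:P) != 0.
    apply/eqP => /(congr1 (fun q => q \Po ('X - u%:P))); rewrite comp_poly0 -comp_polyA.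
    by rewrite comp_polyD comp_polyX comp_polyC subrK comp_polyXr; apply/eqP.
  have [r r0 Hr] := poly_eventually_neq0 c0.
  pose x := Num.min r (v - u) / 2.
  have m0 : 0 < Num.min r (v - u) by rewrite lt_min r0 subr_gt0.
  have x0 : 0 < x by rewrite divr_gt0.
  have : x < Num.min r (v - u) by rewrite /x; lra.
  rewrite lt_min => /andP [xr xv]; exists (u + x); split; [lra|lra|].
  by rewrite -LPE; have := Hr x x0 xr; rewrite horner_comp hornerD hornerX hornerC addrC.
case/eqP: p0; apply: mpoly_eq0P => v; pose y := v ord_max.
pose L := line_poly (fun i : 'I_2 => if i == ord0 then 0 else y) (fun i => if i == ord0 then 1 else 0) p.
have LE s : L.[s] = meval (fun i : 'I_2 => if i == ord0 then s else y) p.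
  rewrite horner_line; congr (meval _ p); apply/funext => i.
  by case: ifP => _; rewrite ?mul0r ?addr0 // mul1r add0r.
have vE : v = fun i : 'I_2 => if i == ord0 then v ord0 else y.
  apply/funext => -[[|[|//]] ii]; rewrite /y; congr (v _); exact: val_inj.
have [L0|/poly_eventually_neq0 [r r0 Hr]] := eqVneq L 0; first by rewrite vE -LE L0 horner0.
have m0 : 0 < Num.min r d by rewrite lt_min r0.
pose x := Num.min r d / 2; have x0 : 0 < x by rewrite divr_gt0.
have : x < Num.min r d by rewrite /x; lra.
rewrite lt_min => /andP [xr xd]; have := Hr x x0 xr.
by rewrite LE; have := (Pb x x0 xd).2 isT y => /= ->; rewrite eqxx.
Qed.

Lemma envn2 (v : 'I_2 -> R) : envn v = [:: v ord0; v ord_max].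
Proof.
apply: (@eq_from_nth _ 0); first by rewrite size_map size_enum_ord.
move=> i; rewrite size_map size_enum_ord => i2.
have -> := nth_envn v (Ordinal i2); case: i i2 => [|[|//]] i2 /=; congr (v _); exact: val_inj.
Qed.

(** E collects the pairs (s, u) with h(s) < u while h exceeds u just beside s. A failure at s puts a
    vertical segment in E, and local constancy spreads a point (s, w) of it to a neighbour (s + sg
    x, w), where h is both below w and above u > w. *)
Lemma eventually_usc h sg : def_fun h -> sg != 0 -> 0 < e0 -> exists2 e1, 0 < e1 & e1 <= e0 /\
  forall s, 0 < s -> s < e1 -> forall u, h s < u -> exists2 d, 0 < d &
    forall x, 0 < x -> x < d -> h (s + sg * x) <= u.
Proof.
move=> hh sg0 e00.
pose E rho := ((0 < rho 0%N /\ rho 0%N < e0) /\ h (rho 0%N) < rho 1%N) /\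
  exists d, 0 < d /\ forall x, 0 < x -> x < d -> forall w, w = rho 0%N + sg * x ->
    (0 < w /\ w < e0) /\ rho 1%N < h w.
have defE : definable E.
  apply: def_and (def_fun_lt _ _ hh) _; apply: (def_ex' (i := 2)) => [|rho d]; last by [].
  apply: def_and (def_lt (tf_const 0) (tf_var R 2)) _.
  apply: (def_all' (i := 3)) => [|rho x]; last by [].
  apply: def_imp (def_lt (tf_const 0) (tf_var R 3)) _.
  apply: def_imp (def_lt (tf_var R 3) (tf_var R 2)) _.
  apply: (def_all' (i := 4)) => [|rho w]; last by [].
  apply: def_imp (def_fun_gt _ _ hh).
  exact: def_eq (tf_var R 4) (tf_add (tf_var R 0) (tf_mul (tf_const sg) (tf_var R 3))).
have [p p0 Hp] := def_locally_constant 2 defE.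
have [e1 e10 He1] := mpoly2_fiber_neq0 p0.
exists (Num.min e1 e0); first by rewrite lt_min e10.
split; first by rewrite ge_min lexx orbT.
move=> s s0; rewrite lt_min => /andP [se1 se0] u hu.
have [b [d [d0 Hd]]] := def_eventually [:: 0; u] 0 s sg (def_fun_gt 0 1 hh).
pose d1 := Num.min d (Num.min (s / `|sg|) ((e0 - s) / `|sg|)).
have sgp : 0 < `|sg| by rewrite normr_gt0.
have d10 : 0 < d1 by rewrite !lt_min d0 !divr_gt0 // subr_gt0.
have dom x : 0 < x -> x < d1 -> 0 < s + sg * x /\ s + sg * x < e0.
  move=> x0; rewrite !lt_min !ltr_pdivlMr // => /and3P [_ h1 h2].
  have : `|sg * x| = x * `|sg| by rewrite normrM mulrC (ger0_norm (ltW x0)).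
  move=> h3; have := ler_norm (sg * x); have := ler_norm (- (sg * x)); rewrite normrN h3.
  by move=> h4 h5; split; lra.
have xd x : x < d1 -> x < d by rewrite lt_min => /andP [].
case: b Hd => Hd; last first.
  exists d1 => // x x0 xd1; rewrite leNgt; apply/negP => hx.
  have [/= H _] := Hd x x0 (xd x xd1); suff : false by [].
  by apply: H; split=> //; exact: dom.
exfalso; have Eu : E (nth 0 [:: s; u]).
  split=> //=; exists d1; split=> // x x0 xd1 w ->.
  by have [_ /= H] := Hd x x0 (xd x xd1); apply: H.
have [w [hw wu pw]] := He1 s s0 se1 (h s) u hu.
have Ew : E (nth 0 [:: s; w]).
  split=> //=; case: Eu => _ /= [d2 [d20 H2]]; exists d2; split=> // x x0 xd2 w' Ew'.
  by have [h1 h2] := H2 x x0 xd2 w' Ew'; split=> //; apply: lt_trans h2.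
have [dl dl0 Hdl] := Hp _ pw.
pose x := Num.min (dl / `|sg|) d1 / 2.
have m0 : 0 < Num.min (dl / `|sg|) d1 by rewrite lt_min d10 divr_gt0.
have x0 : 0 < x by rewrite divr_gt0.
have : x < Num.min (dl / `|sg|) d1 by rewrite /x; lra.
rewrite lt_min ltr_pdivlMr // => /andP [xdl xd1].
have : E (nth 0 (envn (fun i : 'I_2 => if i == ord0 then s + sg * x else w))).
  apply/Hdl; last by rewrite envn2.
  move=> i; case: ifP => _; last by rewrite subrr normr0.
  by rewrite addrAC subrr add0r normrM mulrC (ger0_norm (ltW x0)).
rewrite envn2 /= => -[[_ /= h1] _].
have [_ /(_ isT) [_ /= h2]] := Hd x x0 (xd x xd1).
by have := lt_trans h1 (lt_trans wu h2); rewrite ltxx.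
Qed.

Definition cont_at h s := forall eta, 0 < eta -> exists2 d, 0 < d &
  forall s', `|s' - s| < d -> `|h s' - h s| <= eta.

Lemma eventually_continuous h : def_fun h -> 0 < e0 -> exists2 e1, 0 < e1 & e1 <= e0 /\
  forall s, 0 < s -> s < e1 -> cont_at h s.
Proof.
move=> hh e00; have n1 : (-1 : R) != 0 by rewrite oppr_eq0 oner_eq0.
have [a1 a10 [a1e A1]] := eventually_usc hh (oner_neq0 R) e00.
have [a2 a20 [_ A2]] := eventually_usc hh n1 e00.
have [a3 a30 [_ A3]] := eventually_usc (def_fun_opp hh) (oner_neq0 R) e00.
have [a4 a40 [_ A4]] := eventually_usc (def_fun_opp hh) n1 e00.
exists (Num.min (Num.min a1 a2) (Num.min a3 a4)); first by rewrite !lt_min a10 a20 a30.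
split; first by rewrite !ge_min a1e.
move=> s s0; rewrite !lt_min => /andP [/andP [s1 s2] /andP [s3 s4]] eta eta0.
have up : h s < h s + eta by rewrite ltrDl.
have dn : - h s < - h s + eta by rewrite ltrDl.
have [d1 d10 D1] := A1 s s0 s1 _ up; have [d2 d20 D2] := A2 s s0 s2 _ up.
have [d3 d30 D3] := A3 s s0 s3 _ dn; have [d4 d40 D4] := A4 s s0 s4 _ dn.
exists (Num.min (Num.min d1 d2) (Num.min d3 d4)); first by rewrite !lt_min d10 d20 d30.
move=> s'; rewrite !lt_min => /andP [/andP [x1 x2] /andP [x3 x4]].
have [lt|lt|->] := ltgtP s' s; last by rewrite subrr normr0 ltW.
- rewrite ltr0_norm ?subr_lt0 // opprB in x1 x2 x3 x4.
  have x0 : 0 < s - s' by rewrite subr_gt0.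
  have := D2 _ x0 x2; have := D4 _ x0 x4; rewrite mulN1r opprB subrKC => h1 h2.
  by rewrite ler_norml; apply/andP; split; lra.
- rewrite gtr0_norm ?subr_gt0 // in x1 x2 x3 x4.
  have x0 : 0 < s' - s by rewrite subr_gt0.
  have := D1 _ x0 x1; have := D3 _ x0 x3; rewrite mul1r subrKC => h1 h2.
  by rewrite ler_norml; apply/andP; split; lra.
Qed.

(** The left condition puts the supremum of the points with g a <= g s into that set; the right
    condition forbids it to lie before b. *)
Lemma creeping (g : R -> R) a b : a <= b ->
  (forall s, a <= s -> s < b -> exists2 d, 0 < d & forall x, 0 < x -> x < d -> g s <= g (s + x)) ->
  (forall s, a < s -> s <= b -> forall eta, 0 < eta -> exists2 d, 0 < d &
     forall x, 0 < x -> x < d -> g (s - x) <= g s + eta) -> g a <= g b.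
Proof.
move=> ab Hr Hl; pose S := [set s | [/\ a <= s, s <= b & g a <= g s]].
have Sa : S a by split.
have hS : has_sup S by split; [exists a | exists b => s []].
pose m := sup S; have am : a <= m by apply: (sup_upper_bound hS).
have mb : m <= b by apply: ge_sup => [|s []]; first by exists a.
have gm : g a <= g m.
  apply/ler_addgt0Pr => eta eta0; move: am; rewrite le_eqVlt => /orP [/eqP <-|am].
    by rewrite lerDl ltW.
  have [d d0 Hd] := Hl m am mb eta eta0.
  have [s [sa sb gs] sm] := sup_adherent d0 hS.
  have : s <= m by apply: (sup_upper_bound hS).
  rewrite le_eqVlt => /orP [/eqP <-|lt]; first by apply: (le_trans gs); rewrite lerDl ltW.
  apply: (le_trans gs); have := Hd (m - s); rewrite subKr subr_gt0; apply=> //.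
  by rewrite -/m in sm; lra.
move: mb; rewrite le_eqVlt => /orP [/eqP <- //|mb].
have [d d0 Hd] := Hr m am mb; pose x := Num.min d (b - m) / 2.
have m0 : 0 < Num.min d (b - m) by rewrite lt_min d0 subr_gt0.
have x0 : 0 < x by rewrite divr_gt0.
have : x < Num.min d (b - m) by rewrite /x; lra.
rewrite lt_min => /andP [xd xb].
have : m + x <= m.
  apply: (sup_upper_bound hS); split; [lra|lra|].
  exact: le_trans gm (Hd x x0 xd).
by rewrite gerDl leNgt x0.
Qed.

Definition monotone_on h e1 :=
  (forall s t, 0 < s -> s <= t -> t < e1 -> h s <= h t) \/
  (forall s t, 0 < s -> s <= t -> t < e1 -> h t <= h s).

Lemma cont_left h s eta : cont_at h s -> 0 < eta -> exists2 d, 0 < d &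
  forall x, 0 < x -> x < d -> h (s - x) <= h s + eta /\ - h (s - x) <= - h s + eta.
Proof.
move=> hc eta0; have [d d0 Hd] := hc eta eta0; exists d => // x x0 xd.
have := Hd (s - x); rewrite addrAC subrr add0r normrN (ger0_norm (ltW x0)) => /(_ xd).
by rewrite ler_norml => /andP [h1 h2]; split; lra.
Qed.

(** Either h does not drop just to the right of any small s, or it drops there for all of them;
    continuity and [creeping] globalise this local behaviour. *)
Lemma eventually_tame h : def_fun h -> 0 < e0 -> exists2 e1, 0 < e1 & [/\ e1 <= e0,
  forall s, 0 < s -> s < e1 -> cont_at h s & monotone_on h e1].
Proof.
move=> hh e00; have [e1 e10 [e1e0 Hc]] := eventually_continuous hh e00.
(* Says that h does not fall below its value just to the right. *)
pose Up rho := exists y, ((0 < rho 0%N /\ rho 0%N < e0) /\ h (rho 0%N) = y) /\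
  exists d, 0 < d /\ forall x, 0 < x -> x < d -> forall w, w = rho 0%N + x ->
    ~ ((0 < w /\ w < e0) /\ h w < y).
have defUp : definable Up.
  apply: (def_ex' (i := 1)) => [|rho y]; last by [].
  apply: def_and (def_fun_at _ _ hh) _; apply: (def_ex' (i := 2)) => [|rho d]; last by [].
  apply: def_and (def_lt (tf_const 0) (tf_var R 2)) _.
  apply: (def_all' (i := 3)) => [|rho x]; last by [].
  apply: def_imp (def_lt (tf_const 0) (tf_var R 3)) _.
  apply: def_imp (def_lt (tf_var R 3) (tf_var R 2)) _.
  apply: (def_all' (i := 4)) => [|rho w]; last by [].
  apply: def_imp (def_not (def_fun_lt _ _ hh)).
  exact: def_eq (tf_var R 4) (tf_add (tf_var R 0) (tf_var R 3)).
have [b [d [d0 Hd]]] := def_eventually [::] 0 0 1 defUp.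
have Upb s : 0 < s -> s < d -> Up (nth 0 [:: s]) <-> b.
  by move=> s0 sd; have := Hd s s0 sd; rewrite add0r mul1r.
pose e2 := Num.min d e1; have e20 : 0 < e2 by rewrite lt_min d0.
have e2P s : s < e2 -> s < d /\ s < e1 by rewrite lt_min => /andP [].
exists e2 => //; split.
- by apply: le_trans e1e0; rewrite ge_min lexx orbT.
- by move=> s s0 /e2P [_]; apply: Hc.
case: b {Hd} Upb => Upb; [left|right] => s t s0 st te2.
  apply: (creeping st) => [a sa at'|a sa at' eta eta0].
    have [ad _] := e2P a (lt_trans at' te2); have a0 : 0 < a := lt_le_trans s0 sa.
    have [y [/= [[_ ae] <-] [d2 [d20 H2]]]] := (Upb a a0 ad).2 isT.
    exists (Num.min d2 (e0 - a)); first by rewrite lt_min d20 subr_gt0.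
    move=> x x0; rewrite lt_min => /andP [xd2 xe]; rewrite leNgt; apply/negP => hx.
    by apply: (H2 x x0 xd2 (a + x)) => //; split=> //; split; lra.
  have [_ ae] := e2P a (le_lt_trans at' te2).
  have [d2 d20 H2] := cont_left (Hc a (lt_trans s0 sa) ae) eta0.
  by exists d2 => // x x0 xd; have [] := H2 x x0 xd.
rewrite -lerN2; apply: (creeping (g := fun x => - h x) st) => [a sa at'|a sa at' eta eta0].
  have [ad ae1] := e2P a (lt_trans at' te2); have a0 : 0 < a := lt_le_trans s0 sa.
  have ae0 : a < e0 := lt_le_trans ae1 e1e0.
  have [b' [d2 [d20 H2]]] := def_eventually [:: 0; h a] 0 a 1 (def_fun_lt 0 1 hh).
  case: b' H2 => H2.
    exists d2 => // x x0 xd2; have [_ /(_ isT) [_ /=]] := H2 x x0 xd2.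
    by rewrite mul1r lerN2; apply: ltW.
  have [/(_ _)/= H _] := Upb a a0 ad; exfalso; suff: false by []; apply: H.
  exists (h a); split=> //; exists d2; split=> // x x0 xd2 w -> hw.
  by have [H _] := H2 x x0 xd2; suff: false by []; apply: H; rewrite /= mul1r.
have [_ ae] := e2P a (le_lt_trans at' te2).
have [d2 d20 H2] := cont_left (Hc a (lt_trans s0 sa) ae) eta0.
by exists d2 => // x x0 xd; have [] := H2 x x0 xd.
Qed.

End Tame.

(** * Selection of tame paths in compact definable families *)

Section Selection.
Variables (R : realType) (N : nat).
Implicit Types (M : R -> ('I_N -> R) -> Prop) (A : ('I_N -> R) -> Prop).

Definition rowset A : set 'rV[R]_N := [set v | A (fun i => v ord0 i)].

Lemma meval_continuous (p : mpoly N R) :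
  continuous (fun v : 'rV[R]_N => meval (fun i => v ord0 i) p).
Proof.
move: p; apply: mpoly_ring_ind => [c|i|p q IHp IHq|p q IHp IHq].
- have -> : (fun v : 'rV[R]_N => meval (fun i => v ord0 i) (mpolyC N c)) = fun=> c.
    by apply/funext => v; rewrite mevalC.
  exact: cst_continuous.
- have -> : (fun v : 'rV[R]_N => meval (fun i => v ord0 i) (mpolyX R (mnm1 i))) = fun v => v ord0 i.
    by apply/funext => v; rewrite mevalXU.
  exact: coord_continuous.
- have -> : (fun v : 'rV[R]_N => meval (fun i => v ord0 i) (p + q))
     = (fun v => meval (fun i => v ord0 i) p + meval (fun i => v ord0 i) q).
    by apply/funext => v; rewrite mevalD.
  move=> v; exact: (cvgD (IHp v) (IHq v)).
- have -> : (fun v : 'rV[R]_N => meval (fun i => v ord0 i) (p * q))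
     = (fun v => meval (fun i => v ord0 i) p * meval (fun i => v ord0 i) q).
    by apply/funext => v; rewrite mevalM.
  move=> v; exact: (cvgM (IHp v) (IHq v)).
Qed.

Lemma closed_meval_le (p : mpoly N R) c : closed (rowset (fun x => meval x p <= c)).
Proof.
have -> : rowset (fun x => meval x p <= c) =
    (fun v : 'rV[R]_N => meval (fun i => v ord0 i) p) @^-1` [set y | y <= c] by [].
apply: closed_comp; [move=> v _; exact: meval_continuous | exact: closed_le].
Qed.

Lemma compact_box (dl : R) : compact (rowset (fun x => forall i, `|x i| <= dl)).
Proof.
have -> : rowset (fun x => forall i, `|x i| <= dl)
    = [set v : 'rV[R]_N | forall i, `[- dl, dl]%classic (v ord0 i)].
  by apply/seteqP; split=> v /= H i; have := H i; rewrite in_itv /= ler_norml.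
by apply: (@rV_compact _ _ (fun i => `[- dl, dl]%classic)) => i; apply: segment_compact.
Qed.

Lemma compact_min A (p : mpoly N R) : compact (rowset A) -> (exists x, A x) ->
  exists2 x, A x & forall y, A y -> meval x p <= meval y p.
Proof.
move=> cA [x0 Ax0].
have rowE (x : 'I_N -> R) : (fun i => (\row_j x j) ord0 i) = x.
  by apply/funext => i; rewrite mxE.
have A0 : rowset A !=set0 by exists (\row_i x0 i); rewrite /rowset /= rowE.
have [|v vA Hv] := @compact_EVT_min _ _ (fun v : 'rV[R]_N => meval (fun i => v ord0 i) p) _ A0 cA.
  by apply: continuous_subspaceT; exact: meval_continuous.
exists (fun i => v ord0 i); first by rewrite inE in vA.
move=> y Ay; have := Hv (\row_i y i); rewrite rowE; apply.
by rewrite inE /rowset /= rowE.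
Qed.

Definition def_family M := definable (fun rho => M (rho 0%N) (block N rho 1)).

Lemma def_family_at M a k : def_family M -> definable (fun rho => M (rho a) (block N rho k)).
Proof.
move=> hM; pose s i := if i == 0%N then a else if (i <= N)%N then (k + i.-1)%N else i.
have hs i : (N.+1 <= i)%N -> s i = i by case: i => // i Ni; rewrite /s /= leqNgt Ni.
apply: (def_ext _ (def_rename hM hs)) => rho.
suff -> : block N (fun i => rho (s i)) 1 = block N rho k by rewrite /s eqxx.
by apply/funext => i; rewrite /block /s addnC addn1 /= ltn_ord.
Qed.

Definition argmin_coord M (j : 'I_N) : R -> ('I_N -> R) -> Prop :=
  fun s x => M s x /\ forall x', M s x' -> x j <= x' j.

Lemma def_argmin_coord M j : def_family M -> def_family (argmin_coord M j).
Proof.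
move=> hM; apply: (def_and (Q := fun rho => forall x', M (rho 0%N) x' -> block N rho 1 j <= x' j) (hM)).
apply: (def_allb' (k := N.+1)) => [|rho x]; last by rewrite block_updb_lt ?updb_lt.
apply: def_imp (def_family_at _ _ hM) _; exact: def_le (tf_var R _) (tf_var R _).
Qed.

Lemma argmin_coord_compact M j s : compact (rowset (M s)) -> (exists x, M s x) ->
  compact (rowset (argmin_coord M j s)) /\ exists x, argmin_coord M j s x.
Proof.
move=> cM M0; have [x Mx Hx] := compact_min (mpolyX R (mnm1 j)) cM M0.
have {}Hx y : M s y -> x j <= y j by move=> /Hx; rewrite !mevalXU.
split; last by exists x.
have -> : rowset (argmin_coord M j s) =
    rowset (M s) `&` rowset (fun y => meval y (mpolyX R (mnm1 j)) <= x j).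
  apply/seteqP; split=> v /=.
    by case=> Mv Hv; split=> //; rewrite /rowset /= mevalXU; apply: Hv.
  by case=> Mv; rewrite /rowset /= mevalXU => le; split=> // y /Hx; apply: le_trans.
by apply: compact_closedI => //; exact: closed_meval_le.
Qed.

Definition argmin_coords M (l : seq 'I_N) := foldl argmin_coord M l.

Lemma def_argmin_coords M l : def_family M -> def_family (argmin_coords M l).
Proof. by elim: l M => //= j l IH M hM; apply/IH/def_argmin_coord. Qed.

Lemma argmin_coords_compact M l s : compact (rowset (M s)) -> (exists x, M s x) ->
  compact (rowset (argmin_coords M l s)) /\ exists x, argmin_coords M l s x.
Proof.
elim: l M => //= j l IH M cM M0.
by have [h1 h2] := argmin_coord_compact j cM M0; apply: IH.
Qed.

Lemma argmin_coords_sub M l s x : argmin_coords M l s x -> M s x.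
Proof. by elim: l M => //= j l IH M /IH []. Qed.

Lemma argmin_coords_eq M l s x y j : j \in l ->
  argmin_coords M l s x -> argmin_coords M l s y -> x j = y j.
Proof.
elim: l M => //= j' l IH M; rewrite inE => /orP [/eqP -> hx hy|jl]; last exact: IH.
have [Mx Hx] := argmin_coords_sub hx; have [My Hy] := argmin_coords_sub hy.
by apply/eqP; rewrite eq_le Hx // Hy.
Qed.

(** Minimising the coordinates one after the other singles out one point of each compact fibre
    definably; [eventually_tame] then applies to each coordinate. *)
Theorem tame_selection M (e0 : R) : def_family M -> 0 < e0 ->
  (forall s, 0 < s -> s < e0 -> compact (rowset (M s)) /\ exists x, M s x) ->
  exists (x : R -> 'I_N -> R) (e1 : R), [/\ 0 < e1, e1 <= e0,
    forall s, 0 < s -> s < e1 -> M s (x s),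
    forall j s, 0 < s -> s < e1 -> cont_at (fun s => x s j) s &
    forall j, monotone_on (fun s => x s j) e1].
Proof.
move=> hM e00 HM; pose S := argmin_coords M (enum 'I_N).
have /choice [x Hx] s : exists x, (exists y, S s y) -> S s x.
  by have [[y Sy]|n] := pselect (exists y, S s y); [exists y | exists (fun=> 0)].
have Sx s : 0 < s -> s < e0 -> S s (x s).
  by move=> s0 se; apply: Hx; have [h1 h2] := HM s s0 se;
     have [] := argmin_coords_compact (enum 'I_N) h1 h2.
have hS : def_family S by apply: def_argmin_coords.
have dx j : def_fun e0 (fun s => x s j).
  apply: (def_ext (P := fun rho => exists y, (0 < rho 0%N /\ rho 0%N < e0) /\
     (S (rho 0%N) y /\ y j = rho 1%N))).
    move=> rho; split=> [[y [[h1 h2] [Sy <-]]]|[[h1 h2] <-]].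
      split=> //; apply: (argmin_coords_eq (l := enum 'I_N)) (Sx _ h1 h2) Sy.
      by rewrite mem_enum.
    by exists (x (rho 0%N)); split=> //; split=> //; apply: Sx.
  apply: (def_exb' (k := 2)) => [|rho y]; last by rewrite !updb_lt.
  apply: def_and.
    exact: def_and (def_lt (tf_const 0) (tf_var R 0)) (def_lt (tf_var R 0) (tf_const e0)).
  exact: def_and (def_family_at _ _ hS) (def_eq (tf_var R _) (tf_var R 1)).
have /choice [d Hd] j : exists d, 0 < d /\ [/\ d <= e0,
    forall s, 0 < s -> s < d -> cont_at (fun s => x s j) s & monotone_on (fun s => x s j) d].
  by have [d d0 H] := eventually_tame (dx j) e00; exists d.
have [d1 d10 Hd1] := fin_min (fun j => (Hd j).1).
exists x, (Num.min e0 d1); split.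
- by rewrite lt_min e00.
- by rewrite ge_min lexx.
- by move=> s s0; rewrite lt_min => /andP [se _]; apply: argmin_coords_sub (Sx s s0 se).
- move=> j s s0; rewrite lt_min => /andP [_ sd]; have [_ [_ H _]] := Hd j.
  by apply: H => //; apply: lt_le_trans (Hd1 j).
- move=> j; have [_ [_ _ H]] := Hd j.
  have lt t : t < Num.min e0 d1 -> t < d j.
    by rewrite lt_min => /andP [_ h]; apply: lt_le_trans (Hd1 j).
  by case: H => H; [left|right] => s t s0 st /lt; apply: H.
Qed.

End Selection.

(** * Taylor estimate and mean value inequality along tame paths *)

Section Taylor.
Variables (R : realType) (K : fieldType) (abs : K -> R).
Hypothesis av : absolute_value abs.

Lemma mpoly_taylor n (p : mpoly n K) (r : R) : exists2 C, 0 < C &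
  forall x y delta, (forall i, abs (x i) <= r) -> (forall i, abs (y i) <= r) ->
   (forall i, abs (y i - x i) <= delta) -> 0 <= delta ->
   abs (meval y p - meval x p - \sum_i (y i - x i) * meval x (mderiv i p)) <= C * delta ^+ 2.
Proof.
move: p; apply: mpoly_ring_ind => [c|i|p q [C C0 HC] [C' C'0 HC']|p q [C C0 HC] [C' C'0 HC']].
- exists 1 => // x y dl _ _ _ dl0; rewrite !mevalC subrr sub0r (avN av) big1.
    by rewrite (av0 av) mul1r exprn_ge0.
  by move=> i _; rewrite mderivC meval0 mulr0.
- exists 1 => // x y dl _ _ _ dl0; rewrite !mevalXU (bigD1 i) //= big1 ?addr0 => [|j ji].
    rewrite mderivX mnm1E eqxx scale1r (_ : mnm_sub _ _ = mnm0) ?mpolyX0 ?meval1 ?mulr1.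
      by rewrite subrr (av0 av) mul1r exprn_ge0.
    by apply/mnmP => j; rewrite mnmBE subnn mnm0E.
  by rewrite mderivX mnm1E eq_sym (negPf ji) scale0r meval0 mulr0.
- exists (C + C'); first by rewrite addr_gt0.
  move=> x y dl h1 h2 h3 h4; rewrite !mevalD mulrDl.
  have -> : \sum_i (y i - x i) * meval x (mderiv i (p + q)) =
     \sum_i (y i - x i) * meval x (mderiv i p) + \sum_i (y i - x i) * meval x (mderiv i q).
    by rewrite -big_split; apply: eq_bigr => i _; rewrite mderivD mevalD mulrDr.
  set A := \sum_i _; set B := \sum_i _.
  have -> : meval y p + meval y q - (meval x p + meval x q) - (A + B) =
    (meval y p - meval x p - A) + (meval y q - meval x q - B) by ring.
  by apply: le_trans (avD av _ _) _; apply: lerD; [apply: HC|apply: HC'].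
- have [L L0 HL] := mpoly_lipschitz av p r; have [L' L'0 HL'] := mpoly_lipschitz av q r.
  have [B B0 HB] := mpoly_bounded av p r; have [B' B'0 HB'] := mpoly_bounded av q r.
  exists (L * L' + B * C' + B' * C); first by rewrite !addr_gt0 // mulr_gt0.
  move=> x y dl h1 h2 h3 h4; rewrite !mevalM.
  have -> : \sum_i (y i - x i) * meval x (mderiv i (p * q)) =
     (\sum_i (y i - x i) * meval x (mderiv i p)) * meval x q +
     meval x p * (\sum_i (y i - x i) * meval x (mderiv i q)).
    rewrite mulr_suml mulr_sumr -big_split; apply: eq_bigr => i _ /=.
    by rewrite mderivM mevalD !mevalM; ring.
  set S := \sum_i _; set T := \sum_i _.
  have -> : meval y p * meval y q - meval x p * meval x q - (S * meval x q + meval x p * T) =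
    (meval y p - meval x p) * (meval y q - meval x q) + meval x p * (meval y q - meval x q - T)
    + meval x q * (meval y p - meval x p - S) by ring.
  rewrite [leRHS](_ : _ = L * L' * dl ^+ 2 + B * C' * dl ^+ 2 + B' * C * dl ^+ 2); last by ring.
  apply: le_trans (avD av _ _) _; apply: lerD.
    apply: le_trans (avD av _ _) _; apply: lerD; rewrite (avM av).
      rewrite expr2 mulrACA; apply: ler_pM; rewrite ?(av_ge0 av) //.
        exact: HL. exact: HL'.
    by rewrite -mulrA; apply: ler_pM; rewrite ?(av_ge0 av) //; [apply: HB|apply: HC'].
  by rewrite (avM av) -mulrA; apply: ler_pM; rewrite ?(av_ge0 av) //; [apply: HB'|apply: HC].
Qed.
End Taylor.

Lemma def_finall (R : realType) (I : finType) (P : I -> (nat -> R) -> Prop) :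
  (forall i, definable (P i)) -> definable (fun rho => forall i, P i rho).
Proof.
move=> HP; have H (l : seq I) : definable (fun rho => forall i, i \in l -> P i rho).
  elim: l => [|i l IH]; first by apply: (def_ext _ (def_true R)).
  apply: (def_ext _ (def_and (HP i) IH)) => rho; split.
    by move=> [h1 h2] j; rewrite inE => /orP [/eqP ->|/h2].
  by move=> h; split=> [|j jl]; apply: h; rewrite inE ?eqxx ?jl ?orbT.
apply: (def_ext _ (H (enum I))) => rho.
by split=> [h i|h i _]; apply: h; rewrite mem_enum.
Qed.

Section Chain.
Variables (R : realType) (N : nat) (x : R -> 'I_N -> R) (e1 r : R).
Hypothesis x_bounded : forall s, 0 < s -> s < e1 -> forall i, `|x s i| <= r.
Hypothesis x_cont : forall j s, 0 < s -> s < e1 -> cont_at (fun s => x s j) s.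
Hypothesis x_mono : forall j, monotone_on (fun s => x s j) e1.

(** Plays the part of arc length: monotone coordinates make it additive along the path. *)
Let var a b := \sum_i `|x b i - x a i|.

Lemma var_cont s eta : 0 < s -> s < e1 -> 0 < eta -> exists2 d, 0 < d &
  forall s', `|s' - s| < d -> var s s' <= eta.
Proof.
move=> s0 se eta0; have h0 : 0 < eta / N.+1%:R by rewrite divr_gt0 // ltr0n.
have /choice [d Hd] j : exists d, 0 < d /\
    forall s', `|s' - s| < d -> `|x s' j - x s j| <= eta / N.+1%:R.
  by have [d d0 H] := x_cont j s0 se h0; exists d.
have [d1 d10 Hd1] := fin_min (fun j => (Hd j).1).
exists d1 => // s' Hs'; apply: (@le_trans _ _ (\sum_(i < N) eta / N.+1%:R)).
  by apply: ler_sum => j _; apply: (Hd j).2; apply: lt_le_trans (Hd1 j).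
rewrite sumr_const card_ord -[_ *+ N]mulr_natl mulrA ler_pdivrMr ?ltr0n // mulrC.
by apply: ler_wpM2l; rewrite ?(ltW eta0) // ler_nat.
Qed.

Lemma var_add a s t : 0 < a -> a <= s -> s <= t -> t < e1 -> var a t = var a s + var s t.
Proof.
move=> a0 as' st te; rewrite /var -big_split; apply: eq_bigr => i _ /=.
have s0 : 0 < s := lt_le_trans a0 as'; have se : s < e1 := le_lt_trans st te.
case: (x_mono i) => H; have h1 := H a s a0 as' se; have h2 := H s t s0 st te.
  by rewrite !ger0_norm ?subr_ge0 ?(le_trans h1) //; ring.
by rewrite !ler0_norm ?subr_le0 ?(le_trans h2) //; ring.
Qed.

Lemma var_ge0 a b : 0 <= var a b.
Proof. by apply: sumr_ge0. Qed.

(** A mean value inequality without differentiability of the path, obtained by applying [creeping]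
    to (K + eta) var - p. *)
Lemma chain (p : mpoly N R) (K a b : R) : 0 <= K -> 0 < a -> a <= b -> b < e1 ->
  (forall s, a <= s -> s <= b -> forall i, `|meval (x s) (mderiv i p)| <= K) ->
  meval (x b) p - meval (x a) p <= K * \sum_i `|x b i - x a i|.
Proof.
move=> K0 a0 ab be HK; have [C C0 HC] := mpoly_taylor (absR_absolute_value R) p r.
have [L L0 HL] := mpoly_lipschitz (absR_absolute_value R) p r.
have step s t : 0 < s -> s < e1 -> 0 < t -> t < e1 ->
    (forall i, `|meval (x s) (mderiv i p)| <= K) ->
    meval (x t) p - meval (x s) p <= K * var s t + C * var s t ^+ 2.
  move=> s0 se t0 te Ks; have vi i : absR (x t i - x s i) <= var s t.
    by rewrite /absR /var (bigD1 i) //= lerDl sumr_ge0.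
  have := HC (x s) (x t) (var s t) (x_bounded s0 se) (x_bounded t0 te) vi (var_ge0 _ _).
  rewrite /absR ler_norml => /andP [_].
  have : \sum_i (x t i - x s i) * meval (x s) (mderiv i p) <= K * var s t.
    rewrite /var mulr_sumr; apply: ler_sum => i _; apply: le_trans (ler_norm _) _.
    by rewrite normrM mulrC; apply: ler_wpM2r.
  by lra.
have lip s t : 0 < s -> s < e1 -> 0 < t -> t < e1 ->
    meval (x s) p - meval (x t) p <= L * var s t.
  move=> s0 se t0 te; have vi i : absR (x s i - x t i) <= var s t.
    by rewrite /absR distrC /var (bigD1 i) //= lerDl sumr_ge0.
  have := HL (x s) (x t) (var s t) (x_bounded s0 se) (x_bounded t0 te) vi (var_ge0 _ _).
  by rewrite /absR; apply: le_trans (ler_norm _).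
suff main eta : 0 < eta -> meval (x b) p - meval (x a) p <= (K + eta) * var a b.
  apply/ler_addgt0Pr => ee ee0; have V1 : 0 < var a b + 1 by rewrite ltr_wpDl // var_ge0.
  have := main (ee / (var a b + 1)); rewrite divr_gt0 // => /(_ isT) h.
  apply: (le_trans h); rewrite mulrDl lerD2l mulrAC ler_pdivrMr //.
  by apply: ler_wpM2l; rewrite ?(ltW ee0) // lerDl.
(* To the right, the slack eta absorbs the quadratic Taylor term; to the left, the Lipschitz bound
   suffices. *)
move=> eta0; pose g s := (K + eta) * var a s - meval (x s) p.
have Ke : 0 < K + eta by rewrite ltr_wpDl.
suff : g a <= g b.
  have -> : g a = - meval (x a) p.
    by rewrite /g /var big1 ?mulr0 ?sub0r // => i _; rewrite subrr normr0.
  by rewrite /g; lra.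
apply: (creeping ab) => [s sa sb|s sa sb eta' eta'0].
  have s0 : 0 < s := lt_le_trans a0 sa; have se : s < e1 := lt_trans sb be.
  have eC : 0 < eta / C by rewrite divr_gt0.
  have [d d0 Hd] := var_cont s0 se eC; exists (Num.min d (b - s)).
    by rewrite lt_min d0 subr_gt0.
  move=> t t0; rewrite lt_min => /andP [td tb].
  have st0 : 0 < s + t by rewrite addr_gt0.
  have ste : s + t < e1 by lra.
  have vt : var s (s + t) <= eta / C.
    by apply: Hd; rewrite addrAC subrr add0r ger0_norm // ltW.
  have := step s (s + t) s0 se st0 ste (HK s sa (ltW sb)).
  have : C * var s (s + t) ^+ 2 <= eta * var s (s + t).
    rewrite expr2 mulrA; apply: ler_wpM2r; first exact: var_ge0.
    by rewrite mulrC -ler_pdivlMr.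
  rewrite /g (@var_add a s (s + t)) ?lerDl ?(ltW t0) //.
  set V := var s _; set W := var a s; rewrite mulrDr mulrDl.
  by nra.
have s0 : 0 < s := lt_trans a0 sa; have se : s < e1 := le_lt_trans sb be.
have e0 : 0 < eta' / (K + eta + L) by rewrite divr_gt0 // addr_gt0.
have [d d0 Hd] := var_cont s0 se e0; exists (Num.min d (s - a)).
  by rewrite lt_min d0 subr_gt0.
move=> t t0; rewrite lt_min => /andP [td ta].
have st0 : 0 < s - t by lra.
have ste : s - t < e1 by lra.
have vt : var s (s - t) <= eta' / (K + eta + L).
  by apply: Hd; rewrite addrAC subrr add0r normrN ger0_norm // ltW.
have h1 := lip s (s - t) s0 se st0 ste.
have h2 : var a (s - t) <= var a s.
  have sta : a <= s - t by lra.
  have sts : s - t <= s by rewrite gerBl ltW.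
  by rewrite (var_add a0 sta sts se) lerDl var_ge0.
have h3 : var s (s - t) * (K + eta + L) <= eta'.
  by rewrite -ler_pdivlMr // addr_gt0.
have h4 : (K + eta) * var a (s - t) <= (K + eta) * var a s by rewrite ler_pM2l.
have h5 : 0 <= (K + eta) * var s (s - t) by rewrite mulr_ge0 ?var_ge0 // ltW.
rewrite /g; move: h1 h3 h4 h5; set V := var s _.
by rewrite mulrDr [V * (K + eta)]mulrC [V * L]mulrC; lra.
Qed.
End Chain.

(** * Positive critical values do not accumulate at 0 *)

Section NoCritical.
Variables (R : realType) (N : nat) (f : mpoly N R).
Hypothesis f0 : meval (fun=> 0) f = 0.

Definition grad2 : mpoly N R := \sum_i mderiv i f ^+ 2.

Lemma meval_grad2 x : meval x grad2 = \sum_i meval x (mderiv i f) ^+ 2.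
Proof. by rewrite /grad2 raddf_sum /=; apply: eq_bigr => i _; rewrite rmorphXn. Qed.

Lemma grad2_ge0 x : 0 <= meval x grad2.
Proof. by rewrite meval_grad2; apply: sumr_ge0 => i _; apply: sqr_ge0. Qed.

Lemma grad2_coord x i : meval x (mderiv i f) ^+ 2 <= meval x grad2.
Proof. by rewrite meval_grad2 (bigD1 i) //= lerDl; apply: sumr_ge0 => j _; apply: sqr_ge0. Qed.

Lemma def_box (dl : R) k : definable (fun rho => forall i, `|block N rho k i| <= dl).
Proof.
apply: def_finall => i; apply: (def_ext (P := fun rho => - dl <= rho (k + i)%N /\ rho (k + i)%N <= dl)).
  by move=> rho; rewrite ler_norml; split=> [[-> ->]|/andP].
exact: def_and (def_le (tf_const _) (tf_var R _)) (def_le (tf_var R _) (tf_const _)).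
Qed.

(** The critical values reached in the unit box form a definable set, so all small positive c are
    critical values or none is. In the first case a tame path of critical points with f = c exists,
    and [chain] with gradient 0 keeps f from increasing along it. *)
Lemma no_critical : exists2 dl, 0 < dl & forall x, (forall i, `|x i| <= dl) ->
  meval x grad2 = 0 -> meval x f <= 0.
Proof.
pose M c x := (forall i, `|x i| <= 1) /\ (meval x grad2 <= 0 /\ meval x f = c).
have defM : def_family M.
  apply: def_and (def_box _ _) (def_and _ _); first exact: def_le (tf_meval _ _) (tf_const 0).
  exact: def_eq (tf_meval _ _) (tf_var R 0).
have cM c : compact (rowset (M c)).
  have -> : rowset (M c) = rowset (fun x => forall i, `|x i| <= 1) `&`
      (rowset (fun x => meval x grad2 <= 0) `&`
      (rowset (fun x => meval x f <= c) `&` rowset (fun x => meval x (- f) <= - c))).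
    apply/seteqP; split=> v /=; rewrite /rowset /M /=.
      move=> [h1 [h2 h3]]; split; [exact: h1|split; [exact: h2|split; rewrite ?mevalN h3; exact: lexx]].
    rewrite mevalN lerN2 => -[h1 [h2 [h3 h4]]]; split=> //; split=> //.
    by apply/eqP; rewrite eq_le h3 h4.
  apply: compact_closedI; first exact: compact_box.
  by apply: closedI; [|apply: closedI]; apply: closed_meval_le.
have defE : definable (fun rho => exists x, M (rho 0%N) x).
  by apply: (def_exb' (k := 1)) => [//|rho x]; rewrite updb_lt.
have [b [d [d0 Hd]]] := def_eventually [::] 0 0 1 defE.
have Hb c : 0 < c -> c < d -> (exists x, M c x) <-> b.
  by move=> c0 cd; have := Hd c c0 cd; rewrite /= add0r mul1r.
case: b {Hd} Hb => Hb.
  have [|x [e1 [e10 _ Mx xc xm]]] := tame_selection defM d0.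
    by move=> c c0 cd; split; [exact: cM | apply/Hb].
  have a0 : 0 < e1 / 3 by rewrite divr_gt0.
  have ab : e1 / 3 <= e1 / 2 by lra.
  have be : e1 / 2 < e1 by lra.
  have xb s (s0 : 0 < s) (se : s < e1) : forall i, `|x s i| <= 1 by have [] := Mx s s0 se.
  have gr s : e1 / 3 <= s -> s <= e1 / 2 -> forall i, `|meval (x s) (mderiv i f)| <= 0.
    move=> sa sb i; have [_ [h _]] := Mx s (lt_le_trans a0 sa) (le_lt_trans sb be).
    have h2 := le_trans (grad2_coord (x s) i) h.
    have /eqP : meval (x s) (mderiv i f) ^+ 2 = 0 by apply/eqP; rewrite eq_le h2 sqr_ge0.
    by rewrite sqrf_eq0 => /eqP ->; rewrite normr0.
  have := chain xb xc xm (p := f) (lexx 0) a0 ab be gr.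
  have [_ [_ ->]] := Mx (e1 / 2) (lt_le_trans a0 ab) be.
  have [_ [_ ->]] := Mx (e1 / 3) a0 (le_lt_trans ab be).
  by rewrite mul0r; lra.
have [L L0 HL] := mpoly_lipschitz (absR_absolute_value R) f 1.
have dL : 0 < d / (2 * L) by rewrite divr_gt0 // mulr_gt0.
exists (Num.min 1 (d / (2 * L))); first by rewrite lt_min ltr01.
set dl := Num.min _ _ => x Hx gx; rewrite leNgt; apply/negP => fx.
have dl1 : dl <= 1 by rewrite ge_min lexx.
have dl2 : L * dl <= d / 2.
  have : dl <= d / (2 * L) by rewrite ge_min lexx orbT.
  by rewrite !ler_pdivlMr ?mulr_gt0 // => h; rewrite (_ : L * dl * 2 = dl * (2 * L)) //; ring.
have dl0 : 0 <= dl by rewrite le_min ler01 ltW.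
have : `|meval x f| <= L * dl.
  have := HL x (fun=> 0) dl; rewrite /absR f0 subr0; apply=> // i.
  - exact: le_trans (Hx i) dl1.
  - by rewrite normr0.
  - by rewrite subr0.
rewrite ger0_norm ?(ltW fx) // => h.
have fd : meval x f < d by lra.
suff : false by []; apply/(Hb _ fx fd); exists x; split=> [i|]; first exact: le_trans (Hx i) dl1.
by rewrite gx.
Qed.
End NoCritical.

(** * Algebraic relations satisfied by stationary points *)

Lemma strip_X (A : idomainType) (I : finType) (a : I -> {poly A}) : (exists l, a l != 0) ->
  exists kap (a' : I -> {poly A}), (forall l, a l = 'X^kap * a' l) /\ exists l, (a' l)`_0 != 0.
Proof.
move=> [l0 al0]; have ex : exists k, [exists l, (a l)`_k != 0].
  exists (size (a l0)).-1; apply/existsP; exists l0.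
  by rewrite -lead_coefE lead_coef_eq0.
case: (ex_minnP ex) => kap /existsP [l1 al1] kmin.
exists kap, (fun l => drop_poly kap (a l)); split=> [l|]; last first.
  by exists l1; rewrite coef_drop_poly.
rewrite -[LHS](poly_take_drop kap) mulrC; suff -> : take_poly kap (a l) = 0 by rewrite add0r.
apply/polyP => i; rewrite coef_take_poly coef0; case: ltnP => // ik.
apply/eqP/negPn/negP => h; have := kmin i; rewrite leqNgt ik => F.
by suff : false by []; apply: F; apply/existsP; exists l.
Qed.

Section ElimNonzero.
Variables (K : fieldType) (N e : nat) (Psi : 'I_N -> mpoly N K) (Psi0 : mpoly N K).
Local Notation d := e.+1.
Hypothesis det_neq0 : forall T, (T <= d + N * e)%N -> qr_det e Psi T != 0.

(** With c constant, the matrix is an invertible diagonal matrix times a characteristic matrix in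
    tau. *)
Lemma det_elim_mx_neq0 (c : 'I_N -> K) :
  \det (elim_mx e Psi polyC Psi0 'X (fun l => (c l)%:P)) != 0.
Proof.
pose n := #|{: {ffun 'I_N -> 'I_d}}|.
pose dl : 'rV[K]_n := \row_i qr_det e Psi (top_level (enum_val i)).
pose E0 := elim_mx e Psi idfun Psi0 0 c.
have dl0 i : dl 0 i != 0.
  by rewrite mxE; apply: det_neq0; rewrite /top_level leq_add2l mdeg_box.
have S2 (E : 'M[K]_n) :
    map_mx polyC (diag_mx dl) *m char_poly_mx (- (diag_mx (\row_i (dl 0 i)^-1) *m E))
    = \matrix_(i, j) ((dl 0 i)%:P * 'X *+ (i == j) + (E i j)%:P).
  apply/matrixP => i j; rewrite map_diag_mx !mul_diag_mx mxE [RHS]mxE.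
  rewrite [char_poly_mx _ i j]mxE; set di := dl 0 i.
  have -> : (map_mx polyC dl) 0 i = di%:P by rewrite mxE.
  have -> : ('X%:M : 'M[{poly K}]_n) i j = 'X *+ (i == j) by rewrite mxE.
  rewrite mulrDr mulrnAr; congr (_ + _); rewrite [X in _ * X]mxE [X in - X]mxE [X in - X%:P]mxE.
  rewrite [X in - (- X)%:P]mxE [X in - (- (X * _))%:P]mxE raddfN opprK -polyCM mulrA divff ?mul1r //.
  exact: dl0.
have S1 : elim_mx e Psi polyC Psi0 'X (fun l => (c l)%:P)
    = \matrix_(i, j) ((dl 0 i)%:P * 'X *+ (i == j) + (E0 i j)%:P).
  apply/matrixP => i j; rewrite [LHS]mxE [RHS]mxE [dl 0 i]mxE; congr (_ + _).
  rewrite /E0 mxE mulr0 mul0rn sub0r raddfN; congr (- _); rewrite raddf_sum /=; apply: eq_bigr => k _.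
  rewrite rmorphM rmorph_prod /=; congr (_ * _); apply: eq_bigr => l _.
  by rewrite rmorphXn.
rewrite S1 -S2 det_mulmx mulf_neq0 //.
  rewrite map_diag_mx det_diag; apply/prodf_neq0 => i _.
  by rewrite [X in X != 0]mxE polyC_eq0 dl0.
exact/monic_neq0/char_poly_monic.
Qed.
End ElimNonzero.

Lemma mmap_map_mpolyK (K S : comNzRingType) (kap : {rmorphism K -> S}) (g : {rmorphism S -> K})
    n x (p : mpoly n K) : (forall z, g (kap z) = z) -> mmap g x (map_mpoly kap p) = meval x p.
Proof.
move=> gk; move: p; apply: mpoly_ring_ind.
- by move=> c; rewrite map_mpolyC mmapC mevalC; exact: gk.
- by move=> i; rewrite map_mpolyX mmapX mmap1U mevalXU.
- by move=> p q IHp IHq; rewrite mevalD !raddfD /= IHp IHq.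
- by move=> p q IHp IHq; rewrite mevalM !rmorphM /= IHp IHq.
Qed.

Section CriticalRelation.
Variables (R : realType) (N e : nat) (A B : 'I_N -> mpoly N R).
Variables (face : 'I_N -> option R) (j : 'I_N).
Local Notation d := e.+1.
Local Notation D := (d ^ N)%N.
Hypothesis A_deg : forall i, deg_le (A i) d.
Hypothesis B_deg : forall i, deg_le (B i) d.
Local Notation S := {poly {poly R}}.

(** Optimality on a box: a coordinate is either fixed on a face, or the partial derivative vanishes.
    With A = grad G and B = grad f the functional is G - s f plus rho times a function with partial
    derivatives x_i^d. *)
Definition stationary (rho s : R) (x : 'I_N -> R) := forall i,
  match face i with
  | None => rho * x i ^+ d + meval x (A i) - s * meval x (B i) = 0
  | Some sg => x i = sg
  end.

Let kap : {rmorphism R -> S} := (polyC \o polyC).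
Let Xn (T : comNzRingType) i : mpoly N T := mpolyX T (mnm_muln (mnm1 i) d).

(* A coordinate on a face [x_i = sg] satisfies [rho x_i^d + x_i = rho sg^d + sg], which has the
   required top form; the other coordinates are stationary points of the perturbed functional. *)
Let gPsi (T : comNzRingType) (k : {rmorphism R -> T}) (rho s : T) (i : 'I_N) : mpoly N T :=
  rho *: Xn T i + match face i with
    | None => map_mpoly k (A i) - s *: map_mpoly k (B i)
    | Some _ => mpolyX T (mnm1 i) end.
Let gc (T : comNzRingType) (k : {rmorphism R -> T}) (rho : T) (i : 'I_N) : T :=
  match face i with None => 0 | Some sg => rho * k sg ^+ d + k sg end.
Let Psi0 (T : comNzRingType) : mpoly N T := mpolyX T (mnm1 j).

Let gPsi_deg (T : comNzRingType) (k : {rmorphism R -> T}) rho s i : deg_le (gPsi k rho s i) d.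
Proof.
apply: deg_leD; first by apply/deg_leZ/deg_leX; rewrite mdegMn mdeg1 mul1n.
case: (face i) => [_|]; first by apply: deg_leX; rewrite mdeg1.
by apply: deg_leB; [|apply: deg_leZ]; apply: deg_le_map.
Qed.

Let Psi0_deg (T : comNzRingType) : deg_le (Psi0 T) d.
Proof. by apply: deg_leX; rewrite mdeg1. Qed.

Let map_gPsi (T T' : comNzRingType) (k : {rmorphism R -> T}) (k' : {rmorphism R -> T'})
   (g : {rmorphism T -> T'}) rho s i : (forall z, g (k z) = k' z) ->
  map_mpoly g (gPsi k rho s i) = gPsi k' (g rho) (g s) i.
Proof.
move=> gk; have mk p : map_mpoly g (map_mpoly k p) = map_mpoly k' p.
  by apply/mpolyP => m; rewrite !mcoeff_map_mpoly /= gk.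
rewrite /gPsi rmorphD /= map_mpolyZ map_mpolyX; congr (_ + _).
case: (face i) => [_|]; first by rewrite map_mpolyX.
by rewrite rmorphB /= map_mpolyZ !mk.
Qed.

(** Elimination of the coordinate x_j from the stationarity system; the outer variable is its value,
    the coefficients are polynomials in rho and then s. *)
Let p : {poly S} := \det (elim_mx e (gPsi kap 'X 'X%:P) polyC (Psi0 S) 'X
                            (fun l => (gc kap 'X l)%:P)).

Let ev (rho s : R) : {rmorphism S -> R} := (horner_eval s \o horner_eval rho%:P).

Let evk rho s z : ev rho s (kap z) = z.
Proof. by rewrite /= /horner_eval !hornerC. Qed.
Let ev_rho rho s : ev rho s 'X = rho.
Proof. by rewrite /= /horner_eval hornerX hornerC. Qed.
Let ev_s rho s : ev rho s 'X%:P = s.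
Proof. by rewrite /= /horner_eval hornerC hornerX. Qed.

Let ev_gPsi rho s : (fun l => map_mpoly (ev rho s) (gPsi kap 'X 'X%:P l)) = gPsi idfun rho s.
Proof.
apply/funext => l; rewrite (map_gPsi (k' := idfun)) ?ev_rho ?ev_s //.
Qed.

Let map_Psi0 rho s : map_mpoly (ev rho s) (Psi0 S) = Psi0 R.
Proof. exact: map_mpolyX. Qed.

Let ev_gc rho s l : ev rho s (gc kap 'X l) = gc idfun rho l.
Proof.
rewrite /gc; case: (face l) => [sg|]; last exact: rmorph0.
by rewrite rmorphD rmorphM rmorphXn ev_rho !evk.
Qed.

(** Only the value of x_j is a variable here, linear and on the diagonal, so trivial weights
    suffice. *)
Let size_p : (size p <= D.+1)%N.
Proof.
have <- : #|{: {ffun 'I_N -> 'I_d}}| = D by rewrite card_ffun !card_ord.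
apply: (@size_det_weighted _ _ _ 1 (fun=> 0%N)) => // a b _.
rewrite !addn0 mul1n -subn1 leq_subLR mxE.
apply: leq_trans (size_polyD _ _) _; rewrite geq_max size_polyN; apply/andP; split.
  apply: leq_trans (_ : (size ((qr_det e (gPsi kap 'X 'X%:P) (top_level (enum_val a)))%:P * 'X)%R <= _)%N).
    by case: (a == b); rewrite ?mulr1n ?mulr0n ?size_poly0.
  apply: leq_trans (size_polyMleq _ _) _; rewrite size_polyX.
  by have := size_polyC_leq1 (qr_det e (gPsi kap 'X 'X%:P) (top_level (enum_val a))); lia.
apply: leq_trans (size_sum _ _ _) _; apply/bigmax_leqP => k _.
set c := qr_coord _ _ _ _ _ _.
have -> : c%:P * \prod_(l < N) (gc kap 'X l)%:P ^+ (level_mnm k l %/ d)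
     = (c * \prod_(l < N) gc kap 'X l ^+ (level_mnm k l %/ d))%:P.
  rewrite rmorphM rmorph_prod /=; congr (_ * _); apply: eq_bigr => l _.
  by rewrite rmorphXn.
exact: leq_trans (size_polyC_leq1 _) _.
Qed.

Let p_neq0 : p != 0.
Proof.
have [q q0 Hq] := qr_det_generic e (fun i => match face i with
    | None => map_mpoly (idfun : {rmorphism R -> R}) (A i) - 0 *: map_mpoly idfun (B i)
    | Some _ => mpolyX R (mnm1 i) end) (d + N * e).
have [k k1 kq] := poly_nonroot_natr 1 q0.
have k0 : k%:R != 0 :> R by rewrite pnatr_eq0 -lt0n.
pose rho : R := k%:R^-1.
suff : map_poly (ev rho 0) p != 0 by apply: contra => /eqP ->; rewrite map_poly0.
rewrite /p -det_map_mx.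
rewrite (@elim_mx_rmorph S {poly S} {poly R} N e _ polyC (map_poly (ev rho 0)) (polyC \o ev rho 0));
  last by move=> z; exact: map_polyC.
have -> : elim_mx e (gPsi kap 'X 'X%:P) (polyC \o ev rho 0) (Psi0 S) (map_poly (ev rho 0) 'X)
    (fun l => map_poly (ev rho 0) (gc kap 'X l)%:P)
  = elim_mx e (gPsi kap 'X 'X%:P) (polyC \o ev rho 0) (Psi0 S) 'X (fun l => (gc idfun rho l)%:P).
  congr (elim_mx _ _ _ _ _ _); first exact: map_polyX.
  apply/funext => l; transitivity (map_poly (ev rho 0) (gc kap 'X l)%:P) => //.
  by rewrite map_polyC; congr (_%:P); exact: ev_gc.
have -> : elim_mx e (gPsi kap 'X 'X%:P) (polyC \o ev rho 0) (Psi0 S) 'X (fun l => (gc idfun rho l)%:P)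
  = elim_mx e (fun l => map_mpoly (ev rho 0) (gPsi kap 'X 'X%:P l)) polyC
     (map_mpoly (ev rho 0) (Psi0 S)) 'X (fun l => (gc idfun rho l)%:P).
  by apply/esym; apply: map_elim_mx.
rewrite ev_gPsi map_Psi0; apply: det_elim_mx_neq0 => T HT.
by apply: Hq => //; rewrite ?invr_eq0 // invrK.
Qed.

Lemma critical_relation : exists a : 'I_D.+1 -> S, (exists l, a l != 0) /\
  forall rho s x, stationary rho s x -> \sum_l (a l).[rho%:P].[s] * x j ^+ l = 0.
Proof.
exists (fun l => p`_l); split.
  apply: contrapT => H; case/eqP: p_neq0; apply/polyP => i; rewrite coef0.
  have [lt|ge] := ltnP i D.+1; last by rewrite nth_default // (leq_trans size_p).
  by apply/eqP/negPn/negP => h; apply: H; exists (Ordinal lt).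
move=> rho s x st; pose t := x j; pose E := ev rho s.
have Ek z : E (kap z) = z := evk rho s z.
have Er : E 'X = rho := ev_rho rho s.
have Es : E 'X%:P = s := ev_s rho s.
have Eg l : E (gc kap 'X l) = gc idfun rho l := ev_gc rho s l.
have Ea z : E z = z.[rho%:P].[s] by [].
clearbody E.
pose g : {rmorphism {poly S} -> R} := horner_morph (fun z => mulrC t (E z)).
have gE : g p = \sum_(l < D.+1) (p`_l).[rho%:P].[s] * x j ^+ l.
  rewrite /g /= /horner_morph (horner_coef_wide t (n := D.+1)); last first.
    by rewrite (leq_trans (size_poly _ _)).
  by apply: eq_bigr => l _; rewrite coef_map /= Ea.
rewrite -gE /p -det_map_mx.
rewrite (@elim_mx_rmorph S {poly S} R N e _ polyC g E); last first.
  by move=> z; rewrite /g /= horner_morphC.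
have -> : g 'X = mmap E x (Psi0 S) by rewrite /g /= horner_morphX mmapX mmap1U.
have -> : (fun l => g (gc kap 'X l)%:P) = (fun l => mmap E x (gPsi kap 'X 'X%:P l)).
  apply/funext => l; rewrite /g /= horner_morphC Eg.
  have h1 : mmap E x ('X *: Xn S l) = rho * x l ^+ d.
    rewrite -mul_mpolyC rmorphM /= mmapC mmapX; congr (_ * _); first exact: Er.
    rewrite /mmap1 (bigD1 l) //= mulmnE mnm1E eqxx mul1n big1 ?mulr1 //.
    by move=> i /negPf il; rewrite mulmnE mnm1E eq_sym il expr0.
  rewrite /gPsi rmorphD /= h1.
  have := st l; rewrite /gc; case: (face l) => [sg xl|<-]; first by rewrite mmapX mmap1U xl.
  rewrite rmorphB /= -mul_mpolyC rmorphM /= mmapC !mmap_map_mpolyK; [|exact: Ek|exact: Ek].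
  by rewrite addrA; congr (_ - _ * _); apply/esym; exact: Es.
have pd l : deg_le (gPsi kap 'X 'X%:P l) d by exact: gPsi_deg.
have pd0 : deg_le (Psi0 S) d by exact: Psi0_deg.
exact: (@det_elim_mx S N e _ pd R E _ pd0 x).
Qed.
End CriticalRelation.

(** * Real one-variable polynomials and limits *)

Section RealPolys.
Variable R : realType.

Lemma poly_near (p : {poly R}) z (eta : R) : 0 < eta -> exists2 r, 0 < r &
  forall t, `|t - z| <= r -> `|p.[t] - p.[z]| <= eta.
Proof.
move=> eta0; have [r r0 Hr] := poly_cvg0 (absR_absolute_value R) (p \Po ('X + z%:P)) eta0.
exists r => // t tr; have := Hr (t - z) tr.
by rewrite /absR !horner_comp !hornerD !hornerX !hornerC subrK add0r.
Qed.

Lemma poly_min_interior (p : {poly R}) r : 0 < r ->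
  (forall t, `|t| <= r -> p.[0] <= p.[t]) -> p`_1 = 0.
Proof.
move=> r0 H; apply/eqP/negPn/negP => p1.
have [q pE] : exists q, p = (p`_0)%:P + (p`_1 *: 'X) + q * 'X^2.
  exists (drop_poly 2 p); rewrite -{1}[p](poly_take_drop 2); congr (_ + _).
  apply/polyP => i; rewrite coef_take_poly coefD coefC coefZ coefX.
  by case: i => [|[|i]] /=; rewrite ?mulr0 ?addr0 ?add0r ?mulr1.
have [C C0 HC] := poly_bounded (absR_absolute_value R) q r.
have a0 : 0 < `|p`_1| by rewrite normr_gt0.
pose t0 := Num.min r (`|p`_1| / (2 * C)).
have t00 : 0 < t0 by rewrite lt_min r0 divr_gt0 // mulr_gt0.
have tr : t0 <= r by rewrite ge_min lexx.
have tC : C * t0 <= `|p`_1| / 2.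
  have : t0 <= `|p`_1| / (2 * C) by rewrite ge_min lexx orbT.
  by rewrite !ler_pdivlMr ?mulr_gt0 // => h; rewrite (_ : C * t0 * 2 = t0 * (2 * C)) //; ring.
pose t := - Num.sg p`_1 * t0.
have nt : `|t| = t0 by rewrite normrM normrN normr_sg p1 mul1r gtr0_norm.
have := H t; rewrite nt => /(_ tr).
have -> : p.[t] = p`_0 + p`_1 * t + q.[t] * t ^+ 2.
  by rewrite [in LHS]pE !hornerD hornerC hornerZ hornerX hornerM hornerXn.
have -> : p`_1 * t = - (`|p`_1| * t0).
  by rewrite /t mulNr mulrN mulrA [p`_1 * _]mulrC -normrEsg.
rewrite horner_coef0 -addrA lerDl.
have : `|q.[t] * t ^+ 2| <= C * t0 ^+ 2.
  rewrite normrM normrX nt; apply: ler_wpM2r; first by rewrite exprn_ge0 // ltW.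
  by apply: HC; rewrite /absR nt.
have h2 : C * t0 ^+ 2 <= `|p`_1| / 2 * t0.
  by rewrite expr2 mulrA; apply: ler_wpM2r; rewrite ?(ltW t00).
move=> h1; have := ler_norm (q.[t] * t ^+ 2) => h3; rewrite addrC subr_ge0 leNgt => /negP; apply.
have := mulr_gt0 a0 t00; set W := `|p`_1| * t0 => W0.
by have : `|p`_1| / 2 * t0 = W / 2 by [rewrite mulrAC]; lra.
Qed.

Lemma mono_limit (h : R -> R) e1 B : 0 < e1 -> monotone_on h e1 ->
  (forall s, 0 < s -> s < e1 -> `|h s| <= B) -> exists z, forall eta, 0 < eta ->
  exists2 d, 0 < d & forall s, 0 < s -> s < d -> s < e1 /\ `|h s - z| <= eta.
Proof.
suff H (g : R -> R) : 0 < e1 -> (forall s t, 0 < s -> s <= t -> t < e1 -> g s <= g t) ->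
  (forall s, 0 < s -> s < e1 -> `|g s| <= B) -> exists z, forall eta, 0 < eta ->
  exists2 d, 0 < d & forall s, 0 < s -> s < d -> s < e1 /\ `|g s - z| <= eta.
  move=> e0 [m|m] b; first exact: H.
  have [|s s0 se|z Hz] := H (fun s => - h s) e0; first by move=> s t s0 st te; rewrite lerN2; exact: m.
    by rewrite normrN; exact: b.
  exists (- z) => eta /Hz [d d0 Hd]; exists d => // s s0 sd; have [h1 h2] := Hd s s0 sd.
  by split=> //; rewrite opprK -normrN opprD.
move=> e0 m b; pose S := [set g s | s in [set s | 0 < s /\ s < e1]].
have hS : has_inf S.
  split; first by exists (g (e1 / 2)), (e1 / 2) => //=; split; lra.
  exists (- B) => y [s [s0 se] <-]; have := b s s0 se.
  by rewrite ler_norml => /andP [].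
exists (inf S) => eta eta0.
have [y [s [s0 se] <-] ys] := inf_adherent eta0 hS.
exists s => // t t0 ts; have te : t < e1 by apply: lt_trans se.
split=> //; have h1 : g t <= g s by apply: m => //; apply: ltW.
have h2 : inf S <= g t by apply: ge_inf; [exact: hS.2 | exists t].
by rewrite ger0_norm ?subr_ge0 // lerBlDl; apply: le_trans h1 (ltW ys).
Qed.

Lemma root_order (q : {poly R}) z D : q != 0 -> (size q <= D.+1)%N ->
  exists kp r, [/\ 0 < kp, 0 < r & forall t, `|t - z| <= r -> kp * `|t - z| ^+ D <= `|q.[t]|].
Proof.
move=> q0 sq; pose q1 := q \Po ('X + z%:P).
have q1E t : q.[t] = q1.[t - z] by rewrite horner_comp hornerD hornerX hornerC subrK.
have q10 : q1 != 0.
  apply/eqP => /(congr1 (fun q => q \Po ('X - z%:P))); rewrite comp_poly0 -comp_polyA.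
  by rewrite comp_polyD comp_polyX comp_polyC subrK comp_polyXr; apply/eqP.
have sq1 : size q1 = size q by rewrite size_comp_poly2 // size_XaddC.
have [p [u [q1p u0]]] := poly_split_X q10.
have pD : (p <= D)%N.
  have un0 : u != 0 by apply: contraNneq u0 => ->; rewrite coef0.
  move: sq; rewrite -sq1 q1p mulrC size_mulXn // => h.
  by rewrite -ltnS; apply: leq_trans h; rewrite -addn1 leq_add2l size_poly_gt0.
rewrite -horner_coef0 in u0; have u00 : 0 < `|u.[0]| / 2 by rewrite divr_gt0 // normr_gt0.
have [r r0 Hr] := poly_near u 0 u00.
exists (`|u.[0]| / 2), (Num.min 1 r); split=> //; first by rewrite lt_min ltr01.
move=> t; rewrite le_min => /andP [t1 tr].
rewrite q1E q1p hornerM hornerXn normrM normrX mulrC.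
apply: ler_pM; rewrite ?exprn_ge0 ?(ltW u00) //; first exact: ler_wiXn2l.
have := Hr (t - z); rewrite subr0 => /(_ tr) h.
have := ler_distD u.[t - z] u.[0] 0; rewrite !subr0 distrC => h2; lra.
Qed.
End RealPolys.

(** * Coordinates of limits of stationary points *)

Section FacePoly.
Variables (R : realType) (N e : nat) (A B : 'I_N -> mpoly N R).
Variables (face : 'I_N -> option R) (j : 'I_N).
Local Notation D := (e.+1 ^ N)%N.
Hypothesis A_deg : forall i, deg_le (A i) e.+1.
Hypothesis B_deg : forall i, deg_le (B i) e.+1.

(** Remove the common power of rho from the relation, let rho tend to 0, remove the common power of
    s and set s = 0: the remaining polynomial q is nonzero, and the terms dropped are O(s). *)
Lemma face_poly : exists q : {poly R}, [/\ q != 0, (size q <= D.+1)%N &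
  forall r, 0 <= r -> exists2 C, 0 < C & forall s x, 0 < s -> s <= 1 -> `|x j| <= r ->
  (forall eta, 0 < eta -> exists rho x', [/\ 0 < rho, rho < eta,
     forall i, `|x' i - x i| < eta & stationary e A B face rho s x']) ->
  `|q.[x j]| <= C * s].
Proof.
have [a [anz Ha]] := critical_relation face j A_deg B_deg.
have [kap [a' [aE [l1 a'0]]]] := strip_X anz.
have [kap2 [b' [bE [l2 b'0]]]] : exists kap (b' : 'I_D.+1 -> {poly R}),
    (forall l, (a' l)`_0 = 'X^kap * b' l) /\ exists l, (b' l)`_0 != 0.
  by apply: strip_X; exists l1.
pose q := \poly_(l < D.+1) (b' (inord l))`_0.
have qE t : q.[t] = \sum_(l < D.+1) (b' l)`_0 * t ^+ l.
  by rewrite horner_poly; apply: eq_bigr => l _; rewrite inord_val.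
exists q; split.
- apply: contraNneq b'0 => /(congr1 (fun q : {poly R} => q`_l2)).
  by rewrite coef_poly ltn_ord inord_val coef0 => ->.
- exact: size_poly.
move=> r r0.
have /choice [Cl HCl] l : exists C, 0 < C /\
    forall s, 0 < s -> s <= 1 -> `|(b' l).[s] - (b' l)`_0| <= C * s.
  have [C C0 HC] := poly_bounded (absR_absolute_value R) (drop_poly 1 (b' l)) 1.
  exists C; split=> // s s0 s1.
  have E : b' l = ((b' l)`_0)%:P + drop_poly 1 (b' l) * 'X.
    rewrite -{1}[b' l](poly_take_drop 1) expr1; congr (_ + _).
    by apply/polyP => -[|i]; rewrite coef_take_poly coefC.
  rewrite [in X in X - _]E hornerD hornerC hornerMX addrAC subrr add0r normrM (gtr0_norm s0).
  by apply: ler_wpM2r; [exact: ltW|apply: HC; rewrite /absR gtr0_norm].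
exists (\sum_(l < D.+1) Cl l * r ^+ l + 1).
  by rewrite ltr_wpDl // sumr_ge0 // => l _; rewrite mulr_ge0 ?exprn_ge0 // ltW //; case: (HCl l).
move=> s x s0 s1 xr Hlim.
pose Al l := map_poly (horner_eval s) (a' l).
have AlE l rho : (a' l).[rho%:P].[s] = (Al l).[rho].
  rewrite -[LHS]/(horner_eval s (a' l).[rho%:P]) -horner_map.
  by congr horner; exact: hornerC.
have Al0 l : (Al l).[0] = ((a' l)`_0).[s] by rewrite horner_coef0 coef_map.
pose P0 := \poly_(l < D.+1) ((a' (inord l))`_0).[s].
have P0E t : P0.[t] = \sum_(l < D.+1) (Al l).[0] * t ^+ l.
  by rewrite horner_poly; apply: eq_bigr => l _; rewrite inord_val Al0.
(* Passage to the limit: the relation at (rho, x') is divided by rho^kap, with rho > 0. *)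
have P0x : P0.[x j] = 0.
  apply/eqP/negPn/negP => P0x; have p0 : 0 < `|P0.[x j]| / 4 by rewrite divr_gt0 // normr_gt0.
  have [d1 d10 Hd1] := poly_near P0 (x j) p0.
  pose W := \sum_(l < D.+1) (`|x j| + 1) ^+ l.
  have W0 : 0 < W.
    by rewrite /W big_ord_recl expr0 ltr_wpDr // sumr_ge0 // => l _; rewrite exprn_ge0 // addr_ge0.
  have eta1 : 0 < `|P0.[x j]| / 4 / W by rewrite divr_gt0.
  have /choice [dl Hdl] l : exists d, 0 < d /\
      forall rho, `|rho - 0| <= d -> `|(Al l).[rho] - (Al l).[0]| <= `|P0.[x j]| / 4 / W.
    by have [d d0 Hd] := poly_near (Al l) 0 eta1; exists d.
  have [d2 d20 Hd2] := fin_min (fun l => (Hdl l).1).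
  have m0 : 0 < Num.min 1 (Num.min d1 d2) by rewrite !lt_min ltr01 d10.
  have [rho [x' [rho0 rhom Hx' st]]] := Hlim _ m0.
  move: rhom; rewrite !lt_min => /and3P [_ _ rd2].
  have := Hx' j; rewrite !lt_min => /and3P [x1 xd1 _].
  have rel := Ha rho s x' st.
  have {}rel : \sum_(l < D.+1) (Al l).[rho] * x' j ^+ l = 0.
    have : rho ^+ kap * \sum_(l < D.+1) (Al l).[rho] * x' j ^+ l = 0.
      rewrite -[RHS]rel mulr_sumr; apply: eq_bigr => l _.
      by rewrite aE hornerM hornerXn hornerM AlE mulrA -rmorphXn hornerC.
    by move/eqP; rewrite mulf_eq0 expf_eq0 (gt_eqF rho0) andbF => /eqP.
  have h1 : `|P0.[x' j]| <= `|P0.[x j]| / 4.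
    rewrite -[P0.[x' j]]subr0 -rel P0E -sumrB.
    apply: le_trans (ler_norm_sum _ _ _) _.
    have -> : `|P0.[x j]| / 4 = \sum_(l < D.+1) `|P0.[x j]| / 4 / W * (`|x j| + 1) ^+ l.
      by rewrite -mulr_sumr -/W divfK // gt_eqF.
    apply: ler_sum => l _.
    rewrite -mulrBl normrM normrX; apply: ler_pM; rewrite ?exprn_ge0 //.
      rewrite distrC; apply: (Hdl l).2; rewrite subr0 gtr0_norm //.
      exact: le_trans (ltW rd2) (Hd2 l).
    apply: lerXn2r; rewrite ?nnegrE ?addr_ge0 //.
    by have := ler_distD (x j) (x' j) 0; rewrite !subr0; lra.
  have h2 := Hd1 (x' j) (ltW xd1).
  have := ler_distD P0.[x' j] P0.[x j] 0; rewrite !subr0 [`|P0.[x j] - _|]distrC.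
  by have : 0 < `|P0.[x j]| by [rewrite normr_gt0]; lra.
have rel : \sum_(l < D.+1) (b' l).[s] * x j ^+ l = 0.
  have : s ^+ kap2 * \sum_(l < D.+1) (b' l).[s] * x j ^+ l = 0.
    rewrite -[RHS]P0x P0E mulr_sumr; apply: eq_bigr => l _.
    by rewrite Al0 bE hornerM hornerXn mulrA.
  by move/eqP; rewrite mulf_eq0 expf_eq0 (gt_eqF s0) andbF => /eqP.
rewrite qE mulrDl mul1r.
have -> : \sum_(l < D.+1) (b' l)`_0 * x j ^+ l
    = \sum_(l < D.+1) ((b' l)`_0 - (b' l).[s]) * x j ^+ l.
  rewrite -[LHS]subr0 -[X in _ - X]rel -sumrB; apply: eq_bigr => l _.
  by rewrite mulrBl.
apply: (@le_trans _ _ ((\sum_(l < D.+1) Cl l * r ^+ l) * s)); last by rewrite lerDl ltW.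
apply: le_trans (ler_norm_sum _ _ _) _; rewrite mulr_suml; apply: ler_sum => l _.
rewrite normrM normrX mulrAC; apply: ler_pM; rewrite ?exprn_ge0 //.
  by rewrite distrC; apply: (HCl l).2.
by apply: lerXn2r; rewrite ?nnegrE.
Qed.
End FacePoly.

Lemma sum_pow_le (R : realType) (N k : nat) (a : 'I_N -> R) B : (0 < k)%N ->
  (forall i, 0 <= a i) -> (forall i, a i ^+ k <= B) -> (\sum_i a i) ^+ k <= N%:R ^+ k * B.
Proof.
case: N a => [|N] a k0 a0 aB; first by rewrite big_ord0 expr0n eqn0Ngt k0 mul0r.
have [j _ Hj] := @Order.TotalTheory.arg_maxP _ _ _ (ord0 : 'I_N.+1) xpredT a isT.
apply: (@le_trans _ _ ((N.+1%:R * a j) ^+ k)).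
  apply: lerXn2r; rewrite ?nnegrE ?mulr_ge0 ?sumr_ge0 //.
  apply: (@le_trans _ _ (\sum_(i < N.+1) a j)); first by apply: ler_sum => i _; exact: Hj.
  by rewrite sumr_const card_ord mulr_natl.
by rewrite exprMn ler_wpM2l // exprn_ge0.
Qed.

Lemma mul_shrink (R : realType) (a h : R) : 0 <= a -> 0 <= h -> a * (h / (a + 1)) <= h.
Proof.
by move=> a0 h0; rewrite mulrA ler_pdivrMr ?ltr_wpDl // mulrC ler_wpM2l // lerDl.
Qed.

(** * A gradient inequality by Legendre duality *)

Section Legendre.
Variables (R : realType) (N e : nat) (f : mpoly N R).
Hypothesis f_ge0 : forall x, 0 <= meval x f.
Hypothesis f0 : meval (fun=> 0) f = 0.
Let A i := mderiv i (grad2 f).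
Let B i := mderiv i f.
Hypothesis A_deg : forall i, deg_le (A i) e.+1.
Hypothesis B_deg : forall i, deg_le (B i) e.+1.
Local Notation Bz := (e.+1 ^ N)%N.

(** Its partial derivatives are the powers x_i^(e+1), which supply the top forms of the stationarity
    system. *)
Let w : mpoly N R := e.+2%:R^-1 *: \sum_i mpolyX R (mnm_muln (mnm1 i) e.+2).

Let psi rho s := grad2 f - s *: f + rho *: w.

Let psiE rho s x : meval x (psi rho s) = meval x (grad2 f) - s * meval x f + rho * meval x w.
Proof. by rewrite /psi mevalD mevalB !mevalZ. Qed.

Let dw i x : meval x (mderiv i w) = x i ^+ e.+1.
Proof.
rewrite /w mderivZ mevalZ (raddf_sum (mderiv i)) /= (bigD1 i) //= big1 ?addr0 => [|j /negPf ji].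
  rewrite mderivX mevalZ mulmnE mnm1E eqxx mul1n mulrA mulVf ?mul1r ?pnatr_eq0 //.
  have -> : mnm_sub (mnm_muln (mnm1 i) e.+2) (mnm1 i) = mnm_muln (mnm1 i) e.+1.
    by apply/mnmP => k; rewrite mnmBE !mulmnE mnm1E; case: (i == k); rewrite ?mul1n ?mul0n ?sub0n // subn1.
  rewrite /meval mmapX /mmap1 (bigD1 i) //= mulmnE mnm1E eqxx mul1n big1 ?mulr1 //.
  by move=> l /negPf il; rewrite mulmnE mnm1E eq_sym il expr0.
by rewrite mderivX mulmnE mnm1E ji mul0n scale0r.
Qed.

Variable dl : R.
Hypothesis dl_gt0 : 0 < dl.
Hypothesis dl_le1 : dl <= 1.
Hypothesis no_crit : forall x, (forall i, `|x i| <= dl) -> meval x (grad2 f) = 0 -> meval x f <= 0.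

Let box (x : 'I_N -> R) := forall i, `|x i| <= dl.
Let isMin rho s x := box x /\ forall y, box y -> meval x (psi rho s) <= meval y (psi rho s).
Let face_of (t : {ffun 'I_N -> option bool}) i : option R :=
  omap (fun b : bool => if b then dl else - dl) (t i).

Let min_stationary rho s x : isMin rho s x ->
  exists t, stationary e A B (face_of t) rho s x.
Proof.
move=> [bx Hx].
exists [ffun i => if x i == dl then Some true else if x i == - dl then Some false else None].
move=> i; rewrite /face_of ffunE; case: eqP => //= xd; case: eqP => //= xd'.
have r0 : 0 < dl - `|x i|.
  rewrite subr_gt0 lt_neqAle bx andbT; apply/eqP => E.
  have [x0|x0] := leP 0 (x i); move: E; rewrite ?(ger0_norm x0) ?(ltr0_norm x0) // => E.
  by apply: xd'; rewrite -E opprK.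
pose u k : R := (k == i)%:R.
have := @poly_min_interior R (line_poly x u (psi rho s)) _ r0.
rewrite line_coef1 (bigD1 i) //= /u eqxx mul1r big1 ?addr0 => [H|k /negPf ->]; last by rewrite mul0r.
have {H} : meval x (mderiv i (psi rho s)) = 0.
  apply: H => t tr; rewrite !horner_line.
  have -> : (fun k => x k + (k == i)%:R * 0) = x by apply/funext => k; rewrite mulr0 addr0.
  apply: Hx => k; have [->|_] := eqVneq k i; last by rewrite mul0r addr0.
  by rewrite mul1r; apply: le_trans (ler_normD _ _) _; lra.
have -> : mderiv i (psi rho s) = mderiv i (grad2 f) - s *: mderiv i f + rho *: mderiv i w.
  by rewrite mderivD mderivB !mderivZ.
rewrite mevalD mevalB !mevalZ dw => H.
by rewrite -[RHS]H /A /B; ring.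
Qed.

(** Limits of minimisers as rho tends to 0: they minimise G - s f on the box and inherit the
    relations available for rho > 0. *)
Let Ls s x := forall eta, 0 < eta -> exists rho x',
  [/\ 0 < rho, rho < eta, forall i, `|x' i - x i| < eta & isMin rho s x'].

Let box_limit x : (forall eta, 0 < eta -> exists2 x', box x' & forall i, `|x' i - x i| < eta) -> box x.
Proof.
move=> H i; apply/ler_addgt0Pr => eta /H [x' bx' xx'].
have := bx' i; have := xx' i; have := ler_distD (x' i) (x i) 0.
by rewrite !subr0 [`|x i - _|]distrC; lra.
Qed.

Let Ls_box s x : Ls s x -> box x.
Proof.
move=> H; apply: box_limit => eta /H [rho [x' [_ _ h [bx' _]]]]; by exists x'.
Qed.

Let Ls_min s x y : Ls s x -> box y ->
  meval x (grad2 f) - s * meval x f <= meval y (grad2 f) - s * meval y f.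
Proof.
move=> Lx By; pose p := grad2 f - s *: f.
have pE z : meval z p = meval z (grad2 f) - s * meval z f by rewrite /p mevalB mevalZ.
rewrite -!pE; have bx := Ls_box Lx.
have [L L0 HL] := mpoly_lipschitz (absR_absolute_value R) p dl.
have [W W0 HW] := mpoly_bounded (absR_absolute_value R) w dl.
apply/ler_addgt0Pr => ee ee0; pose eta := ee / (L + 2 * W).
have LW : 0 < L + 2 * W by rewrite addr_gt0 // mulr_gt0.
have eta0 : 0 < eta by rewrite divr_gt0.
have [rho [x' [rho0 rhoe xx' [bx' mx']]]] := Lx eta eta0.
have := mx' y By; rewrite !psiE -!pE => h1.
have h2 : `|meval x' p - meval x p| <= L * eta.
  by apply: (HL x' x eta) => // [i|]; [exact/ltW/xx'|exact: ltW].
have := HW x' bx'; have := HW y By; rewrite /absR => h3 h4.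
have h5 : rho * meval y w <= eta * W.
  apply: (@le_trans _ _ (rho * W)).
    by apply: ler_wpM2l; [exact: ltW | exact: le_trans (ler_norm _) h3].
  by apply: ler_wpM2r; exact: ltW.
have h6 : - (rho * meval x' w) <= eta * W.
  rewrite -mulrN; apply: (@le_trans _ _ (rho * W)).
    apply: ler_wpM2l; first exact: ltW.
    by apply: le_trans (ler_norm _) _; rewrite normrN.
  by apply: ler_wpM2r; exact: ltW.
have h7 : L * eta + eta * W + eta * W = ee.
  by rewrite -[RHS](divfK (lt0r_neq0 LW)) -/eta; ring.
by move: h2; rewrite ler_norml => /andP [h2 _]; lra.
Qed.

Let compact_isMin rho s : compact (rowset (isMin rho s)) /\ exists x, isMin rho s x.
Proof.
have [|x bx Hx] := compact_min (psi rho s) (@compact_box R N dl).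
  by exists (fun=> 0) => i; rewrite normr0 ltW.
split; last by exists x.
have -> : rowset (isMin rho s) = rowset box `&` rowset (fun y => meval y (psi rho s) <= meval x (psi rho s)).
  apply/seteqP; split=> v /=; first by move=> [bv Hv]; split=> //; apply: Hv.
  by move=> [bv Hv]; split=> // y By; apply: le_trans Hv (Hx y By).
by apply: compact_closedI; [exact: compact_box | exact: closed_meval_le].
Qed.

Let def_isMin (gr gs : (nat -> R) -> R) k : term_fun gr -> term_fun gs ->
  (forall rho (y : 'I_N -> R), gr (updb rho (k + N) y) = gr rho) ->
  (forall rho (y : 'I_N -> R), gs (updb rho (k + N) y) = gs rho) ->
  definable (fun rho => isMin (gr rho) (gs rho) (block N rho k)).
Proof.
move=> hr hs Er Es.
have tp l : term_fun (fun rho => meval (block N rho l) (psi (gr rho) (gs rho))).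
  apply: (tf_ext (g := fun rho => meval (block N rho l) (grad2 f) -
    gs rho * meval (block N rho l) f + gr rho * meval (block N rho l) w)).
    by move=> rho; rewrite psiE.
  apply: tf_add (tf_mul hr (tf_meval _ _)).
  exact: tf_sub (tf_meval _ _) (tf_mul hs (tf_meval _ _)).
apply: (def_and (P := fun rho => box (block N rho k))); first exact: def_box.
apply: (def_allb' (k := (k + N)%N)) => [|rho y].
  by apply: def_imp (def_box _ _ _) _; apply: def_le.
by rewrite block_updb_lt // Er Es.
Qed.

Let Ls_nonempty s : exists x, Ls s x.
Proof.
have dM : def_family (fun rho x => isMin rho s x).
  by apply: def_isMin (tf_var R 0) (tf_const s) _ _ => // rho y; rewrite updb_lt.
have [x [e1 [e10 _ Mx xc xm]]] := tame_selection dM ltr01 (fun rho _ _ => compact_isMin rho s).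
have xb j t : 0 < t -> t < e1 -> `|x t j| <= dl by move=> t0 te; have [bx _] := Mx t t0 te; apply: bx.
have /choice [z Hz] j := mono_limit e10 (xm j) (xb j).
exists z => eta eta0; have h0 : 0 < eta / 2 by rewrite divr_gt0.
have /choice [d Hd] j : exists d, 0 < d /\
    forall t, 0 < t -> t < d -> t < e1 /\ `|x t j - z j| <= eta / 2.
  by have [d d0 H] := Hz j _ h0; exists d.
have [d1 d10 Hd1] := fin_min (fun j => (Hd j).1).
pose m := Num.min (Num.min d1 e1) eta.
have m0 : 0 < m by rewrite !lt_min d10 e10.
have r0 : 0 < m / 2 by rewrite divr_gt0.
have : m / 2 < m by lra.
rewrite {2}/m !lt_min => /andP [/andP [rd re] reta].
exists (m / 2), (x (m / 2)); split=> // [i|]; last exact: Mx.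
have [_ h] := (Hd i).2 _ r0 (lt_le_trans rd (Hd1 i)).
by apply: le_lt_trans h _; lra.
Qed.

Let Ls_compact s : compact (rowset (Ls s)).
Proof.
have -> : rowset (Ls s) = rowset box `&` rowset (Ls s).
  by apply/seteqP; split=> [v Lv|v []] //; split=> //; exact: Ls_box Lv.
apply: compact_closedI; first exact: compact_box.
move=> v cv eta eta0; have h0 : 0 < eta / 2 by rewrite divr_gt0.
have [v' [Lv' /= bv']] := cv _ (nbhsx_ballx v _ h0).
have [rho [x' [rho0 rhoe xx' mx']]] := Lv' _ h0.
exists rho, x'; split=> // [|i]; first by lra.
have [_ /(_ ord0 i) /= h] := bv'; have h2 := xx' i.
have := ler_distD (v' ord0 i) (x' i) (v ord0 i).
by rewrite [`|v' _ _ - v _ _|]distrC; move: h; rewrite /ball /=; lra.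
Qed.

Let def_Ls : def_family Ls.
Proof.
apply: (def_ext (P := fun rho => forall eta, 0 < eta -> exists r, exists x' : 'I_N -> R,
   (0 < r /\ r < eta) /\ ((forall i, `|x' i - block N rho 1 i| < eta) /\ isMin r (rho 0%N) x'))).
  move=> rho; split=> H eta /H [r [x' H']]; exists r, x'.
    by case: H' => [[h1 h2] [h3 h4]].
  by case: H'.
apply: (def_all' (i := N.+1)) => [|rho eta]; last first.
  have E : block N (upd rho N.+1 eta) 1 = block N rho 1.
    apply/funext => i; rewrite /block /upd; case: eqP => // E.
    by have := ltn_ord i; move: E; rewrite add1n => -[->]; rewrite ltnn.
  by rewrite E.
apply: def_imp (def_lt (tf_const 0) (tf_var R _)) _.
apply: (def_ex' (i := N.+2)) => [|rho r]; last first.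
  have E : block N (upd rho N.+2 r) 1 = block N rho 1.
    apply/funext => i; rewrite /block /upd; case: eqP => // E.
    by have := ltn_ord i; move: E; rewrite add1n => -[->]; rewrite ltnNge leqW.
  by rewrite E /upd eqn_leq ltnn andbF.
apply: (def_exb' (k := N.+3)) => [|rho x']; last first.
  by rewrite block_updb_lt ?updb_lt //; lia.
apply: def_and.
  exact: def_and (def_lt (tf_const 0) (tf_var R _)) (def_lt (tf_var R _) (tf_var R _)).
apply: def_and.
  apply: def_finall => i; apply: (def_ext (P := fun rho : nat -> R =>
     rho (N.+3 + i)%N - rho (1 + i)%N < rho N.+1 /\ rho (1 + i)%N - rho (N.+3 + i)%N < rho N.+1)).
    move=> rho; rewrite /block ltr_norml; split=> [[h1 h2]|/andP [h1 h2]].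
      by rewrite h1 andbT; lra.
    by split=> //; lra.
  by apply: def_and; apply: def_lt (tf_sub (tf_var R _) (tf_var R _)) (tf_var R _).
by apply: def_isMin (tf_var R _) (tf_var R _) _ _ => rho y; rewrite updb_lt // !addSn ltnS !ltnS leq_addr.
Qed.

(** There are finitely many face patterns, so one of them works for arbitrarily small eta. *)
Let Ls_face s x : Ls s x -> exists t, forall eta, 0 < eta -> exists rho x',
  [/\ 0 < rho, rho < eta, forall i, `|x' i - x i| < eta & stationary e A B (face_of t) rho s x'].
Proof.
move=> Lx; apply: contrapT => H.
have /choice [d Hd] (t : {ffun 'I_N -> option bool}) : exists d, 0 < d /\ ~ exists rho x',
  [/\ 0 < rho, rho < d, forall i, `|x' i - x i| < d & stationary e A B (face_of t) rho s x'].
  apply: contrapT => h; apply: H; exists t => eta eta0; apply: contrapT => h'; apply: h.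
  by exists eta.
have [m m0 Hm] := fin_min (fun t => (Hd t).1).
have [rho [x' [rho0 rm xx' /min_stationary [t st]]]] := Lx m m0.
apply: (Hd t).2; exists rho, x'; split=> // [|i]; first exact: lt_le_trans (Hm t).
exact: lt_le_trans (xx' i) (Hm t).
Qed.

Let face_bound : exists (q : {ffun 'I_N -> option bool} -> 'I_N -> {poly R}) (C : R),
  [/\ 0 < C, forall t j, q t j != 0 /\ (size (q t j) <= Bz.+1)%N &
   forall s x, 0 < s -> s <= 1 -> Ls s x -> exists t, forall j, `|(q t j).[x j]| <= C * s].
Proof.
have /choice [q Hq] (tj : {ffun 'I_N -> option bool} * 'I_N) : exists q : {poly R},
  [/\ q != 0, (size q <= Bz.+1)%N & exists C, 0 < C /\
   forall s x, 0 < s -> s <= 1 -> `|x tj.2| <= dl ->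
  (forall eta, 0 < eta -> exists rho x', [/\ 0 < rho, rho < eta,
     forall i, `|x' i - x i| < eta & stationary e A B (face_of tj.1) rho s x']) ->
  `|q.[x tj.2]| <= C * s].
  have [q [q1 q2 q3]] := face_poly (face_of tj.1) tj.2 A_deg B_deg.
  by have [C C0 HC] := q3 dl (ltW dl_gt0); exists q; split=> //; exists C.
have /choice [C HC] tj := let: And3 _ _ h := Hq tj in h.
have [Cm Cm1 HCm] := fin_max C.
exists (fun t j => q (t, j)), Cm; split; first exact: lt_le_trans Cm1.
  by move=> t j; have [h1 h2 _] := Hq (t, j).
move=> s x s0 s1 Lx; have [t Ht] := Ls_face Lx; exists t => j.
have [_ H] := HC (t, j); apply: le_trans (H s x s0 s1 (Ls_box Lx j) Ht) _.
by apply: ler_wpM2r; [exact: ltW|exact: HCm].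
Qed.

(* [c s = f (x s)] is minus the derivative of the concave function [s |-> min (G - s f)]; along the
   path of minimizers [|grad f|^2 <= s c s], while the coordinates move by at most [s ^ (1/Bz)]. *)
Let value_bound : exists (C e1 : R) (c : R -> R), [/\ 0 < C, 0 < e1,
  forall s, 0 < s -> s < e1 -> 0 <= c s /\ c s ^+ Bz <= C * s ^+ (Bz + 2) &
  forall s y, 0 < s -> s < e1 -> box y -> s * (meval y f - c s) <= meval y (grad2 f)].
Proof.
have [x [e1 [e10 e11 Lx xc xm]]] :=
  tame_selection def_Ls ltr01 (fun s _ _ => conj (@Ls_compact s) (Ls_nonempty s)).
have bx s : 0 < s -> s < e1 -> box (x s) by move=> s0 se; exact: Ls_box (Lx s s0 se).
pose c s := meval (x s) f.
have c0 s : 0 <= c s by exact: f_ge0.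
have b0 : box (fun=> 0) by move=> i; rewrite normr0 ltW.
have G0 : meval (fun=> 0) (grad2 f) = 0.
  rewrite meval_grad2 big1 // => i _; pose u k : R := (k == i)%:R.
  have := @poly_min_interior R (line_poly (fun=> 0) u f) 1 ltr01.
  rewrite line_coef1 (bigD1 i) //= /u eqxx mul1r big1 ?addr0 => [->|k /negPf ->]; last by rewrite mul0r.
    by rewrite expr0n.
  move=> t _; rewrite !horner_line.
  have -> : (fun k => 0 + (k == i)%:R * 0) = (fun=> 0 : R) by apply/funext => k; rewrite mulr0 addr0.
  by rewrite f0 f_ge0.
have Gc s : 0 < s -> s < e1 -> meval (x s) (grad2 f) <= s * c s.
  by move=> s0 se; have := Ls_min (Lx s s0 se) b0; rewrite f0 mulr0 subr0 G0 subr_le0.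
(* Adding the two minimality inequalities gives (t - s)(c s - c t) <= 0. *)
have cm s t : 0 < s -> s <= t -> t < e1 -> c s <= c t.
  rewrite [s <= t]le_eqVlt => s0 /orP [/eqP -> //|st] te; have se := lt_trans st te.
  have t0 := lt_trans s0 st.
  have h1 := Ls_min (Lx s s0 se) (bx t t0 te); have h2 := Ls_min (Lx t t0 te) (bx s s0 se).
  have : (t - s) * (c s - c t) <= 0 by rewrite /c; lra.
  by rewrite pmulr_rle0 ?subr_gt0 // subr_le0.
have /choice [z Hz] j := mono_limit e10 (xm j) (fun s s0 se => bx s s0 se j).
have zlim eta : 0 < eta -> exists2 d, 0 < d &
    forall s, 0 < s -> s < d -> s < e1 /\ forall j, `|x s j - z j| <= eta.
  move=> eta0; have /choice [d Hd] j : exists d, 0 < d /\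
      forall t, 0 < t -> t < d -> t < e1 /\ `|x t j - z j| <= eta.
    by have [d d0 H] := Hz j _ eta0; exists d.
  have [m m0 Hm] := fin_min (fun j => (Hd j).1).
  exists (Num.min m e1); first by rewrite lt_min m0.
  move=> s s0; rewrite lt_min => /andP [sm se]; split=> // j.
  by have [] := (Hd j).2 s s0 (lt_le_trans sm (Hm j)).
have bz : box z.
  apply: box_limit => eta eta0; have h0 : 0 < eta / 2 by lra.
  have [d d0 Hd] := zlim _ h0; have d20 : 0 < d / 2 by lra.
  have [h1 h2] := Hd (d / 2) d20 ltac:(lra); exists (x (d / 2)); first exact: bx.
  by move=> i; have := h2 i; lra.
have plim p eta : 0 < eta -> exists2 d, 0 < d &
    forall s, 0 < s -> s < d -> s < e1 /\ `|meval (x s) p - meval z p| <= eta.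
  move=> eta0; have [L L0 HL] := mpoly_lipschitz (absR_absolute_value R) p dl.
  have [d d0 Hd] := zlim _ (divr_gt0 eta0 L0); exists d => // s s0 sd.
  have [se H] := Hd s s0 sd; split=> //.
  have := HL (x s) z _ (bx s s0 se) bz H (ltW (divr_gt0 eta0 L0)).
  by rewrite /absR mulrCA mulfV ?mulr1 // gt_eqF.
have [F F0 HF] := mpoly_bounded (absR_absolute_value R) f dl.
(* G (x s) <= s c(s) tends to 0, so z is critical and [no_crit] applies. *)
have fz : meval z f = 0.
  apply/eqP; rewrite eq_le f_ge0 andbT; apply: no_crit => //.
  apply/eqP; rewrite eq_le grad2_ge0 andbT; apply/ler_addgt0Pr => ee ee0; rewrite add0r.
  have h0 : 0 < ee / 2 by lra.
  have [d d0 Hd] := plim (grad2 f) _ h0.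
  have FF0 : 0 < ee / 2 / F by rewrite divr_gt0.
  pose s := Num.min d (ee / 2 / F) / 2.
  have m0 : 0 < Num.min d (ee / 2 / F) by rewrite lt_min d0.
  have s0 : 0 < s by rewrite /s; lra.
  have sm : s < Num.min d (ee / 2 / F) by rewrite /s; lra.
  move: sm; rewrite lt_min => /andP [sd sF]; have [se H] := Hd s s0 sd.
  have h1 := Gc s s0 se; have h2 : s * c s <= ee / 2.
    apply: (@le_trans _ _ (s * F)).
      by rewrite ler_pM2l //; apply: le_trans (ler_norm _) (HF _ (bx s s0 se)).
    by rewrite -ler_pdivlMr // ltW.
  by move: H; rewrite ler_norml => /andP [H _]; lra.
have [q [C [C0 Hq Hb]]] := face_bound.
have /choice [kr Hkr] (tj : {ffun 'I_N -> option bool} * 'I_N) : exists kr : R * R,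
  [/\ 0 < kr.1, 0 < kr.2 & forall t, `|t - z tj.2| <= kr.2 ->
   kr.1 * `|t - z tj.2| ^+ Bz <= `|(q tj.1 tj.2).[t]|].
  have [q0 sq] := Hq tj.1 tj.2; have [kp [r [h1 h2 h3]]] := root_order (z tj.2) q0 sq.
  by exists (kp, r).
have kr1 tj : 0 < (kr tj).1 by have [] := Hkr tj.
have kr2 tj : 0 < (kr tj).2 by have [] := Hkr tj.
have [kp kp0 Hkp] := fin_min kr1.
have [r r0 Hr] := fin_min kr2.
have [e2 e20 He2] := zlim r r0.
pose V s := \sum_j `|x s j - z j|.
have [e3 [e30 e32 e31]] : exists e3, [/\ 0 < e3, e3 <= e2 & e3 <= 1].
  by exists (Num.min e2 1); rewrite lt_min e20 ltr01 !ge_min !lexx orbT.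
pose C2 := N%:R ^+ Bz * (C / kp).
(* The coordinates are O(s)-approximate roots of polynomials of degree at most Bz, so they are
   within O(s^(1/Bz)) of their limits. *)
have VB s : 0 < s -> s < e3 -> V s ^+ Bz <= C2 * s.
  move=> s0 se3; have [se H] := He2 s s0 (lt_le_trans se3 e32).
  rewrite /C2 -mulrA; apply: sum_pow_le => [|//|j]; first by rewrite expn_gt0.
  have [t Ht] := Hb s (x s) s0 (ltW (lt_le_trans se3 e31)) (Lx s s0 se).
  have [k0 _ Hk] := Hkr (t, j).
  rewrite mulrAC ler_pdivlMr // mulrC.
  apply: le_trans (Ht j); apply: le_trans (Hk _ (le_trans (H j) (Hr (t, j)))).
  by rewrite ler_wpM2r // ?exprn_ge0 // Hkp.
(* [chain] from a to b with gradient bound sqrt(b c(b)), valid since c is nondecreasing; then a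
   tends to 0, where f tends to f z = 0. *)
have cV b : 0 < b -> b < e3 -> c b <= Num.sqrt (b * c b) * V b.
  move=> b0' be3; have [be _] := He2 b b0' (lt_le_trans be3 e32).
  set K := Num.sqrt _; have K0 : 0 <= K by exact: sqrtr_ge0.
  apply/ler_addgt0Pr => ee ee0; pose KN := K * N%:R + 1.
  have KN0 : 0 < KN by rewrite /KN ltr_wpDl // mulr_ge0.
  have h0 : 0 < ee / 2 by lra.
  have [d1 d10 Hd1] := plim f _ h0; have [d2 d20 Hd2] := zlim _ (divr_gt0 h0 KN0).
  pose m := Num.min (Num.min d1 d2) b; have m0 : 0 < m by rewrite !lt_min d10 d20.
  have a0 : 0 < m / 2 by lra.
  have : m / 2 < m by lra.
  rewrite {2}/m !lt_min; set a := m / 2 => /andP [/andP [ad1 ad2] ab].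
  have [_ ha1] := Hd1 a a0 ad1; have [_ ha2] := Hd2 a a0 ad2.
  have gr s : a <= s -> s <= b -> forall i, `|meval (x s) (mderiv i f)| <= K.
    move=> as' sb i; have s0 : 0 < s := lt_le_trans a0 as'; have se := le_lt_trans sb be.
    rewrite -sqrtr_sqr ler_wsqrtr //; apply: le_trans (grad2_coord _ _ _) _.
    apply: le_trans (Gc s s0 se) _; apply: ler_pM => //; [exact: ltW|exact: cm].
  have := chain bx xc xm (p := f) K0 a0 (ltW ab) be gr.
  have Va : V a <= N%:R * (ee / 2 / KN).
    apply: (@le_trans _ _ (\sum_(i < N) (ee / 2 / KN))); first by apply: ler_sum => i _; exact: ha2.
    by rewrite sumr_const card_ord mulr_natl.
  have Vab : \sum_i `|x b i - x a i| <= V b + V a.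
    rewrite /V -big_split; apply: ler_sum => i _ /=.
    by rewrite [`|x a i - _|]distrC; exact: ler_distD.
  have h1 : K * \sum_i `|x b i - x a i| <= K * V b + K * V a.
    by rewrite -mulrDr; exact: ler_wpM2l.
  have h2 : K * V a <= ee / 2.
    apply: le_trans (ler_wpM2l K0 Va) _.
    have E : K * (N%:R * (ee / 2 / KN)) = K * N%:R * (ee / 2 / (K * N%:R + 1)) by exact: mulrA.
    rewrite E.
    have K1 : 0 <= K * N%:R by exact: mulr_ge0.
    exact: (mul_shrink K1 (ltW h0)).
  move: ha1; rewrite fz subr0 => ha1; have := ler_norm (meval (x a) f).
  rewrite -/(c a) -/(c b) => h3 h4; rewrite -/(c a) in ha1.
  by lra.
exists (C2 ^+ 2 + 1), e3, c; split=> //.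
- by rewrite ltr_wpDl // sqr_ge0.
- move=> s s0 se3; split=> //; have [se _] := He2 s s0 (lt_le_trans se3 e32).
  have [cs0|cs0] := eqVneq (c s) 0.
    by rewrite cs0 expr0n eqn0Ngt expn_gt0 mulr_ge0 ?addr_ge0 ?sqr_ge0 // exprn_ge0 // ltW.
  have cp : 0 < c s by rewrite lt0r cs0 c0.
  have V0 : 0 <= V s by apply: sumr_ge0.
  (* Square the previous bound and cancel one factor c(s). *)
  have h : c s <= s * V s ^+ 2.
    rewrite -(ler_pM2l cp) mulrA [c s * s]mulrC -{1}(sqr_sqrtr (ltW (mulr_gt0 s0 cp))) -exprMn -expr2.
    by rewrite lerXn2r ?nnegrE ?mulr_ge0 ?sqrtr_ge0 // cV.
  apply: (@le_trans _ _ ((s * V s ^+ 2) ^+ Bz)).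
    by rewrite lerXn2r ?nnegrE // mulr_ge0 ?sqr_ge0 // ltW.
  have -> : (s * V s ^+ 2) ^+ Bz = s ^+ Bz * (V s ^+ Bz) ^+ 2 by rewrite exprMn -!exprM mulnC.
  have -> : (C2 ^+ 2 + 1) * s ^+ (Bz + 2) = s ^+ Bz * ((C2 ^+ 2 + 1) * s ^+ 2).
    by rewrite exprD mulrCA.
  have s0' := ltW s0; apply: ler_wpM2l; first exact: exprn_ge0.
  apply: (@le_trans _ _ ((C2 * s) ^+ 2)).
    by rewrite lerXn2r ?nnegrE ?exprn_ge0 ?VB // (le_trans _ (VB s s0 se3)) // exprn_ge0.
  by rewrite exprMn ler_wpM2r ?sqr_ge0 // lerDl.
- move=> s y s0 se3 By; have [se _] := He2 s s0 (lt_le_trans se3 e32).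
  by have := Ls_min (Lx s s0 se) By; have := grad2_ge0 f (x s); rewrite -/(c s); lra.
Qed.

(** Optimise G(y) >= s (f(y) - c(s)) over s: for c(s) at most half of f(y) one gets G(y) >= s f(y) /
    2. *)
Lemma gradient_power : exists C d : R, [/\ 0 < C, 0 < d, d <= dl &
  forall y, (forall i, `|y i| <= d) ->
    C * meval y f ^+ (2 * Bz.+1) <= meval y (grad2 f) ^+ (Bz + 2)].
Proof.
have [C [e1 [c [C0 e10 Hc Hg]]]] := value_bound.
have [L L0 HL] := mpoly_lipschitz (absR_absolute_value R) f dl.
pose m := Num.min 1 (C * e1 ^+ (Bz + 2)).
have m0 : 0 < m by rewrite lt_min ltr01 mulr_gt0 // exprn_gt0.
exists ((2 ^+ (2 * Bz.+1) * C)^-1), (Num.min dl (m / L)); split.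
- by rewrite invr_gt0 mulr_gt0 // exprn_gt0.
- by rewrite lt_min dl_gt0 divr_gt0.
- by rewrite ge_min lexx.
move=> y yd; have By : box y by move=> i; apply: le_trans (yd i) _; rewrite ge_min lexx.
have Bz0 : (0 < Bz)%N by rewrite expn_gt0.
have G0 := grad2_ge0 f y.
have [F0|F0] := eqVneq (meval y f) 0.
  by rewrite F0 expr0n /= mulr0 exprn_ge0.
have {}F0 : 0 < meval y f by rewrite lt0r F0 f_ge0.
set F := meval y f in F0 *; pose h := F / 2; have h0 : 0 < h by rewrite divr_gt0.
have Fm : F <= m.
  have b0 : box (fun=> 0) by move=> i; rewrite normr0 ltW.
  have := HL y (fun=> 0) (m / L) By b0 _ (ltW (divr_gt0 m0 L0)).
  rewrite f0 subr0 /absR mulrCA mulfV ?mulr1 ?gt_eqF // -/F => H.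
  apply: le_trans (ler_norm _) (H _) => i; rewrite subr0; apply: le_trans (yd i) _.
  by rewrite ge_min lexx orbT.
have hm : h < m by rewrite /h; lra.
(* Solves C s^(Bz+2) = h^Bz, so that the bound on c gives c(s) <= h, half of f(y). *)
pose s := powR (h ^+ Bz / C) (Bz + 2)%:R^-1.
have hC0 : 0 < h ^+ Bz / C by rewrite divr_gt0 // exprn_gt0.
have s0 : 0 < s by rewrite powR_gt0.
have sE : s ^+ (Bz + 2) = h ^+ Bz / C.
  by rewrite -powR_mulrn ?ltW // -powRrM mulVf ?powRr1 ?ltW // pnatr_eq0 addn2.
have se : s < e1.
  rewrite ltNge; apply/negP => es.
  have : e1 ^+ (Bz + 2) <= s ^+ (Bz + 2) by rewrite lerXn2r ?nnegrE // ltW.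
  rewrite sE ler_pdivlMr // mulrC leNgt => /negP; apply.
  move: hm; rewrite lt_min => /andP [h1 hC]; apply: le_lt_trans hC.
  rewrite -[X in _ <= X]expr1 ler_wiXn2l //; exact: ltW.
have [c0 cB] := Hc s s0 se.
have ch : c s <= h.
  move: cB; rewrite sE mulrCA mulfV ?gt_eqF // mulr1.
  by rewrite ler_pXn2r // ?nnegrE // ltW.
have GF : s * h <= meval y (grad2 f).
  apply: le_trans (Hg s y s0 se By); rewrite ler_pM2l // -/F.
  by move: ch; rewrite /h; lra.
have : (s * h) ^+ (Bz + 2) <= meval y (grad2 f) ^+ (Bz + 2).
  by rewrite lerXn2r ?nnegrE // mulr_ge0 ?ltW.
apply: le_trans; rewrite exprMn sE mulrAC -exprD.
have E k : (k + (k + 2) = 2 * k.+1)%N by rewrite mul2n -addnn addn2 !addnS addSn.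
rewrite E.
by rewrite /h expr_div_n invfM mulrC mulrA.
Qed.

End Legendre.

(** * From the gradient inequality to a bound by the distance *)

Lemma deg_le_mderiv (A : comNzRingType) n (p : mpoly n A) T i :
  deg_le p T.+1 -> deg_le (mderiv i p) T.
Proof.
move=> pT m; rewrite mcoeff_mderiv => H.
have /pT : mcoeff (mnm_add m (mnm1 i)) p != 0.
  by apply: contraNneq H => ->; rewrite mul0rn.
by rewrite mdegD mdeg1 addn1.
Qed.

Lemma bernoulli_sub (R : realType) (a h : R) n : 0 <= h -> h <= a ->
  a ^+ n.+1 - n.+1%:R * a ^+ n * h <= (a - h) ^+ n.+1.
Proof.
move=> h0 ha; have a0 : 0 <= a := le_trans h0 ha.
elim: n => [|n IH]; first by rewrite !expr1 expr0 mulr1 mul1r.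
rewrite [X in _ <= X]exprS; apply: le_trans (ler_wpM2l _ IH); last by rewrite subr_ge0.
have : 0 <= n.+1%:R * a ^+ n * h ^+ 2 by rewrite !mulr_ge0 ?exprn_ge0 ?sqr_ge0.
have -> : n.+2%:R = n.+1%:R + 1 :> R by rewrite -natr1.
by rewrite [a ^+ n.+2]exprS [a ^+ n.+1]exprS; set u := a ^+ n; set v := n.+1%:R; lra.
Qed.

(* Ekeland's argument: on [S = {x | |x_i - y_i| <= K (phi y - phi x)}], with [phi = f ^ (1 / th)], a
   minimizer of [f] where [f] is positive could be improved by a small step along a coordinate. *)
Lemma gradient_descent (R : realType) N (f : mpoly N R) (n : nat) (m d : R) :
  (forall x, 0 <= meval x f) -> meval (fun=> 0) f = 0 -> 0 < m -> 0 < d ->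
  (forall x phi, (forall i, `|x i| <= d) -> 0 < phi -> phi ^+ n.+1 = meval x f ->
     exists i, m * phi ^+ n <= `|meval x (mderiv i f)|) ->
  exists C r, [/\ 0 < C, 0 < r & forall y, (forall i, `|y i| <= r) ->
    exists a, meval a f = 0 /\ forall i, C * `|y i - a i| ^+ n.+1 <= meval y f].
Proof.
move=> f_ge0 f0 m0 d0 Hg.
have root (t : R) : 0 <= t -> exists2 phi : R, 0 <= phi & phi ^+ n.+1 = t.
  move=> t0; exists (powR t n.+1%:R^-1); first exact: powR_ge0.
  by rewrite -powR_mulrn ?powR_ge0 // -powRrM mulVf ?powRr1 // pnatr_eq0.
(* The factor 2 leaves half of the first-order decrease of f to absorb the Taylor remainder. *)
pose K : R := 2 * n.+1%:R / m; have K0 : 0 < K by rewrite divr_gt0 // mulr_gt0.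
have [L L0 HL] := mpoly_lipschitz (absR_absolute_value R) f d.
have [T T0 HT] := mpoly_taylor (absR_absolute_value R) f d.
pose w := (d / (4 * K)) ^+ n.+1 / L.
have w0 : 0 < w by rewrite divr_gt0 // exprn_gt0 // divr_gt0 // mulr_gt0.
have r0 : 0 < Num.min (d / 4) w by rewrite lt_min divr_gt0.
exists ((K ^+ n.+1)^-1), (Num.min (d / 4) w); split=> //; first by rewrite invr_gt0 exprn_gt0.
move=> y yr; have yd i : `|y i| <= d / 4 by apply: le_trans (yr i) _; rewrite ge_min lexx.
have yd' i : `|y i| <= d by apply: le_trans (yd i) _; lra.
have [py py0 pyE] := root _ (f_ge0 y).
have pyd : K * py <= d / 4.
  rewrite mulrC -ler_pdivlMr // -mulrA -invfM.
  have dK : 0 <= d / (4 * K) by rewrite ltW // divr_gt0 // mulr_gt0.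
  rewrite leNgt; apply/negP => H.
  have : (d / (4 * K)) ^+ n.+1 < py ^+ n.+1 by rewrite ltr_pXn2r // ?nnegrE //.
  rewrite pyE ltNge => /negP; apply.
  have := HL y (fun=> 0) w yd' _ _ (ltW w0); rewrite f0 subr0 /absR => h.
  apply: le_trans (ler_norm _) _; apply: le_trans (h _ _) _ => [i|i|].
  - by rewrite normr0 ltW.
  - by rewrite subr0; apply: le_trans (yr i) _; rewrite ge_min lexx orbT.
  - by rewrite /w mulrCA mulfV ?mulr1 // gt_eqF.
(* S is cut out by polynomial inequalities: the bound on phi is written as 0 <= ell and f <=
   ell^(n+1), which avoids the root. *)
pose ell i (b : bool) : mpoly N R :=
  mpolyC N py - ((-1) ^+ b / K) *: (mpolyX R (mnm1 i) - mpolyC N (y i)).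
have ellE x i b : meval x (ell i b) = py - (-1) ^+ b / K * (x i - y i).
  by rewrite /ell mevalB mevalZ mevalB !mevalC mevalXU.
pose S x := [/\ forall i, `|x i| <= d, forall ib : 'I_N * bool, 0 <= meval x (ell ib.1 ib.2) &
  forall ib : 'I_N * bool, meval x f <= meval x (ell ib.1 ib.2) ^+ n.+1].
have SP x phi : (forall i, `|x i| <= d) -> 0 <= phi -> phi ^+ n.+1 = meval x f ->
    (S x <-> forall i, `|x i - y i| <= K * (py - phi)).
  move=> xd p0 pE; split=> [[_ S1 S2] i|H].
    have h (b : bool) : phi <= py - (-1) ^+ b / K * (x i - y i).
      by rewrite -(ellE x i b) -(@ler_pXn2r _ n.+1) ?nnegrE ?(S1 (i, b)) // pE (S2 (i, b)).
    rewrite ler_norml mulrC -lerNl -!ler_pdivrMr //.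
    by have := h true; have := h false; rewrite expr0 expr1; lra.
  have h i (b : bool) : phi <= py - (-1) ^+ b / K * (x i - y i).
    have := H i; rewrite ler_norml mulrC -lerNl -!ler_pdivrMr // => /andP [].
    by case: b; rewrite ?expr0 ?expr1; lra.
  split=> // -[i b] /=; rewrite ellE; first exact: le_trans (h i b).
  by rewrite -pE lerXn2r ?nnegrE ?h //; exact: le_trans (h i b).
have Sy : S y by apply/(SP y py) => // i; rewrite !subrr mulr0 normr0.
have cS : compact (rowset S).
  have -> : rowset S = rowset (fun x => forall i, `|x i| <= d) `&`
     ((\bigcap_(ib in [set: 'I_N * bool]) rowset (fun x => meval x (- ell ib.1 ib.2) <= 0)) `&`
      \bigcap_(ib in [set: 'I_N * bool])
        rowset (fun x => meval x (f - ell ib.1 ib.2 ^+ n.+1) <= 0)).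
    apply/seteqP; split=> v /=.
      move=> [h1 h2 h3]; split=> //; split=> ib _ /=.
        by rewrite /rowset /= mevalN oppr_le0; exact: h2.
      by rewrite /rowset /= mevalB rmorphXn /= subr_le0; exact: h3.
    move=> [h1 [h2 h3]]; split=> // ib.
      by have := h2 ib I; rewrite /rowset /= mevalN oppr_le0.
    by have := h3 ib I; rewrite /rowset /= mevalB rmorphXn /= subr_le0.
  apply: compact_closedI; first exact: compact_box.
  by apply: closedI; apply: closed_bigI => ib _; exact: closed_meval_le.
have [a Sa Ha] := compact_min f cS (ex_intro _ y Sy).
have ad : forall i, `|a i| <= d by case: Sa.
have [pa pa0 paE] := root _ (f_ge0 a).
have /(SP a pa ad pa0 paE) aK := Sa.
have ady i : `|a i| <= d / 2.
  have := ler_normD (a i - y i) (y i); rewrite subrK => /le_trans; apply.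
  have := aK i; have := yd i; have : 0 <= K * pa by rewrite mulr_ge0 // ltW.
  by rewrite mulrBr; move: pyd; lra.
exists a; split; last first.
  move=> i; rewrite distrC ler_pdivrMl ?exprn_gt0 // -pyE -exprMn.
  have K0' := ltW K0; apply: lerXn2r; [by rewrite nnegrE|by rewrite nnegrE mulr_ge0|apply: le_trans (aK i) _].
  by rewrite ler_pM2l // lerBlDr lerDl.
apply/eqP/negPn/negP => fa; have {}fa : 0 < meval a f by rewrite lt0r fa f_ge0.
have {}pa0 : 0 < pa.
  rewrite lt0r pa0 andbT; apply/eqP => p0; move: fa.
  by rewrite -paE p0 expr0n ltxx.
have [i Hi] := Hg a pa ad pa0 paE; set g := meval a (mderiv i f) in Hi.
have pn0 : 0 < pa ^+ n by rewrite exprn_gt0.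
(* The step stays inside the box, keeps pa - t/K nonnegative, and makes the quadratic remainder at
   most a quarter of the linear gain. *)
pose t := Num.min (Num.min (d / 2) (K * pa)) (m * pa ^+ n / (4 * T)).
have t0 : 0 < t.
  by rewrite /t !lt_min (divr_gt0 d0) ?(mulr_gt0 K0 pa0) ?divr_gt0 ?mulr_gt0 ?ltr0n.
have [td tK tT] : [/\ t <= d / 2, t <= K * pa & t <= m * pa ^+ n / (4 * T)].
  by rewrite /t !ge_min !lexx !orbT.
pose sg : R := if 0 <= g then -1 else 1.
have sg1 : `|sg| = 1 by rewrite /sg; case: ifP; rewrite ?normrN normr1.
have sgg : sg * g = - `|g|.
  by rewrite /sg; case: ltrgt0P => h; rewrite ?mulN1r // ?mul1r ?opprK // h oppr0 ?mulr0.
pose x j := a j + (j == i)%:R * (sg * t).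
have xa j : `|x j - a j| <= t.
  rewrite /x addrAC subrr add0r normrM normrM sg1 mul1r (gtr0_norm t0).
  by case: (j == i); rewrite ?normr1 ?normr0 ?mul1r ?mul0r // ltW.
have xd j : `|x j| <= d.
  have := ler_normD (x j - a j) (a j); rewrite subrK => /le_trans; apply.
  by have := xa j; have := ady j; lra.
have fx : meval x f <= meval a f - m * pa ^+ n * t + T * t ^+ 2.
  have := HT a x t ad xd xa (ltW t0).
  have -> : \sum_j (x j - a j) * meval a (mderiv j f) = sg * t * g.
    rewrite (bigD1 i) //= /x eqxx mul1r addrAC subrr add0r big1 ?addr0 // => j /negPf ->.
    by rewrite mul0r addr0 subrr mul0r.
  rewrite mulrAC sgg /absR => /(le_trans (ler_norm _)).
  have : m * pa ^+ n * t <= `|g| * t by rewrite ler_wpM2r // ltW.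
  by rewrite mulNr; lra.
have tT2 : T * t ^+ 2 <= m * pa ^+ n * t / 4.
  have : t * (4 * T) <= m * pa ^+ n by rewrite -ler_pdivlMr // mulr_gt0.
  by rewrite expr2; have := t0; nra.
have pT0 : 0 < m * pa ^+ n * t by rewrite !mulr_gt0.
have fxa : meval x f < meval a f by lra.
have [px px0 pxE] := root _ (f_ge0 x).
have pxa : px <= pa - t / K.
  have tKa : t / K <= pa by rewrite ler_pdivrMr // mulrC.
  rewrite -(@ler_pXn2r _ n.+1) ?nnegrE ?subr_ge0 // pxE.
  apply: le_trans (bernoulli_sub n (ltW (divr_gt0 t0 K0)) tKa).
  rewrite paE; apply: le_trans fx _.
  have -> : n.+1%:R * pa ^+ n * (t / K) = m * pa ^+ n * t / 2.
    have : n.+1%:R != 0 :> R by rewrite pnatr_eq0.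
    rewrite /K; move: (n.+1%:R) => n1 n10; field.
    by rewrite n10 (gt_eqF m0).
  lra.
suff /Ha : S x by rewrite leNgt fxa.
apply/(SP x px xd px0 pxE) => j.
have := ler_normD (x j - a j) (a j - y j); rewrite addrA subrK => /le_trans; apply.
apply: le_trans (lerD (xa j) (aK j)) _.
have : K * (px + t / K) <= K * pa by rewrite ler_pM2l // -lerBrDr.
by rewrite !mulrBr mulrDr mulrCA mulfV ?gt_eqF // mulr1; lra.
Qed.

Lemma powR_root (R : realType) (n : nat) (t : R) : 0 <= t -> exists2 s : R, 0 <= s & s ^+ n.+1 = t.
Proof.
move=> t0; exists (powR t n.+1%:R^-1); first exact: powR_ge0.
by rewrite -powR_mulrn ?powR_ge0 // -powRrM mulVf ?powRr1 // pnatr_eq0.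
Qed.

Definition zero_bound (R : realType) N (f : mpoly N R) (th : nat) := exists C r : R,
  [/\ 0 < C, 0 < r & forall y, (forall i, `|y i| <= r) ->
    exists a, meval a f = 0 /\ forall i, C * `|y i - a i| ^+ th <= meval y f].

Lemma zero_bound_weaken (R : realType) N (f : mpoly N R) th th' : meval (fun=> 0) f = 0 ->
  (0 < th)%N -> (th <= th')%N -> zero_bound f th -> zero_bound f th'.
Proof.
move=> f0 th0 tt [C [r [C0 r0 H]]].
have [L L0 HL] := mpoly_lipschitz (absR_absolute_value R) f r.
exists C, (Num.min r (C / L)); split=> //; first by rewrite lt_min r0 divr_gt0.
move=> y yd; have yr i : `|y i| <= r by apply: le_trans (yd i) _; rewrite ge_min lexx.
have fC : meval y f <= C.
  have := HL y (fun=> 0) (C / L) yr _ _ (ltW (divr_gt0 C0 L0)).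
  rewrite f0 subr0 /absR mulrCA mulfV ?mulr1 ?gt_eqF // => h.
  apply: le_trans (ler_norm _) (h _ _) => i; first by rewrite normr0 ltW.
  by rewrite subr0; apply: le_trans (yd i) _; rewrite ge_min lexx orbT.
have [a [fa Ha]] := H y yr; exists a; split=> // i; apply: le_trans (Ha i).
rewrite ler_pM2l // ler_wiXn2l //.
rewrite leNgt; apply/negP => h1; move: (le_trans (Ha i) fC).
by rewrite -[X in _ <= X]mulr1 ler_pM2l // leNgt exprn_egt1 // -lt0n th0.
Qed.

(** The gradient of f has degree at most D + 1, that of |grad f|^2 at most 2D + 1, hence the base.
    [gradient_power] gives |grad f| >= C f^(1 - 1/(Bz+2)), the hypothesis of [gradient_descent] for
    some coordinate. *)
Theorem zero_bound_legendre (R : realType) N D (f : mpoly N R) :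
  (forall x, 0 <= meval x f) -> meval (fun=> 0) f = 0 -> deg_le f D.+2 ->
  zero_bound f ((D.*2.+1 ^ N) + 2).
Proof.
move=> f_ge0 f0 df; set e := D.*2; set Bz := (e.+1 ^ N)%N.
have dB i : deg_le (mderiv i f) D.+1 by exact: deg_le_mderiv.
have B_deg i : deg_le (mderiv i f) e.+1.
  by apply: deg_leW (dB i); rewrite ltnS /e -addnn leq_addr.
have A_deg i : deg_le (mderiv i (grad2 f)) e.+1.
  apply: deg_le_mderiv; apply: deg_le_sum => j _.
  have h : deg_le (mderiv j f ^+ 2) (D.+1 * 2) by exact: deg_le_exp (dB j).
  apply: deg_leW h.
  by rewrite /e muln2 doubleS.
have [dl1 dl10 Hcrit] := no_critical f0.
have dl0 : 0 < Num.min dl1 1 by rewrite lt_min dl10 ltr01.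
have [||C [d [C0 d0 _ Hgp]]] := gradient_power f_ge0 f0 A_deg B_deg dl0.
- by rewrite ge_min lexx orbT.
- by move=> x xd; apply: Hcrit => i; apply: le_trans (xd i) _; rewrite ge_min lexx.
have [q q0 qE] := powR_root Bz.+1 (ltW C0).
have {}q0 : 0 < q.
  by rewrite lt0r q0 andbT; apply/eqP => qq; move: C0; rewrite -qE qq expr0n ltxx.
have N0 : 0 < N.+1%:R :> R by rewrite ltr0n.
have qN : 0 < q / N.+1%:R by rewrite divr_gt0.
rewrite addn2; apply: (gradient_descent (m := Num.sqrt (q / N.+1%:R)) (d := d)) => //.
  by rewrite sqrtr_gt0.
move=> x phi xd phi0 phiE; apply: contrapT => H.
have E : (phi ^+ Bz.+2) ^+ (2 * Bz.+1) = (phi ^+ (2 * Bz.+1)) ^+ Bz.+2.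
  by rewrite -!exprM mulnC.
have := Hgp x xd; rewrite -phiE -qE E -exprMn addn2 => hq.
have hG : q * phi ^+ (2 * Bz.+1) <= meval x (grad2 f).
  rewrite -(@ler_pXn2r _ Bz.+2) ?nnegrE ?grad2_ge0 //.
  by rewrite mulr_ge0 ?exprn_ge0 // ltW.
have p0 : 0 < phi ^+ Bz.+1 by rewrite exprn_gt0.
have hi i : meval x (mderiv i f) ^+ 2 <= q / N.+1%:R * phi ^+ (2 * Bz.+1).
  have : `|meval x (mderiv i f)| <= Num.sqrt (q / N.+1%:R) * phi ^+ Bz.+1.
    by rewrite leNgt; apply/negP => h; apply: H; exists i; exact: ltW.
  rewrite -(@ler_pXn2r _ 2) ?nnegrE ?mulr_ge0 ?sqrtr_ge0 ?(ltW p0) //.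
  by rewrite real_normK ?num_real // exprMn sqr_sqrtr ?(ltW qN) // -exprM mulnC.
move: hG; rewrite meval_grad2 leNgt => /negP; apply.
apply: (@le_lt_trans _ _ (\sum_(i < N) q / N.+1%:R * phi ^+ (2 * Bz.+1))); first exact: ler_sum.
rewrite sumr_const card_ord -[_ *+ N]mulr_natl mulrA ltr_pM2r ?exprn_gt0 //.
by rewrite mulrCA -[X in _ < X]mulr1 ltr_pM2l // ltr_pdivrMr // mul1r ltr_nat.
Qed.

(** * Distance bound on a polar curve, and descent to it *)

Lemma path_limit (R : realType) (N : nat) (x : R -> 'I_N -> R) (e1 B : R) : 0 < e1 ->
  (forall j, monotone_on (fun s => x s j) e1) ->
  (forall s, 0 < s -> s < e1 -> forall j, `|x s j| <= B) ->
  exists z, forall eta, 0 < eta -> exists2 d, 0 < d &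
    forall s, 0 < s -> s < d -> s < e1 /\ forall j, `|x s j - z j| <= eta.
Proof.
move=> e10 xm xb; have /choice [z Hz] j := mono_limit e10 (xm j) (fun s s0 se => xb s s0 se j).
exists z => eta eta0; have /choice [d Hd] j : exists d, 0 < d /\
    forall t, 0 < t -> t < d -> t < e1 /\ `|x t j - z j| <= eta.
  by have [d d0 H] := Hz j _ eta0; exists d.
have [m m0 Hm] := fin_min (fun j => (Hd j).1).
exists (Num.min m e1); first by rewrite lt_min m0.
move=> s s0; rewrite lt_min => /andP [sm se]; split=> // j.
by have [] := (Hd j).2 s s0 (lt_le_trans sm (Hm j)).
Qed.

(** Such a set is an intersection of closed polynomial half-spaces; this suits sets defined by
    infinitely many inequalities. *)
Lemma closed_poly_hull (R : realType) N (A : ('I_N -> R) -> Prop) :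
  (forall v, (forall q c, (forall w, A w -> meval w q <= c) -> meval v q <= c) -> A v) ->
  closed (rowset A).
Proof.
move=> H; have -> : rowset A = \bigcap_(qc in [set qc : mpoly N R * R |
    forall w, A w -> meval w qc.1 <= qc.2]) rowset (fun v => meval v qc.1 <= qc.2).
  apply/seteqP; split=> v /= Av; first by move=> [q c] /= h; apply: h.
  by apply: H => q c h; exact: (Av (q, c)).
by apply: closed_bigI => qc _; exact: closed_meval_le.
Qed.

Lemma meval_near0 (R : realType) N (f : mpoly N R) (e : R) : meval (fun=> 0) f = 0 -> 0 < e ->
  exists r : R, [/\ 0 < r, r <= 1 & forall x, (forall i, `|x i| <= r) -> meval x f < e].
Proof.
move=> f0 e0; have [L L0 HL] := mpoly_lipschitz (absR_absolute_value R) f 1.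
have L2 : 0 < 2 * L by rewrite mulr_gt0.
exists (Num.min 1 (e / (2 * L))); split; [by rewrite lt_min ltr01 divr_gt0|by rewrite ge_min lexx|].
move=> x xr; have x1 i : `|x i| <= 1 by apply: le_trans (xr i) _; rewrite ge_min lexx.
have := HL x (fun=> 0) (e / (2 * L)) x1.
rewrite f0 subr0 /absR => h; apply: le_lt_trans (ler_norm _) _.
apply: (@le_lt_trans _ _ (e / 2)); last by rewrite ltr_pdivrMr // ltr_pMr // ltr1n.
have -> : e / 2 = L * (e / (2 * L)) by field; rewrite gt_eqF.
apply: h => [i|i|]; rewrite ?normr0 // ?subr0; last by rewrite ltW // divr_gt0.
by apply: le_trans (xr i) _; rewrite ge_min lexx orbT.
Qed.

Section CurveBound.
Variables (R : realType) (N K Lq : nat) (f p : mpoly N R).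
Hypothesis f_ge0 : forall x, 0 <= meval x f.
Hypothesis f0 : meval (fun=> 0) f = 0.
Variable Q : 'I_N -> 'I_K -> {poly R}.
Hypothesis Q_neq0 : forall j, exists k, Q j k != 0.
Hypothesis Q_deg : forall j k, (size (Q j k) <= Lq.+2)%N.
Hypothesis Q_rel : forall j x, meval x p = 0 -> \sum_k (Q j k).[x j] * meval x f ^+ k = 0.

(* On the curve [p = 0], [q_j (x_j) = O (f x)] for the lowest nonzero coefficient [q_j] of the
   relation between [f x] and [x_j]. *)
Let low_coef j : exists q : {poly R}, [/\ q != 0, (size q <= Lq.+2)%N &
  exists C, 0 < C /\ forall x, (forall i, `|x i| <= 1) -> meval x p = 0 -> 0 < meval x f ->
    meval x f <= 1 -> `|q.[x j]| <= C * meval x f].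
Proof.
have [k1 Qk1] := Q_neq0 j.
have [k Qk Hk] := @arg_minnP _ k1 (fun k => Q j k != 0) val Qk1.
exists (Q j k); split=> //.
have /choice [B HB] l : exists B, 0 < B /\ forall t, `|t| <= 1 -> `|(Q j l).[t]| <= B.
  by have [B B0 H] := poly_bounded (absR_absolute_value R) (Q j l) 1; exists B.
exists (\sum_l B l + 1); split.
  by rewrite ltr_wpDl // sumr_ge0 // => l _; apply: ltW; case: (HB l).
move=> x x1 px fx fx1; set c := meval x f in fx fx1 *.
have := Q_rel j px; rewrite -/c (bigD1 k) //= => /eqP; rewrite addr_eq0 => /eqP E.
have ck : 0 < c ^+ k by rewrite exprn_gt0.
rewrite -(ler_pM2r ck) -{1}(gtr0_norm ck) -normrM E normrN.
apply: le_trans (ler_norm_sum _ _ _) _.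
apply: (@le_trans _ _ (\sum_(l < K | l != k) B l * (c * c ^+ k))).
  apply: ler_sum => l lk; have [B0 Bl] := HB l.
  have [->|Ql] := eqVneq (Q j l) 0.
    by rewrite horner0 mul0r normr0 !mulr_ge0 ?ltW.
  rewrite normrM; apply: ler_pM => //; first exact: Bl.
  have fx' := ltW fx; rewrite ger0_norm ?exprn_ge0 // -exprS; apply: ler_wiXn2l => //.
  by rewrite ltn_neqAle eq_sym lk Hk.
rewrite -mulr_suml -[X in _ <= X]mulrA; apply: ler_wpM2r; first by rewrite mulr_ge0 // ltW.
have [B0 _] := HB k; rewrite [X in _ <= X + _](bigD1 k) //= -addrA addrCA lerDl.
by rewrite addr_ge0 // ltW.
Qed.

Let lift_poly (q : mpoly N R) : mpoly N.+1 R :=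
  mmap (@mpolyC N.+1 R) (fun i => mpolyX R (mnm1 (lift ord0 i))) q.

Let tl (v : 'I_N.+1 -> R) : 'I_N -> R := fun i => v (lift ord0 i).

Let lift_polyE v q : meval v (lift_poly q) = meval (tl v) q.
Proof.
move: q; apply: mpoly_ring_ind => [c|i|q q' IHq IHq'|q q' IHq IHq']; rewrite /lift_poly.
- by rewrite mmapC !mevalC.
- by rewrite mmapX mmap1U !mevalXU.
- by rewrite raddfD /= !mevalD -!/(lift_poly _) IHq IHq'.
- by rewrite rmorphM /= !mevalM -!/(lift_poly _) IHq IHq'.
Qed.

(* [v = (u, x)] with [x] on the curve at the level [f x = s], and [- u] at most the squared distance
   from [x] to the zeros of [f]. *)
Let M (s : R) (v : 'I_N.+1 -> R) :=
  ((forall i, `|tl v i| <= 1) /\ (meval (tl v) p = 0 /\ meval (tl v) f = s)) /\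
  (v ord0 <= 0 /\ forall z, meval z f = 0 -> 0 <= nrm2 (fun i => tl v i - z i) + v ord0).

Let def_M : def_family M.
Proof.
have tlE rho : tl (block N.+1 rho 1) = block N rho 2 by apply/funext => i.
apply: (def_ext (P := fun rho => ((forall i, `|block N rho 2 i| <= 1) /\
    (meval (block N rho 2) p = 0 /\ meval (block N rho 2) f = rho 0%N)) /\
  (rho 1%N <= 0 /\ forall z, meval z f = 0 ->
    0 <= nrm2 (fun i => block N rho 2 i - z i) + rho 1%N))).
  by move=> rho; rewrite /M tlE.
apply: def_and; first apply: def_and (def_box _ _ _) _.
  apply: def_and; first exact: def_eq (tf_meval _ _) (tf_const _).
  exact: def_eq (tf_meval _ _) (tf_var R _).
apply: def_and; first exact: def_le (tf_var R _) (tf_const _).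
apply: (def_allb' (k := (2 + N)%N)) => [|rho x]; last by rewrite block_updb_lt ?updb_lt.
apply: def_imp (def_eq (tf_meval _ _) (tf_const _)) _.
apply: def_le (tf_const _) _; apply: tf_add (tf_var R _).
exact: tf_dist2.
Qed.

Let nrm2_box k (x : 'I_N -> R) : (forall i, `|x i| <= k) -> nrm2 x <= N%:R * k ^+ 2.
Proof.
move=> x1; rewrite /nrm2.
apply: (@le_trans _ _ (\sum_(i < N) k ^+ 2)); last by rewrite sumr_const card_ord mulr_natl.
apply: ler_sum => i _; rewrite -real_normK ?num_real //.
by apply: lerXn2r; rewrite ?nnegrE // (le_trans _ (x1 i)).
Qed.

Let M_compact s : compact (rowset (M s)).
Proof.
have -> : rowset (M s) = rowset (fun v => forall i, `|v i| <= N.+1%:R) `&` rowset (M s).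
  apply/seteqP; split=> [v Mv|v []] //; split=> // i.
  have [[b1 _] [u0 Hz]] := Mv.
  have N1 : 1 <= N.+1%:R :> R by rewrite ler1n.
  have [->|[j ->]] : i = ord0 \/ exists j, i = lift ord0 j.
  - by case: (unliftP ord0 i) => [j ->|->]; [right; exists j|left].
  - have := Hz _ f0; under eq_fun do rewrite subr0.
    have := nrm2_box b1; rewrite expr1n mulr1 -natr1 ler0_norm // => h1 h2.
    by move: h1 h2; set a := nrm2 _; lra.
  - exact: le_trans (b1 j) N1.
apply: compact_closedI; first exact: compact_box.
apply: closed_poly_hull => v H.
have eqH q c : (forall w, M s w -> meval (tl w) q = c) -> meval (tl v) q = c.
  move=> h; apply/eqP; rewrite eq_le -!lift_polyE; apply/andP; split.
    by apply: H => w /h; rewrite lift_polyE => ->.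
  by rewrite -lerN2 -mevalN; apply: H => w /h; rewrite mevalN lift_polyE => ->.
split; [split; [|split]|split].
- move=> i; rewrite ler_norml; apply/andP; split.
    have := H (- mpolyX R (mnm1 (lift ord0 i))) 1; rewrite mevalN mevalXU lerNl; apply.
    by move=> w [[/(_ i) + _] _]; rewrite ler_norml mevalN mevalXU lerNl => /andP [].
  have := H (mpolyX R (mnm1 (lift ord0 i))) 1; rewrite mevalXU; apply.
  by move=> w [[/(_ i) + _] _]; rewrite ler_norml mevalXU => /andP [].
- by apply: eqH => w [[_ []]].
- by apply: eqH => w [[_ []]].
- have := H (mpolyX R (mnm1 ord0)) 0; rewrite mevalXU; apply.
  by move=> w [_ [h _]]; rewrite mevalXU.
- move=> z fz; pose q : mpoly N.+1 R :=
    \sum_i (mpolyX R (mnm1 (lift ord0 i)) - mpolyC N.+1 (z i)) ^+ 2 + mpolyX R (mnm1 ord0).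
  have qE w : meval w q = nrm2 (fun i => tl w i - z i) + w ord0.
    rewrite /q mevalD mevalXU raddf_sum /=; congr (_ + _); apply: eq_bigr => i _.
    by rewrite rmorphXn /= mevalB mevalXU mevalC.
  have := H (- q) 0; rewrite mevalN qE oppr_le0; apply.
  by move=> w [_ [_ h]]; rewrite mevalN qE oppr_le0; apply: h.
Qed.

Let cons (u : R) (x : 'I_N -> R) : 'I_N.+1 -> R :=
  fun i => if unlift ord0 i is Some j then x j else u.

Let cons0 u x : cons u x ord0 = u.
Proof. by rewrite /cons unlift_none. Qed.

Let tl_cons u x : tl (cons u x) = x.
Proof. by apply/funext => i; rewrite /tl /cons liftK. Qed.

(** Follow, as the level s of f decreases, curve points farthest from the zeros of f. The path tends
    to a zero z, and the relations put it within O(s^(1/(Lq+1))) of z; every other curve point at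
    that level is at most as far from the zeros. If no small level is reached, f vanishes on the
    curve near 0. *)
Lemma curve_bound : exists C r : R, [/\ 0 < C, 0 < r &
  forall x, (forall i, `|x i| <= r) -> meval x p = 0 ->
    exists a, meval a f = 0 /\ forall i, C * `|x i - a i| ^+ Lq.+1 <= meval x f].
Proof.
have [L L0 HL] := mpoly_lipschitz (absR_absolute_value R) f 1.
have small e (e0 : 0 < e) := meval_near0 f0 e0.
have defE : definable (fun rho => exists v, M (rho 0%N) v).
  by apply: (def_exb' (k := 1)) => [//|rho x]; rewrite updb_lt.
have [b [d [d0 Hd]]] := def_eventually [::] 0 0 1 defE.
have Hb c : 0 < c -> c < d -> (exists x, M c x) <-> b.
  by move=> c0 cd; have := Hd c c0 cd; rewrite /= add0r mul1r.
case: b {Hd} Hb => Hb; last first.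
  have [r [r0 r1 Hr]] := small d d0.
  exists 1, r; split=> // x xr px; have [fx|fx] := eqVneq (meval x f) 0.
    by exists x; split=> // i; rewrite subrr normr0 expr0n /= mulr0 fx.
  suff : false by []; have {}fx : 0 < meval x f by rewrite lt0r fx f_ge0.
  apply/(Hb _ fx (Hr x xr)); exists (cons 0 x); rewrite /M tl_cons cons0; split.
    by split=> // i; exact: le_trans (xr i) r1.
  by split=> // z _; rewrite addr0 nrm2_ge0.
(* The coordinate of index 0 is minimised first: its negative is then the largest squared distance
   to the zeros at level s. *)
have [|v [e1 [e10 e1d Mv _ vm]]] := tame_selection (def_argmin_coord (ord0 : 'I_N.+1) def_M) d0.
  move=> s s0 sd; apply: argmin_coord_compact; first exact: M_compact.
  exact/(Hb s s0 sd).
have vb s : 0 < s -> s < e1 -> forall j, `|tl (v s) j| <= 1.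
  by move=> s0 se j; have [[[h _] _] _] := Mv s s0 se.
have [z Hz] := path_limit (x := fun s => tl (v s)) e10 (fun j => vm (lift ord0 j)) vb.
have zb i : `|z i| <= 1.
  apply/ler_addgt0Pr => ee ee0; have [d1 d10 Hd1] := Hz ee ee0.
  have h0 : 0 < d1 / 2 by lra.
  have [h1 h2] := Hd1 (d1 / 2) h0 ltac:(lra).
  have := vb _ h0 h1 i; have := h2 i; have := ler_distD (tl (v (d1 / 2)) i) (z i) 0.
  by rewrite !subr0 [`|z i - _|]distrC; lra.
have fz : meval z f = 0.
  apply/eqP; rewrite eq_le f_ge0 andbT; apply/ler_addgt0Pr => ee ee0; rewrite add0r.
  have h0 : 0 < ee / (2 * L) by rewrite divr_gt0 // mulr_gt0.
  have [d1 d10 Hd1] := Hz _ h0.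
  pose s := Num.min d1 ee / 2.
  have m0 : 0 < Num.min d1 ee by rewrite lt_min d10.
  have s0 : 0 < s by rewrite /s; lra.
  have sm : s < Num.min d1 ee by rewrite /s; lra.
  have s2 : s <= ee / 2 by have : Num.min d1 ee <= ee by [rewrite ge_min lexx orbT]; rewrite /s; lra.
  move: sm; rewrite lt_min => /andP [sd _]; have [se H] := Hd1 s s0 sd.
  have [[[_ [_ fs]] _] _] := Mv s s0 se.
  have := HL (tl (v s)) z _ (vb s s0 se) zb H (ltW h0).
  rewrite fs /absR distrC (_ : L * (ee / (2 * L)) = ee / 2); last by field; rewrite gt_eqF.
  by move=> h; have := ler_norm (meval z f - s); lra.
have /choice [q Hq] := low_coef.
have /choice [C HC] j := let: And3 _ _ h := Hq j in h.
have /choice [kr Hkr] j : exists kr : R * R, [/\ 0 < kr.1, 0 < kr.2 &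
   forall t, `|t - z j| <= kr.2 -> kr.1 * `|t - z j| ^+ Lq.+1 <= `|(q j).[t]|].
  have [q0 sq _] := Hq j; have [kp [r [h1 h2 h3]]] := root_order (z j) q0 sq.
  by exists (kp, r).
have kr1 j : 0 < (kr j).1 by have [] := Hkr j.
have kr2 j : 0 < (kr j).2 by have [] := Hkr j.
have [kp kp0 Hkp] := fin_min kr1.
have [r r0 Hr] := fin_min kr2.
have [Cm Cm1 HCm] := fin_max C; have Cm0 : 0 < Cm := lt_le_trans ltr01 Cm1.
have [e2 e20 He2] := Hz r r0.
have e30 : 0 < Num.min e2 1 by rewrite lt_min e20 ltr01.
have [r' [r'0 r'1 Hr']] := small _ e30.
have C20 : 0 < Cm / kp by rewrite divr_gt0.
exists ((N.+1%:R ^+ Lq.+1 * (Cm / kp))^-1), r'; split=> //.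
  by rewrite invr_gt0 mulr_gt0 // exprn_gt0.
move=> x xr px; have [fx|fx] := eqVneq (meval x f) 0.
  by exists x; split=> // i; rewrite subrr normr0 expr0n /= mulr0 fx.
have {fx} s0 : 0 < meval x f by rewrite lt0r fx f_ge0.
have := Hr' x xr; rewrite lt_min; set s := meval x f in s0 * => /andP [se2 s1].
have [se Hs] := He2 s s0 se2.
have [k k0 kE] := powR_root Lq (ltW (mulr_gt0 C20 s0)).
have {}k0 : 0 < k.
  by rewrite lt0r k0 andbT; apply/eqP => kk; have := mulr_gt0 C20 s0; rewrite -kE kk expr0n ltxx.
have vz j : `|tl (v s) j - z j| <= k.
  rewrite -(@ler_pXn2r _ Lq.+1) ?nnegrE ?(ltW k0) // kE mulrAC ler_pdivlMr // mulrC.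
  have [[[_ [pv fv]] _] _] := Mv s s0 se.
  have [C0 H] := HC j; have := H _ (vb s s0 se) pv; rewrite fv => /(_ s0 (ltW s1)) h.
  apply: (@le_trans _ _ (C j * s)); last by rewrite ler_pM2r // HCm.
  apply: le_trans h; have [_ _ hk] := Hkr j.
  apply: le_trans (hk _ (le_trans (Hs j) (Hr j))).
  by rewrite ler_wpM2r // ?exprn_ge0 // Hkp.
(* Otherwise (-(N+1) k^2, x) would belong to M s, although the zero z within k of the selected point
   keeps the minimum at least -N k^2. *)
have [a fa xa] : exists2 a, meval a f = 0 & nrm2 (fun i => x i - a i) < N.+1%:R * k ^+ 2.
  apply: contrapT => H.
  have Mw : M s (cons (- (N.+1%:R * k ^+ 2)) x).
    rewrite /M tl_cons cons0; split; first by split=> // i; exact: le_trans (xr i) r'1.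
    split; first by rewrite oppr_le0 mulr_ge0 // sqr_ge0.
    move=> a fa; rewrite subr_ge0 leNgt; apply/negP => h; apply: H; by exists a.
  have [Ms /(_ _ Mw)] := Mv s s0 se; rewrite cons0 => h1.
  have [_ [_ /(_ z fz) h2]] := Ms.
  have h3 := nrm2_box vz; have : 0 < k ^+ 2 by rewrite exprn_gt0.
  by move: h1; rewrite -natr1; lra.
exists a; split=> // i.
have {}xa : `|x i - a i| <= N.+1%:R * k.
  apply/ltW; apply: (nrm2_coord (x := fun i => x i - a i)); first by rewrite mulr_gt0.
  apply: lt_le_trans xa _; rewrite exprMn ler_pM2r ?exprn_gt0 // expr2.
  by rewrite -[X in X <= _]mulr1 ler_pM2l // ler1n.
have NC : 0 < N.+1%:R ^+ Lq.+1 * (Cm / kp) by rewrite mulr_gt0 // exprn_gt0.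
rewrite ler_pdivrMl // -[X in _ <= X]mulrA -kE -exprMn.
by apply: lerXn2r; rewrite ?nnegrE ?mulr_ge0 // ltW.
Qed.
End CurveBound.

Lemma size_polyM_leS (R : nzRingType) (p q : {poly R}) a b :
  (size p <= a.+1)%N -> (size q <= b.+1)%N -> (size (p * q)%R <= (a + b).+1)%N.
Proof.
move=> pa qb; apply: leq_trans (size_polyMleq _ _) _.
by have := leq_add pa qb; move: (size p) (size q) => x y; lia.
Qed.

Lemma size_line_poly (K : fieldType) n (w u : 'I_n -> K) (p : mpoly n K) D :
  deg_le p D -> (size (line_poly w u p) <= D.+1)%N.
Proof.
apply: (deg_le_ind (P := fun p => (size (line_poly w u p) <= D.+1)%N)).
- move=> m mD; rewrite /line_poly mmapX /mmap1; apply: leq_trans (_ : (mdeg m).+1 <= _)%N => //.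
  rewrite mdegE; apply: (big_ind2 (fun (q : {poly K}) a => (size q <= a.+1)%N)).
  + by rewrite size_poly1.
  + by move=> q1 a1 q2 a2; exact: size_polyM_leS.
  move=> i _; move: (m i) => mi; elim: mi => [|k IH]; first by rewrite expr0 size_poly1.
  rewrite exprS; apply: (@size_polyM_leS _ _ _ 1 k) => //.
  apply: leq_trans (size_polyD _ _) _; rewrite geq_max (leq_trans (size_polyC_leq1 _)) //=.
  by rewrite (leq_trans (size_scale_leq _ _)) // size_polyX.
- by rewrite /line_poly mmap0 size_poly0.
- move=> c q Hq; rewrite /line_poly -mul_mpolyC rmorphM /= mmapC.
  by apply: leq_trans Hq; rewrite mul_polyC size_scale_leq.
- move=> q1 q2 h1 h2; rewrite /line_poly raddfD /=.
  by apply: leq_trans (size_polyD _ _) _; rewrite geq_max h1 h2.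
Qed.

Definition deriv_along (K : fieldType) n (w : 'I_n -> K) (f : mpoly n K) : mpoly n K :=
  \sum_i w i *: mderiv i f.

Lemma meval_deriv_along (K : fieldType) n (w x : 'I_n -> K) (f : mpoly n K) :
  meval x (deriv_along w f) = (line_poly x w f)`_1.
Proof. by rewrite line_coef1 /deriv_along raddf_sum; apply: eq_bigr => i _ /=; rewrite mevalZ. Qed.

(** If the derivative along w vanished identically, f would be constant on the line through 0 and
    w. *)
Lemma deriv_along_neq0 (K : numFieldType) n (w : 'I_n -> K) (f : mpoly n K) :
  meval w f != meval (fun=> 0) f -> deriv_along w f != 0.
Proof.
apply: contra_neq => p0; pose P := line_poly (fun=> 0) w f.
have dP : P^`() = 0.
  apply: numField_poly_eq0 => k; set t : K := k%:R.
  have : (line_poly (fun i => w i * t) w f)`_1 = 0 by rewrite -meval_deriv_along p0 meval0.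
  have -> : line_poly (fun i => w i * t) w f = P \Po ('X + t%:P).
    apply/eqP; rewrite -subr_eq0; apply/eqP; apply: numField_poly_eq0 => l.
    rewrite hornerD hornerN horner_comp hornerD hornerX hornerC /P !horner_line.
    apply/eqP; rewrite subr_eq0; apply/eqP; apply: meval_eq => i.
    by rewrite add0r -mulrDr addrC.
  have -> (q : {poly K}) : q`_1 = q^`().[0] by rewrite horner_coef0 coef_deriv.
  rewrite deriv_comp hornerM derivD derivX derivC addr0 hornerC mulr1.
  by rewrite horner_comp hornerD hornerX hornerC add0r.
have Pc : P = (P`_0)%:P.
  apply/polyP => -[|i]; rewrite coefC //=; have := coef_deriv P i.
  by rewrite dP coef0 => /esym/eqP; rewrite mulrn_eq0 /= => /eqP.
have -> : meval w f = P.[1].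
  by rewrite horner_line; apply: meval_eq => i; rewrite add0r mulr1.
by rewrite Pc hornerC line_coef0.
Qed.

(* A direction [w] with [f (t w)] not identically zero: moving from [y] along [w] until [f] first
   exceeds [f y] on both sides takes a time [O (f y ^ (1 / D))], and [f] has a minimum in between. *)
Lemma line_descent (R : realType) N D (f : mpoly N R) : (forall x, 0 <= meval x f) ->
  meval (fun=> 0) f = 0 -> deg_le f D.+1 -> f != 0 ->
  exists (w : 'I_N -> R) (C r : R), [/\ deriv_along w f != 0, 0 < C, 0 < r &
   forall y, (forall i, `|y i| <= r) -> 0 < meval y f -> exists t,
     let x i := y i + w i * t in
     [/\ C * `|t| ^+ D.+1 <= meval y f, meval x f <= meval y f & meval x (deriv_along w f) = 0]].
Proof.
move=> f_ge0 f0 df fN0.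
have [w wf] : exists w, meval w f != 0.
  apply: contrapT => H; case/eqP: fN0; apply: mpoly_eq0P => v.
  by apply/eqP/negPn/negP => h; apply: H; exists v.
pose av := absR_absolute_value R.
pose P0 := line_poly (fun=> 0) w f; pose k := (size P0).-1.
have P0N : P0 != 0.
  apply: contraNneq wf => P00; have : P0.[1] = 0 by rewrite P00 horner0.
  by rewrite horner_line => /eqP; congr (_ == 0); apply: meval_eq => i; rewrite add0r mulr1.
have kD : (k <= D.+1)%N by have := size_line_poly (fun=> 0) w df; rewrite -/P0 /k; case: (size P0).
pose ka := `|P0`_k|; have ka0 : 0 < ka by rewrite normr_gt0 -/(lead_coef P0) lead_coef_eq0.
pose l1 : seq R := [seq (i : nat)%:R | i <- iota 0 D.+2].
have ul1 : uniq l1.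
  by rewrite map_inj_uniq ?iota_uniq // => a b /eqP; rewrite eqr_nat => /eqP.
have l1P (t : R) : t \in l1 -> exists2 i, (i < D.+2)%N & t = i%:R.
  by case/mapP => i; rewrite mem_iota add0n => /andP [_ iD] ->; exists i.
have [C1 C10 HC1] := interp_bound av ul1 (etrans (size_map _ _) (size_iota _ _)).
pose l2 : seq R := [seq x / D.+2%:R | x <- l1].
have ul2 : uniq l2.
  by rewrite map_inj_uniq // => a b /mulIf; apply; rewrite invr_eq0 pnatr_eq0.
have l2P (t : R) : t \in l2 -> exists2 i, (i < D.+2)%N & t = i%:R / D.+2%:R.
  by case/mapP => t' /l1P [i iD ->] ->; exists i.
have [C2 C20 HC2] := interp_bound av ul2
  (etrans (size_map _ _) (etrans (size_map _ _) (size_iota _ _))).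
have [W W1 HW] := fin_max (fun i => `|w i|).
have [L L0 HL] := mpoly_lipschitz av f (1 + W * D.+2%:R).
have kC : 0 < ka / (4 * C2) by rewrite divr_gt0 // mulr_gt0.
have [r1 [r10 r11 Hr1]] := meval_near0 f0 kC.
have r20 : 0 < ka / 2 / C1 / L by rewrite !divr_gt0.
exists w, (ka / (4 * C2)), (Num.min r1 (ka / 2 / C1 / L)); split=> //.
- by apply: deriv_along_neq0; rewrite f0.
- by rewrite lt_min r10.
move=> y yr fy.
have yr1 i : `|y i| <= r1 by apply: le_trans (yr i) _; rewrite ge_min lexx.
have yr2 i : `|y i| <= ka / 2 / C1 / L by apply: le_trans (yr i) _; rewrite ge_min lexx orbT.
have y1 i : `|y i| <= 1 := le_trans (yr1 i) r11.
have cy := Hr1 y yr1; set c := meval y f in fy cy *.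
pose P := line_poly y w f; have sP : (size P <= D.+2)%N := size_line_poly y w df.
have PE t : P.[t] = meval (fun i => y i + w i * t) f by exact: horner_line.
have P_0 : P.[0] = c by rewrite horner_coef0 line_coef0.
have P_ge0 t : 0 <= P.[t] by rewrite PE.
(* The k-th coefficient depends continuously on the base point, as [interp_bound] quantifies, and
   keeps half its size. *)
have Pk : ka / 2 <= `|P`_k|.
  have : `|(P - P0)`_k| <= C1 * (ka / 2 / C1).
    apply: HC1.
    - apply: leq_trans (size_polyD _ _) _; rewrite size_polyN geq_max sP.
      exact: size_line_poly.
    - move=> t tl; have [i iD ->] := l1P t tl.
      rewrite hornerD hornerN !horner_line.
      have -> : ka / 2 / C1 = L * (ka / 2 / C1 / L) by rewrite mulrCA mulfV ?mulr1 // gt_eqF.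
      have wi j : `|w j * i%:R| <= W * D.+2%:R.
        by rewrite normrM normr_nat ler_pM // ler_nat ltnW.
      have WD : 0 <= W * D.+2%:R by rewrite mulr_ge0 // (le_trans ler01).
      apply: HL => [j|j|j|]; rewrite /absR.
      + by apply: le_trans (ler_normD _ _) _; rewrite lerD.
      + by rewrite add0r (le_trans (wi j)) // lerDr.
      + by rewrite add0r addrK.
      + exact: (ltW r20).
    - by apply: ltW; rewrite !divr_gt0.
  rewrite mulrCA mulfV ?gt_eqF // mulr1 coefB => h.
  by have := ler_distD P`_k P0`_k 0; rewrite !subr0 [`|P0`_k - _|]distrC -/ka; lra.
have C40 : 0 <= c / (ka / (4 * C2)) by rewrite ltW // divr_gt0.
have [l l0 lE] := powR_root D C40.
have cl : c = ka / (4 * C2) * l ^+ D.+1 by rewrite lE mulrC divfK // gt_eqF.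
have l1' : l <= 1.
  rewrite leNgt; apply/negP => h; have : 1 < l ^+ D.+1 by rewrite exprn_egt1.
  by rewrite lE ltr_pdivlMr // mul1r ltNge (ltW cy).
(* If f stayed at most c on the segment, interpolation would bound the rescaled k-th coefficient by
   C2 c, against the choice of l. *)
have exceed (b : R) : `|b| = l -> exists2 u, 0 <= u <= 1 & c < P.[b * u].
  move=> bl; apply: contrapT => H.
  have {}H u : 0 <= u <= 1 -> P.[b * u] <= c.
    by move=> u01; rewrite leNgt; apply/negP => h; apply: H; exists u.
  pose g := \poly_(i < D.+2) (P`_i * b ^+ i).
  have gE u : g.[u] = P.[b * u].
    rewrite horner_poly (horner_coef_wide _ sP); apply: eq_bigr => i _.
    by rewrite exprMn mulrA.
  have : `|g`_k| <= C2 * c.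
    apply: HC2; [exact: size_poly| |exact: ltW].
    move=> x xl; have [i iD ->] := l2P x xl.
    rewrite /absR gE ger0_norm //; apply: H.
    by rewrite divr_ge0 // ler_pdivrMr // mul1r ler_nat ltnW.
  rewrite coef_poly ltnS kD normrM normrX bl leNgt => /negP; apply.
  have lD : 0 < l ^+ D.+1 by rewrite lE divr_gt0.
  apply: (@lt_le_trans _ _ (ka / 2 * l ^+ D.+1)).
    rewrite cl [C2 * _]mulrA ltr_pM2r //.
    have -> : C2 * (ka / (4 * C2)) = ka / 4 by field; rewrite gt_eqF.
    by move: ka0; clearbody ka; lra.
  apply: ler_pM => //; [by rewrite ltW // divr_gt0|by rewrite ltW|].
  exact: ler_wiXn2l.
have [u1 /andP [u10 u11] Pu1] := exceed l (ger0_norm l0).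
have nl : `|- l| = l by rewrite normrN ger0_norm.
have [u2 /andP [u20 u21] Pu2] := exceed (- l) nl.
have h1 : 0 <= l * u1 by rewrite mulr_ge0.
have h2 : - l * u2 <= 0 by rewrite mulNr oppr_le0 mulr_ge0.
have [t tI tmin] := EVT_min (le_trans h2 h1) (continuous_subspaceT (@continuous_horner R P)).
have Pt : P.[t] <= c by rewrite -P_0; apply: tmin; rewrite in_itv /= h2 h1.
move: tI; rewrite in_itv /= => /andP [ta tb].
have {}ta : - l * u2 < t by rewrite lt_neqAle ta andbT; apply: contraTneq Pu2 => ->; rewrite -leNgt.
have {}tb : t < l * u1 by rewrite lt_neqAle tb andbT; apply: contraTneq Pu1 => <-; rewrite -leNgt.
exists t; split.
- rewrite cl ler_pM2l //; apply: lerXn2r; rewrite ?nnegrE //.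
  have k1 : l * u1 <= l by rewrite ler_piMr.
  have k2 : l * u2 <= l by rewrite ler_piMr.
  by rewrite ler_norml; apply/andP; split; [move: ta; rewrite mulNr|]; lra.
- by rewrite -PE.
rewrite meval_deriv_along.
have rho0 : 0 < Num.min (t - - l * u2) (l * u1 - t) by rewrite lt_min !subr_gt0 ta.
apply: (poly_min_interior rho0) => s; rewrite le_min => /andP [s1 s2].
have E s' : (line_poly (fun i => y i + w i * t) w f).[s'] = P.[t + s'].
  by rewrite horner_line PE; apply: meval_eq => i; rewrite mulrDr addrA.
rewrite !E addr0; apply: tmin; rewrite in_itv /=.
move: s1 s2; rewrite !ler_norml => /andP [s1 _] /andP [_ s2].
by apply/andP; split; lra.
Qed.

(** * A relation between f and a coordinate on a plane curve *)

Lemma box_count_le d D L : (d <= D)%N -> (d <= (d * L + 2 * d) * D)%N.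
Proof.
move=> dD; have [->|d0] := posnP d; first by [].
apply: leq_trans dD _.
by rewrite leq_pmull // addn_gt0 orbC muln_gt0 d0.
Qed.

(** With k = d (L + 2) and 2 d D = L one has d (2 k D + L + 2) = k (L + 1); so the multiples of p
    miss fewer than (k + 1)(L + 1) dimensions of the box. *)
Lemma box_count d D L k : (d <= D)%N -> L = (2 * d * D)%N -> k = (d * L + 2 * d)%N ->
  ((k * D + L).+1 * (k * D).+1 <
   k.+1 * L.+1 + ((k * D + L).+1 - d) * ((k * D).+1 - d))%N.
Proof.
move=> dD LE kE; have db : (d <= k * D)%N by rewrite kE; exact: box_count_le.
have [a' aE] : exists a', (k * D + L).+1 = (a' + d)%N.
  by exists ((k * D + L).+1 - d)%N; rewrite subnK // leqW // (leq_trans db) // leq_addr.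
have [b' bE] : exists b', (k * D).+1 = (b' + d)%N.
  by exists ((k * D).+1 - d)%N; rewrite subnK // leqW.
rewrite aE bE !addnK.
have E : (d * (a' + b' + 2 * d) = k * L.+1)%N.
  have -> : (a' + b' + 2 * d = 2 * (k * D) + L + 2)%N.
    by move: aE bE; move: (k * D)%N => kD; lia.
  have E1 : (d * (2 * (k * D)) = k * L)%N by rewrite LE; ring.
  rewrite mulnDr [(d * (_ + L))%N]mulnDr E1 (mulnS k L).
  by move: (k * L)%N => kL; rewrite kE; move: (d * L)%N => dL; lia.
move: E; rewrite [(k.+1 * _)%N]mulSn => <-.
have -> : ((a' + d) * (b' + d) = a' * b' + (a' * d + d * b' + d * d))%N by ring.
have -> : (d * (a' + b' + 2 * d) = a' * d + d * b' + d * d + d * d)%N by ring.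
by move: (a' * b')%N (a' * d + d * b' + d * d)%N (d * d)%N => x y z; lia.
Qed.

(** The cube is the base case: with squares the inequality fails for large E, which is why the plane
    is treated apart. *)
Lemma legendre_exponent_le E n : ((E.*2.+1 ^ n.+3) + 2 <= E.+2 * (3 * E.+1) ^ n.+2)%N.
Proof.
set a := E.*2.+1; set b := (3 * E.+1)%N.
have ab : (a <= b)%N by rewrite /a /b -mul2n; lia.
have abn : (a ^ n <= b ^ n)%N by case: n => // n; rewrite leq_exp2r.
have bn : (0 < b ^ n)%N by rewrite expn_gt0.
have h : (a ^ 3 + 2 <= E.+2 * b ^ 2)%N.
  rewrite /a /b -mul2n !expnS !expn0 !muln1; clear; nia.
rewrite -[n.+3]/(3 + n)%N -[n.+2]/(2 + n)%N [(a ^ _)%N]expnD [(b ^ (2 + n))%N]expnD mulnA.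
apply: (@leq_trans ((a ^ 3 + 2) * b ^ n)%N); last by rewrite leq_mul2r h orbT.
by rewrite mulnDl leq_add ?leq_mul // leq_pmulr.
Qed.

Lemma linear_dependency (K : fieldType) (I J : finType) (A : I -> J -> K) : (#|J| < #|I|)%N ->
  exists c : I -> K, (exists i, c i != 0) /\ forall j, \sum_i c i * A i j = 0.
Proof.
move=> JI; pose M : 'M[K]_(#|I|, #|J|) := \matrix_(a, b) A (enum_val a) (enum_val b).
have : kermx M != 0.
  rewrite kermx_eq0; apply/negP => /eqP rM.
  by have := rank_leq_col M; rewrite rM leqNgt JI.
case/rowV0Pn => v /sub_kermxP vM v0; exists (fun i => v ord0 (enum_rank i)); split.
  apply: contrapT => H; case/eqP: v0; apply/rowP => a; rewrite mxE.
  by apply/eqP/negPn/negP => va; apply: H; exists (enum_val a); rewrite enum_valK.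
move=> j; have /rowP /(_ (enum_rank j)) := vM; rewrite !mxE => E; rewrite -[RHS]E.
rewrite [RHS](reindex (@enum_rank I)) /=; last exact: onW_bij (@enum_rank_bij I).
by apply: eq_bigr => i _; rewrite !mxE !enum_rankK.
Qed.

Section BoxDegree.
Variables (A : comNzRingType) (n : nat).
Implicit Types (p q : mpoly n A) (a b : 'I_n -> nat).

Definition box_deg p a := forall m i, mcoeff m p != 0 -> (m i <= a i)%N.

Lemma box_degM p q a b : box_deg p a -> box_deg q b -> box_deg (p * q) (fun i => a i + b i)%N.
Proof.
move=> pa qb m i; rewrite -mcoeff_msupp => /msuppM_le.
case/allpairsP => [[m1 m2]] /= [h1 h2 ->]; rewrite mnmDE leq_add //; [apply: pa|apply: qb];
  by rewrite -mcoeff_msupp.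
Qed.

Lemma box_degW p a b : (forall i, a i <= b i)%N -> box_deg p a -> box_deg p b.
Proof. by move=> ab pa m i /pa h; apply: leq_trans (h i) (ab i). Qed.

Lemma deg_le_box p D : deg_le p D -> box_deg p (fun=> D).
Proof.
move=> pD m i /pD; apply: leq_trans; rewrite mdegE (bigD1 i) //=; exact: leq_addr.
Qed.

Lemma box_degX (m : multinom n) : box_deg (mpolyX A m) m.
Proof.
move=> m' i; rewrite mcoeffX; have [<- //|_] := eqVneq m m'.
by rewrite eqxx.
Qed.

End BoxDegree.

(* Counting dimensions: the products [f^k x_j^l] outnumber the polynomials modulo [p] in a box of
   monomials, as soon as [l] is allowed to reach [2 d D]. *)
Lemma plane_relation (K : fieldType) (f p : mpoly 2 K) D d (j j' : 'I_2) : j != j' ->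
  deg_le f D -> deg_le p d -> (d <= D)%N -> p != 0 ->
  let L := (2 * d * D)%N in
  exists Q : 'I_(d * L + 2 * d).+1 -> {poly K}, [/\ exists k, Q k != 0,
    forall k, (size (Q k) <= L.+1)%N &
    forall x, meval x p = 0 -> \sum_k (Q k).[x j] * meval x f ^+ k = 0].
Proof.
move=> jj fD pd dD p0 L; set k0 := (d * L + 2 * d)%N.
have j2 i : i = j \/ i = j'.
  move: jj; case: i => [[|[|//]] hi]; case: j => [[|[|//]] hj]; case: j' => [[|[|//]] hj'] //= H;
  by [left; apply: val_inj|right; apply: val_inj].
pose a := (k0 * D + L)%N; pose b := (k0 * D)%N.
pose mon (u v : nat) : multinom 2 := mnm_add (mnm_muln (mnm1 j) u) (mnm_muln (mnm1 j') v).
have monj u v : mon u v j = u.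
  by rewrite mnmDE !mulmnE !mnm1E eqxx eq_sym (negPf jj) mul1n mul0n addn0.
have monj' u v : mon u v j' = v.
  by rewrite mnmDE !mulmnE !mnm1E eqxx (negPf jj) mul1n mul0n add0n.
have monE (m : multinom 2) : m = mon (m j) (m j').
  by apply/mnmP => i; case: (j2 i) => ->; rewrite ?monj ?monj'.
(* The first family gives the unknowns of the relation, the second accounts for working modulo p;
   all lie in one box of monomials. *)
pose g (i : 'I_k0.+1 * 'I_L.+1 + 'I_(a.+1 - d) * 'I_(b.+1 - d)) : mpoly 2 K :=
  match i with
  | inl kl => f ^+ kl.1 * mpolyX K (mon kl.2 0)
  | inr uv => - (p * mpolyX K (mon uv.1 uv.2))
  end.
have db : (d <= b)%N by exact: box_count_le.
have gb i m : mcoeff m (g i) != 0 -> (m j < a.+1)%N /\ (m j' < b.+1)%N.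
  case: i => [[k l]|[u v]] /= H.
    have h1 : deg_le (f ^+ k) (D * k) by exact: deg_le_exp.
    have h2 := box_degM (deg_le_box h1) (@box_degX K 2 (mon l 0)).
    have kb : (D * k <= b)%N by rewrite /b mulnC leq_mul2r -ltnS ltn_ord orbT.
    have := h2 m j H; have := h2 m j' H; rewrite monj monj' addn0 !ltnS => e2 e1.
    split; last exact: leq_trans e2 kb.
    by apply: leq_trans e1 _; rewrite /a leq_add // -ltnS.
  have h2 := box_degM (deg_le_box pd) (@box_degX K 2 (mon u v)).
  have {}H : mcoeff m (p * mpolyX K (mon u v)) != 0 by move: H; rewrite mcoeffN oppr_eq0.
  have := h2 m j H; have := h2 m j' H; rewrite monj monj' => e2 e1.
  have := ltn_ord u; have := ltn_ord v; rewrite !ltn_subRL => hv hu.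
  by split; [exact: leq_ltn_trans e1 hu|exact: leq_ltn_trans e2 hv].
have [|c [[i0 ci0] Hc]] := @linear_dependency K _ ('I_a.+1 * 'I_b.+1)%type
    (fun i uv => mcoeff (mon uv.1 uv.2) (g i)).
  rewrite card_sum !card_prod !card_ord.
  exact: box_count dD erefl erefl.
have G0 : \sum_i c i *: g i = 0.
  apply/mpolyP => m; rewrite mcoeff0 raddf_sum /=.
  have [/andP [m1 m2]|mN] := boolP ((m j < a.+1)%N && (m j' < b.+1)%N).
    rewrite -[RHS](Hc (Ordinal m1, Ordinal m2)); apply: eq_bigr => i _.
    by rewrite mcoeffZ /= -monE.
  rewrite big1 // => i _; rewrite mcoeffZ; apply/eqP; rewrite mulf_eq0 orbC.
  by apply/orP; left; apply: contraNT mN => /gb [-> ->].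
move: G0; rewrite big_sumType /= => G0.
exists (fun k => \poly_(l < L.+1) c (inl (k, inord l))); split.
(* A dependency among the multiples of p alone would read p u = 0 with u a nontrivial combination of
   distinct monomials. *)
- apply: contrapT => H.
  have c0 kl : c (inl kl) = 0.
    apply/eqP/negPn/negP => ckl; apply: H; exists kl.1; apply: contraNneq ckl => q0.
    have := congr1 (fun q : {poly K} => q`_kl.2) q0.
    by rewrite coef_poly ltn_ord inord_val coef0 -surjective_pairing => ->.
  pose u : mpoly 2 K := \sum_uv c (inr uv) *: mpolyX K (mon uv.1 uv.2).
  have : p * u = 0.
    rewrite -[RHS]oppr0 -[in RHS]G0 big1 => [|kl _]; last by rewrite c0 scale0r.
    rewrite add0r -sumrN mulr_sumr; apply: eq_bigr => uv _.
    by rewrite scalerN opprK scalerAr.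
  move/eqP; rewrite mulf_eq0 (negPf p0) /= => /eqP u0.
  case: i0 ci0 => [kl|uv0]; first by rewrite c0 eqxx.
  have := congr1 (mcoeff (mon uv0.1 uv0.2)) u0; rewrite mcoeff0 raddf_sum /= (bigD1 uv0) //=.
  rewrite mcoeffZ mcoeffX eqxx mulr1 big1 ?addr0 => [->|uv uvN]; first by rewrite eqxx.
  rewrite mcoeffZ mcoeffX; case: eqP => [E|_]; last by rewrite mulr0.
  case/eqP: uvN; have := congr1 (fun m : multinom 2 => m j) E.
  have := congr1 (fun m : multinom 2 => m j') E; rewrite !monj !monj' => e2 e1.
  by case: uv uv0 {E} e1 e2 => [u1 v1] [u2 v2] /= e1 e2; congr pair; apply: val_inj.
- by move=> k; exact: size_poly.
move=> x px; have := congr1 (meval x) G0; rewrite mevalD meval0 !raddf_sum /=.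
rewrite [X in _ + X]big1 ?addr0 => [E|uv _]; last by rewrite mevalZ mevalN mevalM px mul0r oppr0 mulr0.
pose F (k : 'I_k0.+1) (l : 'I_L.+1) := meval x (c (inl (k, l)) *: (f ^+ k * mpolyX K (mon l 0))).
transitivity (\sum_(kl : 'I_k0.+1 * 'I_L.+1) F kl.1 kl.2); last first.
  by rewrite -[RHS]E; apply: eq_bigr => -[k l].
rewrite -(pair_bigA _ F) /= /F.
apply: eq_bigr => k _; rewrite horner_poly mulr_suml; apply: eq_bigr => l _.
rewrite inord_val mevalZ mevalM rmorphXn /= -mulrA; congr (_ * _); rewrite mulrC; congr (_ * _).
rewrite /meval mmapX /mmap1 (bigD1 j) //= monj big1 ?mulr1 // => i ij.
by case: (j2 i) => ii; [rewrite ii eqxx in ij|rewrite ii monj' expr0].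
Qed.

(** * Distance bounds for nonnegative polynomials *)

Lemma zero_bound_0 (R : realType) N th : (0 < th)%N -> zero_bound (0 : mpoly N R) th.
Proof.
move=> th0; exists 1, 1; split=> // y _; exists y; rewrite meval0; split=> // i.
by rewrite subrr normr0 expr0n eqn0Ngt th0 mulr0.
Qed.

Lemma zero_bound_line (R : realType) D (f : mpoly 1 R) :
  meval (fun=> 0) f = 0 -> (forall x, 0 <= meval x f) -> deg_le f D.+1 -> zero_bound f D.+1.
Proof.
move=> f0 f_ge0 df; have [->|fN0] := eqVneq f 0; first exact: zero_bound_0.
pose P := line_poly (fun=> 0) (fun=> 1) f.
have PE y : P.[y ord0] = meval y f.
  by rewrite horner_line; apply: meval_eq => i; rewrite add0r mul1r (ord1 i).
have P0 : P != 0.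
  by apply: contraNneq fN0 => P0; apply/eqP/mpoly_eq0P => y; rewrite -PE P0 horner0.
have [kp [r [kp0 r0 H]]] := root_order 0 P0 (size_line_poly _ _ df).
exists kp, r; split=> // y yr; exists (fun=> 0); split=> // i.
have -> : i = ord0 by exact: ord1.
have h := H (y ord0); have := f_ge0 y; rewrite -PE => p0; rewrite (ger0_norm p0) in h.
by apply: h; rewrite subr0; exact: yr.
Qed.

(** [line_descent] moves y to the polar curve of a direction at a cost controlled by f(y) without
    increasing f; there [curve_bound] applies, with degrees D + 1 for the curve and D + 2 for f. *)
Lemma zero_bound_plane (R : realType) D (f : mpoly 2 R) :
  (forall x, 0 <= meval x f) -> meval (fun=> 0) f = 0 -> deg_le f D.+2 ->
  zero_bound f (2 * D.+1 * D.+2).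
Proof.
move=> f_ge0 f0 df; set th := (2 * D.+1 * D.+2)%N.
have thD : (D.+2 <= th)%N by rewrite /th leq_pmull.
have [Lq LqE] : exists Lq, th = Lq.+1 by exists th.-1; rewrite prednK // (leq_trans _ thD).
have [->|fN0] := eqVneq f 0; first by apply: zero_bound_0; rewrite LqE.
have [w [C1 [r1 [pN0 C10 r10 H1]]]] := line_descent f_ge0 f0 df fN0.
set p := deriv_along w f in pN0 H1.
have dp : deg_le p D.+1.
  by apply: deg_le_sum => i _; apply: deg_leZ; exact: deg_le_mderiv.
have /choice [Q HQ] (j : 'I_2) : exists Q : 'I_(D.+1 * th + 2 * D.+1).+1 -> {poly R},
    [/\ exists k, Q k != 0, forall k, (size (Q k) <= th.+1)%N &
    forall x, meval x p = 0 -> \sum_k (Q k).[x j] * meval x f ^+ k = 0].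
  have [j' jj] : exists j' : 'I_2, j != j'.
    by case: j => [[|[|//]] hj]; [exists (Ordinal (erefl : 1 < 2)%N)|exists (Ordinal (erefl : 0 < 2)%N)].
  exact: (plane_relation jj df dp (leqnSn _) pN0).
have [|||C2 [r2 [C20 r20 H2]]] := @curve_bound R 2 _ Lq f p f_ge0 f0 Q.
- by move=> j; have [] := HQ j.
- by move=> j k; rewrite -LqE; have [_ h _] := HQ j; exact: h.
- by move=> j x px; have [_ _ h] := HQ j; exact: h.
have [W W1 HW] := fin_max (fun i => `|w i|); have W0 : 0 < W := lt_le_trans ltr01 W1.
pose rho := Num.min 1 (r2 / 2 / W).
have rho0 : 0 < rho by rewrite lt_min ltr01 !divr_gt0.
have rW : W * rho <= r2 / 2.
  by rewrite mulrC -ler_pdivlMr // ge_min lexx orbT.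
have e0 : 0 < C1 * rho ^+ D.+2 by rewrite mulr_gt0 // exprn_gt0.
have [r3 [r30 _ H3]] := meval_near0 f0 e0.
pose B := W ^+ th / C1 + C2^-1.
have B0 : 0 < B by rewrite addr_gt0 ?divr_gt0 ?exprn_gt0 ?invr_gt0.
have r0 : 0 < Num.min (Num.min r1 (r2 / 2)) r3 by rewrite !lt_min r10 r30 divr_gt0.
exists ((2 ^+ th * B)^-1), (Num.min (Num.min r1 (r2 / 2)) r3); split=> //.
  by rewrite invr_gt0 mulr_gt0 // exprn_gt0.
move=> y yr; have yr1 i : `|y i| <= r1 by apply: le_trans (yr i) _; rewrite !ge_min lexx.
have yr2 i : `|y i| <= r2 / 2 by apply: le_trans (yr i) _; rewrite !ge_min lexx orbT.
have yr3 i : `|y i| <= r3 by apply: le_trans (yr i) _; rewrite !ge_min lexx !orbT.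
have [fy|fy] := eqVneq (meval y f) 0.
  by exists y; split=> // i; rewrite subrr normr0 expr0n LqE /= mulr0 fy.
have {}fy : 0 < meval y f by rewrite lt0r fy f_ge0.
have [t [ht fx px]] := H1 y yr1 fy; set x := fun i => y i + w i * t in fx px.
have trho : `|t| <= rho.
  rewrite -(@ler_pXn2r _ D.+2) ?nnegrE ?(ltW rho0) //.
  by rewrite -(ler_pM2l C10) (le_trans ht) // ltW // H3.
have wt i : `|w i * t| <= W * `|t| by rewrite normrM ler_wpM2r.
have xr i : `|x i| <= r2.
  apply: le_trans (ler_normD _ _) _; rewrite [r2]splitr lerD // (le_trans (wt i)) //.
  by apply: le_trans rW; rewrite ler_pM2l.
have [a [fa Ha]] := H2 x xr px; exists a; split=> // i.
have NC : 0 < 2 ^+ th * B by rewrite mulr_gt0 // exprn_gt0.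
rewrite ler_pdivrMl // -[X in _ <= X]mulrA.
pose v (l : 'I_2) := if l == ord0 then W * `|t| else `|x i - a i|.
apply: (@le_trans _ _ ((\sum_l v l) ^+ th)).
  rewrite big_ord_recl big_ord1 /v eqxx /=.
  apply: lerXn2r; rewrite ?nnegrE ?addr_ge0 ?mulr_ge0 ?(ltW W0) //.
  have -> : y i - a i = - (w i * t) + (x i - a i) by rewrite /x; ring.
  by apply: le_trans (ler_normD _ _) _; rewrite normrN lerD.
apply: sum_pow_le => [|l|l]; first by rewrite LqE.
  by rewrite /v; case: ifP; rewrite // mulr_ge0 // ltW.
rewrite /v /B mulrDl; case: ifP => _.
  apply: (@le_trans _ _ (W ^+ th / C1 * meval y f)); last first.
    by rewrite lerDl mulr_ge0 ?invr_ge0 // ltW.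
  rewrite exprMn -[X in _ <= X]mulrA ler_pM2l ?exprn_gt0 // ler_pdivlMl //.
  apply: le_trans ht; rewrite ler_pM2l //; apply: ler_wiXn2l => //.
  by apply: le_trans trho _; rewrite ge_min lexx.
apply: (@le_trans _ _ (C2^-1 * meval y f)); last first.
  rewrite lerDr; apply: mulr_ge0; last exact: ltW.
  by apply: divr_ge0; [apply: exprn_ge0|]; exact: ltW.
by rewrite ler_pdivlMl // LqE (le_trans (Ha i)).
Qed.

(** Order of vanishing in one variable; in the plane 2 (2d-1) 2d <= 2d (6d-3); from three variables
    on, [zero_bound_legendre] with exponent (4d-3)^(N+1) + 2, compared by [legendre_exponent_le]. *)
Theorem zero_bound_main (R : realType) N d (f : mpoly N.+1 R) : (0 < d)%N ->
  (forall x, 0 <= meval x f) -> meval (fun=> 0) f = 0 -> deg_le f (2 * d) ->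
  zero_bound f (2 * d * (6 * d - 3) ^ N).
Proof.
case: d => // d _ f_ge0 f0; set E := (2 * d)%N.
have -> : (2 * d.+1 = E.+2)%N by rewrite mulnS.
have -> : (6 * d.+1 - 3 = 3 * E.+1)%N by rewrite /E; lia.
move=> df; case: N f f_ge0 f0 df => [|[|N]] f f_ge0 f0 df.
- by rewrite expn0 muln1; exact: zero_bound_line.
- apply: (zero_bound_weaken f0 _ _ (zero_bound_plane f_ge0 f0 df)) => //.
  by rewrite expn1 [(E.+2 * _)%N]mulnC; apply: leq_mul => //; apply: leq_mul.
have H := zero_bound_legendre f_ge0 f0 df.
by apply: (zero_bound_weaken f0 _ (legendre_exponent_le E N) H); rewrite addn2.
Qed.

(** * Transfer between real coordinates and the norms of the statement *)

Section Bridge.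
Variables (R : realType) (K : fieldType) (abs : K -> R) (N k n : nat).
Variables (F : 'rV[K]_N -> 'rV[K]_k) (X : set 'rV[K]_N) (phi : ('I_n -> R) -> 'rV[K]_N).
Variables (G h : mpoly n R).
Hypothesis phi_surj : forall v, exists x, phi x = v.
Hypothesis phi0 : phi (fun=> 0) = 0.
Hypothesis phi_norm : forall x a, enorm abs (phi x - phi a) = Num.sqrt (nrm2 (fun i => x i - a i)).
Hypothesis XE : forall x, X (phi x) <-> meval x G = 0.
Hypothesis FE : forall x, enorm abs (F (phi x)) = Num.sqrt (meval x h).
Hypothesis F0E : forall x, F (phi x) = 0 <-> meval x h = 0.
Hypothesis h_ge0 : forall x, 0 <= meval x h.
Hypothesis G0 : meval (fun=> 0) G = 0.
Hypothesis h0 : meval (fun=> 0) h = 0.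

Local Notation V := (F @^-1` [set 0] `&` X).

Let VE a : V (phi a) <-> inV G h a.
Proof. by split=> [[/F0E ? /XE]|[/XE ? /F0E]]; split. Qed.

Let norm0 x : enorm abs (phi x) = Num.sqrt (nrm2 x).
Proof.
rewrite -[phi x]subr0 -phi0 phi_norm; congr (Num.sqrt (nrm2 _)).
by apply/funext => i; rewrite subr0.
Qed.

Let sqrt_lt u (x : 'I_n -> R) : 0 < u -> (Num.sqrt (nrm2 x) < u) = (nrm2 x < u ^+ 2).
Proof.
move=> u0; rewrite -(@ltr_pXn2r _ 2) ?nnegrE ?sqrtr_ge0 ?(ltW u0) //.
by rewrite sqr_sqrtr ?nrm2_ge0.
Qed.

Lemma edist_isd x t : isd G h x t -> Defs.edist abs (phi x) V = t.
Proof.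
move=> [t0 lb ub]; rewrite /Defs.edist; set S := [set _ | _ in _].
have lbS : lbound S t.
  move=> _ [v Vv <-]; have [a av] := phi_surj v; rewrite -av phi_norm.
  rewrite -[t](ger0_norm t0) -sqrtr_sqr ler_wsqrtr //; apply: lb.
  by apply/VE; rewrite av.
have S0 : S !=set0.
  exists (enorm abs (phi x - phi (fun=> 0))), (phi (fun=> 0)) => //.
  by apply/VE.
apply/eqP; rewrite eq_le; apply/andP; split; last exact: lb_le_inf.
apply/ler_addgt0Pr => e e0; have tu : t < t + e by rewrite ltrDl.
have [a [Va xa]] := ub _ tu; apply: (@le_trans _ _ (enorm abs (phi x - phi a))).
  by apply: ge_inf; [exists t|exists (phi a) => //; apply/VE].
by rewrite phi_norm ltW // sqrt_lt // ltr_wpDl.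
Qed.

Lemma lojasiewicz_exponent_ok eta : lojasiewicz_inequality abs F X eta <-> exponent_ok G h eta.
Proof.
split=> -[C [e [C0 e0 H]]]; exists C, e; split=> //.
  move=> x t Xx xe /edist_isd <-; rewrite -FE; apply: H; first exact/XE.
  by rewrite norm0 sqrt_lt.
move=> v; have [x <-] := phi_surj v => /XE Xx; rewrite norm0 sqrt_lt // => xe.
have [t dt] := isd_exists G0 h0 x.
by rewrite (edist_isd dt) FE; apply: (H x t).
Qed.

(** Any admissible exponent supplies the hypothesis of [min_exponent]; without accumulation of X
    outside the zeros of F, the exponent is 0 by convention. *)
Lemma lojasiewicz_exponent_le th : exponent_ok G h th -> 0 <= th ->
  exists L, is_lojasiewicz_exponent abs F X L /\ L <= th.
Proof.
move=> okth th0; have [cl|ncl] := pselect (clusters_at0 abs (X `\` F @^-1` [set 0])); last first.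
  by exists 0; split.
have cluster e : 0 < e -> exists x, [/\ inX G x, meval x h != 0 & nrm2 x < e ^+ 2].
  move=> e0; have [v [[Xv Fv] _ ve]] := cl e e0.
  have [x xv] := phi_surj v; rewrite -xv in Xv Fv ve; exists x; split; first exact/XE.
    by apply/eqP => hx; apply: Fv; apply/F0E.
  by rewrite -sqrt_lt // -norm0.
have [L [okL Lmin]] := min_exponent h_ge0 G0 h0 cluster okth.
exists L; split; last exact: Lmin.
by split=> // _; split=> [|eta]; [exact/lojasiewicz_exponent_ok|move/lojasiewicz_exponent_ok/Lmin].
Qed.

End Bridge.

(** * The real bound *)

Section RealCase.
Variables (R : realType) (N m r d : nat) (F : 'I_m -> mpoly N.+1 R) (g : 'I_r -> mpoly N.+1 R).
Hypothesis d_gt0 : (0 < d)%N.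
Hypothesis F_deg : forall i, deg_le (F i) d.
Hypothesis g_deg : forall i, deg_le (g i) d.

Let sq k (p : 'I_k -> mpoly N.+1 R) : mpoly N.+1 R := \sum_i p i ^+ 2.

Let sqE k (p : 'I_k -> mpoly N.+1 R) x : meval x (sq p) = \sum_i meval x (p i) ^+ 2.
Proof. by rewrite /sq raddf_sum; apply: eq_bigr => i _ /=; rewrite rmorphXn. Qed.

Let sq_ge0 k (p : 'I_k -> mpoly N.+1 R) x : 0 <= meval x (sq p).
Proof. by rewrite sqE; apply: sumr_ge0 => i _; exact: sqr_ge0. Qed.

Let rowE (v : 'rV[R]_N.+1) : \row_i v ord0 i = v.
Proof. by apply/rowP => i; rewrite mxE. Qed.

Let sq0 k (p : 'I_k -> mpoly N.+1 R) x : polymap p (\row_i x i) = 0 <-> meval x (sq p) = 0.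
Proof.
have E i : polymap p (\row_i x i) ord0 i = meval x (p i).
  by rewrite mxE; apply: meval_eq => j; rewrite mxE.
split=> [/rowP H|].
  by rewrite sqE big1 // => i _; rewrite -E H mxE expr0n.
rewrite sqE => /eqP; rewrite psumr_eq0 => [/allP H|i _]; last exact: sqr_ge0.
apply/rowP => i; rewrite E mxE; apply/eqP; rewrite -sqrf_eq0.
by have := H i; rewrite mem_index_enum; apply.
Qed.

Let sqrt_pow (a M t : R) th : 0 <= t -> 0 <= M -> t ^+ 2 ^+ th <= M * a ->
  0 <= a -> t ^+ th <= Num.sqrt M * Num.sqrt a.
Proof.
move=> t0 M0 H a0; rewrite -sqrtrM // -[t ^+ th]ger0_norm ?exprn_ge0 // -sqrtr_sqr.
by rewrite ler_wsqrtr // -exprM mulnC exprM.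
Qed.

(** The sum of squares of all F_i and g_i has degree at most 2 d and equals |F|^2 on X; the exponent
    of [zero_bound_main] is halved by the square root. *)
Lemma real_exponent : polymap F 0 = 0 -> zero_set g 0 ->
  exists L : R, is_lojasiewicz_exponent (@absR R) (polymap F) (zero_set g) L /\
    L <= d%:R * (6 * d%:R - 3) ^+ N.
Proof.
move=> F0 g0; set th := (d * (6 * d - 3) ^ N)%N.
have -> : d%:R * (6 * d%:R - 3) ^+ N = th%:R :> R.
  rewrite /th natrM natrX natrB ?natrM //.
  by case: d d_gt0 => // d' _; rewrite mulnS.
have th0 : (0 < th)%N.
  rewrite /th muln_gt0 d_gt0 expn_gt0; apply/orP; left.
  by case: d d_gt0 => // d' _; rewrite mulnS.
have row0 : \row_i (0 : R) = 0 :> 'rV[R]_N.+1 by apply/rowP => i; rewrite !mxE.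
have G0 : meval (fun=> 0) (sq g) = 0 by apply/sq0; rewrite row0.
have H0 : meval (fun=> 0) (sq F) = 0 by apply/sq0; rewrite row0.
apply: (@lojasiewicz_exponent_le R R (@absR R) N.+1 m N.+1 (polymap F) (zero_set g)
  (fun x => \row_i x i) (sq g) (sq F)) => //.
- by move=> v; exists (fun i => v ord0 i).
- move=> x a; rewrite /enorm; congr Num.sqrt; apply: eq_bigr => i _.
  by rewrite !mxE real_normK ?num_real.
- by move=> x; exact: sq0.
- move=> x; rewrite /enorm sqE; congr Num.sqrt; apply: eq_bigr => i _.
  by rewrite mxE real_normK ?num_real //; congr (_ ^+ 2); apply: meval_eq => j; rewrite mxE.
have sq_deg k (p : 'I_k -> mpoly N.+1 R) : (forall i, deg_le (p i) d) -> deg_le (sq p) (2 * d).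
  by move=> pd; apply: deg_le_sum => i _; rewrite mulnC; exact: deg_le_exp.
pose f := sq F + sq g.
have f_ge0 x : 0 <= meval x f by rewrite mevalD addr_ge0.
have f0 : meval (fun=> 0) f = 0 by rewrite mevalD G0 H0 addr0.
have df : deg_le f (2 * d) by apply: deg_leD; exact: sq_deg.
have := zero_bound_main d_gt0 f_ge0 f0 df; rewrite -mulnA -/th => -[C [e [C0 e0 H]]].
pose M := N.+1%:R ^+ th / C; have M0 : 0 < M by rewrite divr_gt0 // exprn_gt0.
exists (Num.sqrt M)^-1, e; split=> //; first by rewrite invr_gt0 sqrtr_gt0.
move=> x t Xx xe [t0 lb _]; rewrite powR_mulrn // ler_pdivrMl ?sqrtr_gt0 //.
apply: sqrt_pow => //; first exact: ltW.
have [a [fa Ha]] := H x (fun i => ltW (nrm2_coord i e0 xe)).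
have Va : inV (sq g) (sq F) a.
  have /andP [/eqP h1 /eqP h2] : (meval a (sq F) == 0) && (meval a (sq g) == 0).
    by rewrite -paddr_eq0 // -mevalD fa.
  by split.
apply: (@le_trans _ _ (nrm2 (fun i => x i - a i) ^+ th)).
  by apply: lerXn2r; rewrite ?nnegrE ?sqr_ge0 ?nrm2_ge0 // lb.
rewrite /M -mulrA; apply: sum_pow_le => // i; first exact: sqr_ge0.
rewrite -real_normK ?num_real // -exprM ler_pdivlMl // (le_trans (Ha i)) //.
by rewrite mevalD (Xx : meval x (sq g) = 0) addr0.
Qed.
End RealCase.

(** * The complex bound *)

Section ComplexCase.
Variables (R : realType) (N m r d : nat).
Local Notation K := (complex R).
Variables (F : 'I_m -> mpoly N K) (g : 'I_r -> mpoly N K).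
Hypothesis d_gt0 : (0 < d)%N.
Hypothesis F_deg : forall i, deg_le (F i) d.
Hypothesis g_deg : forall i, deg_le (g i) d.

Let cplx (x : 'I_(N + N) -> R) : 'I_N -> K := fun i => Complex (x (lshift N i)) (x (rshift N i)).

Let absC2 (z : K) : absC z ^+ 2 = complex.Re z ^+ 2 + complex.Im z ^+ 2.
Proof. by case: z => a b; rewrite /absC /= sqr_sqrtr // addr_ge0 ?sqr_ge0. Qed.

Let realify (p : mpoly N K) : exists ab : mpoly (N + N) R * mpoly (N + N) R,
  forall x, meval (cplx x) p = Complex (meval x ab.1) (meval x ab.2).
Proof.
move: p; apply: mpoly_ring_ind => [[a b]|i|p q [[p1 p2] Hp] [[q1 q2] Hq]|p q [[p1 p2] Hp] [[q1 q2] Hq]].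
- by exists (mpolyC _ a, mpolyC _ b) => x; rewrite !mevalC.
- by exists (mpolyX R (mnm1 (lshift N i)), mpolyX R (mnm1 (rshift N i))) => x; rewrite !mevalXU.
- by exists (p1 + q1, p2 + q2) => x; rewrite !mevalD Hp Hq.
- by exists (p1 * q1 - p2 * q2, p1 * q2 + p2 * q1) => x; rewrite !(mevalD, mevalN, mevalM) Hp Hq.
Qed.

Let real_sq k (p : 'I_k -> mpoly N K) : exists q : mpoly (N + N) R,
  forall x, meval x q = \sum_i absC (meval (cplx x) (p i)) ^+ 2.
Proof.
have /choice [ab Hab] i := realify (p i).
exists (\sum_i ((ab i).1 ^+ 2 + (ab i).2 ^+ 2)) => x.
rewrite raddf_sum; apply: eq_bigr => i _ /=.
by rewrite Hab absC2 mevalD !rmorphXn.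
Qed.

Lemma complex_exponent : polymap F 0 = 0 -> zero_set g 0 ->
  exists L : R, is_lojasiewicz_exponent (@absC R) (polymap F) (zero_set g) L /\ L <= d%:R ^+ N.
Proof.
move=> F0 g0; have av := absC_absolute_value R.
have [G GE] := real_sq g; have [h hE] := real_sq F.
pose phi x : 'rV[K]_N := \row_i cplx x i.
have polyE k (p : 'I_k -> mpoly N K) x i : polymap p (phi x) ord0 i = meval (cplx x) (p i).
  by rewrite mxE; apply: meval_eq => j; rewrite mxE.
have zeroE k (p : 'I_k -> mpoly N K) q x :
    (forall x, meval x q = \sum_i absC (meval (cplx x) (p i)) ^+ 2) ->
    polymap p (phi x) = 0 <-> meval x q = 0.
  move=> qE; split=> [/rowP H|].
    by rewrite qE big1 // => i _; rewrite -polyE H mxE (av0 av) expr0n.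
  rewrite qE => /eqP; rewrite psumr_eq0 => [/allP H|i _]; last exact: sqr_ge0.
  apply/rowP => i; rewrite polyE mxE; apply/eqP; rewrite -[_ == 0]negbK -(av_gt0 av) -leNgt.
  have := H i; rewrite mem_index_enum => /(_ isT); rewrite sqrf_eq0 => /eqP ->.
  exact: lexx.
have phi0 : phi (fun=> 0) = 0 by apply/rowP => i; rewrite !mxE.
have phi_norm x a : enorm (@absC R) (phi x - phi a) = Num.sqrt (nrm2 (fun i => x i - a i)).
  rewrite /enorm /nrm2 big_split_ord /= -big_split /=; congr Num.sqrt; apply: eq_bigr => i _.
  by rewrite absC2 !mxE.
have G0 : meval (fun=> 0) G = 0 by apply/(zeroE _ g) => //; rewrite phi0.
have h0 : meval (fun=> 0) h = 0 by apply/(zeroE _ F) => //; rewrite phi0.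
rewrite -natrX; apply: (@lojasiewicz_exponent_le R K (@absC R) N m (N + N) (polymap F) (zero_set g)
  phi G h) => //.
- move=> v; exists (fun i => match split i with
    inl j => complex.Re (v ord0 j) | inr j => complex.Im (v ord0 j) end).
  apply/rowP => j; rewrite mxE /cplx (unsplitK (inl j)) (unsplitK (inr j)).
  by case: (v ord0 j).
- by move=> x; apply: zeroE.
- by move=> x; rewrite /enorm hE; congr Num.sqrt; apply: eq_bigr => i _; rewrite polyE.
- by move=> x; apply: zeroE.
- by move=> x; rewrite hE sumr_ge0 // => i _; exact: sqr_ge0.
have [e dE] : exists e, d = e.+1 by exists d.-1; rewrite prednK.
pose f (j : 'I_(m + r)) := match split j with inl i => F i | inr i => g i end.
have df j : deg_le (f j) e.+1 by rewrite -dE /f; case: split.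
have [C [eps [C0 eps0 H]]] := complex_bound df.
pose D := (e.+1 ^ N)%N; have D0 : (0 < D)%N by rewrite expn_gt0.
have N10 : 0 < N.+1%:R :> R by rewrite ltr0n.
exists (C / N.+1%:R ^+ D), (Num.min eps 1); split.
- by rewrite divr_gt0 // exprn_gt0.
- by rewrite lt_min eps0 ltr01.
move=> x t Xx xe dt; have [t0 lb _] := dt; rewrite dE powR_mulrn // -/D.
have m0 : 0 < Num.min eps 1 by rewrite lt_min eps0 ltr01.
have [->|tN] := eqVneq t 0; first by rewrite expr0n eqn0Ngt D0 mulr0 sqrtr_ge0.
have tp : 0 < t by rewrite lt0r tN.
have t1 : t <= 1.
  have := le_lt_trans (isd_le G0 h0 dt) xe; rewrite ltr_pXn2r ?nnegrE // ?(ltW m0) //.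
  by rewrite lt_min => /andP [_ /ltW].
(* A common zero with all coordinates closer than t / (N+1) would be at Euclidean distance below
   t. *)
have rho0 : 0 < t / N.+1%:R by rewrite divr_gt0.
have rho1 : t / N.+1%:R <= 1.
  by rewrite ler_pdivrMr // mul1r (le_trans t1) // ler1n.
rewrite mulrAC -mulrA -expr_div_n.
have cplx_norm i : absC (cplx x i) <= eps.
  rewrite -(@ler_pXn2r _ 2) ?nnegrE ?(av_ge0 av) ?(ltW eps0) //.
  apply: (@le_trans _ _ (nrm2 x)).
    rewrite absC2 /nrm2 big_split_ord /= -big_split /= (bigD1 i) //= lerDl.
    by apply: sumr_ge0 => j _; rewrite addr_ge0 ?sqr_ge0.
  apply/ltW/(lt_le_trans xe); apply: lerXn2r; rewrite ?nnegrE ?(ltW m0) ?(ltW eps0) //.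
  by rewrite ge_min lexx.
apply: (H (cplx x) cplx_norm _ rho0 rho1).
  move=> y fy; apply: contrapT => Hy.
  have [a aE] : exists a, cplx a = y.
    exists (fun i => match split i with
      inl j => complex.Re (y j) | inr j => complex.Im (y j) end).
    apply/funext => j; rewrite /cplx (unsplitK (inl j)) (unsplitK (inr j)).
    by case: (y j).
  have Va : inV G h a.
    split; [rewrite /inX GE|rewrite hE]; rewrite big1 // => i _; rewrite aE.
      by have := fy (rshift m i); rewrite /f (unsplitK (inr i)) => ->; rewrite (av0 av) expr0n.
    by have := fy (lshift r i); rewrite /f (unsplitK (inl i)) => ->; rewrite (av0 av) expr0n.
  have := lb a Va; rewrite leNgt => /negP; apply.
  apply: (@le_lt_trans _ _ (\sum_(i < N) (t / N.+1%:R) ^+ 2)).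
    rewrite /nrm2 big_split_ord /= -big_split /=; apply: ler_sum => i _.
    have : absC (y i - cplx x i) <= t / N.+1%:R.
      by rewrite leNgt; apply/negP => h'; apply: Hy; exists i; exact: ltW.
    move=> hi; have -> : (x (lshift N i) - a (lshift N i)) ^+ 2 + (x (rshift N i) - a (rshift N i)) ^+ 2
        = absC (y i - cplx x i) ^+ 2 by rewrite absC2 -aE /=; ring.
    by apply: lerXn2r; rewrite ?nnegrE ?(av_ge0 av) // ltW.
  rewrite sumr_const card_ord -[_ *+ N]mulr_natl expr_div_n mulrCA.
  rewrite -[X in _ < X]mulr1 ltr_pM2l ?exprn_gt0 // ltr_pdivrMr ?exprn_gt0 // mul1r.
  by rewrite -natrX ltr_nat expnS leq_pmulr // expn_gt0.
move=> j; have sqrt_ge (a : R) : 0 <= a -> a ^+ 2 <= meval x h -> a <= Num.sqrt (meval x h).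
  by move=> a0 ah; rewrite -[a]ger0_norm // -sqrtr_sqr ler_wsqrtr.
apply: sqrt_ge; first exact: av_ge0.
rewrite /f; case: split => i.
  by rewrite hE (bigD1 i) //= lerDl sumr_ge0 // => l _; exact: sqr_ge0.
have /rowP /(_ i) := (zeroE _ g G x GE).2 Xx; rewrite polyE mxE => ->.
by rewrite (av0 av) expr0n hE sumr_ge0 // => l _; exact: sqr_ge0.
Qed.
End ComplexCase.

Lemma max_degree_le (K : fieldType) n k (p : 'I_k -> mpoly n K) T i :
  (max_degree p <= T)%N -> deg_le (p i) T.
Proof.
by move=> pT; apply: deg_le_mdegree; apply: leq_trans pT; exact: leq_bigmax.
Qed.

Theorem corollary1p3 (R : realType) (N m r : nat) (hNm : (N <= m)%N) :
  (forall (F : 'I_m -> mpoly.mpoly N R) (g : 'I_r -> mpoly.mpoly N R),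
     let X := zero_set g in
     let d := maxn (max_degree F) (max_degree g) in
     polymap F 0 = 0 -> (0 < d)%N -> X 0 -> clusters_at0 (@absR R) X ->
     exists L : R, is_lojasiewicz_exponent (@absR R) (polymap F) X L /\
       L <= d%:R * (6 * d%:R - 3) ^+ N.-1)
  /\
  (forall (F : 'I_m -> mpoly.mpoly N R[i]) (g : 'I_r -> mpoly.mpoly N R[i]),
     let X := zero_set g in
     let d := maxn (max_degree F) (max_degree g) in
     polymap F 0 = 0 -> (0 < d)%N -> X 0 -> clusters_at0 (@absC R) X ->
     exists L : R, is_lojasiewicz_exponent (@absC R) (polymap F) X L /\
       L <= d%:R ^+ N).
Proof.
split.
  (* In dimension 0 the origin is not an accumulation point of X. *)
  case: N hNm => [|N'] hNm F g X d F0 d0 X0 cl.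
    have [x [_ /eqP x0 _]] := cl 1 ltr01; case: x0.
    by apply/rowP => -[].
  have F_deg i : deg_le (F i) d by apply: max_degree_le; exact: leq_maxl.
  have g_deg i : deg_le (g i) d by apply: max_degree_le; exact: leq_maxr.
  exact: (real_exponent d0 F_deg g_deg F0 X0).
move=> F g X d F0 d0 X0 cl.
have F_deg i : deg_le (F i) d by apply: max_degree_le; exact: leq_maxl.
have g_deg i : deg_le (g i) d by apply: max_degree_le; exact: leq_maxr.
exact: (complex_exponent d0 F_deg g_deg F0 X0).
Qed.
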